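(* There exist consistent holomorphic $C_0$-semigroups $(R_p(z))_{z \in \Sigma_{\pi/2}}$ on $L^p(\mathbb{R})$, $p \in (1,\infty)$, such that for every $p\in(1,\infty)$ the semigroup $(R_p(z))_{z\in\Sigma_{\pi/2}}$ has maximal regularity if and only if $p = 2$.
   Context: The spaces $L^p(\mathbb{R})$ are complex. A family of semigroups $(R_p(z))_{z\in\Sigma_{\pi/2}}$ on $L^p$, $p\in(1,\infty)$, is consistent if $R_p(z)f=R_q(z)f$ for all $p,q\in(1,\infty)$, all $f\in L^p\cap L^q$ and all $z\in\Sigma_{\pi/2}$. $\Sigma_{\delta} = \{z \in \mathbb{C}\setminus\{0\} : |\arg z| < \delta\}$. A holomorphic $C_0$-semigroup $(T(z))_{z\in\Sigma_\delta}$ on $X$ ($0<\delta\le\pi/2$) is a $C_0$-semigroup $(T(t))_{t\ge0}$ that extends to a holomorphic map $T:\Sigma_\delta\to\mathcal{L}(X)$ with $T(z+w)=T(z)T(w)$ which is strongly continuous at $0$ (with $T(0)=\mathrm{Id}$) in every smaller subsector. Maximal regularity: the generator $-A$ of a $C_0$-semigroup $(T(t))_{t\ge 0}$ on $X$ (or the semigroup itself) has maximal regularity if for some (equivalently, all) $q\in(1,\infty)$ and $\tau>0$, for every $f\in L^q((0,\tau);X)$ the mild solution $u(t)=\int_0^t T(t-s)f(s)\,ds$ of $\dot u + Au = f$, $u(0)=0$, lies in $W^{1,q}((0,\tau);X)\cap L^q((0,\tau);D(A))$. *)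

(* Defs.v *)
From HB Require Import structures.
From mathcomp Require Import all_boot all_order all_algebra.
From mathcomp Require Import all_classical all_reals all_analysis.
From mathcomp Require Import measurable_realfun complex.

Set Implicit Arguments.
Unset Strict Implicit.
Unset Printing Implicit Defensive.
Import Order.TTheory GRing.Theory Num.Theory.
Import numFieldNormedType.Exports.

Local Open Scope classical_set_scope.
Local Open Scope ring_scope.
Local Open Scope complex_scope.
Local Open Scope quotient_scope.

(* The norm of a normed module over [R[i]] is [R[i]]-valued. *)
Definition rnorm (R : realType) (X : normedZmodType R[i]) (x : X) : R :=
  complex.Re `|x|.

Section cLp.
Context d (T : measurableType d) (R : realType).
Variables (mu : {measure set T -> \bar R}) (p : R).
Local Notation C := R[i].
Implicit Types f g : T -> C.

Definition cLnorm f : \bar R := ('N[mu]_p%:E[EFin \o (fun t => rnorm (f t))])%E.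

(* Complex measurability is measurability of the real and imaginary parts. *)
Definition cLfun : {pred T -> C} := fun f =>
  `[< [/\ measurable_fun setT (@complex.Re R \o f),
          measurable_fun setT (@complex.Im R \o f)
        & (cLnorm f < +oo)%E] >].

Lemma rnormc (z : C) : rnorm z = Num.sqrt (complex.Re z ^+ 2 + complex.Im z ^+ 2).
Proof. by rewrite /rnorm normc_def. Qed.

Lemma rnormE (X : normedZmodType C) (x : X) : (rnorm x)%:C = `|x|.
Proof. by rewrite /rnorm RRe_real// normr_real. Qed.

Lemma rnorm_ge0 (X : normedZmodType C) (x : X) : 0 <= rnorm x.
Proof. by rewrite -lecR rnormE normr_ge0. Qed.

Lemma rnormM (z w : C) : rnorm (z * w) = rnorm z * rnorm w.
Proof. by apply: (@complexI R); rewrite rmorphM/= !rnormE normrM. Qed.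

Lemma rnormD (z w : C) : rnorm (z + w) <= rnorm z + rnorm w.
Proof. by rewrite -lecR rmorphD/= !rnormE ler_normD. Qed.

Lemma rnorm_eq0 (z : C) : rnorm z = 0 -> z = 0.
Proof. by move=> z0; apply/eqP; rewrite -normr_eq0 -rnormE z0. Qed.

Lemma complex_ReM (z w : C) : complex.Re (z * w) =
  complex.Re z * complex.Re w - complex.Im z * complex.Im w.
Proof. by case: z; case: w. Qed.

Lemma complex_ImM (z w : C) : complex.Im (z * w) =
  complex.Re z * complex.Im w + complex.Im z * complex.Re w.
Proof. by case: z; case: w. Qed.

Lemma measurable_rnorm f : measurable_fun setT (@complex.Re R \o f) ->
  measurable_fun setT (@complex.Im R \o f) ->
  measurable_fun setT (fun t => rnorm (f t)).
Proof.
move=> mr mi.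
rewrite (_ : (fun t => _) = (fun t => ((complex.Re (f t)) ^+ 2
   + (complex.Im (f t)) ^+ 2) `^ 2^-1)); last first.
  apply/funext => t; rewrite rnormc powR12_sqrt// addr_ge0// sqr_ge0//.
apply: (measurableT_comp (measurable_powR _)).
by apply: measurable_funD; apply: measurable_funX.
Qed.

Hypothesis p1 : 1 <= p.

Lemma le_Lnorm (u v : T -> R) : measurable_fun setT u -> measurable_fun setT v ->
  (forall t, 0 <= u t <= v t) ->
  ('N[mu]_p%:E[EFin \o u] <= 'N[mu]_p%:E[EFin \o v])%E.
Proof.
move=> mu_ mv uv; have p0 : 0 <= p by apply: le_trans p1.
have u0 t : 0 <= u t by case/andP: (uv t).
have v0 t : 0 <= v t by case/andP: (uv t) => ?; apply: le_trans.
rewrite unlock; apply: gt0_ler_poweR; rewrite ?invr_ge0//.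
- by rewrite in_itv/= leey andbT integral_ge0.
- by rewrite in_itv/= leey andbT integral_ge0.
apply: ge0_le_integral => //=.
- by apply/measurable_EFinP; apply: (measurableT_comp (measurable_powR _)); exact: measurableT_comp.
- by apply/measurable_EFinP; apply: (measurableT_comp (measurable_powR _)); exact: measurableT_comp.
move=> t _; rewrite lee_fin; apply: ge0_ler_powR => //; rewrite ?nnegrE//.
by rewrite !ger0_norm//; case/andP: (uv t).
Qed.


Lemma cLnormD f g : f \in cLfun -> g \in cLfun ->
  (cLnorm (f + g)%R <= cLnorm f + cLnorm g)%E.
Proof.
move=> /asboolP[rf jf _] /asboolP[rg jg _].
have mf := measurable_rnorm rf jf; have mg := measurable_rnorm rg jg.
apply: le_trans (minkowski_EFin mu mf mg p1).
apply: le_Lnorm.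
- apply: measurable_rnorm.
  + rewrite (_ : _ \o _ = (@complex.Re R \o f) \+ (@complex.Re R \o g)).
      exact: measurable_funD.
    by apply/funext => t /=; rewrite raddfD.
  + rewrite (_ : _ \o _ = (@complex.Im R \o f) \+ (@complex.Im R \o g)).
      exact: measurable_funD.
    by apply/funext => t /=; rewrite raddfD.
- exact: measurable_funD.
by move=> t; rewrite rnorm_ge0/= rnormD.
Qed.

Lemma cLnormZ a f : f \in cLfun -> cLnorm (a *: f) = ((rnorm a)%:E * cLnorm f)%E.
Proof.
move=> /asboolP[rf jf lf].
have mf := measurable_rnorm rf jf.
have p1' : (1 <= p%:E)%E by rewrite lee_fin.
have Lf : (fun t => rnorm (f t)) \in Lfun mu p%:E.
  by rewrite inE/=; apply/andP; split; rewrite inE.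
have := LnormZ (Lfun_Sub p1' Lf) (rnorm a).
rewrite (ger0_norm (rnorm_ge0 a)) => <-.
congr Lnorm; apply/funext => t /=; congr EFin.
exact: rnormM.
Qed.

Lemma cLfun_submod : submod_closed cLfun.
Proof.
split.
  apply/asboolP; split.
  - by rewrite (_ : _ \o _ = cst 0).
  - by rewrite (_ : _ \o _ = cst 0).
  rewrite /cLnorm (_ : _ \o _ = cst 0%E); last first.
    by apply/funext => t /=; rewrite /rnorm normr0.
  by rewrite Lnorm0// eqe gt_eqF// (lt_le_trans ltr01).
move=> a f g fL gL.
have /asboolP[rf jf lf] := fL; have /asboolP[rg jg lg] := gL.
have rZ : measurable_fun setT (@complex.Re R \o (a *: f)).
  rewrite (_ : _ \o _ = (fun t => complex.Re a * (@complex.Re R \o f) t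
      - complex.Im a * (@complex.Im R \o f) t)); last first.
    by apply/funext => t; exact: complex_ReM.
  by apply: measurable_funB; apply: measurable_funM.
have jZ : measurable_fun setT (@complex.Im R \o (a *: f)).
  rewrite (_ : _ \o _ = (fun t => complex.Re a * (@complex.Im R \o f) t
      + complex.Im a * (@complex.Re R \o f) t)); last first.
    by apply/funext => t; exact: complex_ImM.
  by apply: measurable_funD; apply: measurable_funM.
have aL : a *: f \in cLfun.
  apply/asboolP; split => //; rewrite cLnormZ// lte_mul_pinfty//.
  by rewrite lee_fin rnorm_ge0.
apply/asboolP; split.
- rewrite (_ : _ \o _ = (@complex.Re R \o (a *: f)) \+ (@complex.Re R \o g)).
    exact: measurable_funD.
  by apply/funext => t /=; rewrite raddfD.
- rewrite (_ : _ \o _ = (@complex.Im R \o (a *: f)) \+ (@complex.Im R \o g)).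
    exact: measurable_funD.
  by apply/funext => t /=; rewrite raddfD.
apply: (le_lt_trans (cLnormD aL gL)); rewrite lte_add_pinfty//.
by move/asboolP: aL => [].
Qed.

End cLp.

Lemma filterS4 T (F : set_system T) {FF : Filter F} (A B P Q G : set T) :
  (forall x, A x -> B x -> P x -> Q x -> G x) -> F A -> F B -> F P -> F Q -> F G.
Proof.
move=> ABG FA FB FP FQ; apply: (@filterS3 _ F FF (A `&` B) P Q) => //.
  by move=> x [Ax Bx] Px Qx; exact: ABG.
exact: filterI.
Qed.

Lemma filterS5 T (F : set_system T) {FF : Filter F} (A B P Q E G : set T) :
  (forall x, A x -> B x -> P x -> Q x -> E x -> G x) ->
  F A -> F B -> F P -> F Q -> F E -> F G.
Proof.
move=> ABG FA FB; move=> FP FQ FE; apply: (@filterS3 _ F FF (A `&` B) (P `&` Q) E) => //.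
- by move=> x [Ax Bx] [Px Qx]; exact: ABG.
- exact: filterI.
- exact: filterI.
Qed.

Section cLp_type.
Context d (T : measurableType d) (R : realType).
Variables (mu : {measure set T -> \bar R}) (p : R) (p1 : 1 <= p).
Local Notation C := R[i].

HB.instance Definition _ :=
  GRing.isSubmodClosed.Build _ _ (cLfun mu p) (cLfun_submod mu p1).

Definition cLfunType (_ : 1 <= p) : Type := {f : T -> C | f \in cLfun mu p}.
Local Notation L := (cLfunType p1).
HB.instance Definition _ := SubType.on L.
HB.instance Definition _ := [Choice of L by <:].
HB.instance Definition _ := [SubChoice_isSubLmodule of L by <:].

Definition cLae (f g : L) := `[< val f = val g %[ae mu] >].

Let cLae_refl : reflexive cLae.
Proof. by move=> f; apply/asboolP/aeW. Qed.

Let cLae_sym : symmetric cLae.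
Proof. by move=> f g; apply/idP/idP => /asboolP h; apply/asboolP/ae_eq_sym. Qed.

Let cLae_trans : transitive cLae.
Proof.
by move=> f g h /asboolP gf /asboolP fh; apply/asboolP/(ae_eq_trans gf fh).
Qed.

Canonical cLae_equiv := EquivRel cLae cLae_refl cLae_sym cLae_trans.

(* [cLp mu p1], with [p1 : 1 <= p], is the complex [L^p] space of [mu]: functions
   modulo almost everywhere equality, a normed module over [R[i]]. *)
Definition cLp : Type := {eq_quot cLae}.
HB.instance Definition _ := Choice.on cLp.
HB.instance Definition _ := EqQuotient.on cLp.

Definition cLp_fun (f : cLp) : T -> C := val (repr f).
Coercion cLp_fun : cLp >-> Funclass.

Definition cLp_of (f : L) : cLp := \pi_cLp f.

Lemma cLp_ofE f : cLp_of f = val f %[ae mu].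
Proof.
have /eqmodP/asboolP // : repr (cLp_of f) = f %[mod cLp] by rewrite reprK.
Qed.

Lemma cLp_eq (f g : cLp) : f = g %[ae mu] -> f = g.
Proof.
move=> fg; rewrite -[f]reprK -[g]reprK; apply/eqmodP/asboolP; exact: fg.
Qed.

Definition cLp0 : cLp := cLp_of 0.
Definition cLp_opp (f : cLp) : cLp := cLp_of (- repr f).
Definition cLp_add (f g : cLp) : cLp := cLp_of (repr f + repr g).
Definition cLp_scale (a : C) (f : cLp) : cLp := cLp_of (a *: repr f).

Lemma cLp0E : cLp0 = cst 0 %[ae mu].
Proof. exact: cLp_ofE. Qed.

Lemma cLp_oppE f : cLp_opp f = (fun t => - f t) %[ae mu].
Proof. exact: cLp_ofE. Qed.

Lemma cLp_addE f g : cLp_add f g = (fun t => f t + g t) %[ae mu].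
Proof. exact: cLp_ofE. Qed.

Lemma cLp_scaleE a f : cLp_scale a f = (fun t => a * f t) %[ae mu].
Proof. exact: cLp_ofE. Qed.

Let cLp_addA : associative cLp_add.
Proof.
move=> f g h; apply: cLp_eq.
move: (cLp_addE f (cLp_add g h)) (cLp_addE (cLp_add f g) h).
move: (cLp_addE g h) (cLp_addE f g).
by apply: filterS4 => t e1 e2 e3 e4 _; rewrite e3// e4// e1// e2// addrA.
Qed.

Let cLp_addC : commutative cLp_add.
Proof.
move=> f g; apply: cLp_eq; move: (cLp_addE f g) (cLp_addE g f).
by apply: filterS2 => t e1 e2 _; rewrite e1// e2// addrC.
Qed.

Let cLp_add0 : left_id cLp0 cLp_add.
Proof.
move=> f; apply: cLp_eq; move: (cLp_addE cLp0 f) cLp0E.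
by apply: filterS2 => t e1 e2 _; rewrite e1// e2// add0r.
Qed.

Let cLp_addN : left_inverse cLp0 cLp_opp cLp_add.
Proof.
move=> f; apply: cLp_eq; move: (cLp_addE (cLp_opp f) f) (cLp_oppE f) cLp0E.
by apply: filterS3 => t e1 e2 e3 _; rewrite e1// e2// e3// addNr.
Qed.

HB.instance Definition _ :=
  GRing.isZmodule.Build cLp cLp_addA cLp_addC cLp_add0 cLp_addN.

Lemma cLpD (f g : cLp) : (f + g : cLp) = (fun t => f t + g t) %[ae mu].
Proof. exact: cLp_addE. Qed.

Let cLp_scaleA a b f : cLp_scale a (cLp_scale b f) = cLp_scale (a * b) f.
Proof.
apply: cLp_eq.
move: (cLp_scaleE a (cLp_scale b f)) (cLp_scaleE b f) (cLp_scaleE (a * b) f).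
by apply: filterS3 => t e1 e2 e3 _; rewrite e1// e2// e3// mulrA.
Qed.

Let cLp_scale1 : left_id 1 cLp_scale.
Proof.
move=> f; apply: cLp_eq; move: (cLp_scaleE 1 f).
by apply: filterS => t e1 _; rewrite e1// mul1r.
Qed.

Let cLp_scaleDr : right_distributive cLp_scale +%R.
Proof.
move=> a f g; apply: cLp_eq.
move: (cLp_scaleE a (f + g)) (cLpD (cLp_scale a f) (cLp_scale a g)).
move: (cLpD f g) (cLp_scaleE a f) (cLp_scaleE a g).
by apply: filterS5 => t e1 e2 e3 e4 e5 _; rewrite e4// e1// e5// e2// e3// mulrDr.
Qed.

Let cLp_scaleDl f : {morph cLp_scale^~ f : a b / a + b}.
Proof.
move=> a b; apply: cLp_eq.
move: (cLp_scaleE (a + b) f) (cLpD (cLp_scale a f) (cLp_scale b f)).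
move: (cLp_scaleE a f) (cLp_scaleE b f).
by apply: filterS4 => t e1 e2 e3 e4 _; rewrite e3// e4// e1// e2// mulrDl.
Qed.

HB.instance Definition _ := GRing.Zmodule_isLmodule.Build C cLp
  cLp_scaleA cLp_scale1 cLp_scaleDr cLp_scaleDl.

Lemma cLpZ a (f : cLp) : (a *: f : cLp) = (fun t => a * f t) %[ae mu].
Proof. exact: cLp_scaleE. Qed.

Lemma cLpP (f : cLp) : (f : T -> C) \in cLfun mu p.
Proof. exact: (valP (repr f)). Qed.

Lemma cLnorm_ae (f g : T -> C) : f \in cLfun mu p -> g \in cLfun mu p ->
  f = g %[ae mu] -> cLnorm mu p f = cLnorm mu p g.
Proof.
move=> /asboolP[rf jf _] /asboolP[rg jg _] fg.
have mf := measurable_rnorm rf jf; have mg := measurable_rnorm rg jg.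
rewrite /cLnorm unlock; congr (_ `^ _)%E.
apply: ge0_ae_eq_integral => //=.
- by apply/measurable_EFinP; apply: (measurableT_comp (measurable_powR _)); exact: measurableT_comp.
- by apply/measurable_EFinP; apply: (measurableT_comp (measurable_powR _)); exact: measurableT_comp.
by move: fg; apply: filterS => t e _; rewrite e.
Qed.

Lemma cLnorm_fin (f : cLp) : cLnorm mu p f \is a fin_num.
Proof.
by rewrite ge0_fin_numE ?Lnorm_ge0//; have /asboolP[] := cLpP f.
Qed.

Definition cLp_norm (f : cLp) : C := (fine (cLnorm mu p f))%:C.

Let cLp_normD (f g : cLp) : cLp_norm (f + g) <= cLp_norm f + cLp_norm g.
Proof.
rewrite /cLp_norm -rmorphD/= lecR -lee_fin EFinD !fineK ?cLnorm_fin//.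
rewrite (cLnorm_ae (cLpP _) _ (cLpD f g)); last exact: rpredD (cLpP f) (cLpP g).
by apply: cLnormD => //; exact: cLpP.
Qed.

Let cLp_normZ a (f : cLp) : cLp_norm (a *: f) = `|a| * cLp_norm f.
Proof.
rewrite /cLp_norm -rnormE -rmorphM/=; congr (_%:C).
apply: EFin_inj; rewrite EFinM !fineK ?cLnorm_fin//.
rewrite (cLnorm_ae (cLpP _) _ (cLpZ a f)); last exact: rpredZ (cLpP f).
by apply: cLnormZ => //; exact: cLpP.
Qed.

Let cLp_norm0_eq0 (f : cLp) : cLp_norm f = 0 -> f = 0.
Proof.
move=> [f0]; have /asboolP[rf jf _] := cLpP f; apply: cLp_eq.
have f0' : cLnorm mu p f = 0%E by rewrite -(fineK (cLnorm_fin f)) f0.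
have p0 : (0 < p%:E)%E by rewrite lte_fin (lt_le_trans ltr01).
have mf : measurable_fun setT (EFin \o (fun t => rnorm (f t))).
  by apply/measurable_EFinP; exact: measurable_rnorm.
move: cLp0E (Lnorm_eq0_eq0 mf p0 f0').
by apply: filterS2 => t e1 e2 _; rewrite e1//; apply: rnorm_eq0; case: (e2 I).
Qed.

HB.instance Definition _ := Lmodule_isNormed.Build C cLp
  cLp_normD cLp_normZ cLp_norm0_eq0.

End cLp_type.

Section bochner.
Context d (T : measurableType d) (R : realType) (X : normedModType R[i]).
Variables (mu : {measure set T -> \bar R}) (D : set T).

Record step := Step {
  step_card : nat;
  step_set : 'I_step_card -> set T;
  step_val : 'I_step_card -> X }.

Definition step_ok (s : step) := forall i,
  measurable (@step_set s i) /\ (mu (@step_set s i `&` D) < +oo)%E.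

Definition step_fun (s : step) (t : T) : X :=
  \sum_(i < step_card s) (\1_(@step_set s i) t)%:C *: @step_val s i.

Definition step_integral (s : step) : X :=
  \sum_(i < step_card s) (fine (mu (@step_set s i `&` D)))%:C *: @step_val s i.

(* [V] is a subspace of [X] and [N] a norm on it: limits are taken in [(V, N)],
   which is [X] itself for [V = setT] and [N = rnorm (X := X)]. *)
Definition strongly_measurable_in (V : set X) (N : X -> R) (f : T -> X) :=
  exists s : nat -> step,
    (forall n, step_ok (s n) /\ forall i, V (@step_val (s n) i)) /\
    {ae mu, forall t, D t ->
      V (f t) /\ N (step_fun (s n) t - f t) @[n --> \oo] --> (0 : R)}.

Definition LqX_in (V : set X) (N : X -> R) (q : R) (f : T -> X) :=
  strongly_measurable_in V N f /\
  (\int[mu]_(t in D) (N (f t) `^ q)%:E < +oo)%E.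

Definition strongly_measurable := strongly_measurable_in setT (@rnorm R X).

Definition LqX := LqX_in setT (@rnorm R X).

Definition has_bochner_integral (f : T -> X) (x : X) :=
  strongly_measurable f /\
  exists s : nat -> step,
    [/\ forall n, step_ok (s n),
        (\int[mu]_(t in D) (rnorm (f t - step_fun (s n) t))%:E)%E
          @[n --> \oo] --> (0 : \bar R)
      & step_integral (s n) @[n --> \oo] --> x].

(* Bochner integrals over [D] are unique; the value is [0] when [f] is not Bochner integrable. *)
Definition bochner_integral (f : T -> X) : X :=
  xget 0 [set x | has_bochner_integral f x].

End bochner.

Section semigroups.
Context (R : realType) (X : normedModType R[i]).
Implicit Types (S : X -> X) (T : R -> X -> X) (x : X).

Definition bounded_operator S :=
  linear S /\ exists M : R, forall x, rnorm (S x) <= M * rnorm x.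

Record C0_semigroup T : Prop := {
  C0_bounded : forall t, 0 <= t -> bounded_operator (T t);
  C0_id : forall x, T 0 x = x;
  C0_add : forall s t, 0 <= s -> 0 <= t -> forall x, T (s + t) x = T s (T t x);
  C0_continuous : forall x, T t x @[t --> 0^'+] --> x }.

(* For [0 < delta <= pi], [theta] is [arg z]. *)
Definition sector (delta : R) : set R[i] :=
  [set z | exists r theta : R, [/\ 0 < r, `|theta| < delta
    & z = (r * cos theta) +i* (r * sin theta)]].

(* Complex differentiability for the operator norm. *)
Definition holomorphic_on (U : set R[i]) (T : R[i] -> X -> X) :=
  forall z, U z -> exists2 S, bounded_operator S &
    forall e : R, 0 < e -> \forall h \near (0 : R[i]^o)^',
      forall x, rnorm (h^-1 *: (T (z + h) x - T z x) - S x) <= e * rnorm x.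

Record holomorphic_C0_semigroup (delta : R) (T : R[i] -> X -> X) : Prop := {
  hol_C0 : C0_semigroup (fun t => T t%:C);
  hol_bounded : forall z, sector delta z -> bounded_operator (T z);
  hol_holomorphic : holomorphic_on (sector delta) T;
  hol_add : forall z w, sector delta z -> sector delta w ->
    forall x, T (z + w) x = T z (T w x);
  hol_continuous : forall delta', 0 < delta' < delta -> forall x,
    T z x @[z --> within (sector delta') (nbhs (0 : R[i]^o))] --> x }.

(* The generator of [T] is written [- A]. *)
Definition diff_quotient T x (h : R) : X := (h^-1)%:C *: (T h x - x).

Definition dom_A T : set X := [set x | cvg (diff_quotient T x h @[h --> 0^'+])].

Definition A_of T x : X := - lim (diff_quotient T x h @[h --> 0^'+]).

Definition graph_norm T x : R := rnorm x + rnorm (A_of T x).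

Definition mild_solution T (f : R -> X) (t : R) : X :=
  bochner_integral (@lebesgue_measure R) `]0, t[ (fun s => T (t - s) (f s)).

Definition test_function (a b : R) (phi : R -> R) :=
  (forall n t, derivable (derive1n n phi) t 1) /\
  exists c e, [/\ a < c, e < b & forall t, t \notin `[c, e] -> phi t = 0].

Definition weak_derivative (a b : R) (u v : R -> X) :=
  forall phi, test_function a b phi ->
    bochner_integral (@lebesgue_measure R) `]a, b[ (fun t => (derive1 phi t)%:C *: u t) =
    - bochner_integral (@lebesgue_measure R) `]a, b[ (fun t => (phi t)%:C *: v t).

Definition W1q (a b q : R) (u : R -> X) :=
  LqX (@lebesgue_measure R) `]a, b[ q u /\
  exists2 v, LqX (@lebesgue_measure R) `]a, b[ q v & weak_derivative a b u v.

Definition maximal_regularity T :=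
  exists q tau : R, [/\ 1 < q, 0 < tau
    & forall f, LqX (@lebesgue_measure R) `]0, tau[ q f ->
        W1q 0 tau q (mild_solution T f) /\
        LqX_in (@lebesgue_measure R) `]0, tau[ (dom_A T) (graph_norm T) q
          (mild_solution T f)].

End semigroups.

Notation LpR p1 := (cLp (@lebesgue_measure _) (ltW p1)).

Definition consistent (R : realType)
    (T : forall (p : R) (p1 : 1 < p), R[i] -> LpR p1 -> LpR p1) :=
  forall (p q : R) (p1 : 1 < p) (q1 : 1 < q) (f : LpR p1) (g : LpR q1),
    f = g %[ae (@lebesgue_measure R)] ->
    forall z, sector (pi / 2) z ->
      T p p1 z f = T q q1 z g %[ae (@lebesgue_measure R)].

(* Main.v *)
(* Let F_k be the projection of L^p(R) onto the functions supported in [-k, k) and constant on the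
   dyadic cells of length 2^-k (local averaging); these are uniformly bounded, commute and tend
   strongly to the identity.  Let r_k be Rademacher functions on [-1, 0), d_k = 1_[k, k+1) and
   w_k = d_k + r_k.  Interpolating, put S_2k = F_k and S_(2k+1) = F_k + <w_k, .> w_k / 2.  Because
   F_k w_k = 0 and F_(k+1) w_k = w_k, the differences P_j = S_(j+1) - S_j form a Schauder
   decomposition of every L^p, and Abel summation shows that T(z) = sum_j exp(- 2^j z) P_j
   defines consistent holomorphic semigroups on the right half plane.

   On L^2 the P_j are orthogonal projections, and maximal regularity follows mode by mode from
   Young's inequality for the kernels l exp(- l t), uniformly in l = 2^j.

   Let p <> 2.  Since P_2k maps both r_k and d_k to w_k / 2, it exchanges the two families; but
   the r_k span l^2 whereas the d_k span l^p.  If p < 2, choose c in l^2 but not in l^p and the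
   bounded forcing f(s) = sum_k c_k exp(i 4^k s) r_k: the modes 2k and 2k+1, whose frequencies
   4^k and 2 * 4^k differ by a factor 2, respond differently at the resonant time frequency, so
   the <d_k, .>-coordinates of A u(t), which are l^p for every element of L^p, would be bounded
   below by a multiple of c_k for large k.  Hence u(t) is outside the domain of A for all t > 0.
   For p > 2 exchange the roles of r_k and d_k. *)
Require Import Defs.
From HB Require Import structures.
From mathcomp Require Import all_boot all_order all_algebra.
From mathcomp Require Import all_classical all_reals all_analysis.
From mathcomp Require Import measurable_realfun complex.
From mathcomp Require Import ring lra zify.
Import Order.TTheory GRing.Theory Num.Theory.
Import numFieldNormedType.Exports.
Local Open Scope classical_set_scope.
Local Open Scope ring_scope.
Local Open Scope complex_scope.
Set Implicit Arguments.
Unset Strict Implicit.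
Unset Printing Implicit Defensive.

(** * Norms and lower integrals *)

(** The decomposition is only conditional, and the example lives on the margin this leaves. By Abel
    summation a symbol m_j of bounded variation gives a bounded operator, and exp(- 2^j z) has
    bounded variation uniformly on every cone |z| <= K Re z. But a symbol maps r_k to ((m_2k +
    m_2k+1) r_k + (m_2k - m_2k+1) d_k) / 2, so one whose neighbouring values m_2k and m_2k+1 stay
    apart for all k would, for p < 2, carry l^2 coefficients to l^p ones. The map from the forcing
    to A u, taken at resonance, has such a symbol. The factor 1/2 in S_(2k+1) normalises w_k,
    because d_k and r_k are orthonormal. As maximal regularity asks for some q and tau, its failure
    must defeat every pair; a bounded continuous forcing whose solution is outside the domain at
    every time in (0, tau) does so. In the positive direction the delicate point is measurability: u
    must be a limit, in the graph norm, of step functions with values in the domain. Each mode of u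
    is uniformly continuous, so finitely many modes sampled on a fine enough grid provide such
    steps. *)

Section rnorm_zmod.
Context (R : realType) (X : normedZmodType R[i]).
Implicit Types (x y : X).

Lemma ler_rnormD x y : rnorm (x + y) <= rnorm x + rnorm y.
Proof. by rewrite -lecR rmorphD/= !rnormE ler_normD. Qed.

Lemma rnorm0 : rnorm (0 : X) = 0.
Proof. by rewrite /rnorm normr0. Qed.

Lemma rnormN x : rnorm (- x) = rnorm x.
Proof. by rewrite /rnorm normrN. Qed.

Lemma rnorm_distC x y : rnorm (x - y) = rnorm (y - x).
Proof. by rewrite /rnorm distrC. Qed.

Lemma ler_rnormB x y : rnorm (x - y) <= rnorm x + rnorm y.
Proof. by rewrite -[rnorm y]rnormN ler_rnormD. Qed.

Lemma rnorm_eq0P x : rnorm x = 0 -> x = 0.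
Proof. by move=> x0; apply/eqP; rewrite -normr_eq0 -rnormE x0. Qed.

Lemma rnorm_sum (I : Type) (r : seq I) (P : pred I) (F : I -> X) :
  rnorm (\sum_(i <- r | P i) F i) <= \sum_(i <- r | P i) rnorm (F i).
Proof.
elim/big_ind2 : _ => [|x a y b xa yb|//]; first by rewrite rnorm0.
by rewrite (le_trans (ler_rnormD _ _))// lerD.
Qed.

Lemma ler_rnorm_dist x y : `|rnorm x - rnorm y| <= rnorm (x - y).
Proof.
rewrite ler_norml; apply/andP; split.
  rewrite lerNl opprB lerBlDr rnorm_distC -[y in leLHS](subrK x).
  by rewrite ler_rnormD.
by rewrite lerBlDr -[x in leLHS](subrK y) ler_rnormD.
Qed.

End rnorm_zmod.

Section rnorm_theory.
Context (R : realType) (X : normedModType R[i]).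
Implicit Types (x y : X) (a : R[i]).

Lemma rnormZ a x : rnorm (a *: x) = rnorm a * rnorm x.
Proof. by apply: (@complexI R); rewrite rmorphM/= !rnormE normrZ. Qed.

Lemma rnorm_real (r : R) : rnorm (r%:C : R[i]) = `|r|.
Proof. by rewrite rnormc/= expr0n addr0 sqrtr_sqr. Qed.

Lemma rnormZr (r : R) x : rnorm (r%:C *: x) = `|r| * rnorm x.
Proof. by rewrite rnormZ rnorm_real. Qed.

Lemma cvg_rnormP (T : Type) (F : set_system T) {FF : Filter F} (f : T -> X) x :
  f t @[t --> F] --> x <-> rnorm (f t - x) @[t --> F] --> (0 : R).
Proof.
split=> [/cvgr_dist_lt fx|/cvgr_dist_lt fx]; apply/cvgrPdist_lt => e e0.
  have e0' : 0 < e%:C :> R[i] by rewrite ltcR.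
  apply: filterS (fx _ e0') => t; rewrite sub0r normrN ger0_norm ?rnorm_ge0//.
  by rewrite -rnormE ltcR rnorm_distC.
have e0' : 0 < complex.Re e by move: e0; rewrite ltcE => /andP[].
have eE : e = (complex.Re e)%:C by rewrite RRe_real// gtr0_real.
apply: filterS (fx _ e0') => t; rewrite sub0r normrN ger0_norm ?rnorm_ge0//.
by rewrite eE -rnormE ltcR rnorm_distC.
Qed.

Lemma cvg_uniqueX (T : Type) (F : set_system T) {FF : ProperFilter F}
    (f : T -> X) x y : f t @[t --> F] --> x -> f t @[t --> F] --> y -> x = y.
Proof. by move=> fx; apply: cvg_unique fx. Qed.

Lemma rnorm_squeeze (T : Type) (F : set_system T) {FF : Filter F}
    (f : T -> X) x (g : T -> R) :
  (\forall t \near F, rnorm (f t - x) <= g t) -> g t @[t --> F] --> (0 : R) ->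
  f t @[t --> F] --> x.
Proof.
move=> fg g0; apply/cvg_rnormP; apply: (squeeze_cvgr _ (cvg_cst 0) g0).
by apply: filterS fg => t ->; rewrite rnorm_ge0.
Qed.

End rnorm_theory.

Lemma cvgMl0 (R : realType) (T : Type) (F : set_system T) {FF : Filter F}
    (c : R) (u : T -> R) :
  u t @[t --> F] --> (0 : R) -> c * u t @[t --> F] --> (0 : R).
Proof. by move=> u0; have h := cvgM (cvg_cst c) u0; rewrite mulr0 in h; exact: h. Qed.

Lemma cvgD00 (R : realType) (T : Type) (F : set_system T) {FF : Filter F}
    (u v : T -> R) : u t @[t --> F] --> (0 : R) ->
  v t @[t --> F] --> (0 : R) -> u t + v t @[t --> F] --> (0 : R).
Proof. by move=> u0 v0; have h := cvgD u0 v0; rewrite addr0 in h; exact: h. Qed.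

Section lower_integral.
Context d (T : measurableType d) (R : realType) (mu : {measure set T -> \bar R}).
Variables (D : set T) (mD : measurable D).
Local Open Scope ereal_scope.
Implicit Types f g : T -> \bar R.
Import HBNNSimple.

(* No measurability: for nonnegative functions the integral is a lower integral. *)
Lemma ae_ge0_le_lower_integral f g : (forall t, D t -> 0 <= f t) ->
  (forall t, D t -> 0 <= g t) -> {ae mu, forall t, D t -> f t <= g t} ->
  \int[mu]_(t in D) f t <= \int[mu]_(t in D) g t.
Proof.
move=> f0 g0 [N [mN N0 fg]]; rewrite !ge0_integralE//.
apply: ge_ereal_sup => _ [h/= hf <-].
apply: le_ereal_sup_tmp.
exists (sintegral mu (proj_nnsfun h (measurableC mN))); last first.
  rewrite -!integralT_nnsfun (ge0_negligible_integral mN)//; last 2 first.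
  - by apply/measurable_EFinP.
  - by move=> x _; rewrite lee_fin.
  rewrite setTD integral_mkcond le_eqVlt; apply/orP; left; apply/eqP.
  apply: eq_integral => x _; rewrite /= patchE mindicE.
  by case: ifPn; rewrite ?mulr1 ?mulr0.
exists (proj_nnsfun h (measurableC mN)) => // x.
rewrite /= mindicE in_setC.
have := hf x; rewrite /patch; case: ifPn => xD hx; last first.
  by case: (x \in N); rewrite /= ?mulr0 ?mulr1.
rewrite inE in xD; case: (boolP (x \in N)) => xN/=; rewrite ?mulr0 ?mulr1.
  exact: g0.
apply: (le_trans hx); apply: contrapT => fgx; move/negP: xN; apply; rewrite inE.
by apply: fg => /= fgDx; apply: fgx; apply: fgDx.
Qed.

End lower_integral.

(** * Step functions and the Bochner integral *)

Section steps.
Context d (T : measurableType d) (R : realType) (X : normedModType R[i]).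
Variables (mu : {measure set T -> \bar R}) (D : set T).
Hypotheses (mD : measurable D) (Dfin : (mu D < +oo)%E).
Implicit Types (V : set X) (f g : T -> X) (x y v : X) (A E : set T).

Lemma fin_muID A : measurable A -> (mu (A `&` D) < +oo)%E.
Proof.
move=> mA; apply: le_lt_trans Dfin.
by apply: le_measure; rewrite ?inE//; exact: measurableI.
Qed.

(** A relation between a function and a value of its integral: sums and linear images can be formed
    without first proving that the integral is independent of the representation. *)
Definition is_step V f x := exists s : step T X,
  [/\ step_ok mu D s, forall i, V (@step_val _ _ _ _ s i), step_fun s = f
    & step_integral mu D s = x].

Lemma is_step0 V : is_step V (fun=> 0) 0.
Proof.
exists (@Step _ _ _ X 0 (fun=> set0) (fun=> 0)); split => [[]//|[]//||].
- by apply/funext => t; rewrite /step_fun big_ord0.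
- by rewrite /step_integral big_ord0.
Qed.

Lemma is_stepD V f g x y : is_step V f x -> is_step V g y ->
  is_step V (fun t => f t + g t) (x + y).
Proof.
move=> [[m E v] [/= ok vV <- <-]] [[n F w] [/= ok' wV <- <-]].
pose ef (i : 'I_(m + n)) := match fintype.split i with inl j => E j | inr j => F j end.
pose vw (i : 'I_(m + n)) := match fintype.split i with inl j => v j | inr j => w j end.
exists (@Step _ _ _ X (m + n) ef vw); split => /=.
- by move=> i /=; rewrite /ef; case: (fintype.split i) => j; [exact: ok|exact: ok'].
- by move=> i /=; rewrite /vw; case: (fintype.split i) => j; [exact: vV|exact: wV].
- apply/funext => t; rewrite /step_fun/= big_split_ord/=.
  by congr (_ + _); apply: eq_bigr => i _; rewrite /ef /vw;
    [rewrite (unsplitK (inl i))|rewrite (unsplitK (inr i))].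
- rewrite /step_integral/= big_split_ord/=.
  by congr (_ + _); apply: eq_bigr => i _; rewrite /ef /vw;
    [rewrite (unsplitK (inl i))|rewrite (unsplitK (inr i))].
Qed.

Lemma is_step_indic V A v : measurable A -> V v ->
  is_step V (fun t => (\1_A t)%:C *: v) ((fine (mu (A `&` D)))%:C *: v).
Proof.
move=> mA Vv; exists (@Step _ _ _ X 1 (fun=> A) (fun=> v)); split => //=.
- by move=> i /=; split => //; exact: fin_muID.
- by apply/funext => t; rewrite /step_fun big_ord1.
- by rewrite /step_integral big_ord1.
Qed.

Lemma is_step_ind V (P : (T -> X) -> X -> Prop) :
  P (fun=> 0) 0 ->
  (forall A v f x, measurable A -> V v -> is_step V f x -> P f x ->
    P (fun t => f t + (\1_A t)%:C *: v) (x + (fine (mu (A `&` D)))%:C *: v)) ->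
  forall f x, is_step V f x -> P f x.
Proof.
move=> P0 PS f x [[n E v] [/= ok vV <- <-]]; rewrite /step_fun /step_integral/=.
elim: n => [|n IH] in E v ok vV *.
  rewrite big_ord0 (_ : (fun t => _) = fun=> 0)//.
  by apply/funext => t; rewrite big_ord0.
rewrite big_ord_recr/= (_ : (fun t => _) = (fun t =>
    (\sum_(i < n) (\1_(E (widen_ord (leqnSn n) i)) t)%:C *:
      v (widen_ord (leqnSn n) i)) + (\1_(E ord_max) t)%:C *: v ord_max)); last first.
  by apply/funext => t; rewrite big_ord_recr.
have ok' : step_ok mu D (@Step _ _ _ X n (fun i => E (widen_ord (leqnSn n) i))
    (fun i => v (widen_ord (leqnSn n) i))) by move=> i; exact: ok.
apply: PS; first by case: (ok ord_max).
- exact: vV.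
- by eexists; split; first exact: ok'; [move=> i; exact: vV| |].
- by apply: IH; [exact: ok'|move=> i; exact: vV].
Qed.

Lemma is_step_linear (Y : normedModType R[i]) V (W : set Y) (L : X -> Y) f x :
  linear L -> (forall v, V v -> W (L v)) -> is_step V f x ->
  exists s : step T Y, [/\ step_ok mu D s,
    forall i, W (@step_val _ _ _ _ s i), step_fun s = L \o f
    & step_integral mu D s = L x].
Proof.
move=> lL VW [[n E v] [/= ok vV <- <-]].
have L0 : L 0 = 0 by have := lL (-1) 0 0; rewrite scaler0 addr0 scaleN1r addNr.
have LD a b : L (a + b) = L a + L b by have := lL 1 a b; rewrite !scale1r.
have LZ c a : L (c *: a) = c *: L a by have := lL c a 0; rewrite addr0 L0 addr0.
exists (@Step _ _ _ Y n E (L \o v)); split => //=.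
- by move=> i; exact: VW.
- apply/funext => t; rewrite /step_fun/= (big_morph L LD L0).
  by apply: eq_bigr => i _; rewrite LZ.
- rewrite /step_integral/= (big_morph L LD L0).
  by apply: eq_bigr => i _; rewrite LZ.
Qed.

Lemma is_step_restrict V A f x : measurable A -> is_step V f x ->
  exists y, is_step V (fun t => (\1_A t)%:C *: f t) y.
Proof.
move=> mA; apply: (@is_step_ind V (fun f x => exists y, is_step V _ y)).
  exists 0; have -> : (fun t => (\1_A t)%:C *: (0 : X)) = fun=> 0.
    by apply/funext => t; rewrite scaler0.
  exact: is_step0.
move=> B v {}f {}x mB Vv _ [y fy].
exists (y + (fine (mu ((A `&` B) `&` D)))%:C *: v).
have -> : (fun t => (\1_A t)%:C *: (f t + (\1_B t)%:C *: v)) =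
   (fun t => (\1_A t)%:C *: f t + (\1_(A `&` B) t)%:C *: v).
  by apply/funext => t; rewrite scalerDr scalerA indicI/= rmorphM.
by apply: is_stepD => //; apply: is_step_indic => //; exact: measurableI.
Qed.

Lemma is_step_sum V (n : nat) (F : nat -> T -> X) :
  (forall i, (i < n)%N -> exists y, is_step V (F i) y) ->
  exists y, is_step V (fun t => \sum_(i < n) F i t) y.
Proof.
elim: n => [|n IH] h.
  exists 0; rewrite (_ : (fun t => _) = fun=> 0); first exact: is_step0.
  by apply/funext => t; rewrite big_ord0.
have [i ni|y yn] := IH; first by apply: h; rewrite (ltn_trans ni).
have [z zn] := h n (ltnSn n); exists (y + z).
rewrite (_ : (fun t => _) = fun t => \sum_(i < n) F i t + F n t); last first.
  by apply/funext => t; rewrite big_ord_recr.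
exact: is_stepD.
Qed.

End steps.

Section step_norm.
Context d (T : measurableType d) (R : realType) (X : normedModType R[i]).
Variables (mu : {measure set T -> \bar R}).
Implicit Types (f g : T -> X) (x y v : X) (A E : set T).

(** The sets may overlap. The constant [c] and the free set [A] carry the induction on [n]: [A] is
    cut by the last set, and on the part inside it the last value is absorbed into [c]. *)
Lemma step_sum_norm n (E : 'I_n -> set T) (v : 'I_n -> X) A c :
  (forall i, measurable (E i)) -> measurable A -> (mu A < +oo)%E ->
  measurable_fun A
    (fun t => rnorm (c + \sum_(i < n) (\1_(E i) t)%:C *: v i)) /\
  ((rnorm ((fine (mu A))%:C *: c +
      \sum_(i < n) (fine (mu (E i `&` A)))%:C *: v i))%:E <=
   \int[mu]_(t in A)
     (rnorm (c + \sum_(i < n) (\1_(E i) t)%:C *: v i))%:E)%E.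
Proof.
elim: n => [|n IH] in E v A c *.
  move=> _ mA Afin; split.
    apply: (eq_measurable_fun (cst (rnorm c))) => // t _.
    by rewrite big_ord0 addr0.
  rewrite big_ord0 addr0.
  rewrite (eq_integral (cst (rnorm c)%:E)); last first.
    by move=> t _; rewrite big_ord0 addr0.
  rewrite (integral_cst mu mA) rnormZr ger0_norm ?fine_ge0// EFinM fineK.
    by rewrite muleC.
  by rewrite ge0_fin_numE.
move=> mE mA Afin; pose F i := E (widen_ord (leqnSn n) i).
pose w i := v (widen_ord (leqnSn n) i); pose B := E ord_max.
have mB : measurable B by exact: mE.
have mAB : measurable (A `&` B) by exact: measurableI.
have mAC : measurable (A `\` B) by exact: measurableD.
have ABfin : (mu (A `&` B) < +oo)%E.
  by apply: le_lt_trans Afin; apply: le_measure; rewrite ?inE.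
have ACfin : (mu (A `\` B) < +oo)%E.
  by apply: le_lt_trans Afin; apply: le_measure; rewrite ?inE//; exact: subDsetl.
have [m1 i1] := IH F w _ (c + v ord_max) (fun i => mE _) mAB ABfin.
have [m2 i2] := IH F w _ c (fun i => mE _) mAC ACfin.
have AE : A = (A `&` B) `|` (A `\` B) by rewrite setUIDK.
have e1 : {in A `&` B, (fun t => rnorm (c + v ord_max + \sum_(i < n) (\1_(F i) t)%:C *: w i)) =1
   (fun t => rnorm (c + \sum_(i < n.+1) (\1_(E i) t)%:C *: v i))}.
  move=> t; rewrite inE => -[_ Bt]; congr rnorm.
  rewrite big_ord_recr/= [in RHS]indicE mem_set// scale1r -addrA; congr (_ + _).
  by rewrite addrC.
have e2 : {in A `\` B, (fun t => rnorm (c + \sum_(i < n) (\1_(F i) t)%:C *: w i)) =1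
   (fun t => rnorm (c + \sum_(i < n.+1) (\1_(E i) t)%:C *: v i))}.
  move=> t; rewrite inE => -[_ Bt]; congr rnorm.
  by rewrite big_ord_recr/= [in RHS]indicE memNset// scale0r addr0.
have mm : measurable_fun A
    (fun t => rnorm (c + \sum_(i < n.+1) (\1_(E i) t)%:C *: v i)).
  rewrite AE; apply/measurable_funU => //; split.
    exact: eq_measurable_fun m1.
  exact: eq_measurable_fun m2.
split => //.
rewrite [in leRHS]AE ge0_integral_setU//=; last 3 first.
- by rewrite -AE; apply/measurable_EFinP.
- by move=> t _; rewrite lee_fin rnorm_ge0.
- by rewrite disj_set2E setDE setIACA setICr setI0.
rewrite -(eq_integral _ _ (fun t h => congr1 EFin (e1 t h))).
rewrite -(eq_integral _ _ (fun t h => congr1 EFin (e2 t h))).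
apply: le_trans (leeD i1 i2); rewrite -EFinD lee_fin.
apply: le_trans (ler_rnormD _ _); rewrite le_eqVlt; apply/orP; left; apply/eqP.
congr rnorm.
have split_mu (G : set T) : measurable G -> fine (mu (G `&` A)) =
    fine (mu (G `&` (A `&` B))) + fine (mu (G `&` (A `\` B))).
  move=> mG; rewrite -fineD; last 2 first.
  - rewrite ge0_fin_numE//; apply: le_lt_trans ABfin.
    by apply: le_measure; rewrite ?inE//; exact: measurableI.
  - rewrite ge0_fin_numE//; apply: le_lt_trans ACfin.
    by apply: le_measure; rewrite ?inE//; exact: measurableI.
  congr fine; rewrite -measureU; last 3 first.
  - exact: measurableI.
  - exact: measurableI.
  - by rewrite -setIIr setDE setIACA setICr setI0 setI0.
  by rewrite -setIUr setUIDK.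
rewrite big_ord_recr/= -/B.
have -> : fine (mu A) = fine (mu (A `&` B)) + fine (mu (A `\` B)).
  by have := split_mu setT measurableT; rewrite !setTI.
rewrite [B `&` A]setIC.
under eq_bigr => i _ do rewrite split_mu// rmorphD scalerDl.
rewrite big_split/= rmorphD/= scalerDl scalerDr.
rewrite -/w -/F.
set a := _ *: c; set b := _ *: c; set e := \sum_(i < n) _; set h := \sum_(i < n) _.
set k := _ *: v _.
by rewrite [LHS](AC (2*(2*1)) ((1*5*3)*(2*4)))/=.
Qed.

End step_norm.

Section bochner_theory.
Context d (T : measurableType d) (R : realType) (X : normedModType R[i]).
Variables (mu : {measure set T -> \bar R}) (D : set T).
Hypotheses (mD : measurable D) (Dfin : (mu D < +oo)%E).
Implicit Types (V : set X) (N : X -> R) (f g : T -> X) (x y v : X) (A E : set T).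

Local Notation sm := (strongly_measurable mu D).
Local Notation L1 f := (\int[mu]_(t in D) (rnorm (f t))%:E)%E.

Lemma strongly_measurable_inP V N f : strongly_measurable_in mu D V N f <->
  exists s : nat -> T -> X, (forall n, exists x, is_step mu D V (s n) x) /\
    {ae mu, forall t, D t -> V (f t) /\ N (s n t - f t) @[n --> \oo] --> (0 : R)}.
Proof.
split=> [[s [sok sf]]|[s [sok sf]]].
  exists (fun n => step_fun (s n)); split => // n.
  by eexists; exists (s n); split; first exact: (sok n).1;
    [exact: (sok n).2| |].
have /choice[r rP] n : exists r : step T X, [/\ step_ok mu D r,
    forall i, V (@step_val _ _ _ _ r i) & step_fun r = s n].
  by have [x [r [rok rV rs _]]] := sok n; exists r.
have rE n : step_fun (r n) = s n by have [] := rP n.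
exists r; split => [n|]; first by have [] := rP n.
move: sf; apply: filterS => t + Dt => /(_ Dt)[Vf sf]; split => //.
by under eq_fun do rewrite rE.
Qed.

Lemma is_step_norm f x : is_step mu D setT f x ->
  measurable_fun D (fun t => rnorm (f t)) /\ ((rnorm x)%:E <= L1 f)%E.
Proof.
move=> [[n E v] [/= ok _ <- <-]].
have [m i] := step_sum_norm v 0 (fun i => (ok i).1) mD Dfin; split.
  apply: eq_measurable_fun m => t _ /=; by rewrite add0r.
rewrite scaler0 add0r in i; apply: (le_trans i); rewrite le_eqVlt; apply/orP.
by left; apply/eqP; apply: eq_integral => t _; rewrite add0r.
Qed.

Lemma sm_step f x : is_step mu D setT f x -> sm f.
Proof.
move=> fx; apply/strongly_measurable_inP; exists (fun=> f).
split => [n|]; first by exists x.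
apply: aeW => t Dt; split => //.
by rewrite subrr rnorm0; exact: cvg_cst.
Qed.

Lemma smD f g : sm f -> sm g -> sm (fun t => f t + g t).
Proof.
move=> /strongly_measurable_inP[s [ss sf]] /strongly_measurable_inP[r [rr rg]].
apply/strongly_measurable_inP; exists (fun n t => s n t + r n t); split => [n|].
  have [x xn] := ss n; have [y yn] := rr n; exists (x + y); exact: is_stepD.
move: sf rg; apply: filterS2 => t sf rg Dt.
have [_ {}sf] := sf Dt; have [_ {}rg] := rg Dt; split => //.
by apply/cvg_rnormP; apply: cvgD; apply/cvg_rnormP.
Qed.

Lemma sm_ae f g : sm f -> {ae mu, forall t, D t -> f t = g t} -> sm g.
Proof.
move=> /strongly_measurable_inP[s [ss sf]] fg.
apply/strongly_measurable_inP; exists s; split => //.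
by move: sf fg; apply: filterS2 => t sf fg Dt; rewrite -fg//; exact: sf.
Qed.

Lemma sm_restrict A f : measurable A -> sm f -> sm (fun t => (\1_A t)%:C *: f t).
Proof.
move=> mA /strongly_measurable_inP[s [ss sf]].
apply/strongly_measurable_inP; exists (fun n t => (\1_A t)%:C *: s n t); split.
  by move=> n; have [x xn] := ss n; apply: is_step_restrict xn.
move: sf; apply: filterS => t sf Dt.
have [_ {}sf] := sf Dt; split => //.
under eq_fun do rewrite -scalerBr rnormZr.
exact: cvgMl0.
Qed.

(** Strong measurability leaves [f] arbitrary on a null set, so its norm itself may fail to be
    measurable. Multiplying by the indicator of the complement of that null set makes the step norms
    converge everywhere on [D]. *)
Lemma sm_norm f : sm f -> exists g : T -> R, [/\ measurable_fun D g,
  forall t, 0 <= g t & {ae mu, forall t, D t -> rnorm (f t) = g t}].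
Proof.
move=> /strongly_measurable_inP[s [ss [N [mN N0 sf]]]].
exists (fun t => rnorm (f t) * \1_(~` N) t); split; last 2 first.
- by move=> t; rewrite mulr_ge0// rnorm_ge0.
- exists N; split => // t /= ft; apply: contrapT => Nt; apply: ft => _.
  by rewrite indicE mem_set// mulr1.
apply: (@measurable_fun_cvg _ _ _ _ (fun n t => rnorm (s n t) * \1_(~` N) t)).
  move=> n; have [x xn] := ss n; apply: measurable_funM.
    exact: (is_step_norm xn).1.
  by apply: measurable_indic; exact: measurableC.
move=> t Dt; case: (pselect (N t)) => Nt.
  rewrite indicE memNset ?mulr0; last by move=> /(_ Nt).
  by under eq_fun do rewrite mulr0; exact: cvg_cst.
rewrite indicE mem_set// mulr1; under eq_fun do rewrite mulr1.
have : ~ ~ (D t -> setT (f t) /\ rnorm (s n t - f t) @[n --> \oo] --> (0:R)).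
  by move=> h; apply: Nt; apply: sf.
move=> /contrapT/(_ Dt)[_ sft]; apply/cvgrPdist_lt => e e0.
move/cvgrPdist_lt : sft => /(_ e e0); apply: filterS => n.
rewrite sub0r normrN ger0_norm ?rnorm_ge0// => h.
by apply: le_lt_trans h; rewrite rnorm_distC ler_rnorm_dist.
Qed.

Lemma le_L1 (u v : T -> R) : (forall t, 0 <= u t) -> (forall t, 0 <= v t) ->
  {ae mu, forall t, D t -> u t <= v t} ->
  (\int[mu]_(t in D) (u t)%:E <= \int[mu]_(t in D) (v t)%:E)%E.
Proof.
move=> u0 v0 uv; apply: ae_ge0_le_lower_integral => [t _|t _|].
- by rewrite lee_fin.
- by rewrite lee_fin.
by move: uv; apply: filterS => t uv Dt; rewrite lee_fin uv.
Qed.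

Lemma eq_L1 (u v : T -> R) : (forall t, 0 <= u t) -> (forall t, 0 <= v t) ->
  {ae mu, forall t, D t -> u t = v t} ->
  (\int[mu]_(t in D) (u t)%:E = \int[mu]_(t in D) (v t)%:E)%E.
Proof.
move=> u0 v0 uv; apply/eqP; rewrite eq_le; apply/andP; split; apply: le_L1 => //;
  by move: uv; apply: filterS => t uv Dt; rewrite uv.
Qed.

Lemma sm_L1D f g : sm f -> sm g ->
  (L1 (fun t => (f t + g t)%R) <= L1 f + L1 g)%E.
Proof.
move=> /sm_norm[u [mu_ u0 fu]] /sm_norm[v [mv v0 gv]].
rewrite (eq_L1 _ u0 fu); last by move=> t; exact: rnorm_ge0.
rewrite (eq_L1 _ v0 gv); last by move=> t; exact: rnorm_ge0.
rewrite -ge0_integralD//; last 4 first.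
- by move=> t _; rewrite lee_fin.
- exact/measurable_EFinP.
- by move=> t _; rewrite lee_fin.
- exact/measurable_EFinP.
under [leRHS]eq_integral do rewrite -EFinD.
apply: le_L1; [by move=> t; exact: rnorm_ge0|by move=> t; rewrite addr_ge0|].
move: fu gv; apply: filterS2 => t fu gv Dt; rewrite -fu// -gv//.
exact: ler_rnormD.
Qed.

Lemma smN f : sm f -> sm (fun t => - f t).
Proof.
move=> /strongly_measurable_inP[s [ss sf]].
apply/strongly_measurable_inP; exists (fun n t => - s n t); split => [n|].
  have [x xn] := ss n; exists (- x).
  have lN : linear (fun v : X => - v).
    by move=> a u v; rewrite opprD scalerN.
  exact: (is_step_linear lN _ xn).
move: sf; apply: filterS => t sf Dt; have [_ {}sf] := sf Dt; split => //.
by under eq_fun do rewrite -opprD rnormN.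
Qed.

Lemma smB f g : sm f -> sm g -> sm (fun t => f t - g t).
Proof. by move=> sf sg; apply: smD => //; exact: smN. Qed.

Lemma sm_L1B f g : sm f -> sm g ->
  (L1 (fun t => (f t - g t)%R) <= L1 f + L1 g)%E.
Proof.
move=> sf sg; apply: (le_trans (sm_L1D sf (smN sg))).
by under [X in (_ + X <= _)%E]eq_integral do rewrite rnormN.
Qed.

Local Notation hb := (has_bochner_integral mu D).

Lemma has_bochnerP f x : hb f x <-> sm f /\ exists (s : nat -> T -> X) (y : nat -> X),
  [/\ forall n, is_step mu D setT (s n) (y n),
      L1 (fun t => f t - s n t) @[n --> \oo] --> (0 : \bar R)
    & y n @[n --> \oo] --> x].
Proof.
split=> [[sf [s [sok s0 sx]]]|[sf [s [y [sok s0 sx]]]]]; split => //.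
  exists (fun n => step_fun (s n)), (fun n => step_integral mu D (s n)).
  by split => // n; exists (s n).
have /choice[r rP] n : exists r : step T X, [/\ step_ok mu D r,
    step_fun r = s n & step_integral mu D r = y n].
  by have [r [rok _ rs ry]] := sok n; exists r.
have rE n : step_fun (r n) = s n by have [] := rP n.
have rI n : step_integral mu D (r n) = y n by have [] := rP n.
exists r; split => [n||]; first by case: (rP n).
  by under eq_fun do rewrite rE.
by under eq_fun do rewrite rI.
Qed.

Lemma lee_cvg0 (a b : \bar R) (u : nat -> \bar R) : (forall n, a <= b + u n)%E ->
  u n @[n --> \oo] --> (0 : \bar R) -> (a <= b)%E.
Proof.
move=> h u0; have hu : ((fun=> b) \+ u @ \oo --> b + 0)%E.
  by apply: cvgeD => //; [rewrite fin_num_adde_defl|exact: cvg_cst].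
rewrite adde0 in hu; apply: cvge_to_ge hu _; exact: nearW.
Qed.

Lemma cvgD0 (u v : nat -> \bar R) : u n @[n --> \oo] --> (0 : \bar R) ->
  v n @[n --> \oo] --> (0 : \bar R) -> (u n + v n)%E @[n --> \oo] --> (0 : \bar R).
Proof.
move=> u0 v0; have h : (u \+ v)%E @ \oo --> (0 + 0 : \bar R)%E by apply: cvgeD.
by rewrite adde0 in h; exact: h.
Qed.

Lemma cvg_rnorm0E (y : nat -> X) x : y n @[n --> \oo] --> x ->
  (rnorm (y n - x))%:E @[n --> \oo] --> (0 : \bar R).
Proof. by move=> /cvg_rnormP h; apply: cvg_EFin => //; exact: nearW. Qed.

(** Passage to the limit from the steps. Applied to a difference of two integrals of one function,
    it also yields their uniqueness. *)
Lemma has_bochner_norm f x : hb f x -> ((rnorm x)%:E <= L1 f)%E.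
Proof.
move=> /has_bochnerP[sf [s [y [ss s0 yx]]]].
apply: (lee_cvg0 _ (cvgD0 s0 (cvg_rnorm0E yx))) => n.
rewrite addeA; apply: (@le_trans _ _ ((rnorm (y n))%:E + (rnorm (y n - x))%:E)%E).
  rewrite -EFinD lee_fin rnorm_distC -[x in leLHS](subrK (y n)) addrC.
  exact: ler_rnormD.
apply: leeD => //; apply: (le_trans (is_step_norm (ss n)).2).
have sfs := smB sf (sm_step (ss n)).
apply: le_trans (sm_L1B sf sfs).
by under [leRHS]eq_integral do rewrite opprB addrC subrK.
Qed.

Lemma has_bochnerD f g x y : hb f x -> hb g y -> hb (fun t => f t + g t) (x + y).
Proof.
move=> /has_bochnerP[sf [s [a [ss s0 ax]]]] /has_bochnerP[sg [r [b [rr r0 bx]]]].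
apply/has_bochnerP; split; first exact: smD.
exists (fun n t => s n t + r n t), (fun n => a n + b n); split.
- by move=> n; exact: is_stepD.
- apply: (squeeze_cvge _ (cvg_cst 0%E) (cvgD0 s0 r0)); apply: nearW => n.
  rewrite integral_ge0/=; last by move=> t _; rewrite lee_fin rnorm_ge0.
  apply: le_trans (sm_L1D (smB sf (sm_step (ss n))) (smB sg (sm_step (rr n)))).
  by under eq_integral do rewrite opprD addrACA.
- exact: cvgD.
Qed.

Lemma has_bochner_ae f g x : hb f x -> {ae mu, forall t, D t -> f t = g t} -> hb g x.
Proof.
move=> /has_bochnerP[sf [s [a [ss s0 ax]]]] fg.
apply/has_bochnerP; split; first exact: sm_ae fg.
exists s, a; split => //.
rewrite (_ : (fun n => L1 (fun t => (g t - s n t)%R)) =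
  (fun n => L1 (fun t => (f t - s n t)%R)))//; apply/funext => n; apply: eq_L1.
- by move=> t; exact: rnorm_ge0.
- by move=> t; exact: rnorm_ge0.
- by move: fg; apply: filterS => t fg Dt; rewrite fg.
Qed.

Lemma has_bochner_step f x : is_step mu D setT f x -> hb f x.
Proof.
move=> fx; apply/has_bochnerP; split; first exact: sm_step fx.
exists (fun=> f), (fun=> x); split => //; last exact: cvg_cst.
under eq_fun do under eq_integral do rewrite subrr rnorm0.
under eq_fun do rewrite integral0_eq//.
exact: cvg_cst.
Qed.

End bochner_theory.

Section bochner_linear.
Context d (T : measurableType d) (R : realType) (X Y : normedModType R[i]).
Variables (mu : {measure set T -> \bar R}) (D : set T).
Hypotheses (mD : measurable D) (Dfin : (mu D < +oo)%E).
Variables (L : X -> Y) (M : R).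
Hypotheses (lL : linear L) (LM : forall x, rnorm (L x) <= M * rnorm x).

Lemma linfun0 : L 0 = 0.
Proof. by have := lL (-1) 0 0; rewrite scaler0 addr0 scaleN1r addNr. Qed.

Lemma linfunD x y : L (x + y) = L x + L y.
Proof. by have := lL 1 x y; rewrite !scale1r. Qed.

Lemma linfunZ a x : L (a *: x) = a *: L x.
Proof. by have := lL a x 0; rewrite addr0 linfun0 addr0. Qed.

Lemma linfunN x : L (- x) = - L x.
Proof. by rewrite -scaleN1r linfunZ scaleN1r. Qed.

Lemma linfunB x y : L (x - y) = L x - L y.
Proof. by rewrite linfunD linfunN. Qed.

Lemma linfun_cvg (U : Type) (F : set_system U) {FF : Filter F} (u : U -> X) x :
  u t @[t --> F] --> x -> L (u t) @[t --> F] --> L x.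
Proof.
move=> /cvg_rnormP ux; apply: (@rnorm_squeeze _ _ _ _ _ _ _ (fun t => M * rnorm (u t - x))).
  by apply: nearW => t; rewrite -linfunB.
exact: cvgMl0.
Qed.

Lemma sm_linear f : strongly_measurable mu D f -> strongly_measurable mu D (L \o f).
Proof.
move=> /(strongly_measurable_inP)[s [ss sf]].
apply/strongly_measurable_inP; exists (fun n => L \o s n); split => [n|].
  by have [x xn] := ss n; exists (L x); exact: (is_step_linear lL _ xn).
move: sf; apply: filterS => t sf Dt; have [_ {}sf] := sf Dt; split => //.
by apply/cvg_rnormP; apply: linfun_cvg; apply/cvg_rnormP.
Qed.

Lemma has_bochner_linear f x : has_bochner_integral mu D f x ->
  has_bochner_integral mu D (L \o f) (L x).
Proof.
move=> /has_bochnerP[sf [s [a [ss s0 ax]]]].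
apply/has_bochnerP => //; split; first exact: sm_linear.
exists (fun n => L \o s n), (L \o a); split.
- by move=> n; exact: (is_step_linear lL _ (ss n)).
- have M0 : 0 <= `|M| by [].
  have s0' : (`|M|%:E * \int[mu]_(t in D) (rnorm (f t - s n t))%:E)%E
      @[n --> \oo] --> (0 : \bar R).
    have h := cvgeZl (isT : `|M|%:E \is a fin_num) s0.
    by rewrite mule0 in h; exact: h.
  apply: (squeeze_cvge _ (cvg_cst 0%E) s0'); apply: nearW => n.
  rewrite integral_ge0/=; last by move=> t _; rewrite lee_fin rnorm_ge0.
  have [g [mg g0 fg]] := sm_norm mD Dfin (smB sf (sm_step (ss n))).
  rewrite (eq_L1 _ g0 fg); last by move=> t; exact: rnorm_ge0.
  rewrite -ge0_integralZl_EFin//; last 2 first.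
  - by move=> t _; rewrite lee_fin.
  - exact/measurable_EFinP.
  under [leRHS]eq_integral do rewrite -EFinM.
  apply: le_L1 => //; first by move=> t; exact: rnorm_ge0.
  - by move=> t; rewrite mulr_ge0.
  move: fg; apply: filterS => t fg Dt; rewrite -linfunB -fg//.
  by apply: (le_trans (LM _)); rewrite ler_wpM2r ?rnorm_ge0// ler_norm.
- exact: linfun_cvg.
Qed.

End bochner_linear.

Section bochner_unique.
Context d (T : measurableType d) (R : realType) (X : normedModType R[i]).
Variables (mu : {measure set T -> \bar R}) (D : set T).
Hypotheses (mD : measurable D) (Dfin : (mu D < +oo)%E).
Implicit Types (f g : T -> X) (x y : X).
Local Notation hb := (has_bochner_integral mu D).

Lemma has_bochnerZ a f x : hb f x -> hb (fun t => a *: f t) (a *: x).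
Proof.
apply: (@has_bochner_linear _ _ _ _ _ _ _ mD Dfin (fun x => a *: x) (rnorm a)).
  by move=> b u v; rewrite scalerDr !scalerA mulrC.
by move=> u; rewrite rnormZ.
Qed.

Lemma has_bochnerB f g x y : hb f x -> hb g y -> hb (fun t => f t - g t) (x - y).
Proof.
move=> fx gy; rewrite -[- y]scaleN1r.
under [X in hb X _]eq_fun do rewrite -scaleN1r.
by apply: has_bochnerD => //; exact: has_bochnerZ.
Qed.

Lemma has_bochner_unique f x y : hb f x -> hb f y -> x = y.
Proof.
move=> fx fy; apply/eqP; rewrite -subr_eq0; apply/eqP; apply: rnorm_eq0P.
have := has_bochner_norm mD Dfin (has_bochnerB fx fy).
under eq_integral do rewrite subrr rnorm0.
rewrite integral0_eq// lee_fin => h.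
by apply/eqP; rewrite eq_le h rnorm_ge0.
Qed.

Lemma bochner_integralE f x : hb f x -> bochner_integral mu D f = x.
Proof.
by move=> fx; apply: xget_unique => // y fy; exact: has_bochner_unique fy fx.
Qed.

End bochner_unique.

Section bochner_domain.
Context d (T : measurableType d) (R : realType) (X : normedModType R[i]).
Variables (mu : {measure set T -> \bar R}) (D D' : set T).
Hypotheses (mD : measurable D) (Dfin : (mu D < +oo)%E).
Hypotheses (mD' : measurable D') (sDD' : D' `<=` D).
Implicit Types (V : set X) (N : X -> R) (f g : T -> X) (x y v : X) (A E : set T).

Lemma sub_domain_fin : (mu D' < +oo)%E.
Proof. by apply: le_lt_trans Dfin; apply: le_measure; rewrite ?inE. Qed.

Lemma is_step_domain V f x : is_step mu D V f x -> exists y,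
  is_step mu D V (fun t => (\1_D' t)%:C *: f t) y /\ is_step mu D' V f y.
Proof.
apply: (@is_step_ind _ _ _ _ mu D V (fun f x => exists y,
   is_step mu D V (fun t => (\1_D' t)%:C *: f t) y /\ is_step mu D' V f y)).
  exists 0; split; last exact: is_step0.
  have -> : (fun t => (\1_D' t)%:C *: (0 : X)) = fun=> 0.
    by apply/funext => t; rewrite scaler0.
  exact: is_step0.
move=> B v {}f {}x mB Vv _ [y [y1 y2]].
exists (y + (fine (mu (B `&` D')))%:C *: v); split; last first.
  by apply: is_stepD => //; apply: is_step_indic => //; exact: sub_domain_fin.
have -> : (fun t => (\1_D' t)%:C *: (f t + (\1_B t)%:C *: v)) =
   (fun t => (\1_D' t)%:C *: f t + (\1_(B `&` D') t)%:C *: v).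
  by apply/funext => t; rewrite scalerDr scalerA setIC indicI/= rmorphM.
apply: is_stepD => //.
have BD : (B `&` D') `&` D = B `&` D' by rewrite -setIA (setIidl sDD').
by rewrite -[in fine _]BD; apply: is_step_indic => //; exact: measurableI.
Qed.

Lemma sm_domain V N f : strongly_measurable_in mu D V N f ->
  strongly_measurable_in mu D' V N f.
Proof.
move=> /strongly_measurable_inP[s [ss sf]].
apply/strongly_measurable_inP; exists s; split => [n|].
  by have [x xn] := ss n; have [y [_ yn]] := is_step_domain xn; exists y.
by move: sf; apply: filterS => t sf Dt; apply: sf; exact: sDD'.
Qed.

Lemma L1_domain (u : T -> R) : (forall t, 0 <= u t) ->
  (\int[mu]_(t in D') (u t)%:E = \int[mu]_(t in D) (u t * \1_D' t)%:E)%E.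
Proof.
move=> u0; rewrite -[in LHS](setIidr sDD') integral_mkcondr.
apply: eq_integral => t _; rewrite patchE indicE; case: ifPn; rewrite ?mulr1//.
by rewrite mulr0.
Qed.

Lemma has_bochner_domain f x :
  has_bochner_integral mu D (fun t => (\1_D' t)%:C *: f t) x ->
  has_bochner_integral mu D' f x.
Proof.
move=> fx; have /has_bochnerP[sf [s [a [ss s0 ax]]]] := fx.
have Dfin' := sub_domain_fin.
have /choice[b bP] n := is_step_domain (ss n).
have smD' : strongly_measurable mu D' f.
  have := sm_domain sf; move=> /sm_ae; apply; apply: aeW => t Dt.
  by rewrite indicE mem_set// scale1r.
have le1 n t : rnorm ((\1_D' t)%:C *: f t - (\1_D' t)%:C *: s n t) <=
    rnorm ((\1_D' t)%:C *: f t - s n t).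
  rewrite indicE; case: (boolP (t \in D')) => _; rewrite ?scale1r//.
  by rewrite !scale0r subrr rnorm0 rnorm_ge0.
apply/has_bochnerP; split => //; exists s, b; split.
- by move=> n; exact: (bP n).2.
- apply: (squeeze_cvge _ (cvg_cst 0%E) s0); apply: nearW => n.
  rewrite integral_ge0/=; last by move=> t _; rewrite lee_fin rnorm_ge0.
  rewrite L1_domain; last by move=> t; exact: rnorm_ge0.
  apply: le_L1; [by move=> t; rewrite mulr_ge0// rnorm_ge0|by move=> t; exact: rnorm_ge0|].
  apply: aeW => t _; rewrite indicE; case: (boolP (t \in D')) => _.
    by rewrite mulr1 scale1r.
  by rewrite mulr0 rnorm_ge0.
- apply/cvg_rnormP.
  suff h : (rnorm (b n - x))%:E @[n --> \oo] --> (0%R%:E : \bar R) by exact: (fine_cvg h).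
  apply: (squeeze_cvge _ (cvg_cst 0%E) s0); apply: nearW => n.
  rewrite lee_fin rnorm_ge0/=.
  have h := has_bochnerB mD Dfin (has_bochner_step (bP n).1) fx.
  apply: (le_trans (has_bochner_norm mD Dfin h)).
  apply: le_L1; [by move=> t; exact: rnorm_ge0|by move=> t; exact: rnorm_ge0|].
  by apply: aeW => t _; rewrite rnorm_distC.
Qed.

End bochner_domain.

(** Completeness in terms of the real-valued norm, kept as a hypothesis of the abstract theory and
    discharged for L^p by the Riesz-Fischer argument. *)
Definition seq_complete (R : realType) (X : normedModType R[i]) :=
  forall u : nat -> X, (forall e : R, 0 < e -> exists N, forall m n,
    (N <= m)%N -> (N <= n)%N -> rnorm (u m - u n) < e) ->
  exists x : X, u n @[n --> \oo] --> x.

Section bochner_exists.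
Context d (T : measurableType d) (R : realType) (X : normedModType R[i]).
Variables (mu : {measure set T -> \bar R}) (D : set T).
Hypotheses (mD : measurable D) (Dfin : (mu D < +oo)%E) (cX : seq_complete X).

Lemma has_bochner_exists (f : T -> X) : strongly_measurable mu D f ->
  (\int[mu]_(t in D) (rnorm (f t))%:E < +oo)%E ->
  exists x, has_bochner_integral mu D f x.
Proof.
move=> sf fi; have [g [mg g0 fg]] := sm_norm mD Dfin sf.
have /strongly_measurable_inP[s [ss scv]] := sf.
rewrite (eq_L1 _ g0 fg) in fi; last by move=> t; exact: rnorm_ge0.
(* Steps are set to zero where they exceed the norm of [f] by more than one. Almost everywhere this
   happens only finitely often, so convergence survives, and the errors are now dominated by
   [2 * g t + 1], which is integrable because [D] has finite measure. *)
pose A n := D `&` [set t | rnorm (s n t) <= g t + 1].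
have mA n : measurable (A n).
  have [x xn] := ss n; apply: measurable_fun_le => //.
    exact: (is_step_norm mD Dfin xn).1.
  by apply: measurable_funD.
pose r n t := (\1_(A n) t)%:C *: s n t.
have /choice[y yP] n : exists y, is_step mu D setT (r n) y.
  by have [x xn] := ss n; apply: is_step_restrict xn.
have /choice[H HP] n := sm_norm mD Dfin (smB sf (sm_step (yP n))).
have Hae : {ae mu, forall t n, D t -> rnorm (f t - r n t) = H n t}.
  apply: ae_foralln => n; by have [_ _] := HP n.
have int0 : (\int[mu]_(t in D) (rnorm (f t - r n t))%:E)%E @[n --> \oo] -->
    (0 : \bar R).
  have igg : mu.-integrable D (fun t => (2 * g t + 1)%:E).
    apply/integrableP; split.
      apply/measurable_EFinP; apply: measurable_funD => //.
      exact: measurable_funM.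
    under eq_integral do rewrite gee0_abs ?lee_fin ?addr_ge0 ?mulr_ge0// EFinD EFinM.
    rewrite ge0_integralD//; last 2 first.
    - by move=> t _; rewrite -EFinM lee_fin mulr_ge0.
    - by apply/measurable_EFinP; exact: measurable_funM.
    rewrite ge0_integralZl_EFin//; last 2 first.
    - by move=> t _; rewrite lee_fin.
    - exact/measurable_EFinP.
    rewrite (integral_cst mu mD) lte_add_pinfty// lte_mul_pinfty//.
  have mH n : measurable_fun D (fun t => (H n t)%:E).
    by apply/measurable_EFinP; have [] := HP n.
  have Hcv : {ae mu, forall t, D t -> (H n t)%:E @[n --> \oo] --> (cst 0%E t : \bar R)}.
    move: Hae scv fg; apply: filterS3 => t Ht scv fgt Dt.
    have [_ {}scv] := scv Dt; apply: cvg_EFin; first exact: nearW.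
    rewrite /=; under eq_fun do rewrite -(Ht _ Dt).
    apply: (squeeze_cvgr _ (cvg_cst (0 : R)) scv).
    move/cvgrPdist_lt : (scv) => /(_ 1 ltr01); apply: filterS => n.
    rewrite sub0r normrN ger0_norm ?rnorm_ge0// => h.
    rewrite /= /r indicE mem_set ?scale1r; first by rewrite rnorm_distC.
    split => //=; rewrite -(fgt Dt) -lerBlDl.
    apply: (le_trans (ler_norm _)); apply: (le_trans (ler_rnorm_dist _ _)).
    exact: ltW.
  have Hbd : {ae mu, forall t n, D t -> (`|(H n t)%:E| <= (2 * g t + 1)%:E)%E}.
    move: Hae fg; apply: filterS2 => t Ht fgt n Dt.
    rewrite -(Ht n Dt) gee0_abs ?lee_fin ?rnorm_ge0//.
    apply: (le_trans (ler_rnormB _ _)); rewrite (fgt Dt) /r indicE.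
    rewrite mulr_natl mulr2n -addrA lerD2l.
    case: (boolP (t \in A n)) => [|_]; last by rewrite scale0r rnorm0 addr_ge0.
    by rewrite inE scale1r => -[].
  have [_ + _] := dominated_convergence mD mH (measurable_cst _) Hcv igg Hbd.
  rewrite (_ : (fun n => (\int[mu]_(t in D) (rnorm (f t - r n t))%:E)%E) =
     (fun n => (\int[mu]_(x in D) `|(H n x)%:E - cst 0 x|)%E)) //.
  apply/funext => n; have [_ H0 HE] := HP n.
  rewrite (eq_L1 _ H0 HE); last by move=> t; exact: rnorm_ge0.
  by apply: eq_integral => t _; rewrite /= ?subr0 ?ger0_norm.
have [] := cX (u := y).
  move=> e e0; have e2 : (0 < e / 2)%R by rewrite divr_gt0.
  have : \forall n \near \oo, (\int[mu]_(t in D) (rnorm (f t - r n t))%:E < (e / 2)%:E)%E.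
    by apply: (int0 [set x | (x < (e/2)%:E)%E]); apply: open_nbhs_nbhs; split; [exact: open_ereal_lt_ereal|rewrite /= lte_fin].
  move=> [N _ NP]; exists N => m n Nm Nn.
  rewrite -lte_fin.
  have hd := has_bochnerB mD Dfin (has_bochner_step (yP m)) (has_bochner_step (yP n)).
  apply: (le_lt_trans (has_bochner_norm mD Dfin hd)).
  rewrite [e]splitr EFinD.
  apply: (le_lt_trans _ (lteD (NP m Nm) (NP n Nn))).
  have := sm_L1B mD Dfin (smB sf (sm_step (yP n))) (smB sf (sm_step (yP m))).
  rewrite addeC; apply: le_trans; rewrite le_eqVlt; apply/orP; left; apply/eqP.
  apply: eq_integral => t _; congr (rnorm _)%:E.
  by rewrite opprB [RHS]addrC addrA subrK.
move=> x yx; exists x; apply/has_bochnerP; split => //.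
by exists r, y.
Qed.

End bochner_exists.

(** * Strong measurability by sampling on a uniform grid *)

Section grid.
Context (R : realType) (a b : R).
Hypothesis ab : a < b.

Definition grid_idx (n : nat) (t : R) : nat := Num.truncn ((t - a) * n.+1%:R).
Definition grid_pt (n k : nat) : R := a + k%:R / n.+1%:R.
Definition grid_cell (n k : nat) : set R := `[grid_pt n k, grid_pt n k.+1[%classic.

Lemma grid_cellP n k t : a < t -> grid_cell n k t <-> k = grid_idx n t.
Proof.
move=> at_; rewrite /grid_cell /= in_itv/= /grid_pt /grid_idx.
have n0 : 0 < n.+1%:R :> R by [].
rewrite -lerBrDl ler_pdivrMr// -ltrBlDl ltr_pdivlMr//.
have h : 0 <= (t - a) * n.+1%:R by rewrite mulr_ge0// subr_ge0 ltW.
split => [/andP[k1 k2]|->]; last exact: truncn_itv.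
by apply/esym/truncn_def; rewrite k1 k2.
Qed.

Lemma grid_ptP n t : a < t ->
  grid_pt n (grid_idx n t) <= t < grid_pt n (grid_idx n t) + n.+1%:R^-1.
Proof.
move=> at_; have /(grid_cellP n _ at_).2 : grid_idx n t = grid_idx n t by [].
rewrite /grid_cell/= in_itv/=.
suff -> : grid_pt n (grid_idx n t).+1 = grid_pt n (grid_idx n t) + n.+1%:R^-1 by [].
by rewrite /grid_pt -[(grid_idx n t).+1]addn1 natrD mulrDl addrA mul1r.
Qed.

Lemma grid_pt_ge n k : a <= grid_pt n k.
Proof. by rewrite /grid_pt lerDl divr_ge0. Qed.

Lemma grid_pt_cvg t : a < t -> grid_pt n (grid_idx n t) @[n --> \oo] --> t.
Proof.
move=> at_; have h : t - n.+1%:R^-1 @[n --> \oo] --> t.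
  have k := cvgB (cvg_cst t) (@cvg_harmonic R); rewrite subr0 in k; exact: k.
apply: (squeeze_cvgr _ h (cvg_cst t)); apply: nearW => n.
have /andP[-> h2] := grid_ptP n at_; rewrite andbT.
by rewrite lerBlDr ltW.
Qed.

End grid.

Lemma ae_lebesgue_filter (R : realType) :
  Filter (almost_everywhere (@lebesgue_measure R)).
Proof. exact: (ae_filter_ringOfSetsType [the {measure set _ -> \bar R} of @lebesgue_measure R]). Qed.

#[global] Hint Extern 0 (Filter (almost_everywhere (@lebesgue_measure _))) =>
  (exact: ae_lebesgue_filter) : typeclass_instances.
#[global] Hint Extern 0 (Filter (nbhs (almost_everywhere (@lebesgue_measure _)))) =>
  (exact: ae_lebesgue_filter) : typeclass_instances.

Section grid_sm.
Context (R : realType) (X : normedModType R[i]) (a b : R).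
Hypothesis ab : a < b.
Local Notation mu := (@lebesgue_measure R).
Local Notation D := (`]a, b[%classic : set R).

Lemma itv_fin : (mu `]a, b[ < +oo)%E.
Proof. by rewrite lebesgue_measure_itv/= lte_fin ab -EFinD ltry. Qed.

(** The mesh index [m n] is free: when [F n k] involves operators whose norm grows with [n], the
    grid can be refined as fast as these norms require. *)
Lemma sm_grid (V : set X) (N : X -> R) (m : nat -> nat)
    (F : nat -> nat -> R -> X) (g : R -> X) :
  (forall n k, exists y, is_step mu D V (F n k) y) ->
  {ae mu, forall t, D t -> V (g t) /\
     N (F n (grid_idx a (m n) t) t - g t) @[n --> \oo] --> (0 : R)} ->
  strongly_measurable_in mu D V N g.
Proof.
move=> sF Fg; apply/strongly_measurable_inP.
pose K n := (Num.truncn ((b - a) * (m n).+1%:R)).+1.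
exists (fun n t => \sum_(k < K n) (\1_(grid_cell a (m n) k) t)%:C *: F n k t).
split => [n|].
  have := (@is_step_sum _ _ _ _ mu D V (K n) (fun k t => (\1_(grid_cell a (m n) k) t)%:C *: F n k t)).
  apply.
  move=> k _; have [y yk] := sF n k; apply: is_step_restrict yk => //.
    exact: itv_fin.
  exact: measurable_itv.
apply: filterS Fg => t Fg Dt; have [Vg {}Fg] := Fg Dt; split => //.
have := Dt; rewrite /= in_itv/= => /andP[at_ tb].
rewrite (_ : (fun n => _) = (fun n => N (F n (grid_idx a (m n) t) t - g t)))//.
apply/funext => n; congr (N (_ - _)).
have kK : (grid_idx a (m n) t < K n)%N.
  rewrite /K ltnS; apply: le_truncn; rewrite ler_wpM2r// lerB// ltW//.
rewrite (bigD1 (Ordinal kK))//= indicE mem_set; last exact/grid_cellP.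
rewrite scale1r big1 ?addr0// => k kn.
rewrite indicE memNset ?scale0r// => /(grid_cellP _ _ at_) ki.
by move/eqP: kn; apply; exact: val_inj.
Qed.

Lemma is_step_cst (V : set X) v : V v -> exists y, is_step mu D V (fun=> v) y.
Proof.
move=> Vv; exists ((fine (mu (setT `&` D)))%:C *: v).
rewrite [X in is_step _ _ _ X](_ : _ = (fun t => (\1_setT t)%:C *: v)).
  by apply: is_step_indic => //; exact: itv_fin.
by apply/funext => t; rewrite indicT scale1r.
Qed.

Lemma sm_continuous (g : R -> X) :
  (forall t, D t -> {for t, continuous g}) -> strongly_measurable mu D g.
Proof.
move=> cg; apply: (@sm_grid setT (@rnorm R X) id (fun n k => fun=> g (grid_pt a n k))).
  by move=> n k; exact: is_step_cst.
apply: aeW => t Dt; split => //.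
apply/cvg_rnormP; have := Dt; rewrite /= in_itv/= => /andP[at_ tb].
exact: (cvg_comp _ _ (grid_pt_cvg at_) (cg _ Dt)).
Qed.

Lemma sm_operators (U : R -> X -> X) (M : R) (f : R -> X) :
  (forall s, a <= s < b -> linear (U s)) ->
  (forall s x, a <= s < b -> rnorm (U s x) <= M * rnorm x) ->
  (forall s x, D s -> {for s, continuous (U^~ x)}) ->
  strongly_measurable mu D f -> strongly_measurable mu D (fun s => U s (f s)).
Proof.
move=> lU MU cU /strongly_measurable_inP[s [ss sf]].
(* The operator is frozen at the left end of each cell. That point can be [a] itself, which is why
   linearity and the bound are assumed at [a] too, while continuity is used only inside the
   interval. *)
pose F n k := if grid_pt a n k < b then U (grid_pt a n k) \o s n else fun=> 0.
apply: (@sm_grid setT (@rnorm R X) id F).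
  move=> n k; rewrite /F; case: ifPn => kb; last by apply: is_step_cst.
  have [y yn] := ss n; exists (U (grid_pt a n k) y).
  have lk : linear (U (grid_pt a n k)) by apply: lU; rewrite grid_pt_ge.
  exact: (is_step_linear lk _ yn).
move: sf; apply: filterS => t + Dt => /(_ Dt)[_ sf]; split => //.
have := Dt; rewrite /= in_itv/= => /andP[at_ tb].
pose p n := grid_pt a n (grid_idx a n t).
have pb n : a <= p n < b.
  by rewrite grid_pt_ge/= (le_lt_trans _ tb)//; case/andP: (grid_ptP n at_).
rewrite (_ : (fun n => _) = (fun n => rnorm (U (p n) (s n t) - U t (f t)))); last first.
  by apply/funext => n; rewrite /F -/(p n); case/andP: (pb n) => _ ->.
apply/cvg_rnormP.
apply: (@rnorm_squeeze _ _ _ _ _ _ _ (fun n => M * rnorm (s n t - f t) +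
     rnorm (U (p n) (f t) - U t (f t)))).
  apply: nearW => n; rewrite -[U (p n) (s n t)](subrK (U (p n) (f t))) -addrA.
  apply: (le_trans (ler_rnormD _ _)); rewrite lerD2r.
  by rewrite -(linfunB (lU _ (pb n))) MU.
apply: cvgD00; first exact: cvgMl0.
apply/cvg_rnormP; exact: (cvg_comp _ _ (grid_pt_cvg at_) (cU _ _ Dt)).
Qed.

End grid_sm.

(** * Elementary estimates and the complex exponential *)

Section elementary.
Context (R : realType).
Implicit Types (x y a b t : R).

Lemma MVT_dist (f df : R -> R) (M b : R) :
  (forall x, is_derive x 1 f (df x)) -> (forall c, `|c| <= `|b| -> `|df c| <= M) ->
  `|f b - f 0| <= M * `|b|.
Proof.
move=> dF dM.
have cf (u v : R) : {within `[u, v], continuous f}.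
  apply: derivable_within_continuous => x _.
  exact: @ex_derive _ _ _ _ _ _ _ (dF x).
have [b0|b0] := leP 0 b.
  have [c] := MVT_segment b0 (fun x _ => dF x) (cf _ _).
  rewrite in_itv/= => /andP[c0 cb] ->; rewrite subr0 normrM ler_wpM2r//.
  by apply: dM; rewrite !ger0_norm.
have [c] := MVT_segment (ltW b0) (fun x _ => dF x) (cf _ _).
rewrite in_itv/= => /andP[bc c0]; rewrite distrC => ->; rewrite sub0r normrM normrN ler_wpM2r//.
by apply: dM; rewrite (ler0_norm c0) (ltr0_norm b0) lerN2.
Qed.

Lemma norm_sin_le b : `|sin b| <= `|b|.
Proof.
rewrite -[X in `|X| <= _]subr0 -{1}sin0 -[leRHS]mul1r.
by apply: (@MVT_dist _ cos) => // c _; exact: cos_max.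
Qed.

Lemma norm_cosB1_le b : `|cos b - 1| <= `|b|.
Proof.
rewrite -{1}cos0 -[leRHS]mul1r.
apply: (@MVT_dist _ (fun x => - sin x)) => c _.
by rewrite normrN sin_max.
Qed.

Lemma norm_cosB1_le2 b : `|cos b - 1| <= `|b| ^+ 2.
Proof.
rewrite -{1}cos0 expr2.
apply: (@MVT_dist _ (fun x => - sin x)) => c cb.
by rewrite normrN (le_trans (norm_sin_le _)).
Qed.

Lemma norm_sinB_le2 b : `|sin b - b| <= `|b| ^+ 2.
Proof.
have h : sin b - b = (sin b - b) - (sin 0 - 0) by rewrite sin0 subr0 subr0.
rewrite h expr2.
apply: (@MVT_dist (fun x => sin x - x) (fun x => cos x - 1)) => c cb.
by rewrite (le_trans (norm_cosB1_le _)).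
Qed.

Lemma expRB1_bounds a : a <= expR a - 1 <= a * expR a.
Proof.
rewrite lerBrDl expR_ge1Dx/= lerBlDr -lerBlDl -{1}[expR a]mul1r -mulrBl.
have := expR_ge1Dx (- a); rewrite expRN => h.
by rewrite -ler_pdivlMr ?expR_gt0// mul1r.
Qed.

Lemma norm_expRB1_le a : `|expR a - 1| <= `|a| * expR `|a|.
Proof.
have /andP[h1 h2] := expRB1_bounds a.
have [a0|a0] := leP 0 a.
  by rewrite (ger0_norm (le_trans a0 h1)) (ger0_norm a0).
have e1 : 1 <= expR (- a) by rewrite -{1}expR0 ler_expR oppr_ge0 ltW.
have h3 : expR a - 1 <= 0 by rewrite subr_le0 expR_le1 ltW.
rewrite (ler0_norm h3) (ltr0_norm a0); apply: (@le_trans _ _ (- a)).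
  by rewrite lerN2.
by rewrite ler_peMr// oppr_ge0 ltW.
Qed.

Lemma norm_expRB1B_le a : `|expR a - 1 - a| <= `|a| ^+ 2 * expR `|a|.
Proof.
have /andP[h1 h2] := expRB1_bounds a.
rewrite ger0_norm ?subr_ge0//; apply: (@le_trans _ _ (a * (expR a - 1))).
  by rewrite mulrBr mulr1 lerD2r.
apply: (le_trans (ler_norm _)); rewrite normrM expr2 -mulrA ler_wpM2l//.
exact: norm_expRB1_le.
Qed.

Lemma expRN_le1 x : 0 <= x -> expR (- x) <= 1.
Proof. by move=> x0; rewrite expR_le1 oppr_le0. Qed.

Lemma pow_expRN_le n t : 0 <= t -> t ^+ n.+1 * expR (- t) <= n.+1`!%:R.
Proof.
move=> t0; rewrite expRN ler_pdivrMr ?expR_gt0// mulrC -ler_pdivrMr ?ltr0n ?fact_gt0//.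
by apply: le_trans (expR_ge1Dxn n t0); rewrite lerDr.
Qed.

(* dominates the increments of [exp (- z 2^j)] by a telescoping sum *)
Lemma mul_expRN_le t : 0 <= t -> t * expR (- t) <= 2 * (expR (- (t / 2)) - expR (- t)).
Proof.
move=> t0; have e : expR (- (t / 2)) = expR (t / 2) * expR (- t).
  by rewrite -expRD; congr expR; field.
rewrite e -{3}[expR (- t)]mul1r -mulrBl mulrA ler_wpM2r ?expR_ge0//.
have := expR_ge1Dx (t / 2); lra.
Qed.

End elementary.

Section cexp.
Context (R : realType).
Implicit Types (z w : R[i]) (r : R).
Local Notation Re := (@complex.Re R).
Local Notation Im := (@complex.Im R).

Definition cexp z : R[i] :=
  (expR (Re z) * cos (Im z)) +i* (expR (Re z) * sin (Im z)).

Lemma cexp0 : cexp 0 = 1.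
Proof. by rewrite /cexp/= expR0 cos0 sin0 mulr1 mulr0. Qed.

Lemma cexpD z w : cexp (z + w) = cexp z * cexp w.
Proof.
case: z w => [a b] [c e]; rewrite /cexp/= expRD cosD sinD.
by apply/eqP; rewrite eq_complex/=; apply/andP; split; apply/eqP; ring.
Qed.

Lemma rnorm_cexp z : rnorm (cexp z) = expR (Re z).
Proof.
rewrite rnormc/= !exprMn -mulrDr cos2Dsin2 mulr1 sqrtr_sqr.
by rewrite ger0_norm// expR_ge0.
Qed.

Lemma normRe_le z : `|Re z| <= rnorm z.
Proof.
rewrite rnormc -sqrtr_sqr ler_sqrt ?lerDl ?sqr_ge0//.
by rewrite addr_ge0 ?sqr_ge0.
Qed.

Lemma normIm_le z : `|Im z| <= rnorm z.
Proof.
rewrite rnormc -sqrtr_sqr ler_sqrt ?lerDr ?sqr_ge0//.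
by rewrite addr_ge0 ?sqr_ge0.
Qed.

Lemma rnormc_le z : rnorm z <= `|Re z| + `|Im z|.
Proof.
rewrite rnormc -(@ler_sqr _ _ (_ + _)) ?nnegrE ?sqrtr_ge0 ?addr_ge0//.
rewrite sqr_sqrtr ?addr_ge0 ?sqr_ge0// sqrrD -!normrX !(ger0_norm (sqr_ge0 _)).
by rewrite addrAC lerDl mulrn_wge0// mulr_ge0.
Qed.

Lemma rnormcV z : rnorm z^-1 = (rnorm z)^-1.
Proof.
have [->|z0] := eqVneq z 0; first by rewrite invr0 rnorm0 invr0.
have h : rnorm (z * z^-1) = 1 by rewrite divff// /rnorm normr1.
have nz : rnorm z != 0 by apply/eqP => /rnorm_eq0 /eqP; apply/negP.
by apply: (mulfI nz); rewrite -rnormM h divff.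
Qed.

Lemma cexp_taylor w :
  rnorm (cexp w - 1 - w) <= 4 * rnorm w ^+ 2 * expR (rnorm w).
Proof.
case: w => [a b]; set w := a +i* b; set N := rnorm w.
have aN : `|a| <= N := normRe_le w; have bN : `|b| <= N := normIm_le w.
have N0 : 0 <= N by exact: rnorm_ge0.
have eaN : expR `|a| <= expR N by rewrite ler_expR.
have eaN' : expR a <= expR N by rewrite ler_expR (le_trans (ler_norm _)).
have e1 : 1 <= expR N by rewrite -{1}expR0 ler_expR.
have e0 : 0 <= expR N by exact: expR_ge0.
have a2 : `|a| ^+ 2 <= N ^+ 2 by rewrite ler_sqr ?nnegrE.
have b2 : `|b| ^+ 2 <= N ^+ 2 by rewrite ler_sqr ?nnegrE.
apply: (le_trans (rnormc_le _)); rewrite /=.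
(* Real and imaginary part give two terms each, and each of the four is at most N^2 exp N: this is
   the constant 4. *)
have -> : expR a * cos b - 1 - a = (expR a - 1 - a) + expR a * (cos b - 1) by ring.
have -> : expR a * sin b - 0 - b = (expR a - 1) * sin b + (sin b - b) by ring.
have h1 := norm_expRB1B_le a; have h2 := norm_cosB1_le2 b.
have h3 := norm_expRB1_le a; have h4 := norm_sin_le b; have h5 := norm_sinB_le2 b.
have k1 : `|expR a - 1 - a| <= N ^+ 2 * expR N.
  by apply: (le_trans h1); rewrite ler_pM// ?exprn_ge0 ?expR_ge0.
have k2 : `|expR a * (cos b - 1)| <= N ^+ 2 * expR N.
  rewrite normrM (ger0_norm (expR_ge0 _)) mulrC ler_pM ?expR_ge0//.
  exact: le_trans b2.
have k3 : `|(expR a - 1) * sin b| <= N ^+ 2 * expR N.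
  rewrite normrM; apply: (@le_trans _ _ ((N * expR N) * N)).
    apply: ler_pM => //; last exact: le_trans bN.
    by apply: (le_trans h3); rewrite ler_pM// expR_ge0.
  by rewrite le_eqVlt; apply/orP; left; apply/eqP; ring.
have k4 : `|sin b - b| <= N ^+ 2 * expR N.
  by apply: (le_trans h5); apply: (le_trans b2); rewrite ler_peMr// exprn_ge0.
have := ler_normD (expR a - 1 - a) (expR a * (cos b - 1)).
have := ler_normD ((expR a - 1) * sin b) (sin b - b).
lra.
Qed.

Lemma cexpB1_le w : 0 <= Re w -> rnorm (cexp (- w) - 1) <= 3 * rnorm w.
Proof.
case: w => [a b] /= a0; set w := a +i* b; set N := rnorm w.
have aN : `|a| <= N := normRe_le w; have bN : `|b| <= N := normIm_le w.
apply: (le_trans (rnormc_le _)); rewrite /= cosN sinN mulrN subr0 normrN.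
have -> : expR (- a) * cos b - 1 = (expR (- a) - 1) + expR (- a) * (cos b - 1) by ring.
have ea : expR (- a) <= 1 by exact: expRN_le1.
have ea0 : 0 <= expR (- a) by exact: expR_ge0.
have k1 : `|expR (- a) - 1| <= N.
  have := expR_ge1Dx (- a); rewrite ler0_norm ?subr_le0// => h.
  by move: aN; rewrite ger0_norm//; lra.
have k2 : `|expR (- a) * (cos b - 1)| <= N.
  rewrite normrM ger0_norm// (le_trans _ bN)//.
  by apply: le_trans (norm_cosB1_le b); rewrite ler_piMl.
have k3 : `|expR (- a) * sin b| <= N.
  rewrite normrM ger0_norm// (le_trans _ bN)//.
  by apply: le_trans (norm_sin_le b); rewrite ler_piMl.
have := ler_normD (expR (- a) - 1) (expR (- a) * (cos b - 1)).
lra.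
Qed.

Lemma sector_Re (delta : R) z : delta <= pi / 2 -> sector delta z -> 0 < Re z.
Proof.
move=> dpi [r [th [r0 thd ->]]] /=; rewrite mulr_gt0//; apply: cos_gt0_pihalf.
by rewrite -ltr_norml (lt_le_trans thd).
Qed.

Lemma sector_cone (delta : R) z : 0 < delta < pi / 2 -> sector delta z ->
  0 < Re z /\ rnorm z <= (cos delta)^-1 * Re z.
Proof.
move=> /andP[d0 dpi] sz; split; first exact: sector_Re (ltW dpi) sz.
have [r [th [r0 thd ->]]] := sz; rewrite rnormc/= !exprMn -mulrDr cos2Dsin2 mulr1.
rewrite sqrtr_sqr gtr0_norm// mulrCA ler_peMr ?ltW//.
have cd : 0 < cos delta by apply: cos_gt0_pihalf; rewrite dpi (lt_trans _ d0)// oppr_lt0 divr_gt0 ?pi_gt0.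
rewrite ltr_pdivlMl// mulr1 -(cos_norm th).
have ppi : pi / 2 <= pi :> R by rewrite ler_pdivrMr// ler_peMr ?pi_ge0// ler1n.
rewrite ltr_cos ?in_itv/= ?normr_ge0 ?(ltW d0)//=.
  by rewrite ltW// (lt_le_trans thd)// (le_trans (ltW dpi)).
by rewrite (le_trans (ltW dpi)).
Qed.

End cexp.

(** * Multipliers of a Schauder decomposition *)

Section multipliers.
Context (R : realType) (X : normedModType R[i]).
Variables (P : nat -> X -> X) (C : R).
Implicit Types (x y : X) (z w : R[i]) (m : nat -> R[i]).

Definition psum n x := \sum_(j < n) P j x.

Record decomposition : Prop := {
  dec_linear : forall j, linear (P j);
  dec_orth : forall i j x, P i (P j x) = if i == j then P j x else 0;
  dec_bound : forall n x, rnorm (psum n x) <= C * rnorm x;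
  dec_cvg : forall x, psum n x @[n --> \oo] --> x }.

Hypothesis (cX : seq_complete X) (dP : decomposition) (C0 : 0 <= C).

Let lP j : linear (P j) := dec_linear dP j.

Lemma dec_P0 j : P j 0 = 0. Proof. exact: linfun0 (lP j). Qed.
Lemma dec_PD j x y : P j (x + y) = P j x + P j y. Proof. exact: linfunD. Qed.
Lemma dec_PZ j a x : P j (a *: x) = a *: P j x. Proof. exact: linfunZ. Qed.
Lemma dec_PB j x y : P j (x - y) = P j x - P j y. Proof. exact: linfunB. Qed.

Lemma dec_Psum j n (F : nat -> X) : P j (\sum_(i < n) F i) = \sum_(i < n) P j (F i).
Proof. exact: (big_morph (P j) (dec_PD j) (dec_P0 j)). Qed.

Lemma dec_Pbound j x : rnorm (P j x) <= 2 * C * rnorm x.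
Proof.
have -> : P j x = psum j.+1 x - psum j x by rewrite /psum big_ord_recr/= addrAC subrr add0r.
apply: (le_trans (ler_rnormB _ _)); rewrite -mulrA mulr_natl mulr2n.
by apply: lerD; exact: (dec_bound dP).
Qed.

Lemma dec_P_cvg j (T : Type) (F : set_system T) {FF : Filter F} (u : T -> X) x :
  u t @[t --> F] --> x -> P j (u t) @[t --> F] --> P j x.
Proof. exact: (linfun_cvg (lP j) (dec_Pbound j)). Qed.

Lemma dec_sep x y : (forall j, P j x = P j y) -> x = y.
Proof.
move=> xy; have h := @dec_cvg dP x; have h' := @dec_cvg dP y.
have e : psum^~ x = psum^~ y by apply/funext => n; apply: eq_bigr => j _.
by rewrite e in h; exact: (cvg_uniqueX h h').
Qed.

Lemma dec_P_psum j n x : P j (psum n x) = if (j < n)%N then P j x else 0.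
Proof.
rewrite /psum (dec_Psum j n (fun i => P i x)); case: ifPn => jn.
  rewrite (bigD1 (Ordinal jn))//= (dec_orth dP) eqxx big1 ?addr0// => i ij.
  rewrite (dec_orth dP) ifN//; apply: contra ij => /eqP ij; apply/eqP.
  exact: val_inj.
rewrite big1// => i _; rewrite (dec_orth dP) ifN//; apply: contra jn => /eqP ->.
exact: ltn_ord.
Qed.

(** A relation rather than an operator, since for a general symbol [m] no image of [x] need exist;
    if one exists, [dec_sep] makes it unique. Unbounded symbols, such as that of A, are covered in
    the same way. *)
Definition multiplies m x y := forall j, P j y = m j *: P j x.

Lemma multiplies_psum m x y n : multiplies m x y ->
  psum n y = \sum_(j < n) m j *: P j x.
Proof. by move=> h; apply: eq_bigr => j _; exact: h. Qed.

Lemma rnorm_le_psum x (B : R) : (forall n, rnorm (psum n x) <= B) -> rnorm x <= B.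
Proof.
move=> h; apply/ler_addgt0Pr => e e0.
have /cvg_rnormP/cvgrPdist_lt/(_ e e0)[N _ NP] := (@dec_cvg dP x).
have := NP N (leqnn N); rewrite sub0r normrN ger0_norm ?rnorm_ge0// => hN.
rewrite -[x](subrK (psum N x)) addrC; apply: (le_trans (ler_rnormD _ _)).
by rewrite lerD// rnorm_distC ltW.
Qed.

Lemma abel_sum m n x : \sum_(j < n.+1) m j *: P j x =
  m n *: psum n.+1 x + \sum_(j < n) (m j - m j.+1) *: psum j.+1 x.
Proof.
elim: n => [|n IH]; first by rewrite /psum !big_ord1 big_ord0 addr0.
rewrite big_ord_recr/= IH [in RHS]big_ord_recr/= scalerBl.
rewrite [psum n.+2 x]/psum big_ord_recr/= -/(psum n.+1 x) scalerDr.
set a := m n *: _; set b := \sum_(i < n) _; set c := _ *: P _ _; set e := m n.+1 *: psum _ _.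
by rewrite [RHS](AC (2*(1*2)) ((4*3*2)*(1*5)))/= subrr addr0.
Qed.

(** After Abel summation only the partial sums of the decomposition occur, each of norm at most [C];
    what is left of the symbol is its last value and its total variation. *)
Lemma multiplies_var m x y (V : R) : multiplies m x y ->
  (forall n, rnorm (m n) + \sum_(j < n) rnorm (m j - m j.+1) <= V) ->
  rnorm y <= C * V * rnorm x.
Proof.
move=> mxy mV; apply: rnorm_le_psum => -[|n].
  rewrite /psum big_ord0 rnorm0 mulr_ge0 ?rnorm_ge0// mulr_ge0//.
  by apply: le_trans (mV 0); rewrite big_ord0 addr0 rnorm_ge0.
rewrite (multiplies_psum _ mxy) abel_sum; apply: (le_trans (ler_rnormD _ _)).
apply: (@le_trans _ _ (C * (rnorm (m n) + \sum_(j < n) rnorm (m j - m j.+1)) * rnorm x)).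
  rewrite mulrDr mulrDl lerD//.
    rewrite rnormZ mulrAC [leRHS]mulrC ler_wpM2l ?rnorm_ge0//.
    exact: (dec_bound dP).
  apply: (le_trans (rnorm_sum _ _ _)); rewrite mulr_sumr mulr_suml.
  apply: ler_sum => j _; rewrite rnormZ mulrAC [leRHS]mulrC ler_wpM2l ?rnorm_ge0//.
  exact: (dec_bound dP).
by rewrite ler_wpM2r ?rnorm_ge0// ler_wpM2l.
Qed.

Lemma multiplies_sum m x y (B : R) : multiplies m x y ->
  (forall n, \sum_(j < n) rnorm (m j) <= B) -> rnorm y <= 2 * C * B * rnorm x.
Proof.
move=> mxy mB; apply: rnorm_le_psum => n; rewrite (multiplies_psum _ mxy).
apply: (le_trans (rnorm_sum _ _ _)).
apply: (@le_trans _ _ (\sum_(j < n) rnorm (m j) * (2 * C * rnorm x))).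
  by apply: ler_sum => j _; rewrite rnormZ ler_wpM2l ?rnorm_ge0// dec_Pbound.
rewrite -mulr_suml mulrC [leRHS]mulrAC ler_wpM2l//.
by rewrite mulr_ge0 ?rnorm_ge0// mulr_ge0.
Qed.

Lemma sum_cauchy (a : nat -> R) (B : R) : (forall n, 0 <= a n) ->
  (forall n, \sum_(j < n) a j <= B) -> forall e : R, 0 < e -> exists N, forall k n : nat,
  (N <= k)%N -> (k <= n)%N -> \sum_(k <= j < n) a j < e.
Proof.
move=> a0 aB e e0; pose s n := \sum_(j < n) a j.
have nd : nondecreasing_seq s.
  by apply/nondecreasing_seqP => n; rewrite /s big_ord_recr/= lerDl.
have cs : cvgn s.
  by apply: nondecreasing_is_cvgn => //; exists B => _ [n _ <-]; exact: aB.
have e2 : 0 < e / 2 by rewrite divr_gt0.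
have /cvgrPdist_lt/(_ _ e2)[N _ NP] := cs.
exists N => m n Nm mn.
have -> : \sum_(m <= j < n) a j = s n - s m.
  rewrite /s -!(big_mkord xpredT a) (big_cat_nat (leq0n m) mn)/= addrAC subrr add0r//.
have := NP m Nm; have := NP n (leq_trans Nm mn); move=> /= h1 h2.
apply: (le_lt_trans (ler_norm _)); rewrite [e]splitr.
have -> : s n - s m = (limn s - s m) - (limn s - s n) by ring.
by apply: (le_lt_trans (ler_normB _ _)); rewrite ltrD.
Qed.

Lemma series_cvg (u : nat -> X) (a : nat -> R) (B : R) :
  (forall n, rnorm (u n) <= a n) -> (forall n, \sum_(j < n) a j <= B) ->
  exists y, (\sum_(j < n) u j) @[n --> \oo] --> y.
Proof.
move=> ua aB; apply: cX => e e0.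
have a0 n : 0 <= a n by apply: le_trans (ua n); exact: rnorm_ge0.
have [N NP] := sum_cauchy a0 aB e0; exists N.
have h (m n : nat) : (N <= m)%N -> (m <= n)%N ->
    rnorm (\sum_(j < n) u j - \sum_(j < m) u j) < e.
  move=> Nm mn; rewrite -!(big_mkord xpredT u) (big_cat_nat (leq0n m) mn)//=.
  rewrite addrAC subrr add0r; apply: le_lt_trans (NP m n Nm mn).
  by apply: (le_trans (rnorm_sum _ _ _)); apply: ler_sum.
move=> m n Nm Nn; have [mn|/ltnW nm] := leqP m n; last exact: h.
by rewrite rnorm_distC; exact: h.
Qed.

Lemma P_series (u : nat -> X) x : (\sum_(j < n) P j (u j)) @[n --> \oo] --> x ->
  forall j, P j x = P j (u j).
Proof.
move=> ux j; have h : P j (\sum_(i < n) P i (u i)) @[n --> \oo] --> P j x by exact: dec_P_cvg.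
have h' : P j (\sum_(i < n) P i (u i)) @[n --> \oo] --> P j (u j).
  apply: cvg_near_cst; exists j.+1 => // n /= jn.
  rewrite (dec_Psum j n (fun i => P i (u i))) (bigD1 (Ordinal jn))//= (dec_orth dP) eqxx big1 ?addr0// => i ij.
  rewrite (dec_orth dP) ifN//; apply: contra ij => /eqP ij; apply/eqP.
  exact: val_inj.
exact: (cvg_uniqueX h h').
Qed.

Lemma multiplies_exists m x (B : R) : (forall n, \sum_(j < n) rnorm (m j) <= B) ->
  exists y, multiplies m x y.
Proof.
move=> mB.
have [||y yP] := @series_cvg (fun j => P j (m j *: x))
    (fun j => 2 * C * rnorm x * rnorm (m j)) (2 * C * rnorm x * B).
- move=> n; rewrite dec_PZ rnormZ mulrC ler_wpM2r ?rnorm_ge0//.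
  exact: dec_Pbound.
- move=> n; rewrite -mulr_sumr ler_wpM2l// mulr_ge0 ?rnorm_ge0//.
  by rewrite mulr_ge0.
by exists y => j; rewrite (@P_series (fun j => m j *: x) y yP) dec_PZ.
Qed.

End multipliers.

(** * The diagonal semigroup *)

Section semigroup.
Context (R : realType) (X : normedModType R[i]).
Variables (P : nat -> X -> X) (C : R).
Hypothesis (cX : seq_complete X) (dP : decomposition P C) (C0 : 0 <= C).
Implicit Types (x y : X) (z w h : R[i]).
Local Notation Re := (@complex.Re R).
Local Notation psum := (psum P).
Local Notation multiplies := (multiplies P).

Definition lam (j : nat) : R := 2 ^+ j.

Lemma lam_gt0 j : 0 < lam j. Proof. exact: exprn_gt0. Qed.
Lemma lamS j : lam j.+1 = 2 * lam j. Proof. exact: exprS. Qed.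

Lemma sum_lamV (n : nat) : \sum_(j < n) (lam j)^-1 <= 2.
Proof.
suff -> : \sum_(j < n) (lam j)^-1 = 2 - 2 * (lam n)^-1.
  by rewrite lerBlDr lerDl mulr_ge0// invr_ge0 ltW// lam_gt0.
elim: n => [|n IH]; first by rewrite big_ord0 /lam expr0 invr1 mulr1 subrr.
rewrite big_ord_recr/= IH lamS; have := lt0r_neq0 (lam_gt0 n) => l0.
by field.
Qed.

Definition msg z (j : nat) : R[i] := cexp (- (z * (lam j)%:C)).

(* [xget] would return the junk value [0] if no such [y] existed; one does for [adm z]. *)
Definition sg z x : X := xget 0 [set y | multiplies (msg z) x y].

Definition adm z := z = 0 \/ 0 < Re z.

Lemma Re_zlam z j : Re (z * (lam j)%:C) = Re z * lam j.
Proof. by case: z => a b; rewrite complex_ReM/= mulr0 subr0. Qed.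

Lemma rnorm_msg z j : rnorm (msg z j) = expR (- (Re z * lam j)).
Proof. by rewrite rnorm_cexp raddfN/= Re_zlam. Qed.

Lemma msg0 j : msg 0 j = 1.
Proof. by rewrite /msg mul0r oppr0 cexp0. Qed.

Lemma msgD z w j : msg (z + w) j = msg z j * msg w j.
Proof. by rewrite /msg mulrDl opprD cexpD. Qed.

Lemma msg_bound (r : R) : 0 < r -> forall n,
  \sum_(j < n) expR (- (r * lam j)) <= r^-1 * 2.
Proof.
move=> r0 n; apply: (@le_trans _ _ (\sum_(j < n) r^-1 * (lam j)^-1)).
  apply: ler_sum => j _; have t0 : 0 < r * lam j by rewrite mulr_gt0// lam_gt0.
  rewrite -invfM -[leRHS]mul1r ler_pdivlMr//.
  by have := pow_expRN_le 0 (ltW t0); rewrite expr1 mulrC.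
by rewrite -mulr_sumr ler_wpM2l ?invr_ge0 ?(ltW r0)// sum_lamV.
Qed.

Lemma sgP z x : adm z -> multiplies (msg z) x (sg z x).
Proof.
move=> az; apply: (@xgetPex _ 0 [set y | multiplies (msg z) x y]).
case: az => [->|z0]; first by exists x => j; rewrite msg0 scale1r.
apply: (@multiplies_exists _ _ _ _ cX dP C0 _ _ ((Re z)^-1 * 2)) => n.
under eq_bigr do rewrite rnorm_msg.
exact: msg_bound.
Qed.

Lemma adm0 : adm 0. Proof. by left. Qed.
Lemma admD z w : adm z -> adm w -> adm (z + w).
Proof.
move=> [->|z0] [->|w0]; rewrite ?add0r ?addr0; [by left|by right|by right|right].
by rewrite raddfD addr_gt0.
Qed.
Lemma adm_real (t : R) : 0 <= t -> adm t%:C.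
Proof. by rewrite le_eqVlt => /orP[/eqP <-|]; [left|right]. Qed.

Lemma sg0 x : sg 0 x = x.
Proof. by apply: (dec_sep dP) => j; rewrite (sgP x adm0) msg0 scale1r. Qed.

Lemma sg_linear z : adm z -> linear (sg z).
Proof.
move=> az a x y; apply: (dec_sep dP) => j.
rewrite (sgP _ az) !(dec_PD dP) !(dec_PZ dP) !(sgP _ az).
by rewrite scalerDr !scalerA mulrC.
Qed.

Lemma sgD z w x : adm z -> adm w -> sg (z + w) x = sg z (sg w x).
Proof.
move=> az aw; apply: (dec_sep dP) => j.
by rewrite (sgP _ (admD az aw)) !sgP// scalerA msgD.
Qed.

Lemma sg_P z x j : adm z -> sg z (P j x) = msg z j *: P j x.
Proof.
move=> az; apply: (dec_sep dP) => i; rewrite (sgP _ az) (dec_PZ dP) (dec_orth dP).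
by case: eqP => [->//|_]; rewrite !scaler0.
Qed.

(** A sector of half-angle delta below pi/2 lies in the cone with K = 1 / cos delta ([sector_cone]);
    the estimates depend on the sector only through [K]. *)
Definition cone (K : R) z := 0 < Re z /\ rnorm z <= K * Re z.

(** As [lam] doubles, [msg z j.+1] is the square of [msg z j], so the increment is
    [msg z j * (1 - msg z j)]. With t = Re z * lam j its modulus is at most 3 K t exp(-t), and
    [mul_expRN_le] bounds this by 6 K times a telescoping difference: the variation is at most 6 K,
    whatever the size of [z]. *)
Lemma sg_bound K z x : 0 <= K -> cone K z -> rnorm (sg z x) <= C * (1 + 6 * K) * rnorm x.
Proof.
move=> K0 [z0 zK]; apply: (multiplies_var dP C0 (sgP x (or_intror z0))) => n.
have e1 : rnorm (msg z n) <= 1.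
  by rewrite rnorm_msg expRN_le1// mulr_ge0 ?ltW// lam_gt0.
apply: lerD => //.
pose g j := expR (- (Re z * lam j / 2)).
apply: (@le_trans _ _ (\sum_(j < n) 6 * K * (g j - g j.+1))).
  apply: ler_sum => j _.
  have -> : msg z j - msg z j.+1 = msg z j * (1 - msg z j).
    rewrite mulrBr mulr1; congr (_ - _); rewrite -msgD /msg lamS.
    by congr cexp; rewrite mulr_natl mulr2n rmorphD/= mulrDr mulrDl.
  rewrite rnormM rnorm_msg rnorm_distC.
  have := @cexpB1_le _ (z * (lam j)%:C); rewrite Re_zlam => /(_ _)/wrap[].
    by rewrite mulr_ge0 ?ltW// lam_gt0.
  move=> h; apply: (@le_trans _ _ (expR (- (Re z * lam j)) * (3 * (K * Re z * lam j)))).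
    rewrite ler_wpM2l ?expR_ge0//; apply: (le_trans h); rewrite ler_wpM2l// rnormM.
    by rewrite rnorm_real (gtr0_norm (lam_gt0 _)) ler_wpM2r// ltW// lam_gt0.
  have t0 : 0 <= Re z * lam j by rewrite mulr_ge0 ?ltW// lam_gt0.
  have := mul_expRN_le t0.
  have -> : expR (- (Re z * lam j)) = g j.+1.
    by rewrite /g lamS; congr (expR (- _)); field.
  rewrite -/(g j) => h2.
  have -> : g j.+1 * (3 * (K * Re z * lam j)) = 3 * K * (Re z * lam j * g j.+1) by ring.
  have -> : 6 * K * (g j - g j.+1) = 3 * K * (2 * (g j - g j.+1)) by ring.
  by rewrite ler_wpM2l// mulr_ge0.
rewrite -mulr_sumr -[leRHS]mulr1 ler_wpM2l ?mulr_ge0//.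
have -> : \sum_(j < n) (g j - g j.+1) = g 0 - g n.
  elim: n {e1} => [|n IH]; first by rewrite big_ord0 subrr.
  by rewrite big_ord_recr/= IH addrA subrK.
have : g 0 <= 1 by rewrite expRN_le1// !mulr_ge0 ?ltW ?lam_gt0.
have := expR_ge0 (- (Re z * lam n / 2)); rewrite -/(g n); lra.
Qed.

Lemma cone_real (t : R) : 0 < t -> cone 1 t%:C.
Proof. by move=> t0; split => //=; rewrite rnorm_real mul1r gtr0_norm. Qed.

Lemma sg_real_bound (t : R) x : 0 <= t -> rnorm (sg t%:C x) <= (C * 7 + 1) * rnorm x.
Proof.
rewrite le_eqVlt => /orP[/eqP <-|t0].
  by rewrite sg0 mulrDl mul1r lerDr !mulr_ge0// rnorm_ge0.
apply: (le_trans (sg_bound x ler01 (cone_real t0))).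
rewrite mulr1 ler_wpM2r ?rnorm_ge0//; rewrite (_ : 1 + 6 = 7 :> R) ?lerDl//.
Qed.

Lemma msgB1_le z j : adm z -> rnorm (msg z j - 1) <= 3 * lam j * rnorm z.
Proof.
move=> az; rewrite mulrAC -mulrA.
have -> : rnorm z * lam j = rnorm (z * (lam j)%:C).
  by rewrite rnormM rnorm_real (gtr0_norm (lam_gt0 j)).
apply: cexpB1_le; rewrite Re_zlam mulr_ge0// ?(ltW (lam_gt0 _))//.
by case: az => [->|/ltW].
Qed.

(** Three terms of size e / 3: two tails of the decomposition, controlled by the uniform bound on
    the cone, and a finite partial sum, on which the semigroup tends to the identity at a Lipschitz
    rate. *)
Lemma sg_near0 K x (e : R) : 0 <= K -> 0 < e -> exists2 r : R, 0 < r &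
  forall z, cone K z -> rnorm z < r -> rnorm (sg z x - x) < e.
Proof.
move=> K0 e0; pose M := C * (1 + 6 * K) + 1.
have M0 : 0 < M by rewrite ltr_wpDl// !mulr_ge0// addr_ge0// mulr_ge0.
have M1 : 1 <= M by rewrite lerDr mulr_ge0// addr_ge0// mulr_ge0.
have e3 : 0 < e / (3 * M) by rewrite divr_gt0// mulr_gt0.
have /cvg_rnormP/cvgrPdist_lt/(_ _ e3)[N _ NP] := @dec_cvg _ _ _ _ dP x.
have {NP} := NP N (leqnn N); rewrite sub0r normrN ger0_norm ?rnorm_ge0// => hN.
pose B := \sum_(j < N) 3 * lam j * rnorm (P j x).
have B0 : 0 <= B by apply: sumr_ge0 => j _; rewrite !mulr_ge0 ?rnorm_ge0// ltW// lam_gt0.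
exists (e / (3 * (B + 1))) => [|z cz zr].
  by rewrite divr_gt0// mulr_gt0// ltr_wpDl.
have az : adm z by right; case: cz.
have -> : sg z x - x = sg z (x - psum N x) + (sg z (psum N x) - psum N x) + (psum N x - x).
  rewrite (linfunB (sg_linear az)).
  by rewrite !addrA !subrK.
have h1 : rnorm (sg z (x - psum N x)) < e / 3.
  apply: (le_lt_trans (sg_bound _ K0 cz)).
  apply: (@le_lt_trans _ _ (M * rnorm (x - psum N x))).
    by rewrite ler_wpM2r ?rnorm_ge0// lerDl.
  move: hN; rewrite rnorm_distC ltr_pdivlMr ?mulr_gt0// ltr_pdivlMr//.
  by congr (_ < _); ring.
have h2 : rnorm (psum N x - x) < e / 3.
  apply: (lt_le_trans hN); rewrite ler_wpM2l ?(ltW e0)// lef_pV2 ?posrE ?mulr_gt0//.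
  by rewrite ler_peMr.
have h3 : rnorm (sg z (psum N x) - psum N x) < e / 3.
  have -> : sg z (psum N x) - psum N x = \sum_(j < N) (msg z j - 1) *: P j x.
    rewrite /psum (big_morph (sg z) (linfunD (sg_linear az)) (linfun0 (sg_linear az))).
    by rewrite -sumrB; apply: eq_bigr => j _; rewrite sg_P// scalerBl scale1r.
  apply: (le_lt_trans (rnorm_sum _ _ _)).
  apply: (@le_lt_trans _ _ (B * rnorm z)).
    rewrite mulr_suml; apply: ler_sum => j _; rewrite rnormZ mulrAC ler_wpM2r ?rnorm_ge0//.
    exact: msgB1_le.
  apply: (@le_lt_trans _ _ ((B + 1) * rnorm z)).
    by rewrite ler_wpM2r ?rnorm_ge0// lerDl.
  move: zr; rewrite ltr_pdivlMr ?mulr_gt0 ?ltr_wpDl// ltr_pdivlMr//.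
  by congr (_ < _); ring.
apply: (le_lt_trans (ler_rnormD _ _)).
have := ler_rnormD (sg z (x - psum N x)) (sg z (psum N x) - psum N x).
lra.
Qed.

Definition dmsg z (j : nat) : R[i] := - ((lam j)%:C * msg z j).

Definition dsg z x : X := xget 0 [set y | multiplies (dmsg z) x y].

(** The factorial bound on t^n exp(-t) is used with one power more than the summand contains; the
    surplus leaves the summable factor 1 / lam j. *)
Lemma pow_lam_bound (r : R) (k n : nat) : 0 < r ->
  \sum_(j < n) (lam j) ^+ k.+1 * expR (- (r * lam j)) <= (k.+2)`!%:R * r^-1 ^+ k.+2 * 2.
Proof.
move=> r0; apply: (@le_trans _ _ (\sum_(j < n) (k.+2)`!%:R * r^-1 ^+ k.+2 * (lam j)^-1)).
  apply: ler_sum => j _; have l0 := lam_gt0 j.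
  have t0 : 0 < r * lam j by rewrite mulr_gt0.
  rewrite exprVn ler_pdivlMr// mulrAC -exprSr -[leRHS]mulrC ler_pdivlMl ?exprn_gt0//.
  by rewrite mulrA -exprMn; exact: pow_expRN_le (ltW t0).
rewrite -mulr_sumr ler_wpM2l ?sum_lamV// mulr_ge0// exprn_ge0// invr_ge0 ltW//.
Qed.

Lemma rnorm_dmsg z j : rnorm (dmsg z j) = lam j * expR (- (Re z * lam j)).
Proof. by rewrite rnormN rnormM rnorm_real rnorm_msg gtr0_norm// lam_gt0. Qed.

Lemma dmsg_bound z n : 0 < Re z ->
  \sum_(j < n) rnorm (dmsg z j) <= 2`!%:R * (Re z)^-1 ^+ 2 * 2.
Proof.
move=> z0; under eq_bigr do rewrite rnorm_dmsg -[X in X * _]expr1.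
exact: pow_lam_bound.
Qed.

Lemma dsgP z x : 0 < Re z -> multiplies (dmsg z) x (dsg z x).
Proof.
move=> z0; apply: (@xgetPex _ 0 [set y | multiplies (dmsg z) x y]).
apply: (@multiplies_exists _ _ _ _ cX dP C0) => n; exact: dmsg_bound.
Qed.

Lemma dsg_bounded z : 0 < Re z -> bounded_operator (dsg z).
Proof.
move=> z0; split.
  move=> a x y; apply: (dec_sep dP) => j.
  rewrite (dsgP _ z0) !(dec_PD dP) !(dec_PZ dP) !(dsgP _ z0).
  by rewrite scalerDr !scalerA mulrC.
exists (2 * C * (2`!%:R * (Re z)^-1 ^+ 2 * 2)) => x.
by apply: (multiplies_sum dP C0 (dsgP x z0)) => n; exact: dmsg_bound.
Qed.

(** The second-order Taylor error of the exponential costs |h| (lam j)^2 exp(|h| lam j). Since |h|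
    <= Re z / 2, half of the decay exp(- Re z lam j) survives and makes these errors summable in
    [j]; the resulting bound is linear in |h| and uniform in [x]. *)
Lemma sg_derivative z h x : 0 < Re z -> rnorm h <= Re z / 2 -> h != 0 ->
  rnorm (h^-1 *: (sg (z + h) x - sg z x) - dsg z x) <=
  2 * C * (4 * rnorm h * (3`!%:R * (Re z / 2)^-1 ^+ 3 * 2)) * rnorm x.
Proof.
move=> z0 hz h0; set r := Re z / 2.
have r0 : 0 < r by rewrite divr_gt0.
have zh : 0 < Re (z + h).
  rewrite raddfD/=; have := normRe_le h; rewrite ler_norml => /andP[+ _].
  move: hz z0; set a := Re z; set b := Re h; lra.
have az : adm z by right. have azh : adm (z + h) by right.
pose m j := h^-1 * (msg (z + h) j - msg z j) - dmsg z j.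
apply: (@multiplies_sum _ _ _ _ dP C0 m).
  move=> j; rewrite !(dec_PB dP) (dec_PZ dP) (dec_PB dP) (sgP x az j) (sgP x azh j) (dsgP x z0 j).
  by rewrite /m -scalerBl scalerA -scalerBl.
move=> n; have hm j : rnorm (m j) <= 4 * rnorm h * (lam j ^+ 2 * expR (- (r * lam j))).
  pose w := - (h * (lam j)%:C).
  have -> : m j = msg z j * (h^-1 * (cexp w - 1 - w)).
    rewrite /m /dmsg msgD {2}/msg -/w -[w in RHS]/w.
    have -> : (lam j)%:C = - (h^-1 * w) by rewrite /w mulrN opprK mulKf.
    by ring.
  rewrite rnormM rnorm_msg rnormM rnormcV.
  have rh0 : 0 < rnorm h by rewrite lt_neqAle rnorm_ge0 andbT eq_sym; apply/eqP => /rnorm_eq0 /eqP; apply/negP.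
  have rw : rnorm w = rnorm h * lam j by rewrite rnormN rnormM rnorm_real gtr0_norm// lam_gt0.
  have := cexp_taylor w; rewrite rw => tw.
  apply: (@le_trans _ _ (expR (- (Re z * lam j)) * ((rnorm h)^-1 * (4 * (rnorm h * lam j) ^+ 2 * expR (rnorm h * lam j))))).
    rewrite ler_wpM2l ?expR_ge0// ler_wpM2l// invr_ge0 ltW//.
  have -> : expR (- (Re z * lam j)) * ((rnorm h)^-1 * (4 * (rnorm h * lam j) ^+ 2 * expR (rnorm h * lam j))) = 4 * rnorm h * (lam j ^+ 2 * (expR (- (Re z * lam j)) * expR (rnorm h * lam j))).
    by have := lt0r_neq0 rh0; set a := rnorm h; move=> a0; field.
  rewrite ler_wpM2l ?mulr_ge0 ?rnorm_ge0// ler_wpM2l ?exprn_ge0 ?(ltW (lam_gt0 _))//.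
  rewrite -expRD ler_expR -mulNr -mulrDl -mulNr ler_wpM2r ?(ltW (lam_gt0 _))//.
  by move: hz; rewrite /r; set a := Re z; lra.
apply: (le_trans (ler_sum _ (fun (j : 'I_n) _ => hm j))).
by rewrite -mulr_sumr ler_wpM2l ?mulr_ge0 ?rnorm_ge0// pow_lam_bound.
Qed.

End semigroup.

Section semigroup_structure.
Context (R : realType) (X : normedModType R[i]).
Variables (P : nat -> X -> X) (C : R).
Hypothesis (cX : seq_complete X) (dP : decomposition P C) (C0 : 0 <= C).
Implicit Types (x y : X) (z w h : R[i]).
Local Notation Re := (@complex.Re R).
Local Notation sg := (sg P).

Lemma near0_rnorm_lt (d : R) : 0 < d -> \forall h \near (0 : R[i]^o), rnorm (h : R[i]) < d.
Proof.
move=> d0; have d0' : 0 < d%:C :> R[i] by rewrite ltcR.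
apply: filterS (nbhs0_lt (V := R[i]^o) d0') => h.
by rewrite -ltcR rnormE.
Qed.

Lemma sg_C0 : C0_semigroup (fun t : R => sg t%:C).
Proof.
split.
- move=> t t0; split; first exact: (sg_linear cX dP C0 (adm_real t0)).
  by exists (C * 7 + 1) => x; exact: sg_real_bound.
- by move=> x; exact: (sg0 cX dP C0).
- by move=> s t s0 t0 x; rewrite rmorphD/=; apply: (sgD cX dP C0); exact: adm_real.
- move=> x; apply/cvg_rnormP/cvgrPdist_lt => e e0.
  have [r r0 hr] := sg_near0 cX dP C0 x ler01 e0.
  near=> t; rewrite sub0r normrN ger0_norm ?rnorm_ge0//; apply: hr.
    by apply: cone_real; near: t; exact: nbhs_right_gt.
  rewrite rnorm_real gtr0_norm; last by near: t; exact: nbhs_right_gt.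
  by near: t; exact: nbhs_right_lt.
Unshelve. all: by end_near. Qed.

Lemma sg_holomorphic : holomorphic_on (sector (pi / 2)) sg.
Proof.
move=> z sz; have z0 : 0 < Re z by exact: sector_Re sz.
exists (dsg P z); first exact: (dsg_bounded cX dP C0).
move=> e e0; set K := 2 * C * (4 * (3`!%:R * (Re z / 2)^-1 ^+ 3 * 2)).
have K0 : 0 <= K.
  have i0 : 0 <= (Re z / 2)^-1 by rewrite invr_ge0 divr_ge0// ltW.
  by rewrite /K !mulr_ge0// exprn_ge0.
near=> h; move=> x.
have h0 : h != 0 by near: h; exact: (@nbhs_dnbhs_neq _ (0 : R[i]^o)).
have hz : rnorm h < Re z / 2.
  by near: h; apply: cvg_within; apply: near0_rnorm_lt; rewrite divr_gt0.
have he : rnorm h < e / (K + 1).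
  by near: h; apply: cvg_within; apply: near0_rnorm_lt; rewrite divr_gt0// ltr_wpDl.
apply: (le_trans (sg_derivative cX dP C0 x z0 (ltW hz) h0)).
rewrite ler_wpM2r ?rnorm_ge0//.
rewrite (_ : 2 * C * _ = K * rnorm h); last by rewrite /K; ring.
rewrite (le_trans (y := (K + 1) * rnorm h)) ?ler_wpM2r ?rnorm_ge0 ?lerDl//.
by rewrite mulrC -ler_pdivlMr ?ltr_wpDl// ltW.
Unshelve. all: by end_near. Qed.

Lemma sg_holomorphic_C0 : holomorphic_C0_semigroup (pi / 2) sg.
Proof.
have aS z : sector (pi / 2) z -> adm z by move=> sz; right; exact: sector_Re sz.
split.
- exact: sg_C0.
- move=> z sz; split; first exact: (sg_linear cX dP C0 (aS _ sz)).
  have z0 : 0 < Re z by exact: sector_Re sz.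
  exists (C * (1 + 6 * (rnorm z / Re z))) => x.
  apply: (sg_bound cX dP C0); first by rewrite divr_ge0 ?rnorm_ge0// ltW.
  by split=> //; rewrite divfK// gt_eqF.
- exact: sg_holomorphic.
- by move=> z w sz sw x; apply: (sgD cX dP C0); exact: aS.
- move=> delta' /andP[d0 dpi] x; apply/cvg_rnormP/cvgrPdist_lt => e e0.
  have cd : 0 < cos delta'.
    apply: cos_gt0_pihalf; rewrite dpi (lt_trans _ d0)// oppr_lt0 divr_gt0 ?pi_gt0//.
  have K0 : 0 <= (cos delta')^-1 by rewrite invr_ge0 ltW.
  have [r r0 hr] := sg_near0 cX dP C0 x K0 e0.
  rewrite near_withinE.
  apply: filterS (near0_rnorm_lt r0) => z zr sz.
  rewrite sub0r normrN ger0_norm ?rnorm_ge0//; apply: hr => //.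
  by apply: sector_cone => //; rewrite d0 dpi.
Qed.

(** A local Lipschitz bound read off from the derivative estimate; it makes the integrand of the
    mild solution strongly measurable. *)
Lemma sg_continuous (t : R) x : 0 < t -> {for t, continuous (fun s : R => sg s%:C x)}.
Proof.
move=> t0; have z0 : 0 < Re (t%:C : R[i]) by [].
have [lD [M MD]] := dsg_bounded cX dP C0 z0.
set K := 2 * C * (4 * (t / 2) * (3`!%:R * (t / 2)^-1 ^+ 3 * 2)).
have K0 : 0 <= K.
  have i0 : 0 <= (t / 2)^-1 by rewrite invr_ge0 divr_ge0// ltW.
  by rewrite /K !mulr_ge0 ?exprn_ge0 ?divr_ge0// ltW.
pose B := K * rnorm x + `|M| * rnorm x.
apply: (@rnorm_squeeze _ _ _ _ _ _ _ (fun s => B * `|s - t|)).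
  have t2 : 0 < t / 2 by rewrite divr_gt0.
  near=> s; have [->|st] := eqVneq s t.
    by rewrite subrr rnorm0 mulr_ge0// addr_ge0// mulr_ge0 ?rnorm_ge0.
  set h := (s - t)%:C : R[i].
  have hn : rnorm h = `|s - t| by rewrite rnorm_real.
  have h0 : h != 0 by rewrite eq_complex/= eqxx andbT subr_eq0.
  have ht : rnorm h <= t / 2.
    rewrite hn distrC ltW//; near: s; exact: cvgr_dist_lt.
  have sE : (s%:C : R[i]) = t%:C + h by rewrite /h -rmorphD/= addrC subrK.
  have := sg_derivative cX dP C0 x z0 ht h0; rewrite -sE => hd.
  have -> : sg s%:C x - sg t%:C x =
    h *: ((h^-1 *: (sg s%:C x - sg t%:C x) - dsg P t%:C x) + dsg P t%:C x).
    by rewrite subrK scalerA divff// scale1r.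
  rewrite rnormZ -hn mulrC ler_wpM2r ?rnorm_ge0//.
  apply: (le_trans (ler_rnormD _ _)); apply: lerD.
    apply: (le_trans hd); rewrite ler_wpM2r ?rnorm_ge0// /K.
    rewrite ler_wpM2l ?mulr_ge0// ler_wpM2r ?ler_wpM2l//.
    have i0 : 0 <= (t / 2)^-1 by rewrite invr_ge0 divr_ge0// ltW.
    by rewrite !mulr_ge0 ?exprn_ge0.
  by apply: (le_trans (MD x)); rewrite ler_wpM2r ?rnorm_ge0// ler_norm.
apply: cvgMl0; apply/cvgrPdist_lt => e e0; near=> s.
rewrite sub0r normrN normr_id distrC; near: s; exact: cvgr_dist_lt.
Unshelve. all: by end_near. Qed.

(** [P j] is continuous, so it passes through the limit of the difference quotient, and on its range
    the semigroup is the scalar exp(- lam j t). *)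
Lemma dom_A_P x j : dom_A (fun t : R => sg t%:C) x ->
  P j (A_of (fun t : R => sg t%:C) x) = (lam R j)%:C *: P j x.
Proof.
move=> dx; set l := lim (diff_quotient (fun t : R => sg t%:C) x h @[h --> 0^'+]).
have hl : diff_quotient (fun t : R => sg t%:C) x h @[h --> 0^'+] --> l by [].
rewrite /A_of -/l (linfunN (dec_linear dP j)); apply/eqP; rewrite eqr_oppLR -scaleNr; apply/eqP.
have h1 : P j (diff_quotient (fun t : R => sg t%:C) x h) @[h --> 0^'+] --> P j l.
  exact: (dec_P_cvg dP).
apply: (cvg_uniqueX h1).
pose g (h : R) := lam R j ^+ 2 * expR (lam R j) * rnorm (P j x) * h.
apply: (@rnorm_squeeze _ _ _ _ _ _ _ g).
  near=> h; have h0 : 0 < h by near: h; exact: nbhs_right_gt.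
  have h1' : h < 1 by near: h; exact: nbhs_right_lt.
  rewrite /diff_quotient (dec_PZ dP) (dec_PB dP).
  rewrite (sgP cX dP C0 x (adm_real (ltW h0)) j).
  set a := - (h * lam R j).
  have mE : msg h%:C j = (expR a)%:C.
    rewrite /msg /cexp -rmorphM/= oppr0 cos0 sin0 mulr1 mulr0.
    by rewrite /a.
  have -> : msg h%:C j *: P j x - P j x = ((expR a)%:C - 1) *: P j x.
    by rewrite scalerBl scale1r mE.
  rewrite scalerA -scalerBl.
  have -> : (h^-1)%:C * ((expR a)%:C - 1) - - (lam R j)%:C = (h^-1 * (expR a - 1 - a))%:C.
    rewrite -[1 in LHS]/(1%:C) -rmorphB/= -rmorphM/= -rmorphN/= -rmorphB/=; congr (_%:C).
    by rewrite /a; field; rewrite gt_eqF.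
  rewrite rnormZr normrM (gtr0_norm (x := h^-1)) ?invr_gt0//.
  rewrite (_ : g h = lam R j ^+ 2 * expR (lam R j) * h * rnorm (P j x)); last first.
    by rewrite /g; ring.
  rewrite ler_wpM2r ?rnorm_ge0//.
  rewrite ler_pdivrMl// (le_trans (norm_expRB1B_le a))//.
  rewrite /a normrN (ger0_norm (mulr_ge0 (ltW h0) (ltW (lam_gt0 R j)))).
  rewrite (_ : h * (lam R j ^+ 2 * expR (lam R j) * h) = (h * lam R j) ^+ 2 * expR (lam R j)); last by ring.
  rewrite ler_wpM2l ?exprn_ge0 ?mulr_ge0 ?(ltW h0) ?(ltW (lam_gt0 R j))//.
  by rewrite ler_expR ler_piMl ?(ltW h1')// ltW// lam_gt0.
apply: cvgMl0; apply: cvg_at_right_filter; exact: cvg_id.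
Unshelve. all: by end_near. Qed.

End semigroup_structure.

(** * Mild solutions and their modes *)

Section mild.
Context (R : realType) (X : normedModType R[i]).
Variables (P : nat -> X -> X) (C : R).
Hypothesis (cX : seq_complete X) (dP : decomposition P C) (C0 : 0 <= C).
Implicit Types (x y : X) (z w h : R[i]).
Local Notation mu := (@lebesgue_measure R).
Local Notation sgR := (fun t : R => sg P t%:C).

Lemma itv0_fin (t : R) : (mu `]0%R, t[ < +oo)%E.
Proof.
rewrite lebesgue_measure_itv/= lte_fin; case: ifPn => _ //.
by rewrite -EFinD ltry.
Qed.

Variables (tau : R) (f : R -> X).
Hypothesis (sf : strongly_measurable mu `]0, tau[ f).
Hypothesis (fi : (\int[mu]_(s in `]0%R, tau[) (rnorm (f s))%:E < +oo)%E).

Lemma mild_L1 (g : R -> R) (M t : R) : 0 < t < tau -> (forall s, 0 <= g s) ->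
  (forall s : R, 0 < s < t -> g s <= M * rnorm (f s)) -> 
  (\int[mu]_(s in `]0%R, t[) (g s)%:E < +oo)%E.
Proof.
move=> /andP[t0 tt] g0 gM.
have sub : `]0, t[ `<=` `]0, tau[.
  by move=> s /=; rewrite !in_itv/= => /andP[-> st]; rewrite (lt_trans st).
have sft : strongly_measurable mu `]0, t[ f.
  by apply: (@sm_domain _ _ _ _ mu _ _ _ _ _ sub) => //; exact: itv0_fin.
have [||v [mv v0 fv]] := @sm_norm _ _ _ _ mu _ _ _ _ sf; [exact: measurable_itv|exact: itv0_fin|].
have fi' := fi; rewrite (eq_L1 _ v0 fv) in fi'; last by move=> s; exact: rnorm_ge0.
apply: (@le_lt_trans _ _ (\int[mu]_(s in `]0%R, t[) (`|M| * v s)%:E)%E).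
  apply: le_L1 => //; first by move=> s; rewrite mulr_ge0.
  apply: filterS fv => s fv st.
  have := gM s; move: (st); rewrite /= in_itv/= => -> /(_ isT) h.
  rewrite -fv; last exact: sub.
  by apply: (le_trans h); rewrite ler_wpM2r ?rnorm_ge0// ler_norm.
under eq_integral do rewrite EFinM.
have mvt : measurable_fun `]0, t[ v by apply: measurable_funS mv.
rewrite ge0_integralZl_EFin//; last 2 first.
- by move=> s _; rewrite lee_fin.
- exact/measurable_EFinP.
rewrite lte_mul_pinfty//; apply: le_lt_trans fi'.
apply: ge0_subset_integral => //.
- exact/measurable_EFinP.
- by move=> s _; rewrite lee_fin.
Qed.

(** Ensures that the mild solution is a true Bochner integral and not the default value [0]. *)
Lemma mild_has_bochner (t : R) : 0 < t < tau ->
  has_bochner_integral mu `]0, t[ (fun s => sgR (t - s) (f s))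
    (mild_solution sgR f t).
Proof.
move=> tt; have /andP[t0 ttau] := tt.
have sub : `]0, t[ `<=` `]0, tau[.
  by move=> s /=; rewrite !in_itv/= => /andP[-> st]; rewrite (lt_trans st).
have sft : strongly_measurable mu `]0, t[ f.
  by apply: (@sm_domain _ _ _ _ mu _ _ _ _ _ sub) => //; exact: itv0_fin.
have sU : strongly_measurable mu `]0, t[ (fun s => sgR (t - s) (f s)).
  apply: (@sm_operators _ _ _ _ t0 (fun s => sgR (t - s)) (C * 7 + 1)) => //.
  - move=> s /andP[_ st]; apply: (sg_linear cX dP C0); apply: adm_real.
    by rewrite subr_ge0 ltW.
  - move=> s x /andP[_ st]; apply: (sg_real_bound cX dP C0).
    by rewrite subr_ge0 ltW.
  - move=> s x; rewrite /= in_itv/= => /andP[_ st].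
    have ts : 0 < t - s by rewrite subr_gt0.
    have c1 : {for s, continuous (fun s : R => t - s)}.
      by apply: cvgB; [exact: cvg_cst|exact: cvg_id].
    exact: (cvg_comp _ _ c1 (sg_continuous cX dP C0 (x := x) ts)).
have sfi : (\int[mu]_(s in `]0%R, t[) (rnorm (sgR (t - s)%R (f s)))%:E < +oo)%E.
  apply: (@mild_L1 _ (C * 7 + 1)) => //; first by move=> s; exact: rnorm_ge0.
  move=> s /andP[_ st]; apply: (sg_real_bound cX dP C0).
  by rewrite subr_ge0 ltW.
have [||x hx] := @has_bochner_exists _ _ _ _ mu _ _ _ cX _ sU sfi;
  [exact: measurable_itv|exact: itv0_fin|].
suff -> : mild_solution sgR f t = x by [].
by apply: (@bochner_integralE _ _ _ _ mu) hx; [exact: measurable_itv|exact: itv0_fin].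
Qed.

Lemma mild_P (t : R) j : 0 < t < tau ->
  has_bochner_integral mu `]0, t[ (fun s => msg (t - s)%:C j *: P j (f s))
    (P j (mild_solution sgR f t)).
Proof.
move=> tt; have h := has_bochner_linear (mu := mu) _ _ (dec_linear dP j) (dec_Pbound dP j)
  (mild_has_bochner tt).
apply: has_bochner_ae; first by apply: h; [exact: measurable_itv|exact: itv0_fin].
 apply: aeW => s /=; rewrite in_itv/= => /andP[_ st].
rewrite (sgP cX dP C0)//; apply: adm_real.
by rewrite subr_ge0 ltW.
Qed.

End mild.

(** * Bochner integrals with an explicit primitive *)

Section bochner_FTC.
Context (R : realType) (X : normedModType R[i]).
Local Notation mu := (@lebesgue_measure R).
Variables (t K : R) (G g : R -> X).
Hypotheses (t0 : 0 < t) (K0 : 0 <= K).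
Hypothesis GK : forall s h : R, 0 <= s -> 0 <= h -> s + h <= t ->
  rnorm (G (s + h) - G s - h%:C *: g s) <= K * h ^+ 2.
Hypothesis gK : forall s h : R, 0 <= s -> 0 <= h -> s + h <= t ->
  rnorm (g (s + h) - g s) <= K * h.

(** The left end is included so that the half-open cells tile the interval exactly; the point [0],
    of measure zero, is dropped at the end. *)
Let D0 : set R := `[0, t[%classic.
Let mD0 : measurable D0. Proof. exact: measurable_itv. Qed.
Let D0E : mu D0 = t%:E.
Proof. by rewrite /D0 lebesgue_measure_itv/= lte_fin t0 oppr0 adde0. Qed.
Let D0fin : (mu D0 < +oo)%E. Proof. by rewrite D0E ltry. Qed.

Let mesh n : R := t / n.+1%:R.
Let mesh_gt0 n : 0 < mesh n. Proof. by rewrite divr_gt0. Qed.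
Let cell n k : set R := `[k%:R * mesh n, k.+1%:R * mesh n[%classic.
Let s_ n (r : R) : X := \sum_(k < n.+1) (\1_(cell n k) r)%:C *: g (k%:R * mesh n).
Let y_ n : X := \sum_(k < n.+1) (mesh n)%:C *: g (k%:R * mesh n).

Let mesh_le n k : (k <= n.+1)%N -> k%:R * mesh n <= t.
Proof.
move=> kn; rewrite /mesh mulrCA ger_pMr// ler_pdivrMr// mul1r.
by rewrite ler_nat.
Qed.

Let is_step_s n : is_step mu D0 setT (s_ n) (y_ n).
Proof.
exists (@Step _ (measurableTypeR R) _ X n.+1 (fun k => cell n k) (fun k => g (k%:R * mesh n))).
split => //=.
- move=> k /=; split; first exact: measurable_itv.
  apply: le_lt_trans D0fin; apply: le_measure; rewrite ?inE//.
  by apply: measurableI => //; exact: measurable_itv.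
- rewrite /step_integral/=; apply: eq_bigr => k _; congr (_%:C *: _).
  rewrite setIidl.
    rewrite /cell lebesgue_measure_itv/= lte_fin ltr_pM2r// ltr_nat ltnSn.
    by rewrite -EFinD/= -mulrBl -natrB// subSnn mul1r.
  move=> r; rewrite /cell /D0 /= !in_itv/= => /andP[r1 r2].
  have km : 0 <= k%:R * mesh n by apply: mulr_ge0 => //; exact: ltW.
  rewrite (le_trans km r1)/=.
  by apply: (lt_le_trans r2); apply: mesh_le.
Qed.

Let mesh_cvg (c : R) : c * mesh n @[n --> \oo] --> (0 : R).
Proof. by apply: cvgMl0; apply: cvgMl0; exact: cvg_harmonic. Qed.

Let s_close n r : D0 r -> rnorm (s_ n r - g r) <= K * mesh n.
Proof.
rewrite /D0 /= in_itv/= => /andP[r0 rt]; have m0 := mesh_gt0 n.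
have rm0 : 0 <= r / mesh n by rewrite divr_ge0// ltW.
pose k := Num.truncn (r / mesh n).
have /andP[k1 k2] : k%:R <= r / mesh n < k.+1%:R := truncn_itv rm0.
have kn : (k < n.+1)%N.
  rewrite -(ltr_nat R); apply: (le_lt_trans k1).
  by rewrite ltr_pdivrMr// /mesh mulrCA divff// mulr1.
rewrite ler_pdivlMr// in k1; rewrite ltr_pdivrMr// in k2.
have -> : s_ n r = g (k%:R * mesh n).
  rewrite /s_ (bigD1 (Ordinal kn))//= indicE mem_set; last first.
    by rewrite /cell /= in_itv/= k1 k2.
  rewrite scale1r big1 ?addr0// => i ik; rewrite indicE memNset ?scale0r//.
  rewrite /cell /= in_itv/= => /andP[i1 i2]; move/eqP: ik; apply; apply: val_inj => /=.
  apply/esym/truncn_def.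
  by rewrite ler_pdivlMr// ltr_pdivrMr// i1 i2.
rewrite rnorm_distC -[r](subrK (k%:R * mesh n)) [r - _ + _]addrC.
have h0 : 0 <= r - k%:R * mesh n by rewrite subr_ge0.
apply: (le_trans (gK _ h0 _)); first by rewrite mulr_ge0// ltW.
  by rewrite addrC subrK ltW.
rewrite ler_wpM2l// lerBlDl ltW//; apply: (lt_le_trans k2).
by rewrite -natr1 mulrDl mul1r.
Qed.

Let y_close n : rnorm (y_ n - (G t - G 0)) <= K * t * mesh n.
Proof.
have m0 := mesh_gt0 n.
have tE : t = n.+1%:R * mesh n by rewrite /mesh mulrCA divff// mulr1.
have -> : G t - G 0 = \sum_(k < n.+1) (G (k.+1%:R * mesh n) - G (k%:R * mesh n)).
  rewrite -(big_mkord xpredT (fun k => G (k.+1%:R * mesh n) - G (k%:R * mesh n))).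
  by rewrite (telescope_sumr (fun k => G (k%:R * mesh n)))// mul0r -tE.
rewrite -sumrB; apply: (le_trans (rnorm_sum _ _ _)).
apply: (@le_trans _ _ (\sum_(k < n.+1) K * mesh n ^+ 2)).
  apply: ler_sum => k _; rewrite rnorm_distC.
  have := @GK (k%:R * mesh n) (mesh n).
  have -> : k%:R * mesh n + mesh n = k.+1%:R * mesh n by rewrite -natr1 mulrDl mul1r.
  apply; [by rewrite mulr_ge0// ltW|exact: ltW|exact: mesh_le].
rewrite sumr_const card_ord -mulr_natl [in leRHS]tE le_eqVlt; apply/orP; left.
by apply/eqP; ring.
Qed.

(** Left Riemann sums with a rate: the Lipschitz bound keeps the steps within K h of [g] on cells of
    length h, and the Taylor bound keeps the step integrals within K h^2 per cell of the telescoping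
    increments of [G]. *)
Lemma has_bochner_FTC : has_bochner_integral mu `]0, t[ g (G t - G 0).
Proof.
have sg0 : strongly_measurable mu D0 g.
  apply/strongly_measurable_inP; exists s_; split => [n|].
    by exists (y_ n); exact: is_step_s.
  apply: aeW => r Dr; split => //.
  apply: (squeeze_cvgr _ (cvg_cst (0 : R)) (mesh_cvg K)); apply: nearW => n.
  by rewrite rnorm_ge0 s_close.
have hD0 : has_bochner_integral mu D0 g (G t - G 0).
  apply/has_bochnerP; split => //; exists s_, y_; split => //.
  - have c0 : (K * mesh n * t)%:E @[n --> \oo] --> (0%R%:E : \bar R).
      apply: cvg_EFin; first exact: nearW.
      rewrite [X in X @ _ --> _](_ : _ = (fun n => (K * t) * mesh n)); first exact: mesh_cvg.
      by apply/funext => n /=; rewrite mulrAC.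
    apply: (squeeze_cvge _ (cvg_cst 0%E) c0); apply: nearW => n.
    rewrite integral_ge0/=; last by move=> r _; rewrite lee_fin rnorm_ge0.
    apply: (@le_trans _ _ (\int[mu]_(r in D0) (K * mesh n)%:E)%E); last first.
      by rewrite (integral_cst mu mD0) [X in (_ * X <= _)%E]D0E -EFinM.
    apply: le_L1; [by move=> r; exact: rnorm_ge0|by move=> r; rewrite mulr_ge0// ltW|].
    by apply: aeW => r Dr; rewrite rnorm_distC s_close.
  - apply: rnorm_squeeze (mesh_cvg (K * t)); apply: nearW => n; exact: y_close.
have sub : `]0, t[ `<=` D0.
  by move=> r; rewrite /D0 /= !in_itv/= => /andP[/ltW -> ->].
apply: (@has_bochner_domain _ _ _ _ mu _ _ mD0 D0fin _ sub); first exact: measurable_itv.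
apply: has_bochner_ae hD0 _; exists [set 0]; split.
- exact: measurable_set1.
- exact: lebesgue_measure_set1.
move=> r /= h; apply: contrapT => r0; apply: h; rewrite /D0/= in_itv/= => /andP[r1 r2].
rewrite indicE mem_set ?scale1r//= in_itv/= r2 andbT lt_neqAle r1 andbT.
by apply/eqP => /esym.
Qed.

End bochner_FTC.

(** * Failure of maximal regularity *)

Section exp_bochner.
Context (R : realType) (X : normedModType R[i]).
Local Notation mu := (@lebesgue_measure R).

Lemma rnorm_cexp_le (z : R[i]) : rnorm (cexp z) <= expR (rnorm z).
Proof. by rewrite rnorm_cexp ler_expR (le_trans (ler_norm _))// normRe_le. Qed.

Lemma has_bochner_cexp (al : R[i]) (t : R) (v : X) : 0 < t -> al != 0 ->
  has_bochner_integral mu `]0, t[ (fun s : R => cexp (al * s%:C) *: v)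
    ((al^-1 * (cexp (al * t%:C) - 1)) *: v).
Proof.
move=> t0 al0; set N := rnorm al; set E := expR (N * t).
have N0 : 0 <= N by exact: rnorm_ge0.
have Np : 0 < N by rewrite lt_neqAle N0 andbT eq_sym; apply/eqP => /rnorm_eq0 /eqP; apply/negP.
have E0 : 0 <= E by exact: expR_ge0.
have ss (s : R) : 0 <= s -> rnorm (al * s%:C) = N * s.
  by move=> s0; rewrite rnormM rnorm_real ger0_norm.
have expE (s : R) : 0 <= s -> s <= t -> rnorm (cexp (al * s%:C)) <= E.
  move=> s0 st; apply: (le_trans (rnorm_cexp_le _)).
  by rewrite ss// ler_expR ler_wpM2l.
have tay (h : R) : 0 <= h -> h <= t ->
    rnorm (cexp (al * h%:C) - 1 - al * h%:C) <= 4 * (N * h) ^+ 2 * E.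
  move=> h0 ht; apply: (le_trans (cexp_taylor _)); rewrite ss//.
  by rewrite ler_wpM2l ?mulr_ge0 ?exprn_ge0 ?mulr_ge0// ler_expR ler_wpM2l.
have hsplit (s h : R) : cexp (al * (s + h)%:C) = cexp (al * s%:C) * cexp (al * h%:C).
  by rewrite -cexpD -mulrDr -rmorphD.
(* The first summand bounds the second-order remainder of the primitive, the second the Lipschitz
   constant of the integrand on [0, t]. *)
pose K := (4 * N * E * E + E * (N + 4 * N ^+ 2 * t * E)) * rnorm v.
have K1 : 0 <= 4 * N * E * E * rnorm v by rewrite !mulr_ge0 ?rnorm_ge0.
have K2 : 0 <= E * (N + 4 * N ^+ 2 * t * E) * rnorm v.
  rewrite mulr_ge0 ?rnorm_ge0// mulr_ge0// addr_ge0// !mulr_ge0 ?exprn_ge0// ltW//.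
have KE : K = 4 * N * E * E * rnorm v + E * (N + 4 * N ^+ 2 * t * E) * rnorm v.
  by rewrite /K mulrDl.
have := @has_bochner_FTC R X t K (fun s => (al^-1 * cexp (al * s%:C)) *: v)
  (fun s => cexp (al * s%:C) *: v) t0.
rewrite rmorph0 mulr0 cexp0 -scalerBl -mulrBr; apply.
- by rewrite KE addr_ge0.
- move=> s h s0 h0 sht.
  have -> : (al^-1 * cexp (al * (s + h)%:C)) *: v - (al^-1 * cexp (al * s%:C)) *: v
      - h%:C *: (cexp (al * s%:C) *: v) =
      (al^-1 * cexp (al * s%:C) * (cexp (al * h%:C) - 1 - al * h%:C)) *: v.
    rewrite scalerA -!scalerBl; congr (_ *: _); rewrite hsplit.
    by field.
  rewrite rnormZ rnormM rnormM rnormcV -/N.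
  have st : s <= t by apply: le_trans sht; rewrite lerDl.
  have ht : h <= t by apply: le_trans sht; rewrite lerDr.
  apply: (@le_trans _ _ (N^-1 * E * (4 * (N * h) ^+ 2 * E) * rnorm v)).
    rewrite ler_wpM2r ?rnorm_ge0// ler_pM ?rnorm_ge0 ?mulr_ge0 ?rnorm_ge0 ?invr_ge0//.
      by rewrite ler_wpM2l ?invr_ge0// expE.
    exact: tay.
  have -> : N^-1 * E * (4 * (N * h) ^+ 2 * E) * rnorm v = (4 * N * E * E * rnorm v) * h ^+ 2.
    by have := lt0r_neq0 Np; move=> Nn; field.
  by rewrite ler_wpM2r ?exprn_ge0// KE lerDl.
- move=> s h s0 h0 sht.
  have st : s <= t by apply: le_trans sht; rewrite lerDl.
  have ht : h <= t by apply: le_trans sht; rewrite lerDr.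
  have -> : cexp (al * (s + h)%:C) *: v - cexp (al * s%:C) *: v =
      (cexp (al * s%:C) * (al * h%:C + (cexp (al * h%:C) - 1 - al * h%:C))) *: v.
    by rewrite -scalerBl; congr (_ *: _); rewrite hsplit; ring.
  rewrite rnormZ rnormM.
  apply: (@le_trans _ _ (E * (N * h + 4 * (N * h) ^+ 2 * E) * rnorm v)).
    rewrite ler_wpM2r ?rnorm_ge0// ler_pM ?rnorm_ge0 ?expE//.
    by apply: (le_trans (rnormD _ _)); rewrite ss// lerD2l tay.
  apply: (@le_trans _ _ (E * (N + 4 * N ^+ 2 * t * E) * rnorm v * h)).
    have -> : E * (N + 4 * N ^+ 2 * t * E) * rnorm v * h =
      E * ((N + 4 * N ^+ 2 * t * E) * h) * rnorm v by ring.
    rewrite ler_wpM2r ?rnorm_ge0// ler_wpM2l//.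
    rewrite [leRHS]mulrDl lerD2l.
    have -> : 4 * (N * h) ^+ 2 * E = 4 * N ^+ 2 * h * E * h by ring.
    rewrite ler_wpM2r// ler_wpM2r// ler_wpM2l// mulr_ge0// exprn_ge0//.
  by rewrite ler_wpM2r// KE lerDr.
Qed.

End exp_bochner.

(** A dyadic version of k^(-1/sigma). The sequence is constant on each block [2^m, 2^(m+1)), so the
    block sums of its r-th powers are the powers of 2^(1 - r/sigma), which is 1 for r = sigma and
    less than 1 for r = rho. The summand 1 in [block] is the term k = 0, where [trunc_log] is 0. *)
Lemma exists_lp_not_lq (R : realType) (sigma rho : R) : 0 < sigma -> sigma < rho ->
  exists c : nat -> R, [/\ forall k, 0 <= c k,
    exists B : R, forall n : nat, \sum_(k < n) c k `^ rho <= B &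
    forall B : R, exists n : nat, B < \sum_(k < n) c k `^ sigma].
Proof.
move=> s0 sr; pose c k : R := (2 `^ (- sigma^-1)) ^+ trunc_log 2 k.
have p0 : 0 < (2 : R) `^ (- sigma^-1) by exact: powR_gt0.
have c0 k : 0 <= c k by rewrite exprn_ge0// ltW.
have cE (r : R) k : c k `^ r = (2 `^ (- (r / sigma))) ^+ trunc_log 2 k.
  rewrite /c -(powR_mulrn _ (powR_ge0 2 _)) -(powR_mulrn _ (powR_ge0 2 (- (r / sigma)))).
  by rewrite -!powRrM; congr (_ `^ _); ring.
have block (r : R) M : \sum_(k < 2 ^ M) c k `^ r =
    1 + \sum_(m < M) (2 `^ (1 - r / sigma)) ^+ m.
  elim: M => [|M IH]; first by rewrite expn0 big_ord1 big_ord0 addr0 cE trunc_log0 expr0.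
  rewrite big_ord_recr/= addrA -IH -!(big_mkord xpredT (fun k => c k `^ r)).
  rewrite (big_cat_nat (n := 2 ^ M))//=; last by rewrite leq_exp2l.
  congr (_ + _); rewrite (eq_big_nat _ _ (F2 := fun=> (2 `^ (- (r / sigma))) ^+ M)); last first.
    move=> i /andP[i1 i2]; rewrite cE; congr (_ ^+ _).
    by apply: trunc_log_eq => //; rewrite i1 i2.
  rewrite sumr_const_nat expnS mul2n -addnn addnK.
  rewrite powRD ?pnatr_eq0 ?implybT// powRr1// exprMn -natrX mulr_natl.
  by [].
exists c; split => //.
- pose r : R := 2 `^ (1 - rho / sigma).
  have r1 : r < 1.
    rewrite /r /powR gt_eqF// expR_lt1 nmulr_rlt0 ?ln_gt0 ?ltr1n//.
    by rewrite subr_lt0 ltr_pdivlMr// mul1r.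
  have r0 : 0 <= r by exact: powR_ge0.
  exists (1 + (1 - r)^-1) => n.
  apply: (@le_trans _ _ (\sum_(k < 2 ^ n) c k `^ rho)).
    rewrite -!(big_mkord xpredT (fun k => c k `^ rho)).
    rewrite [leRHS](big_cat_nat (n := n))//=; last by rewrite ltnW// ltn_expl.
    by rewrite lerDl sumr_ge0// => i _; exact: powR_ge0.
  rewrite block lerD2l -/r.
  have r1' : 0 < 1 - r by rewrite subr_gt0.
  rewrite -[leRHS]mul1r ler_pdivlMr//.
  suff -> : (\sum_(m < n) r ^+ m) * (1 - r) = 1 - r ^+ n by rewrite gerBl exprn_ge0.
  by rewrite mulrC -[RHS]opprB subrX1 -mulNr opprB.
- move=> B; exists (2 ^ (Num.truncn `|B|).+1)%N; rewrite block.
  rewrite (eq_bigr (fun=> 1)); last first.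
    by move=> i _; rewrite divff ?gt_eqF// subrr powRr0 expr1n.
  rewrite sumr_const card_ord.
  have := truncn_itv (normr_ge0 B) => /andP[_ h].
  apply: (le_lt_trans (ler_norm B)); apply: (lt_le_trans h).
  by rewrite lerDr.
Qed.

Lemma powR_lt_inv (R : realType) (r a b : R) : 0 < r -> 0 <= a -> 0 <= b ->
  a `^ r < b `^ r -> a < b.
Proof.
move=> r0 a0 b0; rewrite !ltNge; apply: contra => ba.
by apply: ge0_ler_powR; rewrite ?nnegrE// ltW.
Qed.

Section failure.
Context (R : realType) (X : normedModType R[i]).
Variables (P : nat -> X -> X) (C : R).
Hypothesis (cX : seq_complete X) (dP : decomposition P C) (C0 : 0 <= C).
Local Notation mu := (@lebesgue_measure R).
Local Notation sgR := (fun t : R => sg P t%:C).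
(** The two cases at once, with sigma = min(p, 2) and rho = max(p, 2). For p < 2 the profiles
    [chi k] are the Rademacher functions and [eta k] pairs with the indicators; for p > 2 the roles
    are exchanged. [chi_up] sums the forcing for coefficients in l^rho, [eta_up] says that
    coordinates of vectors lie in l^sigma. *)
Variables (chi : nat -> X) (eta : nat -> X -> R[i]).
Hypothesis chiP : forall k j : nat, j./2 != k -> P j (chi k) = 0.
Hypothesis etaZ : forall k a x, eta k (a *: x) = a * eta k x.
Hypothesis etaP : forall k x, eta k x = eta k (P k.*2 x) + eta k (P k.*2.+1 x).
Hypothesis eta_even : forall k, eta k (P k.*2 (chi k)) = 2^-1.
Hypothesis eta_odd : forall k, eta k (P k.*2.+1 (chi k)) = - 2^-1.
Variables (rho sigma K : R).
Hypotheses (rho0 : 0 < rho) (sigma0 : 0 < sigma) (K0 : 0 <= K).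
Hypothesis chi_up : forall (a : nat -> R[i]) m n,
  rnorm (\sum_(m <= k < n) a k *: chi k) `^ rho <=
  K * \sum_(m <= k < n) rnorm (a k) `^ rho.
Hypothesis eta_up : forall x, exists B : R, forall n : nat,
  \sum_(k < n) rnorm (eta k x) `^ sigma <= B.
Variable c : nat -> R.
Hypothesis c0 : forall k, 0 <= c k.
Hypothesis c_rho : exists B : R, forall n : nat, \sum_(k < n) c k `^ rho <= B.
Hypothesis c_sigma : forall B : R, exists n : nat, B < \sum_(k < n) c k `^ sigma.

Let halfS k : (k.*2.+1)./2 = k. Proof. exact: (half_bit_double k true). Qed.

Let om k : R := lam R k.*2.
Let osc k (s : R) : R[i] := cexp (('i * (om k)%:C) * s%:C).

Let rnorm_osc k s : rnorm (osc k s) = 1.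
Proof.
rewrite rnorm_cexp (_ : complex.Re _ = 0) ?expR0//.
by rewrite /= !mul0r !mulr0 !subr0 ?mul0r ?subrr.
Qed.

Let fN n s := \sum_(k < n) ((c k)%:C * osc k s) *: chi k.

(** The oscillating factors have modulus one, so the threshold does not depend on [s]: the limit [f]
    is bounded and continuous, hence in L^q on every bounded interval for every q. *)
Let fN_cauchy (e : R) : 0 < e -> exists N, forall s m n, (N <= m)%N -> (m <= n)%N ->
  rnorm (fN n s - fN m s) < e.
Proof.
move=> e0; have [B hB] := c_rho.
have e1 : 0 < e `^ rho / (K + 1) by rewrite divr_gt0 ?powR_gt0// ltr_wpDl.
have [N NP] := sum_cauchy (fun n => powR_ge0 (c n) rho) hB e1.
exists N => s m n Nm mn.
have -> : fN n s - fN m s = \sum_(m <= k < n) ((c k)%:C * osc k s) *: chi k.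
  rewrite /fN -!(big_mkord xpredT (fun k => ((c k)%:C * osc k s) *: chi k)).
  by rewrite (big_cat_nat (leq0n m) mn)/= addrAC subrr add0r.
have hK := chi_up (fun k => (c k)%:C * osc k s) m n.
apply: powR_lt_inv rho0 (rnorm_ge0 _) (ltW e0) _.
apply: (le_lt_trans hK).
under eq_bigr do rewrite rnormM rnorm_osc mulr1 rnorm_real ger0_norm//.
apply: (@le_lt_trans _ _ ((K + 1) * \sum_(m <= k < n) c k `^ rho)).
  by rewrite ler_wpM2r ?lerDl// sumr_ge0// => k _; exact: powR_ge0.
have K1 : 0 < K + 1 by rewrite ltr_wpDl.
by rewrite mulrC -ltr_pdivlMr//; exact: NP.
Qed.

Let f_ex s : exists x : X, fN n s @[n --> \oo] --> x.
Proof.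
apply: cX => e e0; have [N NP] := fN_cauchy e0; exists N => m n Nm Nn.
have [mn|/ltnW nm] := leqP m n; last exact: NP.
by rewrite rnorm_distC; exact: NP.
Qed.

Let f s : X := sval (cid (f_ex s)).
Let f_cvg s : fN n s @[n --> \oo] --> f s. Proof. exact: (svalP (cid (f_ex s))). Qed.

Let f_unif (e : R) : 0 < e -> exists N, forall s, rnorm (f s - fN N s) <= e.
Proof.
move=> e0; have [N NP] := fN_cauchy e0; exists N => s.
have /cvg_rnormP h := @f_cvg s.
apply/ler_addgt0Pr => d d0.
have /cvgrPdist_lt/(_ _ d0)[M _ MP] := h.
have := MP (maxn N M) (leq_maxr _ _); rewrite sub0r normrN ger0_norm ?rnorm_ge0// => h1.
rewrite -[f s](subrK (fN (maxn N M) s)) -addrA; apply: (le_trans (ler_rnormD _ _)).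
rewrite [leLHS]addrC; apply: lerD; first by apply/ltW/NP => //; exact: leq_maxl.
by rewrite rnorm_distC ltW.
Qed.

Let osc_lip k s s' : `|s' - s| <= 1 -> rnorm (osc k s' - osc k s) <=
  (om k + 4 * om k ^+ 2 * expR (om k)) * `|s' - s|.
Proof.
move=> ss; set h := s' - s; set w := ('i * (om k)%:C) * h%:C.
have o0 : 0 <= om k by rewrite ltW// lam_gt0.
have wE : rnorm w = om k * `|h|.
  rewrite /w !rnormM !rnorm_real (ger0_norm o0) (_ : rnorm 'i%C = 1) ?mul1r//.
  by rewrite rnormc/= expr0n add0r expr1n sqrtr1.
have -> : osc k s' - osc k s = osc k s * (w + (cexp w - 1 - w)).
  rewrite (_ : osc k s' = osc k s * cexp w); first by ring.
  by rewrite -cexpD -mulrDr -rmorphD/= addrC subrK.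
rewrite rnormM rnorm_osc mul1r; apply: (le_trans (rnormD _ _)).
rewrite [leRHS]mulrDl; apply: lerD; first by rewrite wE.
apply: (le_trans (cexp_taylor _)); rewrite wE.
have -> : 4 * (om k * `|h|) ^+ 2 * expR (om k * `|h|) =
  4 * om k ^+ 2 * (`|h| * expR (om k * `|h|)) * `|h| by ring.
rewrite ler_wpM2r// ler_wpM2l ?mulr_ge0 ?exprn_ge0//.
rewrite -[leRHS]mul1r ler_pM ?expR_ge0// ler_expR -[leRHS]mulr1 ler_wpM2l//.
Qed.

Let fN_continuous n (s : R) (e : R) : 0 < e -> \forall s' \near s, rnorm (fN n s' - fN n s) < e.
Proof.
move=> e0; pose L := \sum_(k < n) c k * (om k + 4 * om k ^+ 2 * expR (om k)) * rnorm (chi k).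
have o0 k : 0 <= om k by rewrite ltW// lam_gt0.
have L0 : 0 <= L.
  apply: sumr_ge0 => k _; rewrite !mulr_ge0 ?rnorm_ge0// addr_ge0//.
  by rewrite mulr_ge0 ?expR_ge0// mulr_ge0// exprn_ge0.
near=> s'.
have h1 : `|s' - s| <= 1 by rewrite distrC ltW//; near: s'; exact: cvgr_dist_lt.
have h2 : `|s' - s| < e / (L + 1).
  by rewrite distrC; near: s'; apply: cvgr_dist_lt => //; rewrite divr_gt0// ltr_wpDl.
rewrite /fN -sumrB; apply: (le_lt_trans (rnorm_sum _ _ _)).
apply: (@le_lt_trans _ _ (L * `|s' - s|)).
  rewrite mulr_suml; apply: ler_sum => k _.
  rewrite -scalerBl -mulrBr rnormZ rnormM rnorm_real (ger0_norm (c0 k)).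
  rewrite [leRHS]mulrAC ler_wpM2r ?rnorm_ge0// -[leRHS]mulrA ler_wpM2l//.
  exact: osc_lip.
apply: (@le_lt_trans _ _ ((L + 1) * `|s' - s|)); first by rewrite ler_wpM2r// lerDl.
by rewrite mulrC -ltr_pdivlMr// ltr_wpDl.
Unshelve. all: by end_near. Qed.

Let f_continuous (s : R) : {for s, continuous f}.
Proof.
apply/cvg_rnormP/cvgrPdist_lt => e e0.
have e3 : 0 < e / 3 by rewrite divr_gt0.
have [N NP] := f_unif e3.
have := fN_continuous N s e3; apply: filterS => s' hs.
rewrite sub0r normrN ger0_norm ?rnorm_ge0//.
have -> : f s' - f s = (f s' - fN N s') + (fN N s' - fN N s) + (fN N s - f s).
  by rewrite !addrA !subrK.
apply: (le_lt_trans (ler_rnormD _ _)).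
have := ler_rnormD (f s' - fN N s') (fN N s' - fN N s).
have := NP s'; have := NP s; rewrite [rnorm (f s - _)]rnorm_distC; lra.
Qed.

Let f_bounded : exists2 M : R, 0 <= M & forall s, rnorm (f s) <= M.
Proof.
have [N NP] := f_unif ltr01.
have M0 : 0 <= \sum_(k < N) c k * rnorm (chi k).
  by apply: sumr_ge0 => k _; rewrite mulr_ge0 ?rnorm_ge0.
exists (1 + \sum_(k < N) c k * rnorm (chi k)); first by rewrite addr_ge0.
move=> s; rewrite -[f s](subrK (fN N s)); apply: (le_trans (ler_rnormD _ _)).
apply: lerD => //; apply: (le_trans (rnorm_sum _ _ _)); apply: ler_sum => k _.
by rewrite rnormZ rnormM rnorm_osc mulr1 rnorm_real (ger0_norm (c0 k)).
Qed.

Let f_P j s : P j (f s) = ((c j./2)%:C * osc j./2 s) *: P j (chi j./2).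
Proof.
have h : P j (fN n s) @[n --> \oo] --> P j (f s) by exact: (dec_P_cvg dP).
apply: (cvg_uniqueX h); apply: cvg_near_cst; exists (j./2).+1 => // n /= jn.
rewrite /fN (dec_Psum dP j n (fun k => ((c k)%:C * osc k s) *: chi k)).
rewrite (bigD1 (Ordinal jn))//= (dec_PZ dP) big1 ?addr0// => i ij.
rewrite (dec_PZ dP) chiP ?scaler0// eq_sym; apply: contra ij => /eqP ij.
by apply/eqP; apply: val_inj.
Qed.

Variables (q tau : R).
Hypotheses (q1 : 1 < q) (tau0 : 0 < tau).

Let f_sm : strongly_measurable mu `]0, tau[ f.
Proof. by apply: sm_continuous => // t _; exact: f_continuous. Qed.

Let f_pow (r : R) : 0 <= r -> (\int[mu]_(s in `]0%R, tau[) (rnorm (f s) `^ r)%:E < +oo)%E.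
Proof.
move=> r0; have [M M0 fM] := f_bounded.
apply: (@le_lt_trans _ _ (\int[mu]_(s in `]0%R, tau[) (M `^ r)%:E)%E).
  apply: le_L1; [by move=> s; exact: powR_ge0|by move=> s; exact: powR_ge0|].
  apply: aeW => s _; apply: ge0_ler_powR => //; rewrite nnegrE ?rnorm_ge0//.
rewrite (integral_cst mu (measurable_itv _)) lte_mul_pinfty// ?lee_fin ?powR_ge0//.
exact: itv0_fin.
Qed.

Let f_LqX : LqX mu `]0, tau[ q f.
Proof. by split => //; apply: f_pow; rewrite ltW// (lt_trans ltr01). Qed.

Let f_L1 : (\int[mu]_(s in `]0%R, tau[) (rnorm (f s))%:E < +oo)%E.
Proof.
apply: le_lt_trans (f_pow ler01); apply: le_L1.
- by move=> s; exact: rnorm_ge0.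
- by move=> s; exact: powR_ge0.
by apply: aeW => s _; rewrite powRr1// rnorm_ge0.
Qed.

Local Notation u := (mild_solution sgR f).

Let al j : R[i] := lam R j +i* om j./2.

(** The mode solves a scalar equation with forcing of frequency [om j./2]; the integral of exp((lam
    + i om) s) produces the factor 1 / [al j]. *)
Let u_P j (t : R) : 0 < t < tau -> (lam R j)%:C *: P j (u t) =
  ((c j./2)%:C * ((lam R j)%:C / al j * (osc j./2 t - (expR (- (lam R j * t)))%:C))) *:
    P j (chi j./2).
Proof.
move=> tt; have t0 : 0 < t by case/andP: tt.
have h1 := mild_P cX dP C0 f_sm f_L1 j tt.
have al0 : al j != 0 by rewrite eq_complex/= negb_and gt_eqF// lam_gt0.
pose E : R[i] := (expR (- (lam R j * t)))%:C.
have h2 := has_bochnerZ (mu := mu) (measurable_itv _) (itv0_fin t) (E * (c j./2)%:C)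
   (has_bochner_cexp (P j (chi j./2)) t0 al0).
have h3 : has_bochner_integral mu `]0, t[ (fun s => msg (t - s)%:C j *: P j (f s))
   ((E * (c j./2)%:C) *: ((al j)^-1 * (cexp (al j * t%:C) - 1) *: P j (chi j./2))).
  apply: has_bochner_ae h2 _; apply: aeW => s _.
  rewrite f_P !scalerA; congr (_ *: _).
  have -> : msg (t - s)%:C j * ((c j./2)%:C * osc j./2 s) =
    (c j./2)%:C * (msg (t - s)%:C j * osc j./2 s) by ring.
  have -> : E * (c j./2)%:C * cexp (al j * s%:C) = (c j./2)%:C * (E * cexp (al j * s%:C)) by ring.
  congr (_ * _); rewrite /E -[(expR _)%:C]/(expR (- (lam R j * t)) +i* 0).
  have -> : expR (- (lam R j * t)) +i* 0 = cexp (- (lam R j * t))%:C.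
    by rewrite /cexp/= cos0 sin0 mulr1 mulr0.
  rewrite /msg /osc -!cexpD; congr cexp.
  by apply/eqP; rewrite eq_complex/=; apply/andP; split; apply/eqP; ring.
have -> := has_bochner_unique (mu := mu) (measurable_itv _) (itv0_fin t) h1 h3.
rewrite !scalerA; congr (_ *: _).
have -> : osc j./2 t = E * cexp (al j * t%:C).
  have -> : E = cexp (- (lam R j * t))%:C by rewrite /E /cexp/= cos0 sin0 mulr1 mulr0.
  rewrite -cexpD /osc; congr cexp.
  by apply/eqP; rewrite eq_complex/=; apply/andP; split; apply/eqP; ring.
rewrite -/E; ring.
Qed.

(** Response of the [j]-th mode of A u to a unit amplitude: the stationary oscillation minus the
    decaying transient. *)
Let kap j t : R[i] := (lam R j)%:C / al j * (osc j./2 t - (expR (- (lam R j * t)))%:C).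

(** Both modes of the pair [k] are driven at frequency 4^k. For the even one the decay rate equals
    this frequency, for the odd one it is twice as large, so the factors are 1 / (1 + i) and 2 / (2
    + i), whatever [k]. *)
Let al_even k : (lam R k.*2)%:C / al k.*2 = 2^-1 +i* (- 2^-1).
Proof.
have l0 := lt0r_neq0 (lam_gt0 R k.*2).
have al0 : al k.*2 != 0 by rewrite eq_complex/= negb_and l0.
apply: (mulIf al0); rewrite divfK// /al doubleK /om.
by apply/eqP; rewrite eq_complex/=; apply/andP; split; apply/eqP; field.
Qed.

Let al_odd k : (lam R k.*2.+1)%:C / al k.*2.+1 = (4 / 5) +i* (- (2 / 5)).
Proof.
have l0 := lt0r_neq0 (lam_gt0 R k.*2.+1).
have al0 : al k.*2.+1 != 0 by rewrite eq_complex/= negb_and l0.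
apply: (mulIf al0); rewrite divfK// /al halfS /om lamS.
by apply/eqP; rewrite eq_complex/=; apply/andP; split; apply/eqP; field.
Qed.

(** The real parts 1/2 and 4/5 of the two factors differ by 3/10, and each transient takes away at
    most 1/10. *)
Let kap_lower k (t : R) : 0 < t -> expR (- (om k * t)) <= 10^-1 ->
  10^-1 <= rnorm (kap k.*2 t - kap k.*2.+1 t).
Proof.
move=> t0 small; rewrite /kap al_even al_odd doubleK halfS.
set o := osc k t; set a := 2^-1 +i* _; set b := (4/5) +i* _.
set x := (expR (- (lam R k.*2 * t)))%:C; set y := (expR _)%:C.
have -> : a * (o - x) - b * (o - y) = (a - b) * o - (a * x - b * y) by ring.
have xs : rnorm x <= 10^-1 by rewrite rnorm_real ger0_norm ?expR_ge0.
have ys : rnorm y <= 10^-1.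
  rewrite rnorm_real ger0_norm ?expR_ge0//; apply: le_trans small.
  rewrite ler_expR lerN2 ler_wpM2r ?(ltW t0)// lamS ler_peMl ?ler1n//.
  by rewrite ltW// lam_gt0.
have ab : 3 / 10 <= rnorm ((a - b) * o).
  rewrite rnormM rnorm_osc mulr1; apply: le_trans (normRe_le _); rewrite /a /b /=.
  by rewrite ler0_norm; lra.
have a1 : rnorm a <= 1.
  apply: (le_trans (rnormc_le _)); rewrite /a/= normrN ger0_norm ?invr_ge0//; lra.
have b1 : rnorm b <= 1.
  rewrite rnormc -sqrtr1 ler_sqrt// /b/=; lra.
have h1 := ler_rnorm_dist ((a - b) * o) (a * x - b * y).
have h2 := ler_rnormB (a * x) (b * y).
have h3 : rnorm (a * x) <= 10^-1.
  by rewrite rnormM -[leRHS]mul1r ler_pM ?rnorm_ge0.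
have h4 : rnorm (b * y) <= 10^-1.
  by rewrite rnormM -[leRHS]mul1r ler_pM ?rnorm_ge0.
have h5 := ler_norm (rnorm ((a - b) * o) - rnorm (a * x - b * y)).
lra.
Qed.

(** If A u(t) existed, its coordinate [eta k] would be c k / 2 times the difference of the two
    responses, because [eta k] takes the values 1/2 and - 1/2 on the two halves of [chi k]. For
    large [k] this is at least c k / 20, which is not in l^sigma. *)
Let u_notin_dom (t : R) : 0 < t < tau -> ~ dom_A sgR (u t).
Proof.
move=> tt du; have t0 : 0 < t by case/andP: tt.
set y := A_of sgR (u t).
have yP j : P j y = ((c j./2)%:C * kap j t) *: P j (chi j./2).
  by rewrite (dom_A_P cX dP C0)// u_P.
have etay k : rnorm (eta k y) = c k * (2^-1 * rnorm (kap k.*2 t - kap k.*2.+1 t)).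
  rewrite etaP !yP doubleK halfS !etaZ eta_even eta_odd.
  have -> : (c k)%:C * kap k.*2 t / 2 + (c k)%:C * kap k.*2.+1 t * - 2^-1 =
     (c k)%:C * (2^-1 * (kap k.*2 t - kap k.*2.+1 t)) by ring.
  by rewrite !rnormM rnorm_real (ger0_norm (c0 k)) rnormcV -[2]/(2%:R) -(rmorph_nat (@real_complex R)) rnorm_real ger0_norm.
have [B hB] := eta_up y.
have small : exists k0 : nat, forall k, (k0 <= k)%N -> expR (- (om k * t)) <= 10^-1.
  (* From here on om k * t >= k * t >= 10, and exp(-10) <= 1/11 < 1/10. *)
  exists (Num.truncn (10 / t)).+1 => k kk.
  have h : 10 <= om k * t.
    rewrite -ler_pdivrMr//; apply: (@le_trans _ _ k%:R).
      have p0 : 0 <= 10 / t by apply: divr_ge0 => //; exact: ltW.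
      have /andP[_ h] := truncn_itv p0.
      by apply: (le_trans (ltW h)); rewrite ler_nat.
    rewrite /om /lam -natrX ler_nat (leq_trans (ltnW (ltn_expl k (ltnSn 1))))//.
    by rewrite leq_exp2l// -addnn leq_addr.
  rewrite expRN lef_pV2 ?posrE ?expR_gt0//; apply: (le_trans h).
  by apply: le_trans (expR_ge1Dx _); rewrite lerDr.
have [k0 hk0] := small.
pose A := \sum_(k < k0) c k `^ sigma.
(* [A] pays for the finitely many indices with a large transient; 20 is the factor 2 from [eta]
   times the 10 from [kap_lower]. *)
have [n hn] := c_sigma (A + B * 20 `^ sigma).
suff : \sum_(k < n) c k `^ sigma <= A + B * 20 `^ sigma by rewrite leNgt hn.
apply: (@le_trans _ _ (A + \sum_(k < n) (rnorm (eta k y) * 20) `^ sigma)); last first.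
  rewrite lerD2l; under eq_bigr do rewrite powRM ?rnorm_ge0//.
  by rewrite -mulr_suml ler_wpM2r ?powR_ge0.
have main k : (k0 <= k)%N -> c k `^ sigma <= (rnorm (eta k y) * 20) `^ sigma.
  move=> kk; apply: ge0_ler_powR; rewrite ?nnegrE ?mulr_ge0 ?rnorm_ge0 ?(ltW sigma0)//.
  rewrite etay -!mulrA ler_peMr//.
  have := kap_lower t0 (hk0 _ kk); lra.
rewrite /A -!(big_mkord xpredT (fun k => c k `^ sigma)).
rewrite -(big_mkord xpredT (fun k => (rnorm (eta k y) * 20) `^ sigma)).
have s0 k : 0 <= c k `^ sigma by exact: powR_ge0.
have s1 k : 0 <= (rnorm (eta k y) * 20) `^ sigma by exact: powR_ge0.
have [nk|kn] := leqP n k0.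
  rewrite [in leRHS](big_cat_nat (leq0n n) nk)/= -addrA lerDl addr_ge0// sumr_ge0//.
rewrite [in leLHS](big_cat_nat (leq0n k0) (ltnW kn))/= lerD2l.
rewrite [in leRHS](big_cat_nat (leq0n k0) (ltnW kn))/=.
rewrite (le_trans (y := \sum_(k0 <= k < n) (rnorm (eta k y) * 20) `^ sigma))//.
  by rewrite !big_nat; apply: ler_sum => k /andP[kk _]; exact: main.
by rewrite lerDr sumr_ge0.
Qed.

(** It is the requirement that u(t) be in the domain for almost every [t] that fails: the
    exceptional null set would contain the whole interval. *)
Lemma not_maximal_regularity_at :
  ~ (forall g, LqX mu `]0, tau[ q g -> W1q 0 tau q (mild_solution sgR g) /\
     LqX_in mu `]0, tau[ (dom_A sgR) (graph_norm sgR) q (mild_solution sgR g)).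
Proof.
move=> /(_ f f_LqX)[_ [/strongly_measurable_inP[s [_ [N [mN N0 hN]]]] _]].
have sub : `]0, tau[ `<=` N.
  move=> t /= tt; apply: hN => /= h; rewrite in_itv/= in tt.
  by have [+ _] := h tt; exact: u_notin_dom.
have : (mu `]0%R, tau[ <= mu N)%E by apply: le_measure; rewrite ?inE.
rewrite [X in (_ <= X)%E]N0 lebesgue_measure_itv/= lte_fin tau0 oppr0 adde0.
by rewrite lee_fin leNgt tau0.
Qed.

End failure.

(** * Maximal regularity for orthogonal decompositions *)

Section hilbert.
Context (R : realType) (X : normedModType R[i]).
Variables (P : nat -> X -> X) (C : R).
Hypothesis (cX : seq_complete X) (dP : decomposition P C) (C0 : 0 <= C).
Hypothesis pyth : forall n x, rnorm (psum P n x) ^+ 2 = \sum_(j < n) rnorm (P j x) ^+ 2.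
Local Notation psum := (psum P).
Local Notation sgR := (fun t : R => sg P t%:C).
Implicit Types (x y : X).

Lemma psum_le n x : rnorm (psum n x) <= rnorm x.
Proof.
apply/ler_addgt0Pr => e e0.
have /cvg_rnormP/cvgrPdist_lt/(_ _ e0)[N _ NP] := @dec_cvg _ _ _ _ dP x.
have := NP (maxn n N) (leq_maxr _ _); rewrite sub0r normrN ger0_norm ?rnorm_ge0// => h.
apply: (@le_trans _ _ (rnorm (psum (maxn n N) x))).
  rewrite -ler_sqr ?nnegrE ?rnorm_ge0// !pyth.
  rewrite -!(big_mkord xpredT (fun j => rnorm (P j x) ^+ 2)).
  rewrite [leRHS](big_cat_nat (leq0n n) (leq_maxl n N))/= lerDl.
  by apply: sumr_ge0 => j _; exact: exprn_ge0 (rnorm_ge0 _).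
rewrite -[psum _ x](subrK x) addrC; apply: (le_trans (ler_rnormD _ _)).
by rewrite lerD2l ltW.
Qed.

Lemma bessel n x : \sum_(j < n) rnorm (P j x) ^+ 2 <= rnorm x ^+ 2.
Proof. by rewrite -pyth ler_sqr ?nnegrE ?rnorm_ge0// psum_le. Qed.

Lemma rnorm_sqr_le x (B : R) : (forall n, \sum_(j < n) rnorm (P j x) ^+ 2 <= B) ->
  rnorm x ^+ 2 <= B.
Proof.
move=> h; have B0 : 0 <= B by have := h 0; rewrite big_ord0.
rewrite -[B]sqr_sqrtr// ler_sqr ?nnegrE ?rnorm_ge0 ?sqrtr_ge0//.
apply: (rnorm_le_psum dP) => n.
rewrite -(@ler_sqr _ (rnorm _)) ?nnegrE ?rnorm_ge0 ?sqrtr_ge0// sqr_sqrtr// pyth.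
exact: h.
Qed.

(** Under the Pythagorean identity the supremum of the symbol takes over the role of its
    variation. *)
Lemma multiplies_contr m x y (r : R) : 0 <= r -> multiplies P m x y ->
  (forall j, rnorm (m j) <= r) -> rnorm y <= r * rnorm x.
Proof.
move=> r0 mxy mr; rewrite -ler_sqr ?nnegrE ?rnorm_ge0 ?mulr_ge0 ?rnorm_ge0//.
apply: rnorm_sqr_le => n; rewrite exprMn.
apply: (@le_trans _ _ (r ^+ 2 * \sum_(j < n) rnorm (P j x) ^+ 2)); last first.
  by rewrite ler_wpM2l ?exprn_ge0// bessel.
rewrite mulr_sumr; apply: ler_sum => j _; rewrite mxy rnormZ exprMn.
by rewrite ler_wpM2r ?exprn_ge0 ?rnorm_ge0// ler_sqr ?nnegrE ?rnorm_ge0.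
Qed.

Lemma rnorm_sum_P (a : nat -> R[i]) x (m n : nat) : (m <= n)%N ->
  rnorm (\sum_(m <= j < n) a j *: P j x) ^+ 2 =
  \sum_(m <= j < n) rnorm (a j *: P j x) ^+ 2.
Proof.
move=> mn; set z := \sum_(m <= j < n) _.
have zE : z = \sum_(j < n) (if (m <= j)%N then a j else 0) *: P j x.
  rewrite -(big_mkord xpredT (fun j => (if (m <= j)%N then a j else 0) *: P j x)).
  rewrite (big_cat_nat (leq0n m) mn)/= big1_seq ?add0r; last first.
    by move=> j; rewrite mem_index_iota => /andP[_ /andP[_ jm]]; rewrite leqNgt jm scale0r.
  by apply: eq_big_nat => j /andP[-> _].
have Pz j : P j z = if (m <= j < n)%N then a j *: P j x else 0.
  rewrite zE (dec_Psum dP j n (fun i => (if (m <= i)%N then a i else 0) *: P i x)).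
  have [jn|nj] := ltnP j n.
    rewrite (bigD1 (Ordinal jn))//= (dec_PZ dP) (dec_orth dP) eqxx big1 ?addr0.
      by rewrite andbT; case: ifP => //; rewrite scale0r.
    move=> i ij; rewrite (dec_PZ dP) (dec_orth dP) (_ : (j == i) = false) ?scaler0//.
    by apply/negbTE; apply: contra ij => /eqP ij; apply/eqP/val_inj.
  rewrite andbF big1// => i _.
  rewrite (dec_PZ dP) (dec_orth dP) (_ : (j == i) = false) ?scaler0//.
  by apply/negbTE/eqP => ij; have := ltn_ord i; rewrite -ij ltnNge nj.
have -> : z = psum n z.
  apply: (dec_sep dP) => j; rewrite (dec_P_psum dP) Pz.
  by case: (ltnP j n) => //; rewrite andbF.
rewrite pyth -(big_mkord xpredT (fun j => rnorm (P j z) ^+ 2)).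
rewrite (big_cat_nat (leq0n m) mn)/= big1_seq ?add0r; last first.
  move=> j; rewrite mem_index_iota => /andP[_ /andP[_ jm]].
  by rewrite Pz leqNgt jm/= rnorm0 expr0n.
by apply: eq_big_nat => j jmn; rewrite Pz jmn.
Qed.

(** Square summability of the scaled modes makes the partial sums Cauchy, since the norm of each
    block is the root of its sum of squares. *)
Lemma multiplies_l2 (a : nat -> R[i]) x (B : R) :
  (forall n, \sum_(j < n) rnorm (a j *: P j x) ^+ 2 <= B) ->
  exists2 y, multiplies P a x y & rnorm y ^+ 2 <= B.
Proof.
move=> aB; have [y yx] : exists y : X, (\sum_(j < n) P j (a j *: x)) @[n --> \oo] --> y.
  apply: cX => e e0; have e2 : 0 < e ^+ 2 by rewrite exprn_gt0.
  have [N NP] := sum_cauchy (fun j => sqr_ge0 (rnorm (a j *: P j x))) aB e2.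
  exists N.
  have h (m n : nat) : (N <= m)%N -> (m <= n)%N ->
     rnorm (\sum_(j < n) P j (a j *: x) - \sum_(j < m) P j (a j *: x)) < e.
    move=> Nm mn; rewrite -!(big_mkord xpredT (fun j => P j (a j *: x))).
    rewrite (big_cat_nat (leq0n m) mn)/= addrAC subrr add0r.
    rewrite (eq_bigr (fun j => a j *: P j x)); last by move=> j _; rewrite (dec_PZ dP).
    rewrite -ltr_sqr ?nnegrE ?rnorm_ge0 ?(ltW e0)// rnorm_sum_P//.
    exact: NP.
  move=> m n Nm Nn; have [mn|/ltnW nm] := leqP m n; last exact: h.
  by rewrite rnorm_distC; exact: h.
have my : multiplies P a x y.
  by move=> j; rewrite (@P_series _ _ _ _ dP (fun j => a j *: x) y yx) (dec_PZ dP).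
exists y => //; apply: rnorm_sqr_le => n.
by under eq_bigr do rewrite my.
Qed.

Definition lamC (j : nat) : R[i] := (lam R j)%:C.

(** The difference quotient plus [y] is the image of [y] under the symbol [th]. Modes below [N] are
    small because th j <= h * lam j, the others because th j <= 1 and the tail of [y] is small. *)
Lemma multiplies_domA x y : multiplies P lamC x y ->
  dom_A sgR x /\ A_of sgR x = y.
Proof.
move=> my.
suff h : diff_quotient sgR x h @[h --> 0^'+] --> - y.
  split; first by apply/cvg_ex; exists (- y).
  by rewrite /A_of (norm_cvg_lim h) opprK.
apply/cvg_rnormP/cvgrPdist_lt => e e0.
have e2 : 0 < e / 2 by rewrite divr_gt0.
have /cvg_rnormP/cvgrPdist_lt/(_ _ e2)[N _ NP] := @dec_cvg _ _ _ _ dP y.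
have := NP N (leqnn N); rewrite sub0r normrN ger0_norm ?rnorm_ge0// => hN.
near=> h; rewrite sub0r normrN ger0_norm ?rnorm_ge0// opprK.
have h0 : 0 < h by near: h; exact: nbhs_right_gt.
have hs : h < e / 2 / (lam R N * rnorm y + 1).
  near: h; apply: nbhs_right_lt; rewrite divr_gt0// ltr_wpDl//.
  by rewrite mulr_ge0 ?rnorm_ge0// ltW// lam_gt0.
(* With r = h * lam j this is 1 - (1 - exp(-r)) / r. *)
pose th j := 1 - (h * lam R j)^-1 * (1 - expR (- (h * lam R j))).
have thP j : 0 <= th j <= 1 /\ th j <= h * lam R j.
  have r0 : 0 < h * lam R j by rewrite mulr_gt0// lam_gt0.
  set r := h * lam R j in r0 *; have /andP[b1 b2] := expRB1_bounds (- r).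
  have b3 : expR (- r) <= 1 by rewrite expR_le1 oppr_le0 ltW.
  rewrite /th -/r; split.
    rewrite subr_ge0 ler_pdivrMl// mulr1; apply/andP; split; first by move: b1; lra.
    by rewrite gerBl mulr_ge0 ?invr_ge0 ?(ltW r0)// subr_ge0.
  rewrite lerBlDr -lerBlDl ler_pdivlMl//.
  have h1 : (r - 1) * r <= 0 \/ 0 <= (r - 1) * r by case: (lerP ((r-1)*r) 0) => [|/ltW]; [left|right].
  have k1 : r * expR (- r) <= r by rewrite -[leRHS]mulr1 ler_wpM2l// ltW.
  have k2 : r * (1 - r) <= r * expR (- r) by rewrite ler_wpM2l ?(ltW r0)//; move: b1; lra.
  by move: b2; rewrite mulrBr mulr1; lra.
set w := diff_quotient sgR x h + y.
have wP : multiplies P (fun j => (th j)%:C) y w.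
  move=> j; rewrite /w (dec_PD dP) /diff_quotient (dec_PZ dP) (dec_PB dP).
  rewrite (sgP cX dP C0 x (adm_real (ltW h0)) j) my.
  have mE : msg h%:C j = (expR (- (h * lam R j)))%:C.
    by rewrite /msg /cexp -rmorphM/= oppr0 cos0 sin0 mulr1 mulr0.
  rewrite mE /lamC.
  have -> : (expR (- (h * lam R j)))%:C *: P j x - P j x =
     ((expR (- (h * lam R j)))%:C - 1) *: P j x by rewrite scalerBl scale1r.
  rewrite !scalerA -scalerDl; congr (_ *: _).
  rewrite -[1 in LHS]/(1%:C) -rmorphB/= -!rmorphM/= -rmorphD/=; congr (_%:C).
  rewrite /th; field; rewrite !gt_eqF//=; exact: lam_gt0.
pose w1 := \sum_(j < N) (th j)%:C *: P j y.
have w1P j : P j w1 = if (j < N)%N then (th j)%:C *: P j y else 0.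
  have := rnorm_sum_P; rewrite /w1 (dec_Psum dP j N (fun i => (th i)%:C *: P i y)).
  have [jn|nj] := ltnP j N => _.
    rewrite (bigD1 (Ordinal jn))//= (dec_PZ dP) (dec_orth dP) eqxx big1 ?addr0// => i ij.
    rewrite (dec_PZ dP) (dec_orth dP) ifN ?scaler0//.
    by apply: contra ij => /eqP ij; apply/eqP/val_inj.
  rewrite big1// => i _; rewrite (dec_PZ dP) (dec_orth dP) ifN ?scaler0//.
  by apply/eqP => ij; have := ltn_ord i; rewrite -ij ltnNge nj.
have n1 : rnorm w1 <= h * lam R N * rnorm y.
  apply: (@multiplies_contr (fun j => if (j < N)%N then (th j)%:C else 0)).
  - by rewrite mulr_ge0 ?(ltW h0)// ltW// lam_gt0.
  - by move=> j; rewrite w1P; case: ifP => //; rewrite scale0r.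
  - move=> j; have [[/andP[t0 _]] t2] := thP j; case: ifP => jN; last first.
      by rewrite rnorm0 mulr_ge0 ?(ltW h0)// ltW// lam_gt0.
    rewrite rnorm_real ger0_norm// (le_trans t2)// ler_wpM2l ?(ltW h0)//.
    by rewrite /lam ler_weXn2l ?ler1n// ltnW.
have n2 : rnorm (w - w1) <= rnorm (y - psum N y).
  rewrite -[leRHS]mul1r.
  apply: (@multiplies_contr (fun j => (th j)%:C)) => //.
    move=> j; rewrite !(dec_PB dP) wP w1P (dec_P_psum dP).
    by case: ifP => _; rewrite ?subrr ?scaler0// subr0 subr0.
  by move=> j; have [/andP[t0 t1] _] := thP j; rewrite rnorm_real ger0_norm.
rewrite -[w](subrK w1) addrC; apply: (le_lt_trans (ler_rnormD _ _)).
rewrite [e]splitr; apply: ltr_leD; last by apply: (le_trans n2); rewrite rnorm_distC ltW.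
apply: (le_lt_trans n1); rewrite -mulrA.
apply: (@le_lt_trans _ _ (h * (lam R N * rnorm y + 1))).
  by rewrite ler_wpM2l ?(ltW h0)// lerDl.
rewrite -ltr_pdivlMr// ltr_wpDl// mulr_ge0 ?rnorm_ge0// ltW// lam_gt0//.
Unshelve. all: by end_near. Qed.

End hilbert.

(** * Young's inequality for the kernels l exp(- l t) *)

Section young.
Context (R : realType).
Local Notation mu := (@lebesgue_measure R).
Let leb := [the {sigma_finite_measure set (measurableTypeR R) -> \bar R} of mu].

Lemma integral_expR (m c a b : R) : a < b ->
  (\int[mu]_(x in `]a, b[) (m * expR (m * x + c))%:E =
   (expR (m * b + c) - expR (m * a + c))%:E)%E.
Proof.
move=> ab; pose F x : R := expR (m * x + c).
have dF (x : R) : is_derive x (1 : R) F (m * expR (m * x + c)).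
  have d1 : is_derive x (1 : R) (fun x : R => m * x + c) m.
    by apply: is_derive_eq; rewrite addr0 /GRing.scale/= mulr1 ?mulr0 ?addr0.
  by have := @is_derive1_comp _ _ _ _ _ _ (is_derive_expR _) d1; rewrite mulrC.
have cf : continuous (fun x : R => m * expR (m * x + c)).
  move=> x; apply: cvgMr; apply: continuous_comp; last exact: continuous_expR.
  by apply: cvgD; [apply: cvgMr; exact: cvg_id|exact: cvg_cst].
have cF : continuous F.
  by move=> x; apply: differentiable_continuous; apply/derivable1_diffP; case: (dF x).
rewrite (_ : (expR (m * b + c) - expR (m * a + c))%:E = ((F b)%:E - (F a)%:E)%E)//.
rewrite -(@continuous_FTC2 _ (fun x => m * expR (m * x + c)) F)//.
- apply/esym/integral_itv_bndoo; apply/measurable_EFinP.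
  by apply: measurable_funTS; apply: continuous_measurable_fun; exact: cf.
- exact: continuous_subspaceT.
- split.
  + by move=> x _; case: (dF x).
  + by apply: cvg_at_right_filter; exact: cF.
  + by apply: cvg_at_left_filter; exact: cF.
- by move=> x _; rewrite derive1E; exact: derive_val.
Qed.

Variables (l tau : R) (g : R -> R).
Hypotheses (l0 : 0 < l) (mg : measurable_fun setT g) (g0 : forall s, 0 <= g s).

Let A : set (R * R) := [set z | 0 < z.2] `&` [set z | z.2 < z.1] `&` [set z | z.1 < tau].

(** Here [z] is the pair (t, s). The extension by zero outside the triangle 0 < s < t < tau lets
    Tonelli's theorem act on the whole plane. *)
Definition young_kernel (z : R * R) : \bar R :=
  (l * expR (- (l * (z.1 - z.2))) * g z.2 ^+ 2 * \1_A z)%:E.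

Let mA : measurable A.
Proof.
have lt_meas (u v : R * R -> R) : measurable_fun setT u -> measurable_fun setT v ->
    measurable [set z | u z < v z].
  move=> mu_ mv; have := @measurable_fun_ltr _ _ _ _ _ _ mu_ mv measurableT [set true] I.
  by rewrite setTI.
apply: measurableI; first apply: measurableI; apply: lt_meas => //.
Qed.

Let mk : measurable_fun setT young_kernel.
Proof.
apply/measurable_EFinP; apply: measurable_funM; last exact: measurable_indic.
apply: measurable_funM; last first.
  by apply: measurable_funX; apply: measurableT_comp.
apply: measurable_funM => //; apply: measurableT_comp => //.
apply: measurableT_comp => //; apply: measurable_funM => //.
exact: measurable_funB.
Qed.

Let k0 z : (0 <= young_kernel z)%E.
Proof. by rewrite lee_fin !mulr_ge0 ?expR_ge0 ?exprn_ge0// ltW. Qed.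

Definition young_fun (t : R) : \bar R := (\int[mu]_s young_kernel (t, s))%E.

Lemma young_fun_ge0 t : (0 <= young_fun t)%E.
Proof. by apply: integral_ge0 => s _; exact: k0. Qed.

Lemma measurable_young_fun : measurable_fun setT young_fun.
Proof. exact: (@measurable_fun_fubini_tonelli_F _ _ _ _ R leb young_kernel mk k0). Qed.

(** After exchanging the integrals, the inner one is the mass of l exp(- l (t - s)) in [t], at most
    1 uniformly in [l]. *)
Lemma integral_young_fun : (\int[mu]_t young_fun t <= \int[mu]_s (g s ^+ 2)%:E)%E.
Proof.
rewrite /young_fun (@fubini_tonelli _ _ _ _ R leb leb young_kernel mk k0).
apply: ge0_le_integral => //.
- by move=> s _; apply: integral_ge0 => t _; exact: k0.
- exact: (@measurable_fun_fubini_tonelli_G _ _ _ _ R leb young_kernel mk k0).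
- by apply/measurable_EFinP; exact: measurable_funX.
move=> s _.
have [st|st] := ltP s tau; last first.
  rewrite integral0_eq ?lee_fin ?exprn_ge0// => t _.
  rewrite /young_kernel indicE memNset ?mulr0// => -[[_ /= h1] h2].
  by have := lt_trans h1 h2; rewrite ltNge st.
apply: (@le_trans _ _ (\int[mu]_(t in `]s, tau[) ((g s ^+ 2)%:E * (l * expR (- (l * (t - s))))%:E))%E).
  rewrite [leRHS]integral_mkcond; apply: ae_ge0_le_lower_integral.
  - by move=> t _; exact: k0.
  - move=> t _; rewrite patchE; case: ifP => // _.
    by rewrite mule_ge0 ?lee_fin ?exprn_ge0// mulr_ge0 ?expR_ge0// ltW.
  apply: aeW => t _; rewrite patchE /young_kernel indicE.
  case: (boolP ((t, s) \in A)) => [|_]; last first.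
    rewrite mulr0; case: ifP => // _.
    by rewrite mule_ge0 ?lee_fin ?exprn_ge0// mulr_ge0 ?expR_ge0// ltW.
  rewrite inE => -[[/= s0 st'] tt].
  by rewrite mem_set/= ?in_itv/= ?st' ?tt// mulr1 muleC -EFinM.
rewrite ge0_integralZl_EFin ?exprn_ge0//; last 2 first.
- by move=> t _; rewrite lee_fin mulr_ge0 ?expR_ge0// ltW.
- apply/measurable_EFinP; apply: measurable_funM => //; apply: measurableT_comp => //.
  apply: measurableT_comp => //; apply: measurable_funM => //.
  exact: measurable_funB.
rewrite -[leRHS]mule1 lee_wpmul2l ?lee_fin ?exprn_ge0//.
have h : (\int[mu]_(t in `]s, tau[) ((- l) * expR ((- l) * t + l * s))%:E =
   (expR (- l * tau + l * s) - expR (- l * s + l * s))%:E)%E by exact: integral_expR.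
have e t : expR (- (l * (t - s))) = expR (- l * t + l * s) by congr expR; ring.
under eq_integral do rewrite e.
have : (- (\int[mu]_(t in `]s, tau[) (l * expR (- l * t + l * s))%:E) =
   (expR (- l * tau + l * s) - expR (- l * s + l * s))%:E)%E.
  rewrite -h -integral_ge0N; last first.
    by move=> t _; rewrite lee_fin mulr_ge0 ?expR_ge0// ltW.
  by apply: eq_integral => t _; rewrite -EFinN; congr EFin; ring.
have -> : - l * s + l * s = 0 by ring.
rewrite expR0 => /eqP; rewrite eqe_oppLR => /eqP ->.
by rewrite -EFinN lee_fin opprB gerBl expR_ge0.
Qed.

(** Cauchy-Schwarz for a kernel k of mass at most 1, by the weighted inequality k g <= th k g^2 + k
    / (4 th). Integration gives w <= th V + 1 / (4 th), and th = 1 / (2 w) turns this into w^2 <=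
    V. *)
Lemma young_pointwise (t w : R) : 0 < t < tau -> 0 <= w ->
  (w%:E <= \int[mu]_(s in `]0%R, t[) (l * expR (- (l * (t - s))) * g s)%:E)%E ->
  ((w ^+ 2)%:E <= young_fun t)%E.
Proof.
move=> /andP[t0 tt] w0 hw; pose k s := l * expR (- (l * (t - s))).
have k_ge0 s : 0 <= k s by rewrite mulr_ge0 ?expR_ge0// ltW.
have mk' : measurable_fun setT k.
  apply: measurable_funM => //; apply: measurableT_comp => //.
  by apply: measurableT_comp => //; apply: measurable_funM => //; exact: measurable_funB.
have VE : young_fun t = (\int[mu]_(s in `]0%R, t[) (k s * g s ^+ 2)%:E)%E.
  rewrite /young_fun [RHS]integral_mkcond; apply: eq_integral => s _.
  rewrite patchE /young_kernel indicE /=; case: ifPn => [|st].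
    rewrite inE/= in_itv/= => /andP[s0 st].
    by rewrite mem_set ?mulr1//; split.
  rewrite memNset ?mulr0// => -[[/= s0 s1] _]; move/negP: st; apply.
  by rewrite inE/= in_itv/= s0 s1.
have k_int : (\int[mu]_(s in `]0%R, t[) (k s)%:E <= 1)%E.
  have h := integral_expR l (- (l * t)) t0.
  rewrite (_ : (\int[mu]_(s in `]0%R, t[) (k s)%:E = \int[mu]_(s in `]0%R, t[) (l * expR (l * s + - (l * t)))%:E)%E).
    by rewrite h lee_fin subrr expR0 gerBl expR_ge0.
  by apply: eq_integral => s _; congr (_ * expR _)%:E; ring.
rewrite VE; set V := (\int[mu]_(s in _) _)%E.
have V0 : (0 <= V)%E.
  by apply: integral_ge0 => s _; rewrite lee_fin mulr_ge0 ?exprn_ge0.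
have key (th : R) : 0 < th -> (w%:E <= th%:E * V + ((4 * th)^-1)%:E)%E.
  move=> th0; apply: (le_trans hw).
  apply: (@le_trans _ _ (\int[mu]_(s in `]0%R, t[) (th%:E * (k s * g s ^+ 2)%:E + ((4 * th)^-1)%:E * (k s)%:E))%E).
    apply: ae_ge0_le_lower_integral.
    - by move=> s _; rewrite lee_fin -/(k s) mulr_ge0.
    - move=> s _; rewrite adde_ge0// -EFinM lee_fin mulr_ge0 ?(ltW th0)//.
        by rewrite mulr_ge0 ?exprn_ge0.
      by rewrite invr_ge0 mulr_ge0// ltW.
    apply: aeW => s _; rewrite -!EFinM -EFinD lee_fin -/(k s).
    rewrite -subr_ge0.
    have -> : th * (k s * g s ^+ 2) + (4 * th)^-1 * k s - k s * g s =
      k s * (th * (g s - (2 * th)^-1) ^+ 2) by field; rewrite gt_eqF.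
    by rewrite mulr_ge0// mulr_ge0 ?sqr_ge0// ltW.
  rewrite ge0_integralD//; last 4 first.
  - by move=> s _; rewrite -EFinM lee_fin !mulr_ge0 ?exprn_ge0// ltW.
  - apply: measurable_funTS; apply/measurable_EFinP; apply: measurable_funM => //.
    by apply: measurable_funM => //; exact: measurable_funX.
  - by move=> s _; rewrite -EFinM lee_fin !mulr_ge0 ?invr_ge0 ?mulr_ge0// ltW.
  - by apply: measurable_funTS; apply/measurable_EFinP; apply: measurable_funM.
  rewrite ge0_integralZl_EFin//; last 3 first.
  - by move=> s _; rewrite lee_fin mulr_ge0 ?exprn_ge0.
  - apply: measurable_funTS; apply/measurable_EFinP; apply: measurable_funM => //.
    exact: measurable_funX.
  - exact: ltW.
  apply: leeD => //.
  rewrite ge0_integralZl_EFin//; last 3 first.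
  - by move=> s _; rewrite lee_fin.
  - by apply: measurable_funTS; apply/measurable_EFinP.
  - by rewrite invr_ge0 mulr_ge0// ltW.
  rewrite -[leRHS]mule1 lee_wpmul2l// lee_fin invr_ge0 mulr_ge0// ltW//.
case: V V0 key => [v| |//] V0 key; last by rewrite leey.
have [->|wn0] := eqVneq w 0; first by rewrite expr0n.
have wp : 0 < w by rewrite lt_neqAle eq_sym wn0.
have th0 : 0 < (2 * w)^-1 by rewrite invr_gt0 mulr_gt0.
have := key _ th0; rewrite -EFinM -EFinD !lee_fin => h.
have h2 : w <= (2 * w)^-1 * v + w / 2.
  by apply: (le_trans h); rewrite lerD2l le_eqVlt; apply/orP; left; apply/eqP; field.
have h3 : w / 2 <= (2 * w)^-1 * v by move: h2; lra.
by move: h3; rewrite ler_pdivlMl ?mulr_gt0// => h3; apply: le_trans h3; rewrite le_eqVlt; apply/orP; left; apply/eqP; field.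
Qed.

End young.

(** * The energy estimate for A u *)

Section hilbert_mild.
Context (R : realType) (X : normedModType R[i]).
Variables (P : nat -> X -> X) (C : R).
Hypothesis (cX : seq_complete X) (dP : decomposition P C) (C0 : 0 <= C).
Hypothesis pyth : forall n x, rnorm (psum P n x) ^+ 2 = \sum_(j < n) rnorm (P j x) ^+ 2.
Local Notation psum := (psum P).
Local Notation sgR := (fun t : R => sg P t%:C).
Local Notation mu := (@lebesgue_measure R).
Variables (tau : R) (f : R -> X).
Hypotheses (tau0 : 0 < tau) (Lf : LqX mu `]0, tau[ 2 f).
Local Notation D := (`]0%R, tau[%classic : set R).
Local Notation u := (mild_solution sgR f).

Let f_sm : strongly_measurable mu D f. Proof. by case: Lf. Qed.

Let f_sq : (\int[mu]_(s in D) (rnorm (f s) ^+ 2)%:E < +oo)%E.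
Proof.
case: Lf => _; apply: le_lt_trans; apply: le_L1.
- by move=> s; rewrite exprn_ge0 ?rnorm_ge0.
- by move=> s; exact: powR_ge0.
by apply: aeW => s _; rewrite powR_mulrn ?rnorm_ge0.
Qed.

Lemma f_L1 : (\int[mu]_(s in D) (rnorm (f s))%:E < +oo)%E.
Proof.
have [||g [mg g0 fg]] := @sm_norm _ _ _ _ mu _ _ _ _ f_sm;
  [exact: measurable_itv|exact: itv0_fin|].
apply: (@le_lt_trans _ _ (\int[mu]_(s in D) ((g s ^+ 2)%:E + 1%:E))%E).
  apply: ae_ge0_le_lower_integral.
  - by move=> s _; rewrite lee_fin rnorm_ge0.
  - by move=> s _; rewrite adde_ge0// lee_fin ?exprn_ge0.
  apply: filterS fg => s fs Ds; rewrite fs// -EFinD lee_fin -subr_ge0.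
  have -> : g s ^+ 2 + 1 - g s = (g s - 2^-1) ^+ 2 + 3 / 4 by field.
  by rewrite addr_ge0 ?sqr_ge0.
rewrite ge0_integralD//; last 2 first.
- by move=> s _; rewrite lee_fin exprn_ge0.
- by apply/measurable_EFinP; exact: measurable_funX.
rewrite lte_add_pinfty//.
  apply: le_lt_trans f_sq; apply: le_L1.
  - by move=> s; rewrite exprn_ge0.
  - by move=> s; rewrite exprn_ge0 ?rnorm_ge0.
  by apply: filterS fg => s fs Ds; rewrite fs.
rewrite (integral_cst mu (measurable_itv _)) mul1e.
exact: itv0_fin.
Qed.

Let Pf_sm j : strongly_measurable mu D (P j \o f).
Proof. exact: (sm_linear (dec_linear dP j) (dec_Pbound dP j) f_sm). Qed.

Lemma ex_component_norms : exists g : nat -> R -> R, forall j, [/\ measurable_fun setT (g j),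
  forall s, 0 <= g j s, forall s, ~ D s -> g j s = 0 &
  {ae mu, forall s, D s -> rnorm (P j (f s)) = g j s}].
Proof.
suff h j : exists g : R -> R, [/\ measurable_fun setT g, forall s, 0 <= g s,
  forall s, ~ D s -> g s = 0 & {ae mu, forall s, D s -> rnorm (P j (f s)) = g s}].
  by have [g gP] := choice h; exists g.
have [||g [mg g0 fg]] := @sm_norm _ _ _ _ mu _ _ _ _ (Pf_sm j);
  [exact: measurable_itv|exact: itv0_fin|].
exists (g \_ D); split.
- apply/(@measurable_restrictT _ _ (measurableTypeR R) _ D g (measurable_itv _)).
  exact: mg.
- by move=> s; rewrite patchE; case: ifP.
- by move=> s sD; rewrite patchE memNset.
by apply: filterS fg => s fs Ds; rewrite patchE mem_set// fs.
Qed.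

(** [G] is the sum over the modes of the Young functions of |P j f|. Each dominates the square of
    lam j P j u pointwise, and by Young and Bessel the integral of [G] is at most that of |f|^2. *)
Lemma mild_energy : exists G : R -> \bar R, [/\ measurable_fun setT G,
  forall t, (0 <= G t)%E, (\int[mu]_(t in setT) G t < +oo)%E &
  forall t, D t -> forall n,
    ((\sum_(j < n) rnorm (lamC R j *: P j (u t)) ^+ 2)%:E <= G t)%E].
Proof.
have [g gP] := ex_component_norms.
pose F j := young_fun (lam R j) tau (g j).
have F0 j t : (0 <= F j t)%E.
  by have [? ? _ _] := gP j; apply: young_fun_ge0 => //; exact: lam_gt0.
have mF j : measurable_fun setT (F j).
  by have [? ? _ _] := gP j; apply: measurable_young_fun => //; exact: lam_gt0.
exists (fun t => \sum_(j <oo) F j t)%E; split.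
- by apply: ge0_emeasurable_sum.
- by move=> t; apply: nneseries_ge0.
- rewrite integral_nneseries//.
  apply: (@le_lt_trans _ _ (\sum_(j <oo) \int[mu]_(s in D) (g j s ^+ 2)%:E)%E).
    apply: lee_nneseries => [j _ _|j _]; first by apply: integral_ge0.
    have [mg g0 gD _] := gP j.
    apply: (le_trans (integral_young_fun tau (lam_gt0 R j) mg g0)).
    rewrite le_eqVlt; apply/orP; left; apply/eqP.
    rewrite [RHS]integral_mkcond; apply: eq_integral => s _; rewrite patchE.
    by case: ifPn => // /negP sD; rewrite gD ?expr0n// => Ds; apply: sD; rewrite inE.
  rewrite -integral_nneseries//; last 2 first.
  - move=> j; have [mg _ _ _] := gP j; apply: measurable_funTS.
    by apply/measurable_EFinP; exact: measurable_funX.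
  - by move=> j s _; rewrite lee_fin sqr_ge0.
  apply: le_lt_trans f_sq; apply: ae_ge0_le_lower_integral.
  - by move=> s _; apply: nneseries_ge0 => j _ _; rewrite lee_fin sqr_ge0.
  - by move=> s _; rewrite lee_fin sqr_ge0.
  have : {ae mu, forall s j, D s -> rnorm (P j (f s)) = g j s}.
    by apply: ae_foralln => j; have [] := gP j.
  apply: filterS => s hs Ds.
  apply: lime_le; first by apply: is_cvg_nneseries => j _ _; rewrite lee_fin sqr_ge0.
  apply: nearW => n; rewrite sumEFin lee_fin big_mkord.
  under eq_bigr do rewrite -hs//.
  exact: (bessel dP pyth).
- move=> t Dt n; have t0 : 0 < t < tau by move: Dt; rewrite /= in_itv.
  apply: (le_trans _ (nneseries_lim_ge n (fun j _ _ => F0 j t))).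
  rewrite -sumEFin big_mkord; apply: lee_sum => j _.
  have [mg g0 gD gae] := gP j.
  apply: young_pointwise => //; [exact: lam_gt0|exact: rnorm_ge0|].
  have h := has_bochnerZ (mu := mu) (measurable_itv _) (itv0_fin t) (lamC R j)
    (mild_P cX dP C0 f_sm f_L1 j t0).
  apply: (le_trans (has_bochner_norm (mu := mu) (measurable_itv _) (itv0_fin t) h)).
  apply: le_L1; [by move=> s; exact: rnorm_ge0| |].
    by move=> s; rewrite !mulr_ge0 ?expR_ge0// ltW// lam_gt0.
  apply: filterS gae => s hs; rewrite /= in_itv/= => /andP[s0 st].
  rewrite /lamC rnormZr rnormZ rnorm_msg/= (gtr0_norm (lam_gt0 _ _)) -mulrA hs; last first.
    by rewrite /= in_itv/= s0 (lt_trans st)//; case/andP: t0.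
  by rewrite [(t - s) * _]mulrC.
Qed.

(** [G] is finite almost everywhere, and there the modes lam j P j u(t) are square summable, so
    their sum exists and is A u(t). *)
Lemma mild_A : exists G : R -> \bar R, [/\ measurable_fun setT G,
  forall t, (0 <= G t)%E, (\int[mu]_(t in setT) G t < +oo)%E &
  {ae mu, forall t, D t -> exists y, [/\ multiplies P (lamC R) (u t) y,
    dom_A sgR (u t), A_of sgR (u t) = y & ((rnorm y ^+ 2)%:E <= G t)%E]}].
Proof.
have [G [mG G0 iG uG]] := mild_energy; exists G; split => //.
have : {ae mu, forall t, setT t -> G t \is a fin_num}.
  apply: integrable_ae => //; apply/integrableP; split => //.
  by under eq_integral do rewrite gee0_abs//.
apply: filterS => t /(_ I) fG Dt.
have hB n : \sum_(j < n) rnorm (lamC R j *: P j (u t)) ^+ 2 <= fine (G t).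
  by rewrite -lee_fin fineK//; exact: uG.
have [y my yB] := multiplies_l2 cX dP pyth hB.
have [du Au] := multiplies_domA cX dP C0 pyth my.
by exists y; split => //; rewrite -(fineK fG) lee_fin.
Qed.

End hilbert_mild.

Lemma real_complexBD (R : realType) (a b c : R) :
  (a - b)%:C + (b - c)%:C = (a - c)%:C :> R[i].
Proof. by rewrite -(rmorphD (real_complex R)) addrA subrK. Qed.

(** * Modulus of continuity of the modes and measurability in the graph norm *)

Section hilbert_mild_sm.
Context (R : realType) (X : normedModType R[i]).
Variables (P : nat -> X -> X) (C : R).
Hypothesis (cX : seq_complete X) (dP : decomposition P C) (C0 : 0 <= C).
Hypothesis pyth : forall n x, rnorm (psum P n x) ^+ 2 = \sum_(j < n) rnorm (P j x) ^+ 2.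
Local Notation psum := (psum P).
Local Notation sgR := (fun t : R => sg P t%:C).
Local Notation mu := (@lebesgue_measure R).
Variables (tau : R) (f : R -> X).
Hypotheses (tau0 : 0 < tau) (Lf : LqX mu `]0, tau[ 2 f).
Local Notation D := (`]0%R, tau[%classic : set R).
Local Notation u := (mild_solution sgR f).

Let f_sm : strongly_measurable mu D f. Proof. by case: Lf. Qed.
Let fL1 := f_L1 Lf.

Lemma rnorm_P_le j x : rnorm (P j x) <= rnorm x.
Proof.
rewrite -ler_sqr ?nnegrE ?rnorm_ge0//; apply: le_trans (bessel dP pyth j.+1 x).
by rewrite big_ord_recr/= lerDr sumr_ge0// => i _; rewrite sqr_ge0.
Qed.

Lemma sg_contr (t : R) x : 0 <= t -> rnorm (sgR t x) <= rnorm x.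
Proof.
move=> t0; rewrite -[leRHS]mul1r.
apply: (multiplies_contr dP pyth ler01 (sgP cX dP C0 x (adm_real t0))) => j.
by rewrite rnorm_msg/= expRN_le1// mulr_ge0// ltW// lam_gt0.
Qed.

Lemma mild_bound (t : R) : D t ->
  rnorm (u t) <= fine (\int[mu]_(s in D) (rnorm (f s))%:E).
Proof.
rewrite /= in_itv/= => Dt; have /andP[t0 tt] := Dt.
rewrite -lee_fin fineK; last by rewrite ge0_fin_numE ?fL1// integral_ge0// => s _; rewrite lee_fin rnorm_ge0.
apply: (le_trans (has_bochner_norm (mu := mu) (measurable_itv _) (itv0_fin t)
  (mild_has_bochner cX dP C0 f_sm fL1 Dt))).
rewrite (@L1_domain _ _ _ mu D); last 2 first.
- by move=> s /=; rewrite !in_itv/= => /andP[-> st]; rewrite (lt_trans st).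
- by move=> s; exact: rnorm_ge0.
apply: le_L1 => [s|s|]; [by rewrite mulr_ge0 ?rnorm_ge0|exact: rnorm_ge0|].
apply: aeW => s _; rewrite indicE.
case: (boolP (s \in _)) => [|_]; last by rewrite mulr0 rnorm_ge0.
rewrite inE/= in_itv/= => /andP[_ st].
by rewrite mulr1 sg_contr// subr_ge0 ltW.
Qed.

(** By the semigroup law the difference is the integral of the forcing over [t, t'[ plus a term of
    order t' - t. As the forcing is only square integrable, |P j f| <= e |P j f|^2 + 1 / (4 e) is
    used under the integral; [e] is to be chosen before the length t' - t. *)
Lemma component_modulus j : exists2 K : R, 0 <= K & forall (e t t' : R), 0 < e ->
  0 < t -> t <= t' -> t' < tau ->
  rnorm (P j (u t') - P j (u t)) <= e * K + (t' - t) * (K + (4 * e)^-1).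
Proof.
have [g_ /(_ j)[]] := ex_component_norms dP Lf; set g := g_ j => mg g0 _ gae.
pose K1 := (\int[mu]_(s in D) (g s ^+ 2)%:E)%E.
have K1fin : K1 \is a fin_num.
  rewrite ge0_fin_numE; last by apply: integral_ge0 => s _; rewrite lee_fin sqr_ge0.
  case: Lf => _; apply: le_lt_trans; apply: le_L1 => [s|s|]; [exact: sqr_ge0|exact: powR_ge0|].
  apply: filterS gae => s gs Ds; rewrite -gs// powR_mulrn ?rnorm_ge0//.
  by rewrite ler_sqr ?nnegrE ?rnorm_ge0// rnorm_P_le.
have K10 : 0 <= fine K1 by rewrite fine_ge0// integral_ge0// => s _; rewrite lee_fin sqr_ge0.
pose B := fine (\int[mu]_(s in D) (rnorm (f s))%:E).
have B0 : 0 <= B by rewrite fine_ge0// integral_ge0// => s _; rewrite lee_fin rnorm_ge0.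
have l0 := lam_gt0 R j.
exists (fine K1 + 3 * lam R j * B); first by rewrite addr_ge0// !mulr_ge0// ltW.
move=> e t t' e0 t0 tt' t't; have t'0 : 0 < t' by apply: lt_le_trans tt'.
have Dt : 0 < t < tau by rewrite t0 (le_lt_trans tt').
have Dt' : 0 < t' < tau by rewrite t'0.
pose F (s : R) := msg (t' - s)%:C j *: P j (f s).
have h' : has_bochner_integral mu `]0, t'[ F (P j (u t')) := mild_P cX dP C0 f_sm fL1 j Dt'.
have hZ : has_bochner_integral mu `]0, t[ F (msg (t' - t)%:C j *: P j (u t)).
  apply: has_bochner_ae (has_bochnerZ (mu := mu) (measurable_itv _) (itv0_fin t) _
    (mild_P cX dP C0 f_sm fL1 j Dt)) _.
  apply: aeW => s _; rewrite scalerA.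
  by rewrite -msgD real_complexBD.
have sub : `]0, t'[ `<=` D.
  by move=> s /=; rewrite !in_itv/= => /andP[-> st]; rewrite (lt_trans st).
have sub' : `]0, t[ `<=` `]0, t'[.
  by move=> s /=; rewrite !in_itv/= => /andP[-> st]; rewrite (lt_le_trans st).
have msg1 (s : R) : s < t' -> rnorm (F s) <= rnorm (P j (f s)).
  move=> st; rewrite rnormZ rnorm_msg/= ler_piMl ?rnorm_ge0// expRN_le1// mulr_ge0 ?(ltW l0)//.
  by rewrite subr_ge0 ltW.
have [||y hy] := @has_bochner_exists _ _ _ _ mu (`]0%R, t'[%classic : set R)
  (measurable_itv _) (itv0_fin t') cX (fun s => (\1_(`]0%R, t[%classic : set R) s)%:C *: F s).
- by apply: sm_restrict; [exact: measurable_itv|exact: itv0_fin|exact: measurable_itv|case: h'].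
- apply: le_lt_trans fL1; rewrite (@L1_domain _ _ _ mu D _ sub); last by move=> s; exact: rnorm_ge0.
  apply: le_L1 => [s|s|]; [by rewrite mulr_ge0 ?rnorm_ge0|exact: rnorm_ge0|].
  apply: aeW => s _; rewrite !indicE.
  case: (boolP (s \in (`]0%R, t'[%classic : set R))) => [|_]; last by rewrite mulr0 rnorm_ge0.
  rewrite inE/= in_itv/= => /andP[_ st]; rewrite mulr1 rnormZr.
  case: (s \in _); rewrite ?normr0 ?mul0r ?rnorm_ge0// normr1 mul1r.
  exact: (le_trans (msg1 _ st) (rnorm_P_le _ _)).
have yE : y = msg (t' - t)%:C j *: P j (u t).
  apply: (has_bochner_unique (mu := mu) (measurable_itv _) (itv0_fin t) _ hZ).
  exact: (@has_bochner_domain _ _ _ _ mu _ _ (measurable_itv `]0%R, t'[) (itv0_fin t') (measurable_itv `]0%R, t[) sub' F y hy).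
have key : rnorm (P j (u t') - y) <= e * fine K1 + (t' - t) * (4 * e)^-1.
  have hB := has_bochnerB (mu := mu) (measurable_itv _) (itv0_fin t') h' hy.
  rewrite -lee_fin; apply: (le_trans (has_bochner_norm (mu := mu) (measurable_itv _) (itv0_fin t') hB)).
  rewrite (@L1_domain _ _ _ mu D _ sub); last by move=> s; exact: rnorm_ge0.
  pose I := (`[t, t'[%classic : set R).
  apply: (@le_trans _ _ (\int[mu]_(s in D) ((e * g s ^+ 2)%:E + ((4 * e)^-1 * \1_I s)%:E))%E).
    apply: ae_ge0_le_lower_integral.
    - by move=> s _; rewrite lee_fin mulr_ge0 ?rnorm_ge0.
    - by move=> s _; rewrite -EFinD lee_fin addr_ge0// mulr_ge0 ?sqr_ge0 ?invr_ge0 ?mulr_ge0// ltW.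
    apply: filterS gae => s gs Ds; rewrite -EFinD lee_fin !indicE.
    have e4 : 0 <= (4 * e)^-1 by rewrite invr_ge0 mulr_ge0// ltW.
    have ge : g s <= e * g s ^+ 2 + (4 * e)^-1.
      rewrite -subr_ge0 (_ : _ - _ = e * (g s - (2 * e)^-1) ^+ 2).
        by rewrite mulr_ge0 ?sqr_ge0// ltW.
      by field; rewrite gt_eqF.
    case: (boolP (s \in (`]0%R, t'[%classic : set R))) => [|_]; last first.
      by rewrite mulr0 addr_ge0// ?mulr_ge0 ?sqr_ge0// ltW.
    rewrite inE/= in_itv/= mulr1 => /andP[s0 st'].
    case: (boolP (s \in (`]0%R, t[%classic : set R))) => [_|].
      by rewrite scale1r subrr rnorm0 addr_ge0// ?mulr_ge0 ?sqr_ge0// ltW.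
    rewrite notin_setE/= in_itv/= s0/= => /negP; rewrite -leNgt => ts.
    have -> : s \in I by rewrite inE /I /= in_itv/= ts st'.
    rewrite scale0r subr0 !mulr1.
    by apply: le_trans (msg1 _ st') _; rewrite gs.
  rewrite ge0_integralD//; last 4 first.
  - by move=> s _; rewrite lee_fin mulr_ge0 ?sqr_ge0// ltW.
  - by apply/measurable_EFinP; apply: measurable_funM => //; apply: measurable_funX; exact: measurable_funTS.
  - by move=> s _; rewrite lee_fin mulr_ge0// invr_ge0 mulr_ge0// ltW.
  - by apply/measurable_EFinP; apply: measurable_funM => //; apply: measurable_indic; exact: measurable_itv.
  under eq_integral do rewrite EFinM.
  rewrite ge0_integralZl//; last 3 first.
  - by apply/measurable_EFinP; apply: measurable_funX; exact: measurable_funTS.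
  - by move=> s _; rewrite lee_fin sqr_ge0.
  - by rewrite lee_fin ltW.
  rewrite -/K1 EFinD EFinM fineK//; apply: leeD => //.
  under eq_integral do rewrite EFinM.
  rewrite ge0_integralZl//; last 2 first.
  - by apply/measurable_EFinP; apply: measurable_indic; exact: measurable_itv.
  - by rewrite lee_fin invr_ge0 mulr_ge0// ltW.
  rewrite integral_indic//; last exact: measurable_itv.
  rewrite [(t' - t) * _]mulrC EFinM; apply: lee_wpmul2l; first by rewrite lee_fin invr_ge0 mulr_ge0// ltW.
  apply: (@le_trans _ _ (mu I)); first by apply: le_measure => //; rewrite ?inE; [apply: measurableI; exact: measurable_itv|exact: measurable_itv].
  rewrite /I lebesgue_measure_itv/= lte_fin; case: ifP => _; first by rewrite EFinD EFinN.
  by rewrite lee_fin subr_ge0.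
have -> : P j (u t') - P j (u t) = (P j (u t') - y) + (y - P j (u t)).
  by rewrite addrA subrK.
apply: (le_trans (ler_rnormD _ _)).
have yu : rnorm (y - P j (u t)) <= (t' - t) * (3 * lam R j * B).
  have -> : y - P j (u t) = (msg (t' - t)%:C j - 1) *: P j (u t).
    by rewrite scalerBl scale1r yE.
  rewrite rnormZ (mulrC (t' - t)).
  have ad : adm (t' - t)%:C by apply: adm_real; rewrite subr_ge0.
  have := msgB1_le j ad; rewrite rnorm_real ger0_norm ?subr_ge0// => m1.
  rewrite mulrAC; apply: ler_pM => //; rewrite ?rnorm_ge0//.
  by apply: (le_trans (rnorm_P_le _ _)); apply: mild_bound; rewrite /= in_itv/=.
apply: (le_trans (lerD key yu)).
rewrite -subr_ge0 (_ : _ - _ = e * (3 * lam R j * B) + (t' - t) * fine K1); last by ring.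
by rewrite addr_ge0// !mulr_ge0 ?subr_ge0// ltW.
Qed.

Lemma mild_uniform (N : nat) (e : R) : 0 < e -> exists2 d : R, 0 < d &
  forall j, (j < N)%N -> forall t t' : R, 0 < t -> t <= t' -> t' < tau -> t' - t < d ->
  rnorm (P j (u t') - P j (u t)) < e.
Proof.
move=> e0; elim: N => [|N [d d0 IH]]; first by exists 1.
have [K K0 KP] := component_modulus N.
pose a := e / (2 * (K + 1)); have K1 : 0 < K + 1 by rewrite ltr_wpDl.
have a0 : 0 < a by rewrite divr_gt0// mulr_gt0.
pose b := K + (4 * a)^-1 + 1.
have ab0 : 0 <= K + (4 * a)^-1 by rewrite addr_ge0// invr_ge0 mulr_ge0// ltW.
have b0 : 0 < b by rewrite ltr_wpDl.
exists (Num.min d (e / (2 * b))); first by rewrite lt_min d0 divr_gt0// mulr_gt0.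
move=> j; rewrite ltnS leq_eqVlt => /orP[/eqP ->|jN] t t' t0 tt' t't; rewrite lt_min => /andP[td te];
  last exact: (IH _ jN).
apply: (le_lt_trans (KP _ _ _ a0 t0 tt' t't)).
have -> : e = e / 2 + e / 2 by field.
apply: ler_ltD.
  rewrite /a invfM mulrA -mulrA ler_piMr//; first by rewrite divr_ge0// ltW.
  by rewrite mulrC ler_pdivrMr// mul1r lerDl.
apply: (@le_lt_trans _ _ ((t' - t) * b)).
  by rewrite ler_wpM2l ?subr_ge0// /b lerDl.
by rewrite -ltr_pdivlMr// -mulrA -invfM.
Qed.

Definition lam_psum n x : X := \sum_(j < n) lamC R j *: P j x.

Lemma multiplies_lam_psum n x : multiplies P (lamC R) (psum n x) (lam_psum n x).
Proof.
move=> j; rewrite (dec_P_psum dP) /lam_psum (dec_Psum dP j n (fun i => lamC R i *: P i x)).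
under eq_bigr do rewrite (dec_PZ dP) (dec_orth dP).
case: ifPn => jn; last first.
  rewrite scaler0 big1// => i _; case: eqP => [ji|]; last by rewrite scaler0.
  by move: jn; rewrite ji ltn_ord.
rewrite (bigD1 (Ordinal jn))//= eqxx big1 ?addr0// => i ij.
rewrite ifN ?scaler0//; apply: contra ij => /eqP ij; apply/eqP; exact: val_inj.
Qed.

Lemma lam_psum_bound n x (e : R) : (forall j, (j < n)%N -> rnorm (P j x) <= e) ->
  rnorm (psum n x) <= n%:R * lam R n * e /\ rnorm (lam_psum n x) <= n%:R * lam R n * e.
Proof.
move=> h; suff H (a : nat -> R[i]) : (forall j, (j < n)%N -> rnorm (a j) <= lam R n) ->
    rnorm (\sum_(j < n) a j *: P j x) <= n%:R * lam R n * e.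
  have lle j : (j < n)%N -> lam R j <= lam R n.
    by move=> jn; rewrite /lam ler_weXn2l ?ler1n// ltnW.
  split; last by apply: H => j jn; rewrite rnorm_real (gtr0_norm (lam_gt0 _ _)) lle.
  rewrite [psum n x](_ : _ = \sum_(j < n) (1 : R[i]) *: P j x).
    apply: (H (fun=> 1)) => j jn; rewrite rnorm_real normr1.
    by apply: le_trans (lle j jn); rewrite /lam exprn_ege1// ler1n.
  by apply: eq_bigr => j _; rewrite scale1r.
move=> ha; apply: (le_trans (rnorm_sum _ _ _)).
have -> : n%:R * lam R n * e = \sum_(j < n) lam R n * e.
  by rewrite sumr_const card_ord -mulrA mulr_natl.
apply: ler_sum => j _.
by rewrite rnormZ; apply: ler_pM; rewrite ?rnorm_ge0//; [exact: ha|exact: h].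
Qed.

(** The [n]-th approximant keeps the first [n] modes, sampled at the grid point left of [t]. The
    mesh [m n] is so fine that these modes barely move within a cell, even after multiplication by
    their eigenvalues. *)
Lemma mild_approx : exists2 m : nat -> nat, forall n, (n <= m n)%N & forall t y,
  D t -> multiplies P (lamC R) (u t) y ->
  let v n := u (grid_pt 0 (m n) (grid_idx 0 (m n) t)) in
  psum n (v n) @[n --> \oo] --> u t /\ lam_psum n (v n) @[n --> \oo] --> y.
Proof.
(* The denominator compensates the factor n * lam n in [lam_psum_bound], leaving an error of at most
   1 / (n + 1). *)
pose e n : R := n.+1%:R^-1 / (n.+1%:R * lam R n).
have e0 n : 0 < e n by rewrite divr_gt0// mulr_gt0// lam_gt0.
have /choice[m mP] n : exists m, (n <= m)%N /\ forall j, (j < n)%N -> forall t t' : R,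
    0 < t -> t <= t' -> t' < tau -> t' - t < m.+1%:R^-1 ->
    rnorm (P j (u t') - P j (u t)) < e n.
  have [d d0 dP'] := mild_uniform n (e0 n).
  have [N _ NP] := near_infty_natSinv_lt (PosNum d0).
  exists (maxn n N); split; first exact: leq_maxl.
  move=> j jn t t' t0 tt' t't tm; apply: dP' => //; apply: (lt_trans tm).
  exact: (NP _ (leq_maxr _ _)).
exists m => [n|t y Dt my v]; first by case: (mP n).
have := Dt; rewrite /= in_itv/= => /andP[t0 tt].
have [N _ NP] := near_infty_natSinv_lt (PosNum t0).
have close n : (N <= n)%N -> rnorm (psum n (v n - u t)) <= n.+1%:R^-1 /\
    rnorm (lam_psum n (v n - u t)) <= n.+1%:R^-1.
  move=> Nn; have [nm mj] := mP n.
  have [g1 g2] := andP (grid_ptP (m n) t0).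
  set gp := grid_pt 0 (m n) _ in g1 g2.
  (* The modulus of continuity holds inside the open interval, so the grid point to the left of [t]
     must not be [0]; this is the case as soon as 1 / (n + 1) < t. *)
  have gp0 : 0 < gp.
    have : t < gp + n.+1%:R^-1.
      by apply: (lt_le_trans g2); rewrite lerD2l lef_pV2 ?posrE// ler_nat.
    move=> h; have h1 : n.+1%:R^-1 < t := NP n Nn.
    by rewrite -(ltrD2r n.+1%:R^-1) add0r; exact: lt_trans h1 h.
  have [] := @lam_psum_bound n (v n - u t) (e n).
    move=> j jn; rewrite (dec_PB dP) rnorm_distC; apply/ltW/mj => //.
    by rewrite ltrBlDl.
  have -> : n%:R * lam R n * e n = n.+1%:R^-1 * (n%:R / n.+1%:R).
    have : n.+1%:R != 0 :> R by rewrite pnatr_eq0.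
    have := lt0r_neq0 (lam_gt0 R n); rewrite /e.
    by move: (lam R n) (n.+1%:R) => a b a0 b0; field; rewrite a0 b0.
  have h1 : n.+1%:R^-1 * (n%:R / n.+1%:R) <= n.+1%:R^-1 :> R.
    by rewrite ler_piMr// ler_pdivrMr// mul1r ler_nat.
  by move=> p1 p2; split; apply: le_trans h1.
have harm : (n.+1%:R^-1 : R) @[n --> \oo] --> (0 : R) by exact: cvg_harmonic.
have nrm0 (a : nat -> X) : (forall n, (N <= n)%N -> rnorm (a n) <= n.+1%:R^-1) ->
    a n @[n --> \oo] --> (0 : X).
  move=> h; apply: (rnorm_squeeze (g := fun n => n.+1%:R^-1)) => //.
  by exists N => // n /= Nn; rewrite subr0 h.
split.
  have h := cvgD (nrm0 _ (fun n Nn => (close n Nn).1)) (@dec_cvg _ _ _ _ dP (u t)).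
  rewrite add0r in h; rewrite (_ : (fun n => psum n (v n)) =
    (fun n => psum n (v n - u t) + psum n (u t))); first exact: h.
  apply/funext => n; rewrite /psum -big_split/=; apply: eq_bigr => j _.
  by rewrite (dec_PB dP) subrK.
have h := cvgD (nrm0 _ (fun n Nn => (close n Nn).2)) (@dec_cvg _ _ _ _ dP y).
rewrite add0r in h; rewrite (_ : (fun n => lam_psum n (v n)) =
  (fun n => lam_psum n (v n - u t) + psum n y)); first exact: h.
apply/funext => n; rewrite (multiplies_psum n my) -big_split/=; apply: eq_bigr => j _.
by rewrite -scalerDr (dec_PB dP) subrK.
Qed.

End hilbert_mild_sm.

Section hilbert_regular.
Context (R : realType) (X : normedModType R[i]).
Variables (P : nat -> X -> X) (C : R).
Hypothesis (cX : seq_complete X) (dP : decomposition P C) (C0 : 0 <= C).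
Hypothesis pyth : forall n x, rnorm (psum P n x) ^+ 2 = \sum_(j < n) rnorm (P j x) ^+ 2.
Local Notation sgR := (fun t : R => sg P t%:C).
Local Notation mu := (@lebesgue_measure R).
Variables (tau : R) (f : R -> X).
Hypotheses (tau0 : 0 < tau) (Lf : LqX mu `]0, tau[ 2 f).
Local Notation D := (`]0%R, tau[%classic : set R).
Local Notation u := (mild_solution sgR f).
Let fL1 := f_L1 Lf.

Lemma powR2 (x : R) : 0 <= x -> x `^ 2 = x ^+ 2.
Proof. exact: powR_mulrn. Qed.

Let m2 (x y : R) : (x + y) ^+ 2 <= 2 * x ^+ 2 + 2 * y ^+ 2.
Proof. by rewrite -subr_ge0 (_ : _ - _ = (x - y) ^+ 2) ?sqr_ge0//; ring. Qed.

Lemma square_integrable (N : R -> R) (G : R -> \bar R) (a b : R) :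
  measurable_fun setT G -> (forall t, (0 <= G t)%E) ->
  (\int[mu]_(t in setT) G t < +oo)%E -> 0 <= a -> 0 <= b -> (forall t, 0 <= N t) ->
  {ae mu, forall t, D t -> ((N t ^+ 2)%:E <= a%:E + b%:E * G t)%E} ->
  (\int[mu]_(t in D) (N t `^ 2)%:E < +oo)%E.
Proof.
move=> mG G0 iG a0 b0 N0 h.
apply: (@le_lt_trans _ _ (\int[mu]_(t in D) (a%:E + b%:E * G t))%E).
  apply: ae_ge0_le_lower_integral => [t _|t _|].
  - by rewrite lee_fin powR_ge0.
  - by rewrite adde_ge0 ?lee_fin// mule_ge0// lee_fin.
  by apply: filterS h => t h /h; rewrite powR2.
have mGD : measurable_fun D G by exact: measurable_funTS.
rewrite ge0_integralD//; last 2 first.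
- by move=> t _; rewrite mule_ge0// lee_fin.
- exact: measurable_funeM.
rewrite lte_add_pinfty//.
  rewrite integral_cst; last exact: measurable_itv.
  by rewrite lte_mul_pinfty ?lee_fin//; exact: itv0_fin.
rewrite ge0_integralZl//.
rewrite lte_mul_pinfty ?lee_fin//.
by apply: le_lt_trans iG; apply: ge0_subset_integral.
Qed.

(** One family of samples serves all three claims: finite sums of modes lie in the domain, and A
    maps them to [lam_psum], so convergence of both sequences is convergence in the graph norm. *)
Lemma mild_LqX : [/\ LqX_in mu D (dom_A sgR) (graph_norm sgR) 2 u, LqX mu D 2 u
  & LqX mu D 2 (fun t => A_of sgR (u t))].
Proof.
have [m _ mP] := mild_approx cX dP C0 pyth Lf.
have [G [mG G0 iG uG]] := mild_A cX dP C0 pyth Lf.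
pose B := fine (\int[mu]_(s in D) (rnorm (f s))%:E).
have uB t : D t -> rnorm (u t) <= B by apply: (mild_bound cX dP C0 pyth Lf).
have B0 : 0 <= B by rewrite fine_ge0// integral_ge0// => s _; rewrite lee_fin rnorm_ge0.
have approx : {ae mu, forall t, D t -> let w n := u (grid_pt 0 (m n) (grid_idx 0 (m n) t)) in
    [/\ dom_A sgR (u t), psum P n (w n) @[n --> \oo] --> u t,
     lam_psum P n (w n) @[n --> \oo] --> A_of sgR (u t),
     graph_norm sgR (psum P n (w n) - u t) @[n --> \oo] --> (0 : R) &
     ((rnorm (A_of sgR (u t)) ^+ 2)%:E <= G t)%E]}.
  apply: filterS uG => t h Dt w; have [y [my du Ay yG]] := h Dt.
  have [up Ap] := mP t y Dt my.
  split; rewrite ?Ay//.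
  have gE n : graph_norm sgR (psum P n (w n) - u t) =
      rnorm (psum P n (w n) - u t) + rnorm (lam_psum P n (w n) - y).
    have md : multiplies P (lamC R) (psum P n (w n) - u t) (lam_psum P n (w n) - y).
      by move=> j; rewrite !(dec_PB dP) my (multiplies_lam_psum dP) scalerBr.
    by rewrite /graph_norm (multiplies_domA cX dP C0 pyth md).2.
  under eq_fun do rewrite gE.
  by apply: cvgD00; apply/cvg_rnormP.
have dpsum n x : dom_A sgR (psum P n x).
  exact: (multiplies_domA cX dP C0 pyth (multiplies_lam_psum dP n x)).1.
have smu : strongly_measurable mu D u.
  apply: (sm_grid (m := m) tau0 (F := fun n k => fun=> psum P n (u (grid_pt 0 (m n) k)))).
    by move=> n k; exact: is_step_cst.
  by apply: filterS approx => t h /h[_ up _ _ _]; split => //; exact/cvg_rnormP.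
have smA : strongly_measurable mu D (fun t => A_of sgR (u t)).
  apply: (sm_grid (m := m) tau0 (F := fun n k => fun=> lam_psum P n (u (grid_pt 0 (m n) k)))).
    by move=> n k; exact: is_step_cst.
  by apply: filterS approx => t h /h[_ _ up _ _]; split => //; exact/cvg_rnormP.
split; split => //.
- apply: (sm_grid (m := m) tau0 (F := fun n k => fun=> psum P n (u (grid_pt 0 (m n) k)))).
    by move=> n k; exact: is_step_cst.
  by apply: filterS approx => t h /h[].
- apply: (square_integrable (G := G) (a := 2 * B ^+ 2) (b := 2)) => //.
  + by rewrite mulr_ge0 ?sqr_ge0.
  + by move=> t; rewrite addr_ge0 ?rnorm_ge0.
  apply: filterS approx => t h Dt; have [_ _ _ _ yG] := h Dt.
  apply: (@le_trans _ _ (2 * B ^+ 2 + 2 * rnorm (A_of sgR (u t)) ^+ 2)%:E).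
    rewrite lee_fin; apply: (le_trans (m2 _ _)); rewrite lerD2r ler_wpM2l//.
    by rewrite ler_sqr ?nnegrE ?rnorm_ge0// uB.
  by rewrite EFinD EFinM leeD2l// EFinM lee_wpmul2l// lee_fin.
- apply: (square_integrable (G := G) (a := B ^+ 2) (b := 0)) => //.
  + by rewrite sqr_ge0.
  + by move=> t; rewrite rnorm_ge0.
  by apply: aeW => t Dt; rewrite mul0e adde0 lee_fin ler_sqr ?nnegrE ?rnorm_ge0// uB.
- apply: (square_integrable (G := G) (a := 0) (b := 1)) => //.
  + by move=> t; rewrite rnorm_ge0.
  by apply: filterS approx => t h /h[_ _ _ _ yG]; rewrite add0e mul1e.
Qed.

Lemma LqX_B (g h : R -> X) : LqX mu D 2 g -> LqX mu D 2 h -> LqX mu D 2 (fun t => g t - h t).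
Proof.
move=> [sg_ ig] [sh ih]; split; first exact: smB.
have [||g' [mg g0 gg]] := @sm_norm _ _ _ _ mu _ _ _ _ sg_;
  [exact: measurable_itv|exact: itv0_fin|].
have [||h' [mh h0 hh]] := @sm_norm _ _ _ _ mu _ _ _ _ sh;
  [exact: measurable_itv|exact: itv0_fin|].
have sq (k : R -> X) (k' : R -> R) : (forall t, 0 <= k' t) ->
    {ae mu, forall t, D t -> rnorm (k t) = k' t} ->
    (\int[mu]_(t in D) (rnorm (k t) `^ 2)%:E < +oo)%E ->
    (\int[mu]_(t in D) (k' t ^+ 2)%:E < +oo)%E.
  move=> k0 kk; apply: le_lt_trans; apply: le_L1 => [t|t|]; [exact: sqr_ge0|exact: powR_ge0|].
  by apply: filterS kk => t e Dt; rewrite powR2 ?rnorm_ge0// e.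
apply: (@le_lt_trans _ _ (\int[mu]_(t in D) (2%:E * (g' t ^+ 2)%:E + 2%:E * (h' t ^+ 2)%:E))%E).
  apply: ae_ge0_le_lower_integral => [t _|t _|]; first by rewrite lee_fin powR_ge0.
    by rewrite -!EFinM -EFinD lee_fin addr_ge0// mulr_ge0 ?sqr_ge0.
  apply: filterS2 gg hh => t gt ht Dt; rewrite powR2 ?rnorm_ge0// -!EFinM -EFinD lee_fin.
  rewrite -gt// -ht//; apply: le_trans (m2 _ _).
  rewrite ler_sqr ?nnegrE ?addr_ge0 ?rnorm_ge0//; exact: ler_rnormB.
rewrite ge0_integralD//; last 4 first.
- by move=> t _; rewrite mule_ge0// lee_fin sqr_ge0.
- by apply: measurable_funeM; apply/measurable_EFinP; exact: measurable_funX.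
- by move=> t _; rewrite mule_ge0// lee_fin sqr_ge0.
- by apply: measurable_funeM; apply/measurable_EFinP; exact: measurable_funX.
rewrite !ge0_integralZl ?lee_fin//; last 4 first.
- by apply/measurable_EFinP; exact: measurable_funX.
- by move=> t _; rewrite lee_fin sqr_ge0.
- by apply/measurable_EFinP; exact: measurable_funX.
- by move=> t _; rewrite lee_fin sqr_ge0.
by rewrite lte_add_pinfty// lte_mul_pinfty// ?lee_fin//; [exact: sq gg ig|exact: sq hh ih].
Qed.

End hilbert_regular.

(** * Weak differentiation of Bochner primitives *)

Section bochner_more.
Context d (T : measurableType d) (R : realType) (X : normedModType R[i]).
Variables (mu : {measure set T -> \bar R}) (D D' : set T).
Hypotheses (mD : measurable D) (Dfin : (mu D < +oo)%E) (cX : seq_complete X).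
Hypotheses (mD' : measurable D') (sDD' : D' `<=` D).

Lemma has_bochner_sum (n : nat) (F : nat -> T -> X) (x : nat -> X) :
  (forall i, (i < n)%N -> has_bochner_integral mu D (F i) (x i)) ->
  has_bochner_integral mu D (fun t => \sum_(i < n) F i t) (\sum_(i < n) x i).
Proof.
elim: n => [|n IH] h.
  under eq_fun do rewrite big_ord0.
  rewrite big_ord0; apply: has_bochner_step => //; exact: is_step0.
under eq_fun do rewrite big_ord_recr/=.
rewrite big_ord_recr/=; apply: has_bochnerD => //; last exact: h.
by apply: IH => i ni; apply: h; rewrite ltnS ltnW.
Qed.

Lemma has_bochner_extend (k : T -> X) x : strongly_measurable mu D k ->
  (\int[mu]_(t in D) (rnorm (k t))%:E < +oo)%E -> has_bochner_integral mu D' k x ->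
  has_bochner_integral mu D (fun t => (\1_D' t)%:C *: k t) x.
Proof.
move=> sk ik kx; have sk' := sm_restrict mD Dfin mD' sk.
have [|y hy] := has_bochner_exists mD Dfin cX sk'.
  apply: le_lt_trans ik; apply: le_L1 => [t|t|]; [exact: rnorm_ge0|exact: rnorm_ge0|].
  apply: aeW => t _; rewrite rnormZr indicE; case: (t \in D').
    by rewrite normr1 mul1r.
  by rewrite normr0 mul0r rnorm_ge0.
have Dfin' : (mu D' < +oo)%E by apply: le_lt_trans Dfin; apply: le_measure; rewrite ?inE.
have e := has_bochner_unique mD' Dfin' kx (has_bochner_domain mD Dfin mD' sDD' hy).
by rewrite e.
Qed.

Lemma has_bochner_rnorm_le (k : T -> X) x (a b : R) (g : T -> R) :
  0 <= a -> 0 <= b -> measurable_fun D g -> (forall t, 0 <= g t) ->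
  has_bochner_integral mu D k x ->
  {ae mu, forall t, D t -> rnorm (k t) <= a + b * g t} ->
  ((rnorm x)%:E <= a%:E * mu D + b%:E * \int[mu]_(t in D) (g t)%:E)%E.
Proof.
move=> a0 b0 mg g0 kx h; apply: (le_trans (has_bochner_norm mD Dfin kx)).
apply: (@le_trans _ _ (\int[mu]_(t in D) (a%:E + b%:E * (g t)%:E))%E).
  apply: ae_ge0_le_lower_integral => [t _|t _|].
  - by rewrite lee_fin rnorm_ge0.
  - by rewrite -EFinM -EFinD lee_fin addr_ge0// mulr_ge0.
  by apply: filterS h => t h /h; rewrite -EFinM -EFinD lee_fin.
rewrite ge0_integralD//; last 2 first.
- by move=> t _; rewrite -EFinM lee_fin mulr_ge0.
- by apply: measurable_funeM; apply/measurable_EFinP.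
rewrite integral_cst// ge0_integralZl//; first exact/measurable_EFinP.
by move=> t _; rewrite lee_fin.
Qed.

End bochner_more.

Lemma indic_itv (R : realType) (s t x : R) : s <= t ->
  \1_(`[s, t[%classic : set R) x = (x < t)%R%:R - (x < s)%R%:R :> R.
Proof.
move=> st; rewrite indicE (_ : (x \in _) = (s <= x < t)); last first.
  by apply/idP/idP; rewrite inE/= in_itv.
rewrite leNgt; case: (ltP x s) => /= xs; last by rewrite subr0.
by rewrite (lt_le_trans xs st) subrr.
Qed.

Lemma indic_itv0 (R : realType) (t x : R) : 0 < x ->
  \1_(`]0%R, t[%classic : set R) x = (x < t)%R%:R :> R.
Proof.
move=> x0; rewrite indicE (_ : (x \in _) = (0 < x < t)); first by rewrite x0.
by apply/idP/idP; rewrite inE/= in_itv.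
Qed.

Section weak_primitive.
Context (R : realType) (X : normedModType R[i]).
Local Notation mu := (@lebesgue_measure R).
Variables (tau c e K B : R) (k Gam : R -> X) (psi dpsi : R -> R).
Local Notation D := (`]0%R, tau[%classic : set R).
Local Notation hb := (has_bochner_integral mu D).
Hypotheses (c0 : 0 < c) (ce : c < e) (etau : e < tau) (K0 : 0 <= K) (B0 : 0 <= B).
Hypotheses (sk : strongly_measurable mu D k)
  (ik : (\int[mu]_(t in D) (rnorm (k t))%:E < +oo)%E).
Hypothesis GamP : forall t : R, c <= t <= e ->
  hb (fun s => (\1_(`]0%R, t[%classic : set R) s)%:C *: k s) (Gam t).
Hypothesis GamB : forall t : R, c <= t <= e -> rnorm (Gam t) <= B.
Hypothesis Gam_cont : forall a : R, 0 < a -> exists2 r : R, 0 < r &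
  forall s t : R, c <= s -> s <= t -> t <= e -> t - s < r -> rnorm (Gam t - Gam s) <= a.
Hypothesis psi_taylor : forall s t : R, c <= s <= e -> c <= t <= e ->
  [/\ `|psi t - psi s - dpsi s * (t - s)| <= K * (t - s) ^+ 2,
      `|psi t - psi s| <= K * `|t - s| & `|dpsi t| <= K].
Hypotheses (psic : psi c = 0) (psie : psi e = 0).
Local Notation J := (`[c, e[%classic : set R).

(** Integration by parts through a discrete version. On a uniform mesh of [c, e] the sums of
    (psi(p_i+1) - psi(p_i)) Gam(p_i) and of psi(p_i+1) (Gam(p_i+1) - Gam(p_i)) cancel, because psi
    vanishes at both ends. Uniform continuity of [Gam] and the Taylor bounds for [psi] bring them
    within a multiple of [a] of [Y1] and [Y2]. *)
Lemma weak_primitive (Y1 Y2 : X) :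
  hb (fun t => (\1_J t * dpsi t)%:C *: Gam t) Y1 ->
  hb (fun t => (\1_J t * psi t)%:C *: k t) Y2 -> Y1 = - Y2.
Proof.
move=> h1 h2.
have [||g [mg g0 kg]] := @sm_norm _ _ _ _ mu _ _ _ _ sk;
  [exact: measurable_itv|exact: itv0_fin|].
pose M := fine (\int[mu]_(t in D) (g t)%:E).
have ig : (\int[mu]_(t in D) (g t)%:E)%E = M%:E.
  rewrite fineK// ge0_fin_numE; last by apply: integral_ge0 => s _; rewrite lee_fin.
  by apply: le_lt_trans ik; apply: le_L1 => [//|t|]; [exact: rnorm_ge0|apply: filterS kg => t h /h ->].
have M0 : 0 <= M by rewrite -lee_fin -ig integral_ge0// => s _; rewrite lee_fin.
have muD : mu D = tau%:E.
  by rewrite lebesgue_measure_itv/= lte_fin (lt_trans c0 (lt_trans ce etau)) EFinN oppe0 adde0.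
suff H (a : R) : 0 < a -> rnorm (Y1 + Y2) <= a * ((2 * K * B + K) * tau + K * M).
  apply/eqP; rewrite -addr_eq0; apply/eqP; apply: rnorm_eq0P; apply/eqP.
  rewrite eq_le rnorm_ge0 andbT; set W := (2 * K * B + K) * tau + K * M in H.
  have W0 : 0 <= W by rewrite addr_ge0 ?mulr_ge0 ?addr_ge0 ?mulr_ge0// ltW// (lt_trans c0 (lt_trans ce etau)).
  apply/ler_addgt0Pr => b b0; rewrite add0r; have W1 : 0 < W + 1 by rewrite ltr_wpDl.
  apply: (le_trans (H (b / (W + 1)) (divr_gt0 b0 W1))).
  by rewrite -mulrA ler_piMr ?(ltW b0)// mulrC ler_pdivrMr// mul1r lerDl.
move=> a0; have [r r0 rP] := Gam_cont a0.
have [N [h [N0 h0 hN ha hr]]] : exists N (h : R), [/\ (0 < N)%N, 0 < h, c + N%:R * h = e, h <= a & h < r].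
  have q0 : 0 < Num.min a r / (e - c) by rewrite divr_gt0 ?subr_gt0// lt_min a0.
  have [n _ /(_ n (leqnn n)) nP] := near_infty_natSinv_lt (PosNum q0).
  have ec : 0 < e - c by rewrite subr_gt0.
  have := nP; rewrite /= ltr_pdivlMr// lt_min mulrC => /andP[n1 n2].
  exists n.+1, ((e - c) / n.+1%:R); split => //; first by rewrite divr_gt0.
    by rewrite mulrC divfK ?pnatr_eq0// addrC subrK.
  exact: ltW.
pose p (i : nat) : R := c + i%:R * h.
have pS i : p i.+1 = p i + h by rewrite /p -[i.+1]addn1 natrD mulrDl mul1r addrA.
have pm i : p i <= p i.+1 by rewrite pS lerDl ltW.
have pJ i : (i <= N)%N -> c <= p i <= e.
  by move=> iN; rewrite lerDl mulr_ge0 ?(ltW h0)//= -hN lerD2l ler_wpM2r ?(ltW h0)// ler_nat.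
pose cell (i : nat) := (`[p i, p i.+1[%classic : set R).
have cellJ t : \sum_(i < N) \1_(cell i) t = \1_J t :> R.
  rewrite (indic_itv _ (ltW ce)); under eq_bigr do rewrite (indic_itv _ (pm _)).
  rewrite -(big_mkord xpredT (fun i => (t < p i.+1)%R%:R - (t < p i)%R%:R)) telescope_sumr//.
  by rewrite /p hN mul0r addr0.
have cell_bound t (V : X) (G : nat -> X) (b : R) : 0 <= b ->
    (forall i, (i < N)%N -> p i <= t -> t < p i.+1 -> rnorm (V - G i) <= b) ->
    rnorm ((\1_J t)%:C *: V - \sum_(i < N) (\1_(cell i) t)%:C *: G i) <= b.
  move=> b0 hb_; rewrite -cellJ raddf_sum/= scaler_suml -sumrB.
  apply: (le_trans (rnorm_sum _ _ _)).
  apply: (@le_trans _ _ (\sum_(i < N) \1_(cell i) t * b)).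
    apply: ler_sum => i _; rewrite -scalerBr rnormZr indicE.
    case: (boolP (t \in cell i)) => [|_]; last by rewrite normr0 !mul0r.
    rewrite inE /cell/= in_itv/= => /andP[t1 t2]; rewrite normr1 !mul1r; exact: hb_.
  rewrite -mulr_suml cellJ indicE; case: (t \in J); rewrite ?mul1r//.
  by rewrite mul0r.
pose F1 t := \sum_(i < N) (\1_(cell i) t)%:C *: (((psi (p i.+1) - psi (p i)) / h)%:C *: Gam (p i)).
pose F2 t := \sum_(i < N) (\1_(cell i) t)%:C *: ((psi (p i.+1))%:C *: k t).
have hF1 : hb F1 (\sum_(i < N) (psi (p i.+1) - psi (p i))%:C *: Gam (p i)).
  apply: (has_bochner_sum (mu := mu) (measurable_itv _) (itv0_fin tau)
    (F := fun i t => (\1_(cell i) t)%:C *: (((psi (p i.+1) - psi (p i)) / h)%:C *: Gam (p i)))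
    (x := fun i => (psi (p i.+1) - psi (p i))%:C *: Gam (p i))) => i iN.
  have cD : cell i `&` D = cell i.
    apply: setIidl => s; rewrite /cell/= !in_itv/= => /andP[s1 s2].
    have /andP[p1 _] := pJ i (ltnW iN); have /andP[_ p2] := pJ _ iN.
    by rewrite (lt_le_trans c0 (le_trans p1 s1)) (lt_trans s2 (le_lt_trans p2 etau)).
  have mc : fine (mu (cell i `&` D)) = h.
    rewrite cD /cell lebesgue_measure_itv/= lte_fin pS ltrDl h0 -EFinD/=.
    by rewrite addrAC subrr add0r.
  have -> : (psi (p i.+1) - psi (p i))%:C *: Gam (p i) =
      (fine (mu (cell i `&` D)))%:C *: (((psi (p i.+1) - psi (p i)) / h)%:C *: Gam (p i)).
    by rewrite mc scalerA -(rmorphM (real_complex R)) mulrC divfK ?gt_eqF.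
  have st := @is_step_indic _ _ _ _ mu D (measurable_itv _) (itv0_fin tau) setT (cell i)
    (((psi (p i.+1) - psi (p i)) / h)%:C *: Gam (p i)) (measurable_itv _) I.
  exact: has_bochner_step st.
have hF2 : hb F2 (\sum_(i < N) (psi (p i.+1))%:C *: (Gam (p i.+1) - Gam (p i))).
  apply: (has_bochner_sum (mu := mu) (measurable_itv _) (itv0_fin tau)
    (F := fun i t => (\1_(cell i) t)%:C *: ((psi (p i.+1))%:C *: k t))
    (x := fun i => (psi (p i.+1))%:C *: (Gam (p i.+1) - Gam (p i)))) => i iN.
  have hB := has_bochnerB (mu := mu) (measurable_itv _) (itv0_fin tau)
    (GamP (pJ _ iN)) (GamP (pJ _ (ltnW iN))).
  apply: has_bochner_ae (has_bochnerZ (mu := mu) (measurable_itv _) (itv0_fin tau) _ hB) _.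
  apply: aeW => s Ds; rewrite -scalerBl scalerA mulrC -scalerA; congr (_ *: _).
  suff -> : \1_(cell i) s = \1_(`]0%R, p i.+1[%classic : set R) s -
      \1_(`]0%R, p i[%classic : set R) s :> R by rewrite (rmorphB (real_complex R)).
  have s0 : 0 < s by move: Ds; rewrite /= in_itv/= => /andP[].
  by rewrite !(indic_itv0 _ s0) (indic_itv _ (pm i)).
have zero : \sum_(i < N) (psi (p i.+1) - psi (p i))%:C *: Gam (p i) +
    \sum_(i < N) (psi (p i.+1))%:C *: (Gam (p i.+1) - Gam (p i)) = 0.
  rewrite -big_split/=.
  transitivity (\sum_(0 <= i < N) ((psi (p i.+1))%:C *: Gam (p i.+1) - (psi (p i))%:C *: Gam (p i))).
    rewrite big_mkord; apply: eq_bigr => i _.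
    by rewrite rmorphB/= scalerBl scalerBr addrC addrA subrK.
  rewrite (telescope_sumr (fun i => (psi (p i))%:C *: Gam (p i)))//.
  by rewrite /p hN psie mul0r addr0 psic !scale0r subrr.
have E1 := has_bochnerB (mu := mu) (measurable_itv _) (itv0_fin tau) h1 hF1.
have E2 := has_bochnerB (mu := mu) (measurable_itv _) (itv0_fin tau) h2 hF2.
have Ka : 0 <= K * a by rewrite mulr_ge0// ltW.
have Kb : 0 <= a * (2 * K * B + K) by rewrite mulr_ge0 ?(ltW a0)// addr_ge0// !mulr_ge0.
(* Taylor expansion about [t] towards both ends of its cell: two errors K h^2, divided by h. *)
have slope i t : (i < N)%N -> p i <= t -> t < p i.+1 ->
    `|dpsi t - (psi (p i.+1) - psi (p i)) / h| <= 2 * K * a.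
  move=> iN it ti; have /andP[ci ie] := pJ i (ltnW iN); have /andP[ci' ie'] := pJ _ iN.
  have tJ : c <= t <= e by rewrite (le_trans ci it) (le_trans (ltW ti) ie').
  have [A0 _ _] := psi_taylor tJ (pJ _ (ltnW iN)).
  have [A1 _ _] := psi_taylor tJ (pJ _ iN).
  have d1 : (p i.+1 - t) ^+ 2 <= h ^+ 2.
    by rewrite ler_sqr ?nnegrE ?(ltW h0) ?subr_ge0 ?(ltW ti)// lerBlDr pS [p i + h]addrC lerD2l.
  have d0 : (p i - t) ^+ 2 <= h ^+ 2.
    rewrite -sqrrN opprB ler_sqr ?nnegrE ?(ltW h0) ?subr_ge0// lerBlDl -pS; exact: ltW.
  rewrite -(ler_pM2r h0) -[X in _ * X <= _](gtr0_norm h0) -normrM mulrBl divfK ?gt_eqF//.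
  have -> : dpsi t * h - (psi (p i.+1) - psi (p i)) =
      (psi (p i) - psi t - dpsi t * (p i - t)) - (psi (p i.+1) - psi t - dpsi t * (p i.+1 - t)).
    by rewrite pS; ring.
  apply: (le_trans (ler_normB _ _)).
  apply: (@le_trans _ _ (K * h ^+ 2 + K * h ^+ 2)).
    by apply: lerD; [apply: (le_trans A0)|apply: (le_trans A1)]; rewrite ler_wpM2l.
  rewrite (_ : K * h ^+ 2 + K * h ^+ 2 = 2 * K * h * h); last by ring.
  by rewrite ler_wpM2r ?(ltW h0)// ler_wpM2l// mulr_ge0.
have B1 : rnorm (Y1 - \sum_(i < N) (psi (p i.+1) - psi (p i))%:C *: Gam (p i)) <=
    a * (2 * K * B + K) * tau.
  rewrite -lee_fin EFinM -muD.
  have := has_bochner_rnorm_le (mu := mu) (measurable_itv _) (itv0_fin tau) Kb (lexx 0) mg g0 E1.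
  rewrite mul0e adde0; apply.
  apply: aeW => t Dt; rewrite mul0r addr0 rmorphM/= -scalerA.
  apply: (cell_bound t _ (fun i => ((psi (p i.+1) - psi (p i)) / h)%:C *: Gam (p i)) _ Kb) => i iN it ti.
  have /andP[ci ie] := pJ i (ltnW iN); have /andP[ci' ie'] := pJ _ iN.
  have tJ : c <= t <= e by rewrite (le_trans ci it) (le_trans (ltW ti) ie').
  set q := _ / h.
  have -> : (dpsi t)%:C *: Gam t - q%:C *: Gam (p i) =
      (dpsi t)%:C *: (Gam t - Gam (p i)) + (dpsi t - q)%:C *: Gam (p i).
    by rewrite scalerBr rmorphB/= scalerBl addrA subrK.
  apply: (le_trans (ler_rnormD _ _)); rewrite !rnormZr mulrDr addrC [a * K]mulrC.
  have -> : a * (2 * K * B) = 2 * K * a * B by ring.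
  have [_ _ dK] := psi_taylor tJ tJ.
  apply: lerD; apply: ler_pM; rewrite ?normr_ge0 ?rnorm_ge0//.
  - exact: slope.
  - by apply: GamB; exact: pJ (ltnW iN).
  - apply: rP => //; first by case/andP: tJ.
    by apply: lt_trans hr; rewrite ltrBlDl -pS.
have B2 : rnorm (Y2 - \sum_(i < N) (psi (p i.+1))%:C *: (Gam (p i.+1) - Gam (p i))) <=
    K * a * M.
  rewrite -lee_fin EFinM -ig.
  have := has_bochner_rnorm_le (mu := mu) (measurable_itv _) (itv0_fin tau) (lexx 0) Ka mg g0 E2.
  rewrite mul0e add0e; apply.
  apply: filterS kg => t kt Dt; rewrite add0r rmorphM/= -scalerA.
  apply: (cell_bound t _ (fun i => (psi (p i.+1))%:C *: k t)); first by rewrite mulr_ge0.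
  move=> i iN it ti.
  have /andP[ci ie] := pJ i (ltnW iN); have /andP[ci' ie'] := pJ _ iN.
  have tJ : c <= t <= e by rewrite (le_trans ci it) (le_trans (ltW ti) ie').
  rewrite -scalerBl -raddfB rnormZr kt// ler_wpM2r//.
  have [_ A _] := psi_taylor (pJ _ iN) tJ; apply: (le_trans A); rewrite ler_wpM2l//.
  apply: le_trans ha; rewrite distrC ger0_norm ?subr_ge0 ?(ltW ti)//.
  by rewrite lerBlDr pS [p i + h]addrC lerD2l.
set S1 := \sum_(i < N) (_ - _)%:C *: _ in B1 zero.
set S2 := \sum_(i < N) _%:C *: (_ - _) in B2 zero.
have -> : Y1 + Y2 = (Y1 - S1) + (Y2 - S2).
  by rewrite addrACA -opprD zero oppr0 addr0.
apply: (le_trans (ler_rnormD _ _)); apply: (le_trans (lerD B1 B2)).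
by rewrite le_eqVlt; apply/orP; left; apply/eqP; ring.
Qed.

End weak_primitive.

Section C2_functions.
Context (R : realType).

Lemma derivable_cont (g dg : R -> R) : (forall x : R, is_derive x 1 g (dg x)) -> continuous g.
Proof.
by move=> h x; apply: differentiable_continuous; apply/derivable1_diffP; case: (h x).
Qed.

Lemma continuous_bounded (g : R -> R) (a b : R) : a <= b -> continuous g ->
  exists2 M : R, 0 <= M & forall t : R, a <= t <= b -> `|g t| <= M.
Proof.
move=> ab cg; have cn : {within `[a, b], continuous (fun t => `|g t|)}.
  by apply: continuous_subspaceT => t; apply: continuous_comp; [exact: cg|exact: norm_continuous].
have [c _ cM] := EVT_max ab cn.
by exists `|g c| => // t tab; apply: cM; rewrite in_itv.
Qed.

Lemma MVT_sym (g dg : R -> R) (a b s t : R) : (forall x : R, is_derive x 1 g (dg x)) ->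
  a <= s <= b -> a <= t <= b ->
  exists x : R, [/\ a <= x <= b, `|x - s| <= `|t - s| & g t - g s = dg x * (t - s)].
Proof.
move=> hg /andP[as_ sb] /andP[at_ tb].
have cg A : {within A, continuous g} by apply: continuous_subspaceT; exact: derivable_cont hg.
have [st|/ltW ts] := leP s t.
  have [x] := MVT_segment st (fun x _ => hg x) (cg _).
  rewrite in_itv/= => /andP[sx xt] e; exists x; rewrite (le_trans as_ sx) (le_trans xt tb) e; split => //.
  by rewrite !ger0_norm ?subr_ge0// lerD2r.
have [x] := MVT_segment ts (fun x _ => hg x) (cg _).
rewrite in_itv/= => /andP[tx xs] e; exists x; rewrite (le_trans at_ tx) (le_trans xs sb); split => //.
  by rewrite !ler0_norm ?subr_le0// lerN2 lerD2r.
by rewrite -opprB e -mulrN opprB.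
Qed.

Lemma C2_taylor (psi dpsi ddpsi : R -> R) (a b : R) : a <= b ->
  (forall x : R, is_derive x 1 psi (dpsi x)) -> (forall x : R, is_derive x 1 dpsi (ddpsi x)) ->
  continuous ddpsi -> exists2 K : R, 0 <= K &
  forall s t : R, a <= s <= b -> a <= t <= b ->
  [/\ `|psi t - psi s - dpsi s * (t - s)| <= K * (t - s) ^+ 2,
      `|psi t - psi s| <= K * `|t - s| & `|dpsi t| <= K].
Proof.
move=> ab h1 h2 c2.
have [K1 K10 K1P] := continuous_bounded ab (derivable_cont h2).
have [K2 K20 K2P] := continuous_bounded ab c2.
exists (K1 + K2); first exact: addr_ge0.
move=> s t sab tab; have [x [xab xs ->]] := MVT_sym h1 sab tab.
have [y [yab _ yE]] := MVT_sym h2 sab xab.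
split.
- rewrite -mulrBl yE !normrM -[(t - s) ^+ 2]real_normK ?num_real// expr2 mulrA ler_wpM2r//.
  apply: ler_pM => //; apply: (le_trans (K2P _ yab)); by rewrite lerDr.
- by rewrite normrM ler_wpM2r//; apply: (le_trans (K1P _ xab)); rewrite lerDl.
- by apply: (le_trans (K1P _ tab)); rewrite lerDl.
Qed.
End C2_functions.

Lemma msg_real (R : realType) (t : R) j : msg t%:C j = (expR (- (t * lam R j)))%:C.
Proof.
rewrite /msg /cexp; have -> : - (t%:C * (lam R j)%:C) = (- (t * lam R j))%:C :> R[i].
  by rewrite -(rmorphM (real_complex R)) -(rmorphN (real_complex R)).
by rewrite /= sin0 cos0 mulr1 mulr0.
Qed.

Section smul.
Context (R : realType) (X : normedModType R[i]).
Local Notation mu := (@lebesgue_measure R).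
Variables (tau : R) (k : R -> X) (psi : R -> R).
Local Notation D := (`]0%R, tau[%classic : set R).
Hypotheses (tau0 : 0 < tau) (cX : seq_complete X) (cpsi : continuous psi).
Hypotheses (sk : strongly_measurable mu D k)
  (ik : (\int[mu]_(t in D) (rnorm (k t))%:E < +oo)%E).

Lemma smul_sm : strongly_measurable mu D (fun t => (psi t)%:C *: k t).
Proof.
have [M M0 Mp] := continuous_bounded (ltW tau0) cpsi.
apply: (@sm_operators _ _ _ _ tau0 (fun t x => (psi t)%:C *: x) M) => //.
- by move=> s _ a x y; rewrite scalerDr !scalerA mulrC.
- by move=> s x /andP[s0 st]; rewrite rnormZr ler_wpM2r ?rnorm_ge0// Mp// s0 ltW.
move=> s x _; apply/cvg_rnormP.
have h : psi t @[t --> s] --> psi s by exact: cpsi.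
have {}h : `|psi t - psi s| @[t --> s] --> (0 : R).
  have h' := cvg_norm (cvgB h (cvg_cst (psi s))); rewrite subrr normr0 in h'; exact: h'.
under eq_fun do rewrite -scalerBl -(rmorphB (real_complex R)) rnormZr mulrC.
exact: cvgMl0.
Qed.

Lemma smul_L1 : (\int[mu]_(t in D) (rnorm ((psi t)%:C *: k t))%:E < +oo)%E.
Proof.
have [M M0 Mp] := continuous_bounded (ltW tau0) cpsi.
have [||g [mg g0 kg]] := @sm_norm _ _ _ _ mu _ _ _ _ sk;
  [exact: measurable_itv|exact: itv0_fin|].
apply: (@le_lt_trans _ _ (\int[mu]_(t in D) (M%:E * (g t)%:E))%E).
  apply: ae_ge0_le_lower_integral => [t _|t _|]; first by rewrite lee_fin rnorm_ge0.
    by rewrite mule_ge0 ?lee_fin.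
  apply: filterS kg => t kt Dt; rewrite -EFinM lee_fin rnormZr kt// ler_wpM2r// Mp//.
  by move: Dt; rewrite /= in_itv/= => /andP[t0 tt]; rewrite !ltW.
rewrite ge0_integralZl ?lee_fin//; last 2 first.
- exact/measurable_EFinP.
- by move=> t _; rewrite lee_fin.
rewrite lte_mul_pinfty ?lee_fin//.
apply: le_lt_trans ik; apply: le_L1 => [//|t|]; first exact: rnorm_ge0.
by apply: filterS kg => t kt Dt; rewrite kt.
Qed.

Lemma smul_has_bochner : exists Y, has_bochner_integral mu D (fun t => (psi t)%:C *: k t) Y.
Proof. by apply: (@has_bochner_exists _ _ _ _ mu); [exact: measurable_itv|exact: itv0_fin|exact: cX|exact: smul_sm|exact: smul_L1]. Qed.

End smul.

(** * The weak time derivative of the mild solution *)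

Section hilbert_max_reg.
Context (R : realType) (X : normedModType R[i]).
Variables (P : nat -> X -> X) (C : R).
Hypothesis (cX : seq_complete X) (dP : decomposition P C) (C0 : 0 <= C).
Hypothesis pyth : forall n x, rnorm (psum P n x) ^+ 2 = \sum_(j < n) rnorm (P j x) ^+ 2.
Local Notation sgR := (fun t : R => sg P t%:C).
Local Notation mu := (@lebesgue_measure R).
Variables (tau : R) (f : R -> X).
Hypotheses (tau0 : 0 < tau) (Lf : LqX mu `]0, tau[ 2 f).
Local Notation D := (`]0%R, tau[%classic : set R).
Local Notation hb := (has_bochner_integral mu D).
Local Notation u := (mild_solution sgR f).
Let fsm : strongly_measurable mu D f. Proof. by case: Lf. Qed.
Let fL1 := f_L1 Lf.

Section mode.
Variables (j : nat) (phi : R -> R) (c e : R).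
Hypotheses (c0 : 0 < c) (ce : c < e) (etau : e < tau).
Hypothesis phi_diff : forall n t, derivable (derive1n n phi) t 1.
Hypothesis phi_supp : forall t, ~~ (c <= t < e) -> phi t = 0 /\ derive1 phi t = 0.
Hypothesis phi_c : phi c = 0.
Local Notation l := (lam R j).
Local Notation w := (fun t => P j (u t)).
Local Notation h := (fun t => P j (f t)).

(** Integrating factor. [Gam] = exp(t l) P j u is a primitive of [k] = exp(s l) P j f, and [psi] =
    phi exp(- t l) compensates, so [weak_primitive] applies to a mode although it is not known to be
    differentiable. *)
Let E (t : R) := expR (- (t * l)).
Let psi t := phi t * E t.
Let dpsi t := (derive1 phi t - l * phi t) * E t.
Let ddpsi t := (derive1n 2 phi t - 2 * l * derive1 phi t + l ^+ 2 * phi t) * E t.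
Let k (s : R) : X := (expR (s * l))%:C *: h s.
Let Gam (t : R) : X := (expR (t * l))%:C *: w t.

Lemma is_derive_derive1n n (t : R) : is_derive t 1 (derive1n n phi) (derive1n n.+1 phi t).
Proof. by split; [exact: phi_diff|rewrite derive1nS derive1E]. Qed.

Let dE (t : R) : is_derive t (1 : R) E (- l * E t).
Proof.
have d1 : is_derive t (1 : R) (fun t : R => - (t * l)) (- l).
  by apply: is_derive_eq; rewrite /GRing.scale/=; ring.
by have := @is_derive1_comp _ _ _ _ _ _ (is_derive_expR _) d1; rewrite mulrC.
Qed.

Lemma psi_taylor : exists2 K : R, 0 <= K & forall s t : R, c <= s <= e -> c <= t <= e ->
  [/\ `|psi t - psi s - dpsi s * (t - s)| <= K * (t - s) ^+ 2,
      `|psi t - psi s| <= K * `|t - s| & `|dpsi t| <= K].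
Proof.
have d0 (t : R) : is_derive t (1 : R) phi (derive1 phi t) := is_derive_derive1n 0 t.
have d1 (t : R) : is_derive t (1 : R) (derive1 phi) (derive1n 2 phi t) := is_derive_derive1n 1 t.
have d2 (t : R) := is_derive_derive1n 2 t.
apply: (@C2_taylor _ psi dpsi ddpsi c e (ltW ce)).
- move=> x; have hM := is_deriveM (d0 x) (dE x); apply: (is_derive_eq hM).
  by rewrite /dpsi /GRing.scale/=; ring.
- move=> x; have dd : is_derive x (1 : R) (fun t => derive1 phi t - l * phi t)
      (derive1n 2 phi x - l * derive1 phi x).
    exact: is_deriveB.
  have hM := is_deriveM dd (dE x); apply: (is_derive_eq hM).
  by rewrite /ddpsi /GRing.scale/=; ring.
move=> x; have c1 := derivable_cont d0; have c2 := derivable_cont d1; have c3 := derivable_cont d2.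
apply: cvgM; last exact: (derivable_cont dE).
by apply: cvgD; [apply: cvgB; [exact: c3|apply: cvgM; [exact: cvg_cst|exact: c2]]|
  apply: cvgM; [exact: cvg_cst|exact: c1]].
Qed.

Let eE (x : R) : expR (x * l) * E x = 1.
Proof. by rewrite /E -expRD subrr expR0. Qed.

Let expl_cont : continuous (fun x : R => expR (x * l)).
Proof.
move=> x; apply: continuous_comp; last exact: continuous_expR.
by apply: cvgM; [exact: cvg_id|exact: cvg_cst].
Qed.

Let hsm : strongly_measurable mu D h.
Proof. exact: (sm_linear (dec_linear dP j) (dec_Pbound dP j) fsm). Qed.

Let hL1 : (\int[mu]_(t in D) (rnorm (h t))%:E < +oo)%E.
Proof.
apply: le_lt_trans fL1; apply: le_L1 => [t|t|]; [exact: rnorm_ge0|exact: rnorm_ge0|].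
by apply: aeW => t _; exact: (rnorm_P_le dP pyth).
Qed.

Let GamP (t : R) : c <= t <= e -> hb (fun s => (\1_(`]0%R, t[%classic : set R) s)%:C *: k s) (Gam t).
Proof.
move=> /andP[ct te]; have t0 : 0 < t := lt_le_trans c0 ct.
have tt : t < tau := le_lt_trans te etau.
apply: (@has_bochner_extend _ _ _ _ mu) => //.
- exact: itv0_fin.
- by move=> s /=; rewrite !in_itv/= => /andP[-> st]; rewrite (lt_trans st).
- exact: smul_sm.
- exact: smul_L1.
have t0t : 0 < t < tau by rewrite t0.
apply: has_bochner_ae (has_bochnerZ (mu := mu) (measurable_itv _) (itv0_fin t) (expR (t * l))%:C
  (mild_P cX dP C0 fsm fL1 j t0t)) _.
apply: aeW => s _; rewrite /k scalerA msg_real -(rmorphM (real_complex R)) -expRD; congr ((expR _)%:C *: _).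
by ring.
Qed.

Let M := fine (\int[mu]_(s in D) (rnorm (f s))%:E).

Let wB (t : R) : c <= t <= e -> rnorm (w t) <= M.
Proof.
move=> /andP[ct te]; apply: (le_trans (rnorm_P_le dP pyth _ _)).
apply: (mild_bound cX dP C0 pyth Lf).
by rewrite /= in_itv/= (lt_le_trans c0 ct) (le_lt_trans te etau).
Qed.

Let M0 : 0 <= M.
Proof. by rewrite fine_ge0// integral_ge0// => s _; rewrite lee_fin rnorm_ge0. Qed.

Let expl_le (t : R) : t <= e -> expR (t * l) <= expR (e * l).
Proof. by move=> te; rewrite ler_expR ler_wpM2r// ltW// lam_gt0. Qed.

Let GamB (t : R) : c <= t <= e -> rnorm (Gam t) <= expR (e * l) * M.
Proof.
move=> te; rewrite /Gam rnormZr ger0_norm ?expR_ge0//.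
by apply: ler_pM; rewrite ?expR_ge0 ?rnorm_ge0 ?expl_le ?wB//; case/andP: te.
Qed.

Let Gam_cont (a : R) : 0 < a -> exists2 r : R, 0 < r &
  forall s t : R, c <= s -> s <= t -> t <= e -> t - s < r -> rnorm (Gam t - Gam s) <= a.
Proof.
move=> a0; have de (x : R) : is_derive x (1 : R) (fun x : R => expR (x * l)) (l * expR (x * l)).
  have d1 : is_derive x (1 : R) (fun t : R => t * l) l.
    by apply: is_derive_eq; rewrite /GRing.scale/=; ring.
  by have := @is_derive1_comp _ _ _ _ _ _ (is_derive_expR _) d1; rewrite mulrC.
pose q := expR (e * l); have q0 : 0 < q := expR_gt0 _.
have l0 : 0 < l := lam_gt0 R j.
have [d d0 dP'] := mild_uniform cX dP C0 pyth Lf j.+1 (divr_gt0 a0 (mulr_gt0 (ltr0n R 2) q0)).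
have Q0 : 0 < 2 * (l * q * (M + 1)) by rewrite !mulr_gt0// ltr_wpDl.
exists (Num.min d (a / (2 * (l * q * (M + 1))))); first by rewrite lt_min d0 divr_gt0.
move=> s t cs st te; rewrite lt_min => /andP[tsd]; rewrite ltr_pdivlMr// => tsa.
have cse : c <= s <= e by rewrite cs (le_trans st te).
have cte : c <= t <= e by rewrite te (le_trans cs st).
have -> : Gam t - Gam s = (expR (t * l))%:C *: (w t - w s) + (expR (t * l) - expR (s * l))%:C *: w s.
  by rewrite /Gam (rmorphB (real_complex R)) scalerBl scalerBr addrA subrK.
apply: (le_trans (ler_rnormD _ _)); rewrite !rnormZr.
have -> : a = q * (a / (2 * q)) + a / 2 by field; rewrite gt_eqF.
apply: lerD.
  apply: ler_pM; rewrite ?normr_ge0 ?rnorm_ge0//.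
    by rewrite ger0_norm ?expR_ge0// expl_le.
  apply/ltW/dP' => //; first exact: lt_le_trans c0 cs.
  exact: le_lt_trans te etau.
have [x [/andP[cx xe] _ ->]] := MVT_sym de cse cte.
rewrite ger0_norm; last by rewrite !mulr_ge0 ?subr_ge0 ?expR_ge0// ltW.
rewrite ler_pdivlMr// mulrC; apply: le_trans (ltW tsa).
rewrite (_ : (t - s) * _ = 2 * (l * q * (t - s) * (M + 1))); last by ring.
rewrite ler_wpM2l//; apply: ler_pM; rewrite ?rnorm_ge0//.
- by rewrite !mulr_ge0 ?subr_ge0 ?expR_ge0// ltW.
- by rewrite ler_wpM2r ?subr_ge0// ler_wpM2l ?(ltW l0)// expl_le.
- by apply: (le_trans (wB cse)); rewrite lerDl.
Qed.

(** With [W] the integral of phi h, that of l phi w is W - Y2. Since dpsi Gam = (phi' - l phi) w and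
    psi k = phi h, [weak_primitive] reads Y1 - (W - Y2) = - W. *)
Lemma mode_weak (Y1 Y2 : X) : hb (fun t => (derive1 phi t)%:C *: w t) Y1 ->
  hb (fun t => (phi t)%:C *: (h t - l%:C *: w t)) Y2 -> Y1 = - Y2.
Proof.
move=> h1 h2; have [K K0 KP] := psi_taylor.
have cphi : continuous phi := derivable_cont (is_derive_derive1n 0).
have [W hW] := smul_has_bochner tau0 cX cphi hsm hL1.
have mD : measurable D by exact: measurable_itv.
have fD := itv0_fin tau.
have hZ := has_bochnerB (mu := mu) mD fD hW h2.
have hV := has_bochnerB (mu := mu) mD fD h1 hZ.
have dom (x : R) : \1_(`[c, e[%classic : set R) x * phi x = phi x /\
    \1_(`[c, e[%classic : set R) x * derive1 phi x = derive1 phi x.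
  rewrite indicE; case: (boolP (x \in _)) => [_|]; first by rewrite !mul1r.
  rewrite notin_setE/= in_itv/= => /negP xn; have [-> ->] := phi_supp xn.
  by rewrite !mulr0.
suff : Y1 - (W - Y2) = - W.
  by move/eqP; rewrite opprB addrA subr_eq addNr addr_eq0 => /eqP.
apply: (@weak_primitive _ _ tau c e K (expR (e * l) * M) k Gam psi dpsi) => //.
- by rewrite mulr_ge0 ?expR_ge0.
- exact: smul_sm.
- exact: smul_L1.
- by rewrite /psi phi_c mul0r.
- have [pe _] : phi e = 0 /\ derive1 phi e = 0 by apply: phi_supp; rewrite ltxx andbF.
  by rewrite /psi pe mul0r.
- apply: has_bochner_ae hV _; apply: aeW => t _; have [p1 p2] := dom t.
  rewrite -scalerBr; have -> : h t - (h t - l%:C *: w t) = l%:C *: w t.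
    by rewrite opprB addrC subrK.
  rewrite scalerA -(rmorphM (real_complex R)) -scalerBl.
  rewrite -(rmorphB (real_complex R)) /Gam scalerA -(rmorphM (real_complex R)).
  congr (_%:C *: _); rewrite /dpsi mulrA mulrBr p2 -mulrA [E t * _]mulrC eE mulr1.
  by rewrite mulrCA p1 mulrC.
- apply: has_bochner_ae hW _; apply: aeW => t _; have [p1 p2] := dom t.
  rewrite /k scalerA -(rmorphM (real_complex R)); congr (_%:C *: _).
  by rewrite /psi mulrA p1 -mulrA [E t * _]mulrC eE mulr1.
Qed.

End mode.
(** The projections commute with Bochner integrals and separate points, so the identity is checked
    mode by mode. *)
Lemma mild_weak_derivative :
  weak_derivative 0 tau u (fun t => f t - A_of sgR (u t)).
Proof.
move=> phi [phid [c1 [e1 [c10 e1tau supp1]]]].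
(* A test function may come with c1 > e1; it then vanishes identically and the degenerate interval
   at [tau / 2] will do. *)
have [c0 [e0 [c00 c0e0 e0tau supp]]] : exists c e : R, [/\ 0 < c, c <= e, e < tau &
    forall t, t \notin `[c, e] -> phi t = 0].
  have [c1e1|e1c1] := leP c1 e1; first by exists c1, e1.
  exists (tau / 2), (tau / 2); rewrite divr_gt0// ltr_pdivrMr// mulr_natr mulr2n ltrDl; split => // t _.
  apply: supp1; rewrite in_itv/=; apply/negP => /andP[a b].
  by have := le_lt_trans (le_trans a b) e1c1; rewrite ltxx.
have phi_diff : forall n (t : R), derivable (derive1n n phi) t 1 := phid.
have dphi n (t : R) := is_derive_derive1n phi_diff n t.
have [_ Lu LA] := mild_LqX cX dP C0 pyth tau0 Lf.
have Lv : LqX mu D 2 (fun t => f t - A_of sgR (u t)) by exact: (LqX_B Lf LA).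
have [smu _] := Lu; have [smv _] := Lv.
have [Y1 h1] := smul_has_bochner tau0 cX (derivable_cont (dphi 1)) smu (f_L1 Lu).
have [Y2 h2] := smul_has_bochner tau0 cX (derivable_cont (dphi 0)) smv (f_L1 Lv).
have mD : measurable D by exact: measurable_itv.
have fD := itv0_fin tau.
rewrite (bochner_integralE (mu := mu) mD fD h1) (bochner_integralE (mu := mu) mD fD h2).
(* A strictly larger interval: every point outside it has a neighbourhood on which [phi] vanishes,
   so the derivative vanishes there too. *)
pose c := c0 / 2; pose e := (e0 + tau) / 2.
have cP : 0 < c < c0 by rewrite divr_gt0//= ltr_pdivrMr// mulr_natr mulr2n ltrDl.
have eP : e0 < e < tau by rewrite ltr_pdivlMr// ltr_pdivrMr// !mulr_natr !mulr2n ltrD2l ltrD2r e0tau.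
have [cp cc0] := andP cP; have [e0e et] := andP eP.
have ce : c < e by rewrite (lt_trans cc0)// (le_lt_trans c0e0).
apply: (dec_sep dP) => j; rewrite -scaleN1r (dec_PZ dP) scaleN1r.
have h1' := has_bochner_linear (mu := mu) mD fD (dec_linear dP j) (dec_Pbound dP j) h1.
have h2' := has_bochner_linear (mu := mu) mD fD (dec_linear dP j) (dec_Pbound dP j) h2.
apply: (@mode_weak j phi c e) => //.
- move=> t tn; have tn' : t < c0 \/ e0 < t.
    by move: tn; rewrite negb_and -ltNge -leNgt => /orP[tc|et']; [left; apply: lt_trans cc0|right; apply: lt_le_trans et'].
  have near0 : \forall s \near t, phi s = 0.
    case: tn' => [tc|et']; [have := lt_nbhsl tc|have := lt_nbhsr et']; apply: filterS => s hs;
      by apply: supp; rewrite in_itv/= negb_and -!ltNge hs ?orbT.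
  split; first exact: (nbhs_singleton near0).
  rewrite derive1E -(derive_cst (0 : R) t (1 : R)); exact: near_eq_derive.
- by apply: supp; rewrite in_itv/= negb_and -ltNge cc0.
- apply: has_bochner_ae h1' _; apply: aeW => t _ /=; by rewrite (dec_PZ dP).
- apply: has_bochner_ae h2' _.
  have [G [_ _ _ uG]] := mild_A cX dP C0 pyth Lf.
  apply: filterS uG => t h Dt; have [y [my _ Ay _]] := h Dt.
  by rewrite /= (dec_PZ dP) (dec_PB dP) Ay my.
Qed.

End hilbert_max_reg.

Theorem hilbert_maximal_regularity (R : realType) (X : normedModType R[i])
    (P : nat -> X -> X) (C : R) : seq_complete X -> decomposition P C -> 0 <= C ->
  (forall n x, rnorm (psum P n x) ^+ 2 = \sum_(j < n) rnorm (P j x) ^+ 2) ->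
  maximal_regularity (fun t : R => sg P t%:C).
Proof.
move=> cX dP C0 pyth; exists 2, 1; split; [by rewrite ltr1n|by []|move=> f Lf].
have [h1 h2 h3] := mild_LqX cX dP C0 pyth ltr01 Lf.
split; last exact: h1.
split; first exact: h2.
exists (fun t => f t - A_of (fun t : R => sg P t%:C) (mild_solution (fun t : R => sg P t%:C) f t)).
  exact: (LqX_B Lf h3).
exact: (mild_weak_derivative cX dP C0 pyth ltr01 Lf).
Qed.

(** * Completeness of the complex Lebesgue spaces *)

Section complex_Lp.
Context d (T : measurableType d) (R : realType).
Variables (mu : {measure set T -> \bar R}) (p : R) (p1 : 1 <= p).
Local Notation Lp := (cLp mu p1).
Implicit Types (f g : T -> R[i]) (x y : Lp).

Definition pint f : \bar R := (\int[mu]_t (rnorm (f t) `^ p)%:E)%E.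

Definition cmeas f := measurable_fun setT (@complex.Re R \o f) /\
  measurable_fun setT (@complex.Im R \o f).

Let p0 : 0 < p. Proof. exact: lt_le_trans p1. Qed.

Lemma pint_ge0 f : (0 <= pint f)%E.
Proof. by apply: integral_ge0 => t _; rewrite lee_fin powR_ge0. Qed.

Lemma cLnormE f : cLnorm mu p f = (pint f `^ p^-1)%E.
Proof.
rewrite /cLnorm unlock; apply: (congr1 (fun z => z `^ p^-1)%E).
by apply: eq_integral => t _; rewrite /= ger0_norm ?rnorm_ge0.
Qed.

Lemma cLfunP f : f \in cLfun mu p <-> cmeas f /\ (pint f < +oo)%E.
Proof.
have h : (cLnorm mu p f < +oo)%E <-> (pint f < +oo)%E.
  rewrite cLnormE; have := pint_ge0 f; case: (pint f) => [r _|_|//].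
    by rewrite poweR_EFin !ltry.
  by rewrite poweRyr ?ltxx// invr_eq0 gt_eqF.
split; first by move=> /asboolP[r i /h].
by move=> [[r i] /h k]; apply/asboolP.
Qed.

Lemma cLp_cmeas x : cmeas x.
Proof. by have /cLfunP[] := cLpP x. Qed.

Lemma cmeasB f g : cmeas f -> cmeas g -> cmeas (fun t => f t - g t).
Proof.
move=> [r1 i1] [r2 i2]; split.
  rewrite (_ : _ \o _ = (@complex.Re R \o f) \- (@complex.Re R \o g)).
    exact: measurable_funB.
  by apply/funext => t /=; rewrite raddfB.
rewrite (_ : _ \o _ = (@complex.Im R \o f) \- (@complex.Im R \o g)).
  exact: measurable_funB.
by apply/funext => t /=; rewrite raddfB.
Qed.

Lemma cmeas_rnorm f : cmeas f -> measurable_fun setT (fun t => rnorm (f t)).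
Proof. by move=> [r i]; exact: measurable_rnorm. Qed.

Lemma rnorm_cLp x : (rnorm x)%:E = cLnorm mu p x.
Proof.
rewrite /rnorm; have -> : `|x| = cLp_norm x by [].
by rewrite /cLp_norm/= fineK// cLnorm_fin.
Qed.

Lemma pint_cLp x : pint x = (rnorm x `^ p)%:E.
Proof.
rewrite -poweR_EFin rnorm_cLp cLnormE -poweRrM mulVf ?gt_eqF// poweRe1//.
exact: pint_ge0.
Qed.

Lemma le_pint f g : {ae mu, forall t, rnorm (f t) <= rnorm (g t)} -> (pint f <= pint g)%E.
Proof.
move=> h; apply: ae_ge0_le_lower_integral => [t _|t _|]; [by rewrite lee_fin powR_ge0|by rewrite lee_fin powR_ge0|].
apply: filterS h => t h _; rewrite lee_fin; apply: ge0_ler_powR; rewrite ?nnegrE ?rnorm_ge0//.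
exact: ltW.
Qed.

Lemma eq_pint f g : f = g %[ae mu] -> pint f = pint g.
Proof.
move=> fg; apply/eqP; rewrite eq_le; apply/andP; split; apply: le_pint;
  by apply: filterS fg => t /(_ I) ->.
Qed.

Lemma rnorm_le_pint x (r : R) : 0 <= r -> (pint x <= (r `^ p)%:E)%E -> rnorm x <= r.
Proof.
move=> r0; rewrite pint_cLp lee_fin; apply: contra_le => rx.
by apply: gt0_ltr_powR => //; rewrite nnegrE ?rnorm_ge0.
Qed.

Lemma exists_cLp f : cmeas f -> (pint f < +oo)%E -> exists x : Lp, x = f %[ae mu].
Proof.
move=> mf pf; have fL : f \in cLfun mu p by apply/cLfunP.
exists (cLp_of (exist _ f fL : cLfunType mu p1)); exact: cLp_ofE.
Qed.

Lemma cLpB x y : (x - y : Lp) = (fun t => x t - y t) %[ae mu].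
Proof.
move: (cLpD x (- y)) (cLp_oppE y); apply: filterS2 => t e1 e2 _.
rewrite e1//; congr (_ + _); exact: e2.
Qed.

End complex_Lp.

Lemma cvg_geometric_steps (R : realType) (a : nat -> R) (B : R) : 0 <= B ->
  (forall k, `|a k.+1 - a k| <= B * 2 ^- k) ->
  exists2 l : R, a n @[n --> \oo] --> l & forall k, `|l - a k| <= 2 * B * 2 ^- k.
Proof.
move=> B0 aB.
have step k m : `|a (k + m)%N - a k| <= 2 * B * 2 ^- k * (1 - 2 ^- m).
  elim: m => [|m IH]; first by rewrite addn0 subrr normr0 expr0 invr1 subrr mulr0.
  rewrite addnS -[a (k + m).+1](subrK (a (k + m)%N)) -addrA.
  apply: (le_trans (ler_normD _ _)); apply: (le_trans (lerD (aB _) IH)).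
  rewrite exprD exprS !invfM -subr_ge0 le_eqVlt; apply/orP; left; apply/eqP.
  by field; rewrite !expf_neq0.
have le2 k m : `|a (k + m)%N - a k| <= 2 * B * 2 ^- k.
  apply: (le_trans (step k m)); apply: ler_piMr; first by rewrite !mulr_ge0// invr_ge0 exprn_ge0.
  by rewrite lerBlDr lerDl invr_ge0 exprn_ge0.
have : cvg (a n @[n --> \oo]).
  have ct : cvgn (series (telescope a)).
    apply: normed_cvg; apply: (@series_le_cvg _ _ (geometric B 2^-1)) => [n|n|n|].
    - exact: normr_ge0.
    - by rewrite /geometric/= mulr_ge0// exprn_ge0// invr_ge0.
    - by rewrite /geometric/= exprVn; exact: aB.
    by apply: is_cvg_geometric_series; rewrite ger0_norm ?invr_ge0// invf_lt1// ltr1n.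
  have -> : a = (fun n => a 0 + series (telescope a) n) by apply/funext => n; exact: eq_sum_telescope.
  by apply: is_cvgD => //; exact: is_cvg_cst.
move=> /cvg_ex[l al]; exists l => // k.
have h : `|a (n + k)%N - a k| @[n --> \oo] --> `|l - a k|.
  apply: cvg_norm; apply: cvgB; last exact: cvg_cst.
  by rewrite (cvg_shiftn k a).
apply: (cvgr_to_le h).
by apply: nearW => n; rewrite addnC; exact: le2.
Qed.

Section riesz_fischer.
Context d (T : measurableType d) (R : realType).
Variables (mu : {measure set T -> \bar R}) (p : R) (p1 : 1 <= p).
Local Notation Lp := (cLp mu p1).

Let p0 : 0 < p. Proof. exact: lt_le_trans p1. Qed.

Lemma ler_powR_inj (a b : R) : 0 <= a -> 0 <= b -> a `^ p <= b `^ p -> a <= b.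
Proof.
move=> a0 b0; apply: contra_le => ba; apply: gt0_ltr_powR => //.
Qed.

(** Of the rate 4^-k a factor 2^-k pays for the summability of the p-th powers of 2^k |v_k+1 - v_k|;
    where their sum [S] is finite, the increments are at most S^(1/p) 2^-k, and the sequence
    converges pointwise with a rate. *)
Lemma riesz_fischer_fast (v : nat -> Lp) : (forall k, rnorm (v k.+1 - v k) <= 4 ^- k) ->
  exists x : Lp, v k @[k --> \oo] --> x.
Proof.
move=> hv; pose g k t := rnorm (v k.+1 t - v k t).
have cm k : cmeas (fun t => v k.+1 t - v k t).
  by apply: cmeasB; exact: cLp_cmeas.
pose a k t : \bar R := ((2 ^+ k * g k t) `^ p)%:E.
have a0 k t : (0 <= a k t)%E by rewrite lee_fin powR_ge0.
have ma k : measurable_fun setT (a k).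
  apply/measurable_EFinP; apply: (measurableT_comp (measurable_powR _)).
  by apply: measurable_funM => //; exact: cmeas_rnorm.
pose S t := (\sum_(k <oo) a k t)%E.
have S0 t : (0 <= S t)%E by apply: nneseries_ge0.
have mS : measurable_fun setT S by apply: ge0_emeasurable_sum.
have intS : (\int[mu]_t S t <= 2%:E)%E.
  rewrite integral_nneseries//.
  apply: (@le_trans _ _ (\sum_(k <oo) (2 ^- k)%:E)%E).
    apply: lee_nneseries => [k _ _|k _]; first by apply: integral_ge0 => t _; exact: a0.
    under eq_integral do rewrite /a powRM ?rnorm_ge0// EFinM.
    rewrite ge0_integralZl//; last 2 first.
    - by apply/measurable_EFinP; apply: (measurableT_comp (measurable_powR _)); exact: (cmeas_rnorm (cm k)).
    - by move=> *; rewrite lee_fin powR_ge0.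
    have -> : (\int[mu]_t (g k t `^ p)%:E = pint mu p ((v k.+1 - v k)%R : Lp))%E.
      by apply/esym/(eq_pint p1)/cLpB.
    rewrite pint_cLp -EFinM lee_fin -powRM ?rnorm_ge0//.
    apply: (@le_trans _ _ ((2 ^- k) `^ p)).
      apply: ge0_ler_powR; rewrite ?nnegrE ?(ltW p0) ?mulr_ge0 ?rnorm_ge0 ?invr_ge0 ?exprn_ge0//.
      rewrite -ler_pdivlMl ?exprn_gt0// (le_trans (hv k))// -invfM -exprMn.
      by rewrite (_ : 2 * 2 = 4 :> R)//; ring.
    have h0 : 0 < 2 ^- k :> R by rewrite invr_gt0 exprn_gt0.
    have h1 : 2 ^- k <= 1 :> R by rewrite invf_le1 ?exprn_gt0// exprn_ege1// ler1n.
    rewrite -[leRHS]powRr1 ?(ltW h0)//.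
    by rewrite /powR gt_eqF// ler_expR ler_wnM2r// ln_le0.
  apply: lime_le; first by apply: is_cvg_nneseries => k _ _; rewrite lee_fin.
  apply: nearW => n; rewrite sumEFin lee_fin big_mkord.
  suff -> : \sum_(i < n) 2 ^- i = 2 - 2 * 2 ^- n :> R.
    by rewrite lerBlDr lerDl mulr_ge0// invr_ge0 exprn_ge0.
  elim: n => [|n IH]; first by rewrite big_ord0 expr0 invr1 mulr1 subrr.
  by rewrite big_ord_recr/= IH exprS invfM; field; rewrite expf_neq0.
have : {ae mu, forall t, setT t -> S t \is a fin_num}.
  apply: integrable_ae => //; apply/integrableP; split => //.
  under eq_integral do rewrite gee0_abs//.
  by apply: le_lt_trans intS _; rewrite ltry.
move=> [N [mN N0 NP]].
pose B t := fine (S t) `^ p^-1.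
have B0 t : 0 <= B t by exact: powR_ge0.
have gB k t : ~ N t -> g k t <= B t * 2 ^- k.
  move=> Nt; have fS : S t \is a fin_num by apply: contrapT => h; apply: Nt; apply: NP => /(_ I).
  rewrite ler_pdivlMr ?exprn_gt0// mulrC; apply: ler_powR_inj => //.
    by rewrite mulr_ge0 ?rnorm_ge0 ?exprn_ge0.
  rewrite /B -powRrM mulVf ?gt_eqF// powRr1 ?fine_ge0//.
  rewrite -lee_fin fineK//.
  apply: le_trans (nneseries_lim_ge k.+1 (fun k _ _ => a0 k t)).
  by rewrite big_nat_recr//= leeDr// sume_ge0.
(* Zero on the null set, so that the limit exists at every point and is measurable. *)
pose w k t : R[i] := if t \in N then 0 else v k t.
have wB k t : rnorm (w k.+1 t - w k t) <= B t * 2 ^- k.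
  rewrite /w; case: ifPn => [_|]; first by rewrite subrr rnorm0 mulr_ge0// invr_ge0 exprn_ge0.
  by rewrite notin_setE => /(gB k).
have /choice[f fP] t : exists z : R[i], [/\ complex.Re (w n t) @[n --> \oo] --> complex.Re z,
    complex.Im (w n t) @[n --> \oo] --> complex.Im z &
    forall k, rnorm (z - w k t) <= 4 * B t * 2 ^- k].
  have [|r rl rB] := @cvg_geometric_steps R (fun n => complex.Re (w n t)) (B t) (B0 t).
    move=> k; apply: le_trans (wB k t); rewrite -raddfB; exact: normRe_le.
  have [|i il iB] := @cvg_geometric_steps R (fun n => complex.Im (w n t)) (B t) (B0 t).
    move=> k; apply: le_trans (wB k t); rewrite -raddfB; exact: normIm_le.
  exists (r +i* i); split => // k; apply: (le_trans (rnormc_le _)).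
  rewrite !raddfB/=; apply: (le_trans (lerD (rB k) (iB k))).
  by rewrite le_eqVlt; apply/orP; left; apply/eqP; ring.
have cw k : cmeas (w k).
  have [r1 i1] := cLp_cmeas (v k); have mN' : measurable (~` N) by exact: measurableC.
  have mI : measurable_fun setT (\1_(~` N) : T -> R) by exact: measurable_indic.
  split.
    rewrite (_ : _ \o _ = (\1_(~` N) \* (@complex.Re R \o v k))); first exact: measurable_funM.
    apply/funext => t; rewrite /w /= indicE in_setC; case: (t \in N); first by rewrite mul0r.
    by rewrite mul1r.
  rewrite (_ : _ \o _ = (\1_(~` N) \* (@complex.Im R \o v k))); first exact: measurable_funM.
  apply/funext => t; rewrite /w /= indicE in_setC; case: (t \in N); first by rewrite mul0r.
  by rewrite mul1r.
have cf : cmeas f.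
  split.
    apply: (@measurable_fun_cvg _ _ _ _ (fun n => @complex.Re R \o w n)) => [n|t _].
      by case: (cw n).
    by case: (fP t).
  apply: (@measurable_fun_cvg _ _ _ _ (fun n => @complex.Im R \o w n)) => [n|t _].
    by case: (cw n).
  by case: (fP t).
have vw k : v k = w k %[ae mu].
  exists N; split => // t /= h; apply: contrapT => Nt; apply: h => _.
  by rewrite /w memNset.
(* The pointwise rate 4 B 2^-k, with B^p = S and an integral of [S] at most 2 <= 2^p, gives 8 *
   2^-k, rounded up to 16 * 2^-k. *)
have intfw k : (pint mu p (fun t => (f t - w k t)%R) <= ((16 * 2 ^- k) `^ p)%:E)%E.
  apply: (@le_trans _ _ (\int[mu]_t (((4 * 2 ^- k) `^ p)%:E * S t))%E).
    apply: ae_ge0_le_lower_integral => [t _|t _|].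
    - by rewrite lee_fin powR_ge0.
    - by rewrite mule_ge0// lee_fin powR_ge0.
    exists N; split => // t /= h; apply: NP => fS; apply: h => _; rewrite -(fineK (fS I)).
    have -> : fine (S t) = B t `^ p by rewrite /B -powRrM mulVf ?gt_eqF// powRr1 ?fine_ge0.
    rewrite -EFinM lee_fin -powRM ?powR_ge0 ?mulr_ge0 ?invr_ge0 ?exprn_ge0//.
    apply: ge0_ler_powR; rewrite ?nnegrE ?(ltW p0) ?rnorm_ge0 ?mulr_ge0 ?invr_ge0 ?exprn_ge0//.
    have [_ _ h'] := fP t; apply: (le_trans (h' k)).
    by rewrite le_eqVlt; apply/orP; left; apply/eqP; ring.
  rewrite ge0_integralZl ?lee_fin ?powR_ge0//.
  apply: (@le_trans _ _ (((4 * 2 ^- k) `^ p)%:E * 2%:E)%E).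
    by rewrite lee_wpmul2l// lee_fin powR_ge0.
  rewrite -EFinM lee_fin -[X in _ * X]powRr1//.
  apply: (@le_trans _ _ ((4 * 2 ^- k) `^ p * 2 `^ p)).
    by rewrite ler_wpM2l ?powR_ge0// ler_powR// ler1n.
  rewrite -powRM ?mulr_ge0 ?invr_ge0 ?exprn_ge0//.
  apply: ge0_ler_powR; rewrite ?nnegrE ?(ltW p0) ?mulr_ge0 ?invr_ge0 ?exprn_ge0//.
  rewrite mulrAC ler_wpM2r ?invr_ge0 ?exprn_ge0//; lra.
have cfw k : cmeas (fun t => f t - w k t) by exact: cmeasB.
have [z0 z0E] : exists z : Lp, z = (fun t => f t - w 0 t) %[ae mu].
  apply: exists_cLp => //; apply: le_lt_trans (intfw 0) _; exact: ltry.
have xE : (z0 + v 0 : Lp) = f %[ae mu].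
  move: (cLpD z0 (v 0)) z0E (vw 0); apply: filterS3 => t e1 e2 e3 _.
  by rewrite e1// e2// e3// subrK.
exists (z0 + v 0); apply: (@rnorm_squeeze _ _ _ _ _ _ _ (fun k => 16 * 2 ^- k)).
  apply: nearW => k; rewrite rnorm_distC; apply: rnorm_le_pint.
    by rewrite mulr_ge0// invr_ge0 exprn_ge0.
  rewrite (eq_pint p1 (g := fun t => f t - w k t)); first exact: intfw.
  move: (cLpB (z0 + v 0) (v k)) xE (vw k); apply: filterS3 => t e1 e2 e3 _.
  by rewrite e1// e2// e3.
apply: cvgMl0.
have := @cvg_geometric R 1 2^-1; rewrite /geometric/=.
under eq_fun do rewrite mul1r exprVn.
by apply; rewrite ger0_norm ?invr_ge0// invf_lt1// ltr1n.
Qed.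

Lemma cLp_complete : seq_complete Lp.
Proof.
move=> u uc; have c4 k : 0 < 4 ^- k :> R by rewrite invr_gt0 exprn_gt0.
have /choice[N NP] k : exists N, forall m n, (N <= m)%N -> (N <= n)%N -> rnorm (u m - u n) < 4 ^- k.
  exact: uc.
(* Summing all thresholds so far makes the subsequence monotone and beyond [N k]; the summand [k]
   sends it to infinity. *)
pose n (k : nat) : nat := (k + \sum_(i < k.+1) N i)%N.
have nN k : (N k <= n k)%N by rewrite /n big_ord_recr/= addnA leq_addl.
have nS k : (n k <= n k.+1)%N by rewrite /n [in leqRHS]big_ord_recr/= leq_add// leq_addr.
have [|x vx] := @riesz_fischer_fast (fun k => u (n k)).
  by move=> k; apply/ltW/NP; [exact: leq_trans (nS k)|exact: nN].
exists x; apply/cvg_rnormP/cvgrPdist_lt => e e0.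
have e2 : 0 < e / 2 by rewrite divr_gt0.
have /cvg_rnormP/cvgrPdist_lt/(_ _ e2)[K1 _ K1P] := vx.
have [K2 K2P] := uc _ e2.
exists K2 => // m /= mK; rewrite sub0r normrN ger0_norm ?rnorm_ge0//.
pose k := maxn K1 K2.
have -> : u m - x = (u m - u (n k)) + (u (n k) - x) by rewrite addrA subrK.
apply: (le_lt_trans (ler_rnormD _ _)); rewrite [ltRHS]splitr; apply: ltrD.
  by apply: K2P => //; rewrite (leq_trans (leq_maxr K1 K2))// leq_addr.
by have := K1P k (leq_maxl _ _); rewrite sub0r normrN ger0_norm ?rnorm_ge0.
Qed.
End riesz_fischer.

(** * Pairings with compactly supported bounded functions *)

Section test_functions.
Context (R : realType).
Local Notation mu := (@lebesgue_measure R).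
Implicit Types (b f g : R -> R).

Definition box (M : R) : set R := `[- M, M[%classic.

(** A single [M] bounds the values and the support: these functions lie in every L^p and pair with
    every locally integrable function, which lets all p be treated with the same functionals. *)
Definition test b := measurable_fun setT b /\
  exists2 M : R, 0 <= M & forall t, `|b t| <= M * \1_(box M) t.

Definition loc_int f := measurable_fun setT f /\
  forall M : R, (\int[mu]_(t in box M) `|f t|%:E < +oo)%E.

Definition rp b f : R := (\int[mu]_t (b t * f t))%R.

Lemma box_fin (M : R) : (mu (box M) < +oo)%E.
Proof.
by rewrite lebesgue_measure_itv/= lte_fin; case: ifP => _ //; rewrite -EFinD ltry.
Qed.

Lemma test_loc_int b : test b -> loc_int b.
Proof.
move=> [mb [M M0 bM]]; split => // N.
apply: (@le_lt_trans _ _ (\int[mu]_(t in box N) (cst M%:E t))%E).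
  apply: ge0_le_integral => //=; first exact: measurable_itv.
  - by apply/measurable_EFinP; apply: measurableT_comp => //; exact: measurable_funTS.
  - move=> t _; rewrite lee_fin (le_trans (bM t))// indicE; case: (_ \in _); rewrite ?mulr1//.
    by rewrite mulr0.
rewrite integral_cst; last exact: measurable_itv.
by rewrite lte_mul_pinfty ?lee_fin// box_fin.
Qed.

Lemma test_integrable b f : test b -> loc_int f ->
  mu.-integrable setT (EFin \o (fun t => b t * f t)).
Proof.
move=> [mb [M M0 bM]] [mf fi]; apply/integrableP; split.
  by apply/measurable_EFinP; exact: measurable_funM.
apply: (@le_lt_trans _ _ (\int[mu]_(t in box M) (M%:E * `|f t|%:E))%E).
  rewrite [leRHS]integral_mkcond; apply: ge0_le_integral => //=.
  - by apply/measurable_EFinP; apply: measurableT_comp => //; exact: measurable_funM.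
  - apply/(measurable_restrictT _ (measurable_itv _)).
    by apply: measurable_funeM; apply/measurable_EFinP; apply: measurableT_comp => //; exact: measurable_funTS.
  - move=> t _; rewrite patchE; have := bM t; rewrite indicE; case: (_ \in _) => bt.
      by rewrite -EFinM lee_fin normrM ler_wpM2r//; rewrite mulr1 in bt.
    by rewrite normrM lee_fin; rewrite mulr0 normr_le0 in bt; rewrite (eqP bt) normr0 mul0r.
rewrite ge0_integralZl ?lee_fin//; first by rewrite lte_mul_pinfty ?lee_fin// fi.
  exact: measurable_itv.
by apply/measurable_EFinP; apply: measurableT_comp => //; exact: measurable_funTS.
Qed.

Lemma loc_intD f g : loc_int f -> loc_int g -> loc_int (fun t => f t + g t).
Proof.
move=> [mf fi] [mg gi]; split => [|M]; first exact: measurable_funD.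
have mB := measurable_itv `[- M, M[ : measurable (box M).
have mf' : measurable_fun (box M) (fun t => `|f t|%:E).
  by apply/measurable_EFinP; apply: measurableT_comp => //; exact: measurable_funTS.
have mg' : measurable_fun (box M) (fun t => `|g t|%:E).
  by apply/measurable_EFinP; apply: measurableT_comp => //; exact: measurable_funTS.
apply: (@le_lt_trans _ _ (\int[mu]_(t in box M) (`|f t|%:E + `|g t|%:E))%E).
  apply: ge0_le_integral => //=.
  - by apply/measurable_EFinP; apply: measurableT_comp => //; apply: measurable_funTS; exact: measurable_funD.
  - exact: emeasurable_funD.
  - by move=> t _; rewrite -EFinD lee_fin ler_normD.
by rewrite ge0_integralD// lte_add_pinfty.
Qed.

Lemma loc_intZ (a : R) f : loc_int f -> loc_int (fun t => a * f t).
Proof.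
move=> [mf fi]; split => [|M]; first exact: measurable_funM.
under eq_integral do rewrite normrM EFinM.
rewrite ge0_integralZl ?lee_fin//; first by rewrite lte_mul_pinfty ?lee_fin// fi.
  exact: measurable_itv.
by apply/measurable_EFinP; apply: measurableT_comp => //; exact: measurable_funTS.
Qed.

Lemma testD b b' : test b -> test b' -> test (fun t => b t + b' t).
Proof.
move=> [mb [M M0 bM]] [mb' [N N0 bN]]; split; first exact: measurable_funD.
exists (M + N); first exact: addr_ge0.
move=> t; apply: (le_trans (ler_normD _ _)); apply: (le_trans (lerD (bM t) (bN t))).
have sub K K' : 0 <= K -> 0 <= K' -> \1_(box K) t <= \1_(box (K + K')) t :> R.
  move=> K0 K'0; rewrite !indicE ler_nat; case: (boolP (t \in box K)) => //.
  rewrite inE /box/= in_itv/= => /andP[h1 h2]; rewrite mem_set//= in_itv/= opprD.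
  by rewrite (le_trans _ h1) ?gerDl ?oppr_le0// (lt_le_trans h2)// lerDl.
rewrite mulrDl; apply: lerD; first by rewrite ler_wpM2l// sub.
by rewrite ler_wpM2l// (addrC M) sub.
Qed.

Lemma testZ (a : R) b : test b -> test (fun t => a * b t).
Proof.
move=> [mb [M M0 bM]]; split; first exact: measurable_funM.
exists (Num.max M (`|a| * M)); first by rewrite le_max M0.
move=> t; rewrite normrM; apply: (@le_trans _ _ (`|a| * (M * \1_(box M) t))); first by rewrite ler_wpM2l.
rewrite mulrA; apply: ler_pM; rewrite ?mulr_ge0//; first by rewrite le_max lexx orbT.
rewrite !indicE ler_nat; case: (boolP (t \in box M)) => //.
rewrite inE /box/= in_itv/= => /andP[h1 h2]; rewrite mem_set//= in_itv/=.
by rewrite (le_trans _ h1) ?lerN2 ?le_max ?lexx// (lt_le_trans h2)// le_max lexx.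
Qed.

Lemma test_indic (a c : R) : test (\1_(`[a, c[%classic : set R)).
Proof.
split; first by apply: measurable_indic; exact: measurable_itv.
have M0 : 0 <= 1 + `|a| + `|c| by rewrite !addr_ge0.
exists (1 + `|a| + `|c|) => // t; rewrite indicE; case: (boolP (t \in _)) => [|_].
  rewrite inE/= in_itv/= => /andP[h1 h2]; rewrite normr1 indicE mem_set ?mulr1.
    by rewrite -addrA lerDl addr_ge0.
  rewrite /box/= in_itv/=; apply/andP; split.
    by rewrite (le_trans _ h1)// lerNl; have := ler_norm (- a); rewrite normrN => h; apply: (le_trans h); rewrite addrAC lerDr addr_ge0.
  by rewrite (lt_le_trans h2)// (le_trans (ler_norm c))// lerDr addr_ge0.
by rewrite normr0 mulr_ge0.
Qed.

Lemma rpDr b f g : test b -> loc_int f -> loc_int g ->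
  rp b (fun t => f t + g t) = rp b f + rp b g.
Proof.
move=> tb lf lg; rewrite /rp -RintegralD//; try exact: test_integrable.
by apply: eq_Rintegral => t _; rewrite mulrDr.
Qed.

Lemma rpDl b b' f : test b -> test b' -> loc_int f ->
  rp (fun t => b t + b' t) f = rp b f + rp b' f.
Proof.
move=> tb tb' lf; rewrite /rp -RintegralD//; try exact: test_integrable.
by apply: eq_Rintegral => t _; rewrite mulrDl.
Qed.

Lemma rpZr b f (a : R) : test b -> loc_int f -> rp b (fun t => a * f t) = a * rp b f.
Proof.
move=> tb lf; rewrite /rp -RintegralZl//; last exact: test_integrable.
by apply: eq_Rintegral => t _; rewrite mulrCA.
Qed.

Lemma rpZl b f (a : R) : test b -> loc_int f -> rp (fun t => a * b t) f = a * rp b f.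
Proof.
move=> tb lf; rewrite /rp -RintegralZl//; last exact: test_integrable.
by apply: eq_Rintegral => t _; rewrite mulrA.
Qed.

Lemma rp_sym b b' : rp b b' = rp b' b.
Proof. by apply: eq_Rintegral => t _; rewrite mulrC. Qed.

Lemma rp_ae b f g : test b -> loc_int f -> loc_int g -> f = g %[ae mu] -> rp b f = rp b g.
Proof.
move=> tb lf lg fg; rewrite /rp /Rintegral; congr fine; apply: ae_eq_integral => //.
- by case/integrableP: (test_integrable tb lf).
- by case/integrableP: (test_integrable tb lg).
by apply: filterS fg => t /(_ I) e _; rewrite e.
Qed.

Lemma rp_indic (a c a' c' : R) : a <= c -> a' <= a -> c <= c' ->
  rp (\1_(`[a, c[%classic : set R)) (\1_(`[a', c'[%classic : set R)) = c - a.
Proof.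
move=> ac a'a cc'; rewrite /rp /Rintegral.
under eq_integral => t _.
  rewrite (_ : \1_(`[a, c[%classic : set R) t * _ = \1_(`[a, c[%classic : set R) t); last first.
    rewrite !indicE; case: (boolP (t \in (`[a, c[%classic : set R))) => [|_]; last by rewrite mul0r.
    rewrite inE/= in_itv/= => /andP[h1 h2]; rewrite mem_set ?mulr1//= in_itv/=.
    by rewrite (le_trans a'a h1) (lt_le_trans h2 cc').
  over.
rewrite integral_indic//.
rewrite setIT; transitivity (fine (mu (`[a, c[%classic : set R))); first by [].
rewrite lebesgue_measure_itv/= lte_fin; move: ac; rewrite le_eqVlt => /orP[/eqP ->|->//].
by rewrite ltxx/= subrr.
Qed.

Lemma rp0 b b' : (forall t, b t * b' t = 0) -> rp b b' = 0.
Proof. by move=> h; rewrite /rp /Rintegral integral0_eq// => t _; rewrite h. Qed.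

End test_functions.

Section pairing.
Context (R : realType).
Local Notation mu := (@lebesgue_measure R).
Implicit Types (b : R -> R) (f g : R -> R[i]).

(** The integral of b f; as [b] is real no conjugation enters, and the pairing is complex linear in
    [f]. *)
Definition pr b f : R[i] := rp b (@complex.Re R \o f) +i* rp b (@complex.Im R \o f).

Definition cloc f := loc_int (@complex.Re R \o f) /\ loc_int (@complex.Im R \o f).

Lemma pr_ae b f g : test b -> cloc f -> cloc g -> f = g %[ae mu] -> pr b f = pr b g.
Proof.
move=> tb [rf if_] [rg ig] fg; congr (_ +i* _); apply: rp_ae => //;
  by apply: filterS fg => t /(_ I) e _ /=; rewrite e.
Qed.

Lemma cloc_real b : test b -> cloc (fun t => (b t)%:C).
Proof.
move=> tb; split; first exact: test_loc_int.
rewrite (_ : _ \o _ = (fun t => 0 * b t)); first by apply: loc_intZ; exact: test_loc_int.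
by apply/funext => t; rewrite mul0r.
Qed.

Lemma pr_real b b' : test b -> test b' -> pr b (fun t => (b' t)%:C) = (rp b b')%:C.
Proof.
move=> tb tb'; rewrite /pr; congr (_ +i* _).
by apply: rp0 => t; rewrite /= mulr0.
Qed.

Lemma prDl b b' f : test b -> test b' -> cloc f -> pr (fun t => b t + b' t) f = pr b f + pr b' f.
Proof. by move=> tb tb' [rf if_]; rewrite /pr !rpDl. Qed.

Lemma prZl (a : R) b f : test b -> cloc f -> pr (fun t => a * b t) f = a%:C * pr b f.
Proof.
move=> tb [rf if_]; rewrite /pr !rpZl//.
by apply/eqP; rewrite eq_complex/= !mul0r subr0 addr0 !eqxx.
Qed.

Lemma prDr b f g : test b -> cloc f -> cloc g -> pr b (fun t => f t + g t) = pr b f + pr b g.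
Proof.
move=> tb [rf if_] [rg ig]; rewrite /pr -[RHS]/((rp b _ + rp b _) +i* (rp b _ + rp b _)) -!rpDr//.
by congr (rp _ _ +i* rp _ _); apply/funext => t /=; rewrite raddfD.
Qed.

Lemma clocZ z f : cloc f -> cloc (fun t => z * f t).
Proof.
move=> [rf if_]; split.
  rewrite (_ : _ \o _ = (fun t => complex.Re z * (@complex.Re R \o f) t + (- complex.Im z) * (@complex.Im R \o f) t)).
    by apply: loc_intD; exact: loc_intZ.
  by apply/funext => t; rewrite /= complex_ReM mulNr.
rewrite (_ : _ \o _ = (fun t => complex.Re z * (@complex.Im R \o f) t + complex.Im z * (@complex.Re R \o f) t)).
  by apply: loc_intD; exact: loc_intZ.
by apply/funext => t; rewrite /= complex_ImM.
Qed.

Lemma clocD f g : cloc f -> cloc g -> cloc (fun t => f t + g t).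
Proof.
move=> [rf if_] [rg ig]; split.
  rewrite (_ : _ \o _ = (fun t => (@complex.Re R \o f) t + (@complex.Re R \o g) t)); first exact: loc_intD.
  by apply/funext => t; rewrite /= raddfD.
rewrite (_ : _ \o _ = (fun t => (@complex.Im R \o f) t + (@complex.Im R \o g) t)); first exact: loc_intD.
by apply/funext => t; rewrite /= raddfD.
Qed.

Lemma prZr b z f : test b -> cloc f -> pr b (fun t => z * f t) = z * pr b f.
Proof.
move=> tb [rf if_]; apply/eqP; rewrite eq_complex complex_ReM complex_ImM /=; apply/andP; split; apply/eqP.
  rewrite -mulNr -!(rpZr _ tb)// -rpDr//; try exact: loc_intZ.
  by congr (rp _ _); apply/funext => t; rewrite /= complex_ReM mulNr.
rewrite -!(rpZr _ tb)// -rpDr//; try exact: loc_intZ.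
by congr (rp _ _); apply/funext => t; rewrite /= complex_ImM.
Qed.

End pairing.

Section pairing_Lp.
Context (R : realType).
Local Notation mu := (@lebesgue_measure R).
Variables (p : R) (p1 : 1 <= p).
Local Notation Lp := (cLp mu p1).
Implicit Types (b : R -> R) (x y : Lp).

Let p0 : 0 < p. Proof. exact: lt_le_trans p1. Qed.

(** An additive form of Hoelder's inequality: for y > t, the factor y^(1-p) is at most t^(1-p). The
    parameter is optimised after integration. *)
Lemma young_split (y t : R) : 0 <= y -> 0 < t -> y <= t + t `^ (1 - p) * y `^ p.
Proof.
move=> y0 t0; have [yt|ty] := leP y t; first by rewrite (le_trans yt)// lerDl mulr_ge0// powR_ge0.
apply: (@le_trans _ _ (t `^ (1 - p) * y `^ p)); last by rewrite lerDr ltW.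
have y0' : 0 < y by exact: lt_trans ty.
rewrite -[y in leLHS]powRr1// -[X in y `^ X](subrK p) powRD; last by apply/implyP => _; rewrite gt_eqF.
rewrite ler_wpM2r ?powR_ge0// /powR !gt_eqF// ler_expR ler_wnM2l ?subr_le0//.
by rewrite ler_ln// ltW.
Qed.

Lemma int_young (E : set R) x (m t A : R) : measurable E -> mu E = m%:E -> 0 < t ->
  (\int[mu]_(s in E) (rnorm (x s) `^ p)%:E <= A%:E)%E ->
  (\int[mu]_(s in E) (rnorm (x s))%:E <= (t * m + t `^ (1 - p) * A)%:E)%E.
Proof.
move=> mE Em t0 EA; have mx := cmeas_rnorm (cLp_cmeas x).
have mxp : measurable_fun E (fun s => (rnorm (x s) `^ p)%:E).
  by apply/measurable_EFinP; apply: measurable_funTS; exact: (measurableT_comp (measurable_powR _)).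
apply: (@le_trans _ _ (\int[mu]_(s in E) (t%:E + (t `^ (1 - p))%:E * (rnorm (x s) `^ p)%:E))%E).
  apply: ge0_le_integral => //=.
  - by move=> s _; rewrite lee_fin rnorm_ge0.
  - by apply/measurable_EFinP; exact: measurable_funTS.
  - by apply: emeasurable_funD => //; exact: measurable_funeM.
  by move=> s _; rewrite -EFinM -EFinD lee_fin young_split// rnorm_ge0.
rewrite ge0_integralD//; last 3 first.
- by move=> s _; rewrite lee_fin ltW.
- by move=> s _; rewrite mule_ge0// lee_fin powR_ge0.
- exact: measurable_funeM.
rewrite [X in (X + _)%E](_ : _ = (t * m)%:E); last first.
  by rewrite integral_cst//; exact: (congr1 (fun z => (t%:E * z)%E) Em).
rewrite EFinD leeD2l// ge0_integralZl ?lee_fin ?powR_ge0//.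
  by rewrite EFinM lee_wpmul2l// lee_fin powR_ge0.
by move=> s _; rewrite lee_fin powR_ge0.
Qed.

Lemma pint_sub (E : set R) x : measurable E ->
  (\int[mu]_(s in E) (rnorm (x s) `^ p)%:E <= (rnorm x `^ p)%:E)%E.
Proof.
move=> mE; rewrite -pint_cLp; apply: ge0_subset_integral => //.
  by apply/measurable_EFinP; apply: (measurableT_comp (measurable_powR _)); exact: (cmeas_rnorm (cLp_cmeas x)).
by move=> s _; rewrite lee_fin powR_ge0.
Qed.

Lemma cLp_cloc x : cloc x.
Proof.
have [rx ix] := cLp_cmeas x.
have h M : (\int[mu]_(s in box M) (rnorm (x s))%:E < +oo)%E.
  have mB : measurable (box M) by exact: measurable_itv.
  have fB : mu (box M) = (fine (mu (box M)))%:E by rewrite fineK// ge0_fin_numE// box_fin.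
  by apply: le_lt_trans (int_young mB fB ltr01 (pint_sub x mB)) _; rewrite ltry.
split; split => // M; apply: le_lt_trans (h M); apply: ge0_le_integral => //=;
  try exact: measurable_itv.
- by apply/measurable_EFinP; apply: measurableT_comp => //; exact: measurable_funTS.
- by apply/measurable_EFinP; apply: measurable_funTS; exact: (cmeas_rnorm (cLp_cmeas x)).
- by move=> t _; rewrite lee_fin normRe_le.
- by apply/measurable_EFinP; apply: measurableT_comp => //; exact: measurable_funTS.
- by apply/measurable_EFinP; apply: measurable_funTS; exact: (cmeas_rnorm (cLp_cmeas x)).
- by move=> t _; rewrite lee_fin normIm_le.
Qed.

Lemma prD b x y : test b -> pr b (x + y : Lp) = pr b x + pr b y.
Proof.
move=> tb; rewrite -prDr//; try exact: cLp_cloc.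
apply: pr_ae => //; [exact: cLp_cloc|by apply: clocD; exact: cLp_cloc|exact: cLpD].
Qed.

Lemma prZ b z x : test b -> pr b (z *: x : Lp) = z * pr b x.
Proof.
move=> tb; rewrite -prZr//; try exact: cLp_cloc.
apply: pr_ae => //; [exact: cLp_cloc|by apply: clocZ; exact: cLp_cloc|exact: cLpZ].
Qed.

(* Junk value [0] unless [b] is in [L^p]; every [test] function is. *)
Definition cl b : Lp := xget 0 [set x : Lp | x = (fun t => (b t)%:C) %[ae mu]].

Lemma test_cLp b : test b -> cmeas (fun t => (b t)%:C) /\ (pint mu p (fun t => (b t)%:C) < +oo)%E.
Proof.
move=> [mb [M M0 bM]]; split.
  split; first exact: mb.
  by rewrite (_ : _ \o _ = cst 0).
apply: (@le_lt_trans _ _ (\int[mu]_t ((M `^ p)%:E * (\1_(box M) t)%:E))%E).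
  apply: ae_ge0_le_lower_integral => [t _|t _|].
  - by rewrite lee_fin powR_ge0.
  - by rewrite mule_ge0// lee_fin powR_ge0.
  apply: aeW => t _; rewrite -EFinM lee_fin rnorm_real; have := bM t; rewrite indicE.
  case: (_ \in _); rewrite ?mulr1 => h.
    by apply: ge0_ler_powR; rewrite ?nnegrE ?(ltW p0).
  by rewrite mulr0 normr_le0 in h; rewrite (eqP h) normr0 powR0 ?gt_eqF// mulr0.
have mB : measurable (box M) by exact: measurable_itv.
rewrite ge0_integralZl ?lee_fin ?powR_ge0//; last first.
  by apply/measurable_EFinP; exact: measurable_indic.
rewrite integral_indic// setIT lte_mul_pinfty ?lee_fin ?powR_ge0//; exact: box_fin.
Qed.

Lemma clE b : test b -> cl b = (fun t => (b t)%:C) %[ae mu].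
Proof.
move=> /test_cLp[mb ib].
by have /(xgetPex 0) := @exists_cLp _ _ R mu p p1 _ mb ib.
Qed.

Lemma pr_cl b b' : test b -> test b' -> pr b (cl b') = (rp b b')%:C.
Proof.
move=> tb tb'; rewrite -pr_real//; apply: pr_ae => //; [exact: cLp_cloc|exact: cloc_real|exact: clE].
Qed.

Lemma clD b b' : test b -> test b' -> cl (fun t => b t + b' t) = cl b + cl b'.
Proof.
move=> tb tb'; apply: cLp_eq; move: (clE (testD tb tb')) (clE tb) (clE tb') (cLpD (cl b) (cl b')).
by apply: filterS4 => t e1 e2 e3 e4 _; rewrite e1// e4// e2// e3// (rmorphD (real_complex R)).
Qed.

Lemma clZ (a : R) b : test b -> cl (fun t => a * b t) = a%:C *: cl b.
Proof.
move=> tb; apply: cLp_eq; move: (clE (testZ a tb)) (clE tb) (cLpZ a%:C (cl b)).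
by apply: filterS3 => t e1 e2 e3 _; rewrite e1// e3// e2// (rmorphM (real_complex R)).
Qed.

(** Hoelder on a set of measure [m]. The parameter t = (A / m)^(1/p) makes the two terms of
    [young_split] equal; with real and imaginary part this gives the constant 4. For A = 0 that
    parameter would be 0, so there it is sent to 0 instead. *)
Lemma pr_bound b (E : set R) x (m A : R) : test b -> measurable E -> mu E = m%:E -> 0 < m ->
  (forall t, `|b t| <= \1_E t) -> 0 <= A ->
  (\int[mu]_(s in E) (rnorm (x s) `^ p)%:E <= A%:E)%E ->
  rnorm (pr b x) <= 4 * m * (A / m) `^ p^-1.
Proof.
move=> tb mE Em m0 bE A0 EA.
have mx : measurable_fun E (fun s => (rnorm (x s))%:E).
  by apply/measurable_EFinP; apply: measurable_funTS; exact: (cmeas_rnorm (cLp_cmeas x)).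
have half (h : R -> R) : loc_int h -> (forall t, `|h t| <= rnorm (x t)) ->
    (`|rp b h|%:E <= \int[mu]_(s in E) (rnorm (x s))%:E)%E.
  move=> lh hx; have ih := test_integrable tb lh.
  apply: (@le_trans _ _ (\int[mu]_t `|(b t * h t)%:E|)%E).
    rewrite /rp EFin_normr_Rintegral//; exact: le_abse_integral (measurable_int _ ih).
  rewrite [leRHS]integral_mkcond; apply: ge0_le_integral => //.
  - by apply: measurableT_comp => //; exact: measurable_int ih.
  - exact/(measurable_restrictT _ mE).
  move=> t _; rewrite patchE; have := bE t; rewrite indicE; case: (_ \in _) => bt.
    by rewrite lee_fin normrM -[leRHS]mul1r ler_pM.
  by rewrite normr_le0 in bt; rewrite (eqP bt) mul0r abse0.
have key t : 0 < t -> rnorm (pr b x) <= 2 * (t * m + t `^ (1 - p) * A).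
  move=> t0; apply: (le_trans (rnormc_le _)); rewrite mulr_natl mulr2n.
  have [lr li] := cLp_cloc x; have yx := int_young mE Em t0 EA.
  by apply: lerD; rewrite -lee_fin; apply: (le_trans (half _ _ _) yx) => //= s; [exact: normRe_le|exact: normIm_le].
have [A00|A0'] := eqVneq A 0.
  rewrite A00 mul0r powR0 ?invr_eq0 ?gt_eqF// mulr0; apply/ler_addgt0Pr => e e0.
  have e0' : 0 < e / (2 * m) by rewrite divr_gt0// mulr_gt0.
  apply: (le_trans (key _ e0')); rewrite A00 mulr0 addr0 add0r.
  by rewrite (_ : 2 * _ = e)//; field; rewrite gt_eqF.
have q0 : 0 < A / m by rewrite divr_gt0// lt_neqAle eq_sym A0'.
have s0 : 0 < (A / m) `^ p^-1 by exact: powR_gt0.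
apply: (le_trans (key _ s0)); rewrite -powRrM.
have -> : (A / m) `^ (p^-1 * (1 - p)) * A = (A / m) `^ p^-1 * m.
  rewrite (_ : p^-1 * (1 - p) = p^-1 + - 1); last by field; rewrite gt_eqF.
  rewrite powRD; last by apply/implyP => _; rewrite gt_eqF.
  rewrite powRN powRr1 ?(ltW q0)// -mulrA; congr (_ * _).
  by rewrite invf_div divfK.
by rewrite le_eqVlt; apply/orP; left; apply/eqP; ring.
Qed.

End pairing_Lp.

(** * Dyadic cells, Rademacher functions and translates *)

Section dyadic.
Context (R : realType).
Implicit Types (K k i : nat) (t s : R) (g : R -> R).

Lemma le_truncn (m : nat) (z : R) : 0 <= z -> (m <= Num.truncn z)%N = (m%:R <= z).
Proof.
move=> z0; have /andP[h1 h2] := truncn_itv z0; apply/idP/idP => h.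
  by rewrite (le_trans _ h1)// ler_nat.
by rewrite -ltnS -(ltr_nat R); exact: le_lt_trans h2.
Qed.

(** Cells of length 2^-K, numbered from the left end - K of the box [-K, K). To the left of the box
    the truncation returns 0, so the number is meaningful only under [inbox]. *)
Definition idx K t : nat := Num.truncn ((t + K%:R) * 2 ^+ K).

Definition ncell K : nat := (K.*2 * 2 ^ K)%N.

Definition cpt K i : R := i%:R / 2 ^+ K - K%:R.

Definition cellb K i : R -> R := \1_(`[cpt K i, cpt K i.+1[%classic).

Definition inbox K t : bool := - K%:R <= t < K%:R.

Lemma pow2_gt0 K : 0 < 2 ^+ K :> R. Proof. by rewrite exprn_gt0. Qed.

Lemma cptS K i : cpt K i.+1 = cpt K i + 2 ^- K.
Proof. by rewrite /cpt -[i.+1]addn1 natrD mulrDl mul1r addrAC. Qed.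

Lemma cpt_le K i : cpt K i <= cpt K i.+1.
Proof. by rewrite cptS lerDl invr_ge0 ltW// pow2_gt0. Qed.

Lemma idx_thr K (m : nat) t : - K%:R <= t -> (m <= idx K t)%N = (cpt K m <= t).
Proof.
move=> Kt; rewrite /idx le_truncn; last first.
  by rewrite mulr_ge0 ?(ltW (pow2_gt0 K))// -lerBlDr sub0r.
by rewrite /cpt lerBlDr ler_pdivrMr// pow2_gt0.
Qed.

Lemma idx_thr_lt K (m : nat) t : - K%:R <= t -> (idx K t < m)%N = (t < cpt K m).
Proof. by move=> Kt; rewrite ltnNge idx_thr// -ltNge. Qed.

Lemma cpt0 K : cpt K 0 = - K%:R.
Proof. by rewrite /cpt mul0r add0r. Qed.

Lemma cpt_mul K (m : nat) : cpt K (m * 2 ^ K) = m%:R - K%:R.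
Proof. by rewrite /cpt natrM natrX mulfK// gt_eqF// pow2_gt0. Qed.

Lemma cpt_ncell K : cpt K (ncell K) = K%:R.
Proof. by rewrite /ncell cpt_mul -addnn natrD addrK. Qed.

Lemma cpt_mono K i i' : (i <= i')%N -> cpt K i <= cpt K i'.
Proof. by move=> ii; rewrite /cpt lerD2r ler_pM2r ?invr_gt0 ?pow2_gt0// ler_nat. Qed.

Lemma cellbE K i t : (i < ncell K)%N -> cellb K i t = (inbox K t && (idx K t == i))%:R.
Proof.
move=> iN; rewrite /cellb indicE; congr (_%:R).
have -> : (t \in (`[cpt K i, cpt K i.+1[%classic : set R)) = (cpt K i <= t < cpt K i.+1).
  by apply/idP/idP; rewrite inE/= in_itv.
have [Kt|tK] := leP (- K%:R) t.
  rewrite -idx_thr// -idx_thr_lt// ltnS -eqn_leq eq_sym /inbox Kt/=.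
  rewrite -[X in _ < X]cpt_ncell -idx_thr_lt//.
  by case: eqP => [->|]; rewrite ?iN// andbF.
have -> : (cpt K i <= t) = false.
  by apply/negbTE; rewrite -ltNge (lt_le_trans tK)// -cpt0 cpt_mono.
by rewrite /inbox leNgt tK.
Qed.

Lemma inboxS K t : inbox K t -> inbox K.+1 t.
Proof.
move=> /andP[h1 h2]; apply/andP; split.
  by rewrite (le_trans _ h1)// lerN2 ler_nat.
by rewrite (lt_le_trans h2)// ler_nat.
Qed.

Lemma idx_lt K t : inbox K t -> (idx K t < ncell K)%N.
Proof. by move=> /andP[h1 h2]; rewrite idx_thr_lt// cpt_ncell. Qed.

(** Each coarse cell splits into two fine ones, and the finer box starts one unit, that is
    [2 ^ K.+1] fine cells, further to the left. *)
Lemma cptD2 K i : cpt K.+1 (i.*2 + 2 ^ K.+1) = cpt K i.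
Proof.
rewrite /cpt natrD natrX -muln2 natrM exprS -[K.+1]addn1 natrD.
by field; rewrite gt_eqF// pow2_gt0.
Qed.

Lemma inbox_idx K t : inbox K.+1 t ->
  inbox K t = (2 ^ K.+1 <= idx K.+1 t < (ncell K).*2 + 2 ^ K.+1)%N.
Proof.
move=> /andP[h1 _]; rewrite idx_thr// idx_thr_lt// cptD2 cpt_ncell.
by rewrite -[X in cpt _ X]add0n -[X in cpt _ (X + _)]double0 cptD2 cpt0.
Qed.

Lemma idxS K t : inbox K t -> idx K t = ((idx K.+1 t - 2 ^ K.+1)./2)%N.
Proof.
move=> bt; have /andP[h1 _] := bt; have /andP[h2 _] := inboxS bt.
have := inbox_idx (inboxS bt); rewrite bt => /esym/andP[le2 _].
apply/eqP; rewrite eqn_leq; apply/andP; split.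
  have := leqnn (idx K t); rewrite idx_thr// -cptD2 -idx_thr//.
  by move: (2 ^ K.+1)%N (idx K.+1 t) (idx K t) le2 => x y z; lia.
rewrite idx_thr// -cptD2 -idx_thr//.
by move: (2 ^ K.+1)%N (idx K.+1 t) le2 => x y; lia.
Qed.

(** The range of the averaging operator of level [K] within the test functions. *)
Definition lev K g := [/\ test g, forall t, ~~ inbox K t -> g t = 0 &
  forall s t, inbox K s -> inbox K t -> idx K s = idx K t -> g s = g t].

Lemma levS K g : lev K g -> lev K.+1 g.
Proof.
move=> [tg g0 gc]; split => // [t tn|s t bs bt st].
  by apply: g0; apply: contra tn; exact: inboxS.
have bst : inbox K s = inbox K t by rewrite (inbox_idx bs) (inbox_idx bt) st.
have [bt'|bt'] := boolP (inbox K t); last by rewrite !g0// bst.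
have bs' : inbox K s by rewrite bst.
by apply: gc => //; rewrite (idxS bs') (idxS bt') st.
Qed.

Lemma lev_le K K' g : (K <= K')%N -> lev K g -> lev K' g.
Proof.
move=> /subnK <-; elim: (K' - K)%N => [//|n IH] h; rewrite addSn; exact/levS/IH.
Qed.

Lemma test_cellb K i : test (cellb K i).
Proof. exact: test_indic. Qed.

Lemma lev_cellb K i : (i < ncell K)%N -> lev K (cellb K i).
Proof.
move=> iN; split; first exact: test_cellb.
  by move=> t bt; rewrite cellbE// (negbTE bt).
by move=> s t bs bt st; rewrite !cellbE// bs bt st.
Qed.

Lemma rp_cellb K i : rp (cellb K i) (cellb K i) = 2 ^- K.
Proof. by rewrite /cellb rp_indic ?cpt_le// cptS addrAC subrr add0r. Qed.

(** Averaging on the cells, [2 ^+ K] being the inverse of their length. This version on real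
    functions gives, with [WR], the transposes of the operators on L^p. *)
Definition FR K g t : R := \sum_(i < ncell K) 2 ^+ K * rp (cellb K i) g * cellb K i t.

Lemma FR_lev K g : lev K g -> FR K g = g.
Proof.
move=> [tg g0 gc]; apply/funext => t; rewrite /FR.
have [bt|bt] := boolP (inbox K t); last first.
  by rewrite g0// big1// => i _; rewrite cellbE// (negbTE bt) mulr0.
rewrite (bigD1 (Ordinal (idx_lt bt)))//= big1 ?addr0 => [|i ii]; last first.
  rewrite cellbE// bt/=; case: eqP => [it|_]; last by rewrite mulr0.
  by move: ii; rewrite -val_eqE/= it eqxx.
rewrite cellbE ?idx_lt// bt eqxx mulr1.
have -> : rp (cellb K (idx K t)) g = rp (cellb K (idx K t)) (fun s => g t * cellb K (idx K t) s).
  apply: eq_Rintegral => s _; rewrite cellbE ?idx_lt//.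
  case: (boolP (inbox K s)) => bs; last by rewrite !mul0r.
  case: eqP => [st|_]; last by rewrite !mul0r.
  by rewrite /= mulr1 !mul1r; exact: gc.
rewrite rpZr ?rp_cellb; [|exact: test_cellb|exact/test_loc_int/test_cellb].
by rewrite mulrCA divff ?mulr1// gt_eqF// pow2_gt0.
Qed.

Definition dl k : R -> R := \1_(`[k%:R, k.+1%:R[%classic).

Definition neg1 : R -> R := \1_(`[-1, 0[%classic).

(* [idx k.+1 t] numbers the dyadic cell of length 2^-(k+1) containing [t], so [rd k] is a
   Rademacher function on [-1, 0). *)
Definition rd k t : R := neg1 t * (-1) ^+ idx k.+1 t.

(* [dl k] vanishes on [-k, k) and [rd k] has mean zero on the cells of length 2^-k, so the
   k-th conditional expectation [FR k] kills [w k]: this makes the [SR n] an increasing family. *)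
Definition w k t : R := dl k t + rd k t.

Lemma neg1E t : neg1 t = (-1 <= t < 0)%R%:R.
Proof.
rewrite /neg1 indicE (_ : (t \in _) = (-1 <= t < 0)%R)//.
by apply/idP/idP; rewrite inE/= in_itv.
Qed.

Lemma dlE k t : dl k t = (k%:R <= t < k.+1%:R)%R%:R.
Proof.
rewrite /dl indicE (_ : (t \in _) = (k%:R <= t < k.+1%:R)%R)//.
by apply/idP/idP; rewrite inE/= in_itv.
Qed.

Lemma neg1_inbox k t : -1 <= t < 0 -> inbox k.+1 t.
Proof.
move=> /andP[h1 h2]; apply/andP; split; first by rewrite (le_trans _ h1)// lerN2 ler1n.
by rewrite (lt_le_trans h2).
Qed.

Lemma neg1_idx k t : inbox k.+1 t ->
  (-1 <= t < 0) = (k * 2 ^ k.+1 <= idx k.+1 t < k.+1 * 2 ^ k.+1)%N.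
Proof.
move=> /andP[h1 _]; rewrite idx_thr// idx_thr_lt// !cpt_mul subrr.
by rewrite -[k.+1]addn1 natrD opprD addrA subrr add0r.
Qed.

Lemma dl_idx k t : inbox k.+1 t ->
  (k%:R <= t < k.+1%:R) = ((k.*2.+1) * 2 ^ k.+1 <= idx k.+1 t)%N.
Proof.
move=> /andP[h1 ->]; rewrite andbT idx_thr// cpt_mul.
by congr (_ <= _); rewrite -addnn -addnS natrD addrK.
Qed.

Lemma test_rd k : test (rd k).
Proof.
have [mn [M M0 nM]] := test_indic (-1 : R) 0.
split; last first.
  exists M => // t; apply: le_trans (nM t); rewrite /rd normrM normrX normrN1 expr1n mulr1.
  by [].
have -> : rd k = (fun t => \sum_(i < ncell k.+1) (-1) ^+ i * (neg1 t * cellb k.+1 i t)).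
  apply/funext => t; rewrite /rd neg1E; case: (boolP (-1 <= t < 0)) => tn; last first.
    by rewrite mul0r big1// => i _; rewrite mul0r mulr0.
  have bt := neg1_inbox k tn; rewrite mul1r (bigD1 (Ordinal (idx_lt bt)))//= big1 ?addr0 => [|i ii].
    by rewrite cellbE ?idx_lt// bt eqxx !mulr1.
  rewrite cellbE// bt/=; case: eqP => [it|_]; last by rewrite !mulr0.
  by move: ii; rewrite -val_eqE/= it eqxx.
apply: measurable_sum => i; apply: measurable_funM => //; apply: measurable_funM => //.
by case: (test_cellb k.+1 i).
Qed.

Lemma test_dl k : test (dl k). Proof. exact: test_indic. Qed.

Lemma test_w k : test (w k).
Proof. by apply: testD; [exact: test_dl|exact: test_rd]. Qed.

Lemma lev_w k : lev k.+1 (w k).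
Proof.
split; first exact: test_w.
  move=> t bt; rewrite /w /rd neg1E dlE.
  have -> : (-1 <= t < 0) = false by apply: contraNF bt; exact: neg1_inbox.
  rewrite mul0r addr0; have -> // : (k%:R <= t < k.+1%:R) = false.
  apply: contraNF bt => /andP[h1 h2]; apply/andP; split => //.
  by rewrite (le_trans _ h1)// (@le_trans _ _ 0)// oppr_le0.
by move=> s t bs bt st; rewrite /w /rd !neg1E !dlE (neg1_idx bs) (neg1_idx bt) (dl_idx bs) (dl_idx bt) st.
Qed.

Lemma dl_rd k l t : dl k t * rd l t = 0.
Proof.
rewrite /rd neg1E dlE; case: (boolP (-1 <= t < 0)) => [/andP[_ t0]|_]; last by rewrite mul0r mulr0.
have -> : (k%:R <= t) = false by apply/negbTE; rewrite -ltNge (lt_le_trans t0).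
by rewrite mul0r.
Qed.

Lemma dl_dl k l : rp (dl k) (dl l) = (k == l)%:R.
Proof.
case: eqP => [->|/eqP kl]; first by rewrite rp_indic ?ler_nat// -natr1 addrAC subrr add0r.
apply: rp0 => t; rewrite !dlE; case: (boolP (k%:R <= t < k.+1%:R)) => [/andP[h1 h2]|_]; last by rewrite mul0r.
case: (boolP (l%:R <= t < l.+1%:R)) => [/andP[h3 h4]|_]; last by rewrite mulr0.
have := le_lt_trans h1 h4; have := le_lt_trans h3 h2; rewrite !ltr_nat !ltnS => lk lk'.
by move: kl; rewrite eqn_leq lk lk'.
Qed.

Lemma rd_rd k : rp (rd k) (rd k) = 1.
Proof.
transitivity (rp neg1 neg1).
  apply: eq_Rintegral => t _; rewrite /rd mulrACA.
  by rewrite (_ : (-1) ^+ _ * _ = 1 :> R) ?mulr1// -expr2 sqrr_sign.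
by rewrite rp_indic// sub0r opprK.
Qed.

(** On a cell inside the box [-K, K) the part [dl K] vanishes, and [rd K] is either zero or takes
    the values 1 and -1 on the two halves of the cell. *)
Lemma rp_w_cell K i : (i < ncell K)%N -> rp (w K) (cellb K i) = 0.
Proof.
move=> iN; pose A := (i.*2 + 2 ^ K.+1)%N.
have AN : (A.+1 < ncell K.+1)%N.
  by move: iN; rewrite /A /ncell expnS; move: (2 ^ K)%N => x; nia.
pose e : R := ((K.-1 * 2 ^ K <= i < K * 2 ^ K)%N)%:R.
have wc t : w K t * cellb K i t = e * (cellb K.+1 A t - cellb K.+1 A.+1 t).
  rewrite (cellbE _ iN) (cellbE _ AN) (cellbE _ (ltnW AN)).
  have [bt|bt] := boolP (inbox K t); last first.
    rewrite mulr0; have [bt'|bt'] := boolP (inbox K.+1 t); last by rewrite /= subrr mulr0.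
    have := inbox_idx bt'; rewrite (negbTE bt) => /esym hn.
    have -> : (idx K.+1 t == A) = false.
      apply/negbTE; apply/eqP => jA; move: hn; rewrite jA /A; move: (2 ^ K.+1)%N (ncell K) iN => x y.
      by lia.
    have -> : (idx K.+1 t == A.+1) = false.
      apply/negbTE; apply/eqP => jA; move: hn; rewrite jA /A; move: (2 ^ K.+1)%N (ncell K) iN => x y.
      by lia.
    by rewrite /= subrr mulr0.
  have bt' := inboxS bt; rewrite bt' /= idxS//.
  have := inbox_idx bt'; rewrite bt => /esym/andP[j1 j2].
  have dl0 : dl K t = 0.
    by rewrite dlE; case/andP: bt => _ tK; rewrite leNgt tK.
  rewrite /w dl0 add0r /rd neg1E (neg1_idx bt').
  have -> : ((idx K.+1 t - 2 ^ K.+1)./2 == i) = (idx K.+1 t == A) || (idx K.+1 t == A.+1).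
    by rewrite /A; move: (2 ^ K.+1)%N (idx K.+1 t) j1 => x y; lia.
  have K0 : (0 < K)%N by case: (K) iN.
  have oA : odd A = false by rewrite /A oddD odd_double oddX.
  have [jA|jA] := eqVneq (idx K.+1 t) A.
    rewrite jA; have -> : (A == A.+1) = false by apply/negbTE; rewrite neq_ltn ltnSn.
    rewrite /= subr0 !mulr1 -signr_odd oA expr0 mulr1 /e; congr (_%:R).
    by rewrite /A expnS; move: (2 ^ K)%N (K) K0 => x [//|k] _; nia.
  have [jA'|jA'] := eqVneq (idx K.+1 t) A.+1; last by rewrite /= subrr !mulr0.
  rewrite jA' /= sub0r mulr1 -signr_odd /= oA expr1 !mulrN1 /e; congr (- _%:R).
  by rewrite /A expnS; move: (2 ^ K)%N (K) K0 => x [//|k] _; nia.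
have tA := test_cellb K.+1 A; have tB := test_cellb K.+1 A.+1.
have lA := test_loc_int tA; have lB := test_loc_int tB.
have sq m t : cellb K.+1 m t * cellb K.+1 m t = cellb K.+1 m t.
  by rewrite /cellb indicE; case: (_ \in _); rewrite ?mulr1 ?mulr0.
transitivity (rp (fun t => e * cellb K.+1 A t) (cellb K.+1 A) +
  rp (fun t => - e * cellb K.+1 A.+1 t) (cellb K.+1 A.+1)).
  have i1 := test_integrable (testZ e tA) lA; have i2 := test_integrable (testZ (- e) tB) lB.
  rewrite /rp -RintegralD//; apply: eq_Rintegral => t _.
  by rewrite wc -!mulrA !sq mulNr -mulrBr.
by rewrite !rpZl// !rp_cellb mulNr subrr.
Qed.

Lemma test_lin n (c : nat -> R) (b : nat -> R -> R) : (forall i, test (b i)) ->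
  test (fun t => \sum_(i < n) c i * b i t).
Proof.
move=> tb; elim: n => [|n IH].
  under eq_fun do rewrite big_ord0.
  have := testZ 0 (test_indic (0 : R) 0); congr test; apply/funext => t; exact: mul0r.
under eq_fun do rewrite big_ord_recr/=.
by apply: testD => //; exact: testZ.
Qed.

Lemma rp_lin n (c : nat -> R) (b : nat -> R -> R) g : (forall i, test (b i)) -> loc_int g ->
  rp (fun t => \sum_(i < n) c i * b i t) g = \sum_(i < n) c i * rp (b i) g.
Proof.
move=> tb lg; elim: n => [|n IH].
  rewrite big_ord0 /rp; under eq_Rintegral do rewrite big_ord0 mul0r.
  by rewrite /Rintegral integral0.
rewrite big_ord_recr/= -IH -rpZl//; under [in LHS]eq_fun do rewrite big_ord_recr/=.
by rewrite rpDl//; [exact: test_lin|exact: testZ].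
Qed.

Lemma rp_w_lev K g : lev K g -> rp (w K) g = 0.
Proof.
move=> lg; rewrite -(FR_lev lg) rp_sym.
rewrite (rp_lin _ (fun i => 2 ^+ K * rp (cellb K i) g) (test_cellb K) (test_loc_int (test_w K))).
by rewrite big1// => i _; rewrite (rp_sym (cellb K i) (w K)) rp_w_cell// mulr0.
Qed.

Lemma rp_w_w k : rp (w k) (w k) = 2.
Proof.
have tw := test_w k; have td := test_dl k; have tr := test_rd k.
rewrite {1}/w rpDl//; last exact: test_loc_int.
rewrite [rp (dl k) _]rp_sym [rp (rd k) _]rp_sym /w !rpDl//; try exact: test_loc_int.
rewrite dl_dl rd_rd eqxx rp_sym (rp0 (b := dl k) (b' := rd k)); last by move=> t; exact: dl_rd.
by rewrite addr0 add0r.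
Qed.

Definition WR k g t : R := 2^-1 * rp (w k) g * w k t.

Definition SR n g t : R := FR n./2 g t + (odd n)%:R * WR n./2 g t.

Lemma SR_lev n g : lev n./2 g -> SR n g = g.
Proof.
move=> lg; apply/funext => t; rewrite /SR FR_lev// /WR rp_w_lev//.
by rewrite mulr0 mul0r mulr0 addr0.
Qed.

Lemma SR_w k n : (k.*2 < n)%N -> SR n (w k) = w k.
Proof.
move=> kn; have [kn'|nk] := ltnP k n./2.
  by apply: SR_lev; apply: lev_le kn' (lev_w k).
have nE : n = k.*2.+1.
  apply/eqP; rewrite eqn_leq kn andbT -(odd_double_half n) -addn1 addnC.
  by apply: leq_add; [rewrite leq_double|case: odd].
rewrite nE; apply/funext => t; rewrite /SR /= uphalf_double odd_double/= mul1r /WR rp_w_w.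
rewrite /FR big1 ?add0r; first by rewrite mulVf ?mul1r.
by move=> i _; rewrite rp_sym rp_w_cell// mulr0 mul0r.
Qed.

Lemma SR_cell k i n : (i < ncell k)%N -> (k <= n./2)%N -> SR n (cellb k i) = cellb k i.
Proof. by move=> iN kn; apply: SR_lev; apply: lev_le kn (lev_cellb iN). Qed.

End dyadic.

(** * The decomposition of the Lebesgue spaces *)

Section dyadic_Lp.
Context (R : realType).
Local Notation mu := (@lebesgue_measure R).
Variables (p : R) (p1 : 1 <= p).
Local Notation Lp := (cLp mu p1).
Implicit Types (b : R -> R) (x y : Lp).

Let p0 : 0 < p. Proof. exact: lt_le_trans p1. Qed.

Lemma pr_lin n (c : nat -> R) (b : nat -> R -> R) x : (forall i, test (b i)) ->
  pr (fun t => \sum_(i < n) c i * b i t) x = \sum_(i < n) (c i)%:C * pr (b i) x.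
Proof.
move=> tb; have [rx ix] := cLp_cloc x; rewrite /pr !rp_lin//.
elim: n => [|n IH]; first by rewrite !big_ord0.
rewrite !big_ord_recr/= -IH; apply/eqP; rewrite eq_complex/=.
by rewrite !mul0r subr0 addr0 !eqxx.
Qed.

Lemma cl_lin n (c : nat -> R) (b : nat -> R -> R) : (forall i, test (b i)) ->
  cl p1 (fun t => \sum_(i < n) c i * b i t) = \sum_(i < n) (c i)%:C *: cl p1 (b i).
Proof.
move=> tb; elim: n => [|n IH].
  rewrite big_ord0; apply: cLp_eq; move: (clE p1 (test_lin 0 c tb)) (@cLp0E _ _ R mu p p1).
  by apply: filterS2 => t e1 e2 _; rewrite e1// e2// big_ord0.
rewrite big_ord_recr/= -IH -clZ// -clD//; last exact: testZ.
  by congr cl; apply/funext => t; rewrite big_ord_recr.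
exact: test_lin.
Qed.

Lemma pr_sumr b n (F : nat -> Lp) : test b ->
  pr b (\sum_(i < n) F i : Lp) = \sum_(i < n) pr b (F i).
Proof.
move=> tb; elim: n => [|n IH].
  by rewrite !big_ord0 -(scale0r (0 : Lp)) prZ// mul0r.
by rewrite !big_ord_recr/= prD// IH.
Qed.

Definition dF K x : Lp := \sum_(i < ncell K) ((2 ^+ K)%:C * pr (cellb K i) x) *: cl p1 (cellb K i).
Definition dW k x : Lp := (2^-1%:C * pr (w k) x) *: cl p1 (w k).
Definition dS n x : Lp := dF n./2 x + (odd n)%:R%:C *: dW n./2 x.
Definition dP j x : Lp := dS j.+1 x - dS j x.

Lemma psum_dP n x : psum dP n x = dS n x.
Proof.
rewrite /psum -(big_mkord xpredT (fun j => dP j x)) /dP telescope_sumr//.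
have -> : dS 0 x = 0; last by rewrite subr0.
by rewrite /dS /dF /ncell/= big_ord0 scale0r addr0.
Qed.

Lemma dF_linear K : linear (dF K).
Proof.
move=> a x y; rewrite /dF scaler_sumr -big_split/=; apply: eq_bigr => i _.
have tc := test_cellb R K i.
by rewrite prD// prZ// mulrDr scalerDl scalerA mulrCA.
Qed.

Lemma dW_linear k : linear (dW k).
Proof.
move=> a x y; rewrite /dW; have tw := test_w R k.
by rewrite prD// prZ// mulrDr scalerDl scalerA mulrCA.
Qed.

Lemma dS_linear n : linear (dS n).
Proof.
have sw (z a : R[i]) (v : Lp) : z *: (a *: v) = a *: (z *: v) by rewrite !scalerA mulrC.
by move=> a x y; rewrite /dS dF_linear dW_linear !scalerDr sw addrACA.
Qed.

Lemma dSB n x y : dS n (x - y) = dS n x - dS n y.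
Proof. by rewrite -scaleN1r addrC dS_linear scaleN1r addrC. Qed.

Lemma dS0 n : dS n 0 = 0.
Proof. by have := dSB n 0 0; rewrite !subrr. Qed.

Lemma dP_linear j : linear (dP j).
Proof. by move=> a x y; rewrite /dP !dS_linear scalerBr opprD addrACA. Qed.

Lemma test_FR K b : test (FR K b).
Proof. by apply: (test_lin _ (fun i => 2 ^+ K * rp (cellb K i) b)); exact: test_cellb. Qed.

Lemma test_WR k b : test (WR k b).
Proof. by apply: testZ; exact: test_w. Qed.

(** The operators are their own transposes, so identities on L^p reduce to pointwise identities for
    test functions. *)
Lemma pr_dS b n x : test b -> pr b (dS n x) = pr (SR n b) x.
Proof.
move=> tb; have lx := cLp_cloc x.
have hF K : pr b (dF K x) = pr (FR K b) x.
  rewrite /dF (pr_sumr _ (fun i => ((2 ^+ K)%:C * pr (cellb K i) x) *: cl p1 (cellb K i)) tb).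
  rewrite (pr_lin _ (fun i => 2 ^+ K * rp (cellb K i) b)); last exact: test_cellb.
  apply: eq_bigr => i _; rewrite prZ// pr_cl//; last exact: test_cellb.
  by rewrite rp_sym (rmorphM (real_complex R)) mulrAC.
have hW k : pr b (dW k x) = pr (WR k b) x.
  rewrite /dW prZ// pr_cl//; last exact: test_w.
  rewrite /WR prZl//; last exact: test_w.
  by rewrite rp_sym (rmorphM (real_complex R)) mulrAC.
rewrite /dS prD// prZ// hF hW /SR prDl ?prZl//; try exact: test_FR; try exact: test_WR.
  exact: test_w.
by apply: testZ; exact: test_WR.
Qed.

Lemma dS_cl n b : test b -> dS n (cl p1 b) = cl p1 (SR n b).
Proof.
move=> tb.
have hF K : dF K (cl p1 b) = cl p1 (FR K b).
  rewrite (cl_lin _ (fun i => 2 ^+ K * rp (cellb K i) b)); last exact: test_cellb.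
  apply: eq_bigr => i _; rewrite pr_cl//; last exact: test_cellb.
  by rewrite (rmorphM (real_complex R)).
have hW k : dW k (cl p1 b) = cl p1 (WR k b).
  rewrite /dW pr_cl//; last exact: test_w.
  by rewrite /WR clZ ?(rmorphM (real_complex R))//; exact: test_w.
rewrite /dS hF hW /SR clD ?clZ//; try exact: test_FR; try exact: test_WR.
  exact: test_w.
by apply: testZ; exact: test_WR.
Qed.

Lemma dS_id m (b : R -> R) z : test b -> SR m b = b -> dS m (z *: cl p1 b) = z *: cl p1 b.
Proof.
move=> tb e; have := dS_linear m z (cl p1 b) 0; rewrite addr0 => ->.
by rewrite dS0 addr0 dS_cl// e.
Qed.

Lemma dS_sum n m (F : nat -> Lp) : dS n (\sum_(i < m) F i) = \sum_(i < m) dS n (F i).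
Proof.
have SD x y : dS n (x + y) = dS n x + dS n y by rewrite -[x in LHS]scale1r dS_linear scale1r.
exact: (big_morph (dS n) SD (dS0 n)).
Qed.

Lemma dS_comp_ge n m x : (n <= m)%N -> dS m (dS n x) = dS n x.
Proof.
move=> nm; have SD a y z : dS m (y + a *: z) = dS m y + a *: dS m z.
  by rewrite addrC dS_linear addrC.
have hF : dS m (dF n./2 x) = dF n./2 x.
  rewrite /dF (dS_sum m _ (fun i => ((2 ^+ n./2)%:C * pr (cellb n./2 i) x) *: cl p1 (cellb n./2 i))).
  apply: eq_bigr => i _; apply: dS_id; first exact: test_cellb.
  by apply: SR_cell => //; exact: half_leq.
have -> : dS n x = dF n./2 x + (odd n)%:R%:C *: dW n./2 x by [].
rewrite SD hF; congr (_ + _); case: (boolP (odd n)) => on; last by rewrite !scale0r.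
congr (_ *: _); apply: dS_id; first exact: test_w.
apply: SR_w; apply: leq_trans nm.
by rewrite -[X in (_ < X)%N](odd_double_half n) on.
Qed.

(** The transpose of the inclusion of ranges: the functions that [dS n] pairs with are fixed by
    [SR m]. *)
Lemma dS_comp_le n m x : (n <= m)%N -> dS n (dS m x) = dS n x.
Proof.
move=> nm; rewrite /dS /dF /dW; congr (_ + _).
  apply: eq_bigr => i _; rewrite pr_dS ?SR_cell//; [exact: half_leq|exact: test_cellb].
case: (boolP (odd n)) => on; last by rewrite !scale0r.
rewrite pr_dS ?SR_w//; last exact: test_w.
by apply: leq_trans nm; rewrite -[X in (_ < X)%N](odd_double_half n) on.
Qed.

Lemma dP_orth i j x : dP i (dP j x) = if i == j then dP j x else 0.
Proof.
have comp n m : dS n (dS m x) = dS (minn n m) x.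
  case: (leqP n m) => [nm|/ltnW mn]; first exact: dS_comp_le.
  exact: dS_comp_ge.
rewrite /dP !dSB !comp; case: eqP => [->|/eqP ij].
  rewrite !minnn (minn_idPr (leqnSn j)) (minn_idPl (leqnSn j)).
  by rewrite subrr subr0.
have [ij'|ji|ij'] := ltngtP i j; last by rewrite ij' eqxx in ij.
  rewrite (minn_idPl ij') (minn_idPl (leqW ij')) (minn_idPl (leqW (ltnW ij'))).
  by rewrite !subrr.
rewrite (minn_idPr ji) (minn_idPr (leqW ji)) (minn_idPr (leqW (ltnW ji))).
by rewrite !subrr.
Qed.

Lemma cells_pow K (c : nat -> R[i]) t :
  rnorm (\sum_(i < ncell K) c i * (cellb K i t)%:C) `^ p <=
  \sum_(i < ncell K) rnorm (c i) `^ p * cellb K i t.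
Proof.
have cell0 i : 0 <= cellb K i t by rewrite /cellb indicE.
have [bt|bt] := boolP (inbox K t); last first.
  rewrite big1 ?rnorm0 ?powR0 ?gt_eqF// => [|i _]; last by rewrite cellbE// (negbTE bt) mulr0.
  by rewrite sumr_ge0// => i _; rewrite mulr_ge0 ?powR_ge0.
rewrite (bigD1 (Ordinal (idx_lt bt)))//= big1 ?addr0 => [|i ii]; last first.
  rewrite cellbE// bt/=; case: eqP => [it|_]; last by rewrite mulr0.
  by move: ii; rewrite -val_eqE/= it eqxx.
rewrite (bigD1 (Ordinal (idx_lt bt)))//= cellbE ?idx_lt// bt eqxx !mulr1 lerDl.
by rewrite sumr_ge0// => i _; rewrite mulr_ge0 ?powR_ge0.
Qed.

Lemma mu_cell K i : mu (`[cpt R K i, cpt R K i.+1[%classic : set R) = (2 ^- K)%:E.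
Proof.
rewrite lebesgue_measure_itv/= lte_fin cptS ltrDl invr_gt0 pow2_gt0 -EFinD.
by rewrite addrAC subrr add0r.
Qed.

Lemma int_cells K (g : R -> \bar R) (c : nat -> R) : (forall i, 0 <= c i) ->
  measurable_fun setT g -> (forall t, (0 <= g t)%E) ->
  (\int[mu]_t (\sum_(i < ncell K) (c i * cellb K i t)%:E * g t) =
   \sum_(i < ncell K) (c i)%:E * \int[mu]_(t in `[cpt R K i, cpt R K i.+1[%classic) g t)%E.
Proof.
move=> c0 mg g0; have cell0 i t : 0 <= cellb K i t by rewrite /cellb indicE.
have mc i : measurable_fun setT (fun t => (c i * cellb K i t)%:E).
  by apply/measurable_EFinP; apply: measurable_funM => //; case: (@test_cellb R K i).
rewrite ge0_integral_sum//; last 2 first.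
- by move=> i; exact: emeasurable_funM (mc i) mg.
- by move=> i t _; rewrite mule_ge0// lee_fin mulr_ge0.
apply: eq_bigr => i _; rewrite -ge0_integralZl ?lee_fin//; try exact: measurable_funTS.
rewrite [RHS]integral_mkcond; apply: eq_integral => t _; rewrite patchE /cellb indicE.
by case: (_ \in _); rewrite ?mulr1// mulr0 mul0e.
Qed.

(** Jensen's inequality cell by cell, with the constant 4 of [pr_bound]. The cells are disjoint, so
    the p-th powers add up to at most the integral of |x|^p. *)
Lemma dF_bound K x : rnorm (dF K x) <= 4 * rnorm x.
Proof.
apply: rnorm_le_pint; first by rewrite mulr_ge0 ?rnorm_ge0.
pose c (i : nat) : R[i] := (2 ^+ K)%:C * pr (cellb K i) x.
pose A (i : nat) := (\int[mu]_(t in `[cpt R K i, cpt R K i.+1[%classic) (rnorm (x t) `^ p)%:E)%E.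
have mx : measurable_fun setT (fun t => (rnorm (x t) `^ p)%:E).
  by apply/measurable_EFinP; apply: (measurableT_comp (measurable_powR _)); exact: (cmeas_rnorm (cLp_cmeas x)).
have A0 i : (0 <= A i)%E by apply: integral_ge0 => t _; rewrite lee_fin powR_ge0.
have Afin i : A i = (fine (A i))%:E.
  rewrite fineK// ge0_fin_numE//; apply: le_lt_trans (pint_sub x _) _; first exact: measurable_itv.
  exact: ltry.
have FE : dF K x = (fun t => \sum_(i < ncell K) c i * (cellb K i t)%:C) %[ae mu].
  rewrite /dF -/(c _); elim: (ncell K) => [|n IH].
    by move: (@cLp0E _ _ R mu p p1); rewrite big_ord0; apply: filterS => t e _; rewrite e// big_ord0.
  rewrite big_ord_recr/=.
  move: IH (cLpD (\sum_(i < n) c i *: cl p1 (cellb K i)) (c n *: cl p1 (cellb K n)))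
    (cLpZ (c n) (cl p1 (cellb K n))) (clE p1 (@test_cellb R K n)).
  by apply: filterS4 => t e1 e2 e3 e4 _; rewrite e2// e1// e3// e4// big_ord_recr.
rewrite (eq_pint p1 FE).
have cA i : rnorm (c i) `^ p * 2 ^- K <= 4 `^ p * fine (A i).
  have pb : rnorm (pr (cellb K i) x) <= 4 * 2 ^- K * (fine (A i) / 2 ^- K) `^ p^-1.
    apply: (pr_bound (@test_cellb R K i) (measurable_itv _) (mu_cell K i)).
    - by rewrite invr_gt0 pow2_gt0.
    - by move=> t; rewrite ger0_norm ?indicE.
    - exact: fine_ge0.
    - by rewrite -Afin.
  rewrite /c rnormM rnorm_real ger0_norm ?(ltW (pow2_gt0 R K))//.
  have q0 : 0 <= fine (A i) / 2 ^- K by rewrite divr_ge0 ?fine_ge0// invr_ge0 ltW// pow2_gt0.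
  have h : 2 ^+ K * rnorm (pr (cellb K i) x) <= 4 * (fine (A i) / 2 ^- K) `^ p^-1.
    apply: (le_trans (ler_wpM2l (ltW (pow2_gt0 R K)) pb)); rewrite le_eqVlt; apply/orP; left; apply/eqP.
    by rewrite [4 * _]mulrC !mulrA divff ?mul1r// gt_eqF// pow2_gt0.
  apply: (@le_trans _ _ ((4 * (fine (A i) / 2 ^- K) `^ p^-1) `^ p * 2 ^- K)).
    rewrite ler_wpM2r ?invr_ge0 ?(ltW (pow2_gt0 R K))//.
    apply: ge0_ler_powR; rewrite ?nnegrE ?(ltW p0) ?mulr_ge0 ?rnorm_ge0 ?powR_ge0 ?(ltW (pow2_gt0 R K))//.
  rewrite powRM ?powR_ge0// -powRrM mulVf ?gt_eqF// powRr1// -mulrA divfK//.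
apply: (@le_trans _ _ (\int[mu]_t (\sum_(i < ncell K) ((rnorm (c i) `^ p * cellb K i t)%:E * 1%:E)))%E).
  apply: ae_ge0_le_lower_integral => [t _|t _|].
  - by rewrite lee_fin powR_ge0.
  - by apply: sume_ge0 => i _; rewrite mule1 lee_fin mulr_ge0 ?powR_ge0// /cellb indicE.
  apply: aeW => t _.
  rewrite [X in (_ <= X)%E](_ : _ = (\sum_(i < ncell K) rnorm (c i) `^ p * cellb K i t)%:E).
    by rewrite lee_fin cells_pow.
  by rewrite -sumEFin; apply: eq_bigr => i _; rewrite mule1.
rewrite [leLHS](_ : _ = \sum_(i < ncell K) (rnorm (c i) `^ p)%:E *
    \int[mu]_(t in `[cpt R K i, cpt R K i.+1[%classic) 1%:E)%E; last first.
  apply: (@int_cells K (fun=> 1%:E) (fun i => rnorm (c i) `^ p)) => // *; rewrite ?lee_fin//; exact: powR_ge0.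
apply: (@le_trans _ _ (\sum_(i < ncell K) (4 `^ p)%:E * A i)%E).
  apply: lee_sum => i _; rewrite integral_cst; last exact: measurable_itv.
  rewrite mul1e [X in (_ * X)%E](_ : _ = (2 ^- K)%:E); last exact: mu_cell.
  by rewrite Afin -!EFinM lee_fin cA.
rewrite [leLHS](_ : _ = \int[mu]_t (\sum_(i < ncell K) (4 `^ p * cellb K i t)%:E * (rnorm (x t) `^ p)%:E))%E; last first.
  apply/esym; apply: (@int_cells K (fun t => (rnorm (x t) `^ p)%:E) (fun=> 4 `^ p)) => // *; rewrite ?lee_fin; exact: powR_ge0.
rewrite powRM ?rnorm_ge0// EFinM -pint_cLp /pint -ge0_integralZl ?lee_fin ?powR_ge0//; last by move=> t _; rewrite lee_fin powR_ge0.
apply: ae_ge0_le_lower_integral => [t _|t _|].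
- by apply: sume_ge0 => i _; rewrite mule_ge0// lee_fin ?powR_ge0// mulr_ge0 ?powR_ge0// /cellb indicE.
- by rewrite mule_ge0// lee_fin powR_ge0.
apply: aeW => t _; under eq_bigr do rewrite -EFinM.
rewrite sumEFin -EFinM lee_fin -mulr_suml -mulr_sumr ler_wpM2r ?powR_ge0// ler_piMr ?powR_ge0//.
have [bt|bt] := boolP (inbox K t); last by rewrite big1// => i _; rewrite cellbE// (negbTE bt).
rewrite (bigD1 (Ordinal (idx_lt bt)))//= big1 ?addr0 => [|i ii].
  by rewrite cellbE ?idx_lt// bt eqxx.
rewrite cellbE// bt/=; case: eqP => [it|_] //.
by move: ii; rewrite -val_eqE/= it eqxx.
Qed.

Lemma pr_unit b (E : set R) x : test b -> measurable E -> mu E = 1%:E ->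
  (forall t, `|b t| <= \1_E t) -> rnorm (pr b x) <= 4 * rnorm x.
Proof.
move=> tb mE E1 bE.
have := pr_bound tb mE E1 ltr01 bE (powR_ge0 (rnorm x) p) (pint_sub x mE).
by rewrite divr1 -powRrM mulfV ?gt_eqF// powRr1 ?rnorm_ge0// mulr1.
Qed.

Lemma rnorm_cl_unit b (E : set R) : test b -> measurable E -> mu E = 1%:E ->
  (forall t, `|b t| <= \1_E t) -> rnorm (cl p1 b) <= 1.
Proof.
move=> tb mE E1 bE; apply: rnorm_le_pint => //; rewrite powR1 (eq_pint p1 (clE p1 tb)).
apply: (@le_trans _ _ (\int[mu]_t (\1_E t)%:E)%E).
  apply: ae_ge0_le_lower_integral => [t _|t _|].
  - by rewrite lee_fin powR_ge0.
  - by rewrite lee_fin.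
  apply: aeW => t _; rewrite lee_fin rnorm_real; have := bE t; rewrite indicE.
  case: (_ \in _) => h; last by rewrite normr_le0 in h; rewrite (eqP h) normr0 powR0 ?gt_eqF.
  have e1 : true%:R = 1 `^ p :> R by rewrite powR1.
  by rewrite e1; apply: ge0_ler_powR; rewrite ?nnegrE ?(ltW p0).
by rewrite integral_indic// setIT le_eqVlt; apply/orP; left; apply/eqP; exact: E1.
Qed.

Lemma mu_unit (a : R) : mu (`[a, a + 1[%classic : set R) = 1%:E.
Proof. by rewrite lebesgue_measure_itv/= lte_fin ltrDl ltr01 -EFinD addrAC subrr add0r. Qed.

Lemma mu_dl k : mu (`[k%:R, k.+1%:R[%classic : set R) = 1%:E.
Proof. by rewrite -natr1 mu_unit. Qed.

Lemma mu_neg1 : mu (`[-1, 0[%classic : set R) = 1%:E.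
Proof. by have := mu_unit (-1); rewrite addNr. Qed.

Lemma dl_le k (t : R) : `|dl k t| <= \1_(`[k%:R, k.+1%:R[%classic : set R) t.
Proof. by rewrite /dl ger0_norm ?indicE. Qed.

Lemma rd_le k (t : R) : `|rd k t| <= \1_(`[-1, 0[%classic : set R) t.
Proof. by rewrite /rd normrM normrX normrN1 expr1n mulr1 /neg1 ger0_norm ?indicE. Qed.

Lemma pr_dl k x : rnorm (pr (dl k) x) <= 4 * rnorm x.
Proof. exact: (pr_unit x (test_dl R k) (measurable_itv _) (mu_dl k) (dl_le k)). Qed.

Lemma pr_rd k x : rnorm (pr (rd k) x) <= 4 * rnorm x.
Proof. exact: (pr_unit x (test_rd R k) (measurable_itv _) mu_neg1 (rd_le k)). Qed.

Lemma cl_dl k : rnorm (cl p1 (dl k)) <= 1.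
Proof. exact: (rnorm_cl_unit (test_dl R k) (measurable_itv _) (mu_dl k) (dl_le k)). Qed.

Lemma cl_rd k : rnorm (cl p1 (rd k)) <= 1.
Proof. exact: (rnorm_cl_unit (test_rd R k) (measurable_itv _) mu_neg1 (rd_le k)). Qed.

(** 4 for the averaging and 8 = (1/2) (4 + 4) (1 + 1) for the rank-one term. The bound is uniform
    because each [dS n] contains at most one such term: the earlier ones are absorbed in the
    averaging. *)
Lemma dS_bound n x : rnorm (dS n x) <= 12 * rnorm x.
Proof.
have hW k : rnorm (dW k x) <= 8 * rnorm x.
  rewrite /dW /w clD ?prDl//; try exact: test_dl; try exact: test_rd; try exact: cLp_cloc.
  rewrite rnormZ rnormM rnorm_real ger0_norm ?invr_ge0//.
  have h1 := le_trans (rnormD _ _) (lerD (pr_dl k x) (pr_rd k x)).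
  have h2 := le_trans (ler_rnormD _ _) (lerD (cl_dl k) (cl_rd k)).
  apply: (@le_trans _ _ (2^-1 * (4 * rnorm x + 4 * rnorm x) * (1 + 1))).
    apply: ler_pM; rewrite ?mulr_ge0 ?rnorm_ge0 ?invr_ge0//; first exact: ler_wpM2l.
  by rewrite le_eqVlt; apply/orP; left; apply/eqP; field.
rewrite /dS; apply: (le_trans (ler_rnormD _ _)).
have -> : 12 * rnorm x = 4 * rnorm x + 8 * rnorm x by ring.
apply: lerD; first exact: dF_bound.
case: (odd n); first by rewrite scale1r.
by rewrite scale0r rnorm0 mulr_ge0 ?rnorm_ge0.
Qed.

End dyadic_Lp.

(** * Dyadic differentiation and strong convergence to the identity *)

Section differentiation.
Context (R : realType).
Local Notation mu := (@lebesgue_measure R).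
Implicit Types (h : R -> R) (t s : R).

Lemma loc_int_locally h : loc_int h -> locally_integrable setT h.
Proof.
move=> [mh ih]; split => //; first exact: openT.
move=> A _ /compact_bounded[M [_ MP]].
apply: le_lt_trans (ih (M + 2)); rewrite integral_mkcond [leRHS]integral_mkcond.
apply: ae_ge0_le_lower_integral => [t _|t _|].
- by rewrite patchE; case: (t \in A).
- by rewrite patchE; case: (t \in box (M + 2)).
apply: aeW => t _; rewrite !patchE; case: (boolP (t \in A)) => tA; last first.
  by rewrite (_ : point = 0%E :> \bar R)//; case: (t \in box (M + 2)).
have tM : `|t| <= M + 1 by apply: MP; [rewrite ltrDl|rewrite inE in tA].
rewrite mem_set//; move: tM; rewrite ler_norml => /andP[t1 t2].
by rewrite /box/= in_itv/=; lra.
Qed.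

Lemma int_cell K i h : loc_int h ->
  (\int[mu]_(t in `[cpt R K i, cpt R K i.+1[%classic) (h t)%:E = (rp (cellb K i) h)%:E)%E.
Proof.
move=> lh; have ih := test_integrable (@test_cellb R K i) lh.
rewrite /rp /Rintegral fineK; last exact: integrable_fin_num ih.
transitivity (\int[mu]_t (cellb K i t * h t)%:E)%E; last by [].
rewrite [LHS]integral_mkcond; apply: eq_integral => t _; rewrite patchE /cellb indicE.
by case: (_ \in _); rewrite ?mul1r ?mul0r.
Qed.

Lemma inbox_le K K' t : (K <= K')%N -> inbox K t -> inbox K' t.
Proof. by move=> /subnK <-; elim: (K' - K)%N => [//|n IH] h; rewrite addSn; exact/inboxS/IH. Qed.

Lemma inbox_eq M d s t : inbox (d + M) s -> inbox (d + M) t -> idx (d + M) s = idx (d + M) t ->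
  inbox M s = inbox M t.
Proof.
elim: d => [|d IH]; first by rewrite add0n => -> ->.
rewrite addSn => bs bt st.
have e : inbox (d + M) s = inbox (d + M) t by rewrite (inbox_idx bs) (inbox_idx bt) st.
have [bt'|bt'] := boolP (inbox (d + M) t).
  have bs' : inbox (d + M) s by rewrite e.
  by apply: IH => //; rewrite (idxS bs') (idxS bt') st.
have no (r : R) : ~~ inbox (d + M) r -> inbox M r = false.
  move=> h; apply/negbTE/negP => h2; move/negP: h; apply.
  by have := @inbox_le M (d + M) r (leq_addl d M) h2.
by rewrite !no// e.
Qed.

Definition nbox t : nat := (Num.truncn `|t|).+1.

Lemma inbox_nbox n t : inbox (n + nbox t) t.
Proof.
have h : `|t| < (n + nbox t)%:R.
  have /andP[_ h] := truncn_itv (normr_ge0 t).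
  by apply: (lt_le_trans h); rewrite ler_nat leq_addl.
by move: h; rewrite ltr_norml => /andP[h1 h2]; rewrite /inbox (ltW h1).
Qed.

Lemma cell_idx K t : inbox K t -> cpt R K (idx K t) <= t < cpt R K (idx K t).+1.
Proof. by move=> /andP[h _]; rewrite -idx_thr// -idx_thr_lt// leqnn ltnSn. Qed.

(** The cells containing [t] shrink nicely to [t]: the ball of radius 2 * 2^-K around [t] contains
    the cell and has four times its measure. The shift by [nbox t] skips the levels whose box may
    miss [t]. *)
Lemma dyadic_diff h : loc_int h ->
  {ae mu, forall t, (2 ^+ K * rp (cellb K (idx K t)) h) @[K --> \oo] --> h t}.
Proof.
move=> lh; have locf := loc_int_locally lh.
pose E t n : set R := `[cpt R (n + nbox t) (idx (n + nbox t) t), cpt R (n + nbox t) (idx (n + nbox t) t).+1[%classic.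
have hE t : nicely_shrinking t (E t).
  split; first by move=> n; exact: measurable_itv.
  have r0 n : 0 < 2 * 2 ^- (n + nbox t) :> R by rewrite mulr_gt0// invr_gt0 pow2_gt0.
  exists (4, fun n => PosNum (r0 n)); split => //=.
  - have h0 : (2 * 2 ^- n : R) @[n --> \oo] --> (0 : R).
      apply: cvgMl0; have := @cvg_geometric R 1 2^-1; rewrite /geometric/=.
      under eq_fun do rewrite mul1r exprVn.
      by apply; rewrite ger0_norm ?invr_ge0// invf_lt1// ltr1n.
    by rewrite (cvg_shiftn (nbox t) (fun n => 2 * 2 ^- n : R)).
  - move=> n s; rewrite /E/= in_itv/= => /andP[s1 s2].
    have /andP[t1 t2] := cell_idx (inbox_nbox n t); rewrite cptS in s2 t2.
    rewrite /ball/= ltr_norml; move: s1 s2 t1 t2.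
    have := r0 n; move: (2 ^- (n + nbox t)) (cpt R _ _) => a b; lra.
  - move=> n; rewrite lebesgue_measure_ball; last exact: ltW (r0 n).
    rewrite [mu (E t n)](_ : _ = (2 ^- (n + nbox t))%:E); last exact: mu_cell.
    by rewrite -EFinM lee_fin mulr2n; move: (2 ^- (n + nbox t)) => a; lra.
apply: filterS (lebesgue_differentiation locf) => t /(nice_lebesgue_differentiation hE locf) lim.
rewrite -(cvg_shiftn (nbox t)).
pose q n := 2 ^+ (n + nbox t) * rp (cellb (n + nbox t) (idx (n + nbox t) t)) h.
have e n : ((mu (E t n))^-1 * \int[mu]_(y in E t n) (h y)%:E = (q n)%:E)%E.
  rewrite (int_cell _ _ lh); have -> : mu (E t n) = (2 ^- (n + nbox t))%:E by exact: mu_cell.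
  by rewrite inver gt_eqF ?invr_gt0 ?pow2_gt0// invrK -EFinM.
have lim' : (q n)%:E @[n --> \oo] --> (h t)%:E.
  by apply: cvg_trans lim; apply: near_eq_cvg; apply: nearW => n; exact: e.
by move/fine_cvgP: lim' => [_ lim']; exact: lim'.
Qed.

Lemma dyadic_zero h : loc_int h -> (forall K i, (i < ncell K)%N -> rp (cellb K i) h = 0) ->
  {ae mu, forall t, h t = 0}.
Proof.
move=> lh h0; apply: filterS (dyadic_diff lh) => t lim.
have lim0 : (2 ^+ K * rp (cellb K (idx K t)) h) @[K --> \oo] --> (0 : R).
  apply: cvg_near_cst; exists (nbox t) => // K /= tK; rewrite h0 ?mulr0//.
  apply: idx_lt; rewrite -(subnK tK); exact: inbox_nbox.
exact: (cvg_unique _ lim lim0).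
Qed.

End differentiation.

Section dyadic_density.
Context (R : realType).
Local Notation mu := (@lebesgue_measure R).
Variables (p : R) (p1 : 1 <= p).
Local Notation Lp := (cLp mu p1).
Implicit Types (x y z : Lp).

Let p0 : 0 < p. Proof. exact: lt_le_trans p1. Qed.

Lemma powR_cvg_zero (T : Type) (F : set_system T) {FF : Filter F} (u : T -> R) :
  (forall t, 0 <= u t) -> u t @[t --> F] --> (0 : R) -> (u t `^ p) @[t --> F] --> (0 : R).
Proof.
move=> u0 uc; apply/cvgrPdist_lt => e e0.
have e1 : 0 < Num.min e 1 by rewrite lt_min e0 ltr01.
have /cvgrPdist_lt/(_ _ e1) := uc; apply: filterS => t.
rewrite !sub0r !normrN !ger0_norm ?powR_ge0// lt_min => /andP[ue u1].
apply: le_lt_trans ue; have [->|un] := eqVneq (u t) 0; first by rewrite powR0 ?gt_eqF.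
have u0' : 0 < u t by rewrite lt_neqAle eq_sym un u0.
rewrite -[leRHS]powRr1// /powR gt_eqF// ler_expR ler_wnM2r// ln_le0// ltW//.
Qed.

Lemma pint_dominated (f_ : nat -> R -> R[i]) (G : R -> R) :
  (forall n, cmeas (f_ n)) -> measurable_fun setT G -> (forall t, 0 <= G t) ->
  (\int[mu]_t (G t)%:E < +oo)%E ->
  {ae mu, forall t, rnorm (f_ n t) @[n --> \oo] --> (0 : R)} ->
  (forall n, {ae mu, forall t, rnorm (f_ n t) `^ p <= G t}) ->
  forall e : R, 0 < e -> exists N, forall n, (N <= n)%N -> (pint mu p (f_ n) <= e%:E)%E.
Proof.
move=> mf mG G0 iG f0 fG e e0.
have mfp n : measurable_fun setT (fun t => (rnorm (f_ n t) `^ p)%:E).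
  by apply/measurable_EFinP; apply: (measurableT_comp (measurable_powR _)); exact: cmeas_rnorm.
have [] := @dominated_convergence _ _ _ mu setT measurableT
  (fun n t => (rnorm (f_ n t) `^ p)%:E) (fun=> 0%E) (fun t => (G t)%:E) mfp.
- exact: measurable_cst.
- apply: filterS f0 => t ft _; apply: cvg_EFin; first exact: nearW.
  by apply: powR_cvg_zero => // n; exact: rnorm_ge0.
- apply/integrableP; split; first exact/measurable_EFinP.
  by under eq_integral do rewrite gee0_abs ?lee_fin//.
- have := ae_foralln fG; apply: filterS => t h n _.
  by rewrite gee0_abs ?lee_fin ?powR_ge0.
move=> _ _; rewrite integral0 => lim.
have /fine_cvgP[fin /cvgrPdist_lt/(_ _ e0) lim'] := lim.
have [N _ NP] := filterI fin lim'; exists N => n Nn; have [h1 h2] := NP n Nn.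
have h1' : pint mu p (f_ n) \is a fin_num := h1.
have h2' : `|0 - fine (pint mu p (f_ n))| < e := h2.
rewrite -(fineK h1') lee_fin; apply: ltW; apply: le_lt_trans h2'.
by rewrite sub0r normrN ler_norm.
Qed.

Lemma cmeas_real_mul (g : R -> R) (f : R -> R[i]) : measurable_fun setT g -> cmeas f ->
  cmeas (fun t => (g t)%:C * f t).
Proof.
move=> mg [rf if_]; split.
  rewrite (_ : _ \o _ = g \* (@complex.Re R \o f)); first exact: measurable_funM.
  by apply/funext => t /=; rewrite complex_ReM/= mul0r subr0.
rewrite (_ : _ \o _ = g \* (@complex.Im R \o f)); first exact: measurable_funM.
by apply/funext => t /=; rewrite complex_ImM/= mul0r addr0.
Qed.

Lemma trunc_density x (e : R) : 0 < e -> exists z (M : nat),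
  [/\ rnorm (z - x) <= e, {ae mu, forall t, rnorm (z t) <= M%:R} &
   {ae mu, forall t, ~~ inbox M t -> z t = 0}].
Proof.
move=> e0; have mx := cLp_cmeas x; have mr := cmeas_rnorm mx.
pose A n : set R := [set t | rnorm (x t) <= n%:R] `&` `[- n%:R, n%:R[%classic.
have mA n : measurable (A n).
  apply: measurableI; last exact: measurable_itv.
  have -> : [set t | rnorm (x t) <= n%:R] = setT `&` (fun t => rnorm (x t)) @^-1` `]-oo, n%:R]%classic.
    by rewrite setTI; apply/seteqP; split => t /=; rewrite in_itv.
  by apply: mr => //; exact: measurable_itv.
pose g n : R -> R := \1_(~` A n).
have mg n : measurable_fun setT (g n) by apply: measurable_indic; exact: measurableC.
have g1 n t : 0 <= g n t <= 1 by rewrite /g indicE; case: (_ \in _); rewrite ?lexx ?ler01.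
have AE n t : (t \in A n) = (rnorm (x t) <= n%:R) && inbox n t.
  by apply/idP/idP; rewrite inE/= /A/= in_itv => /andP.
have [|||N NP] := @pint_dominated (fun n t => (g n t)%:C * x t) (fun t => rnorm (x t) `^ p)
    (fun n => cmeas_real_mul (mg n) mx) (measurableT_comp (measurable_powR _) mr)
    (fun t => powR_ge0 _ _) _ _ _ (e `^ p) (powR_gt0 _ e0).
- by have := pint_cLp x; rewrite /pint => ->; rewrite ltry.
- apply: aeW => t; apply: cvg_near_cst; exists (maxn (nbox t) (Num.truncn (rnorm (x t))).+1) => // n /=.
  rewrite geq_max => /andP[n1 n2]; rewrite /g indicE in_setC AE.
  have -> : rnorm (x t) <= n%:R.
    have /andP[_ h] := truncn_itv (rnorm_ge0 (x t)).
    by rewrite (le_trans (ltW h))// ler_nat.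
  by rewrite -(subnK n1) inbox_nbox/= mul0r rnorm0.
- move=> n; apply: aeW => t; apply: ge0_ler_powR; rewrite ?nnegrE ?(ltW p0) ?rnorm_ge0//.
  have /andP[h1 h2] := g1 n t.
  by rewrite rnormM rnorm_real ger0_norm// ler_piMl// rnorm_ge0.
have mz : cmeas (fun t => (\1_(A N) t)%:C * x t).
  by apply: cmeas_real_mul => //; exact: measurable_indic.
have [z zE] : exists z : Lp, z = (fun t => (\1_(A N) t)%:C * x t) %[ae mu].
  apply: exists_cLp => //; apply: (@le_lt_trans _ _ (pint mu p x)); last by rewrite pint_cLp ltry.
  apply: le_pint => //; apply: aeW => t; rewrite rnormM rnorm_real indicE.
  by case: (_ \in _); rewrite ?normr1 ?mul1r// normr0 mul0r rnorm_ge0.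
exists z, N; split.
- apply: rnorm_le_pint; first exact: ltW.
  apply: le_trans (NP N (leqnn _)); apply: le_pint => //.
  move: (cLpB z x) zE; apply: filterS2 => t e1 e2; rewrite e1// e2// /g !indicE in_setC.
  by case: (_ \in _); rewrite /= ?mul1r ?mul0r ?subrr ?sub0r ?rnormN// rnorm0 rnorm_ge0.
- apply: filterS zE => t /(_ I) ->; rewrite indicE AE; case: (boolP (rnorm (x t) <= N%:R)) => h.
    by case: (inbox N t); rewrite ?mul1r// mul0r rnorm0.
  by rewrite mul0r rnorm0.
- by apply: filterS zE => t /(_ I) -> tN; rewrite indicE AE (negbTE tN) andbF mul0r.
Qed.

Lemma dF_ae x : {ae mu, forall t K, dF K x t =
  if inbox K t then (2 ^+ K)%:C * pr (cellb K (idx K t)) x else 0}.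
Proof.
apply: ae_foralln => K.
have FE : dF K x = (fun t => \sum_(i < ncell K) ((2 ^+ K)%:C * pr (cellb K i) x) * (cellb K i t)%:C) %[ae mu].
  rewrite /dF; elim: (ncell K) => [|n IH].
    by move: (@cLp0E _ _ R mu p p1); rewrite big_ord0; apply: filterS => t e _; rewrite e// big_ord0.
  rewrite big_ord_recr/=; set c := _ * pr (cellb K n) x.
  move: IH (cLpD (\sum_(i < n) ((2 ^+ K)%:C * pr (cellb K i) x) *: cl p1 (cellb K i)) (c *: cl p1 (cellb K n)))
    (cLpZ c (cl p1 (cellb K n))) (clE p1 (@test_cellb R K n)).
  by apply: filterS4 => t e1 e2 e3 e4 _; rewrite e2// e1// e3// e4// big_ord_recr.
apply: filterS FE => t /(_ I) ->; case: (boolP (inbox K t)) => bt; last first.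
  by rewrite big1// => i _; rewrite cellbE// (negbTE bt) mulr0.
rewrite (bigD1 (Ordinal (idx_lt bt)))//= big1 ?addr0 => [|i ii].
  by rewrite cellbE ?idx_lt// bt eqxx mulr1.
rewrite cellbE// bt/=; case: eqP => [it|_]; last by rewrite mulr0.
by move: ii; rewrite -val_eqE/= it eqxx.
Qed.

Lemma dF_cvg_ae x : {ae mu, forall t, rnorm (dF K x t - x t) @[K --> \oo] --> (0 : R)}.
Proof.
have [rx ix] := cLp_cloc x.
move: (dF_ae x) (dyadic_diff rx) (dyadic_diff ix); apply: filterS3 => t e cr ci.
have c0 : `|2 ^+ K * rp (cellb K (idx K t)) (@complex.Re R \o x) - complex.Re (x t)| +
    `|2 ^+ K * rp (cellb K (idx K t)) (@complex.Im R \o x) - complex.Im (x t)| @[K --> \oo] --> (0 : R).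
  have dist0 (u : nat -> R) (l : R) : u n @[n --> \oo] --> l -> `|u n - l| @[n --> \oo] --> (0 : R).
    move=> ul; have h := cvg_norm (cvgB ul (cvg_cst l)); rewrite subrr normr0 in h; exact: h.
  by apply: cvgD00; apply: dist0.
apply: (squeeze_cvgr _ (cvg_cst (0 : R)) c0); exists (nbox t) => // K /= tK.
rewrite rnorm_ge0/= e; have -> : inbox K t by rewrite -(subnK tK) inbox_nbox.
set b := cellb K _.
have -> : (2 ^+ K)%:C * pr b x - x t = (2 ^+ K * rp b (@complex.Re R \o x) - complex.Re (x t)) +i*
    (2 ^+ K * rp b (@complex.Im R \o x) - complex.Im (x t)).
  rewrite /pr; case: (x t) => a c; apply/eqP; rewrite eq_complex/=.
  by rewrite !mul0r subr0 addr0 !eqxx.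
exact: rnormc_le.
Qed.

(** For K >= M the box of level [M] is a union of cells, so the averages vanish outside it and are
    at most 4 M inside; dominated convergence with the bound 5 M then upgrades the pointwise
    limit. *)
Lemma dF_density x (M : nat) (e : R) : {ae mu, forall t, rnorm (x t) <= M%:R} ->
  {ae mu, forall t, ~~ inbox M t -> x t = 0} -> 0 < e -> exists K, rnorm (dF K x - x) <= e.
Proof.
move=> xM x0 e0; pose g : R -> R := \1_(`[- M%:R, M%:R[%classic).
have M0 : 0 <= 5 * M%:R :> R by rewrite mulr_ge0.
have gE t : g t = (inbox M t)%:R.
  rewrite /g indicE (_ : (t \in _) = inbox M t)//.
  by apply/idP/idP; rewrite inE/= in_itv.
have small K t : (M <= K)%N -> inbox K t ->
    rnorm ((2 ^+ K)%:C * pr (cellb K (idx K t)) x) <= 4 * M%:R * g t.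
  move=> MK bt; rewrite rnormM rnorm_real ger0_norm ?(ltW (pow2_gt0 R K))//.
  pose I := `[cpt R K (idx K t), cpt R K (idx K t).+1[%classic : set R.
  have A0 : 0 <= (M%:R * g t) `^ p * 2 ^- K by rewrite mulr_ge0 ?powR_ge0// invr_ge0 ltW// pow2_gt0.
  have IE s : s \in I -> g s = g t.
    move=> sI; have : cellb K (idx K t) s = 1 by rewrite /cellb indicE sI.
    rewrite cellbE ?idx_lt//; case: (boolP (inbox K s)) => bs; last by move=> /esym/eqP; rewrite oner_eq0.
    case: eqP => [st _|_]; last by move=> /esym/eqP; rewrite oner_eq0.
    by rewrite !gE; congr (nat_of_bool _)%:R; move: bs bt st; rewrite -(subnK MK); exact: inbox_eq.
  have iA : (\int[mu]_(s in I) (rnorm (x s) `^ p)%:E <= ((M%:R * g t) `^ p * 2 ^- K)%:E)%E.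
    apply: (@le_trans _ _ (\int[mu]_(s in I) (cst ((M%:R * g t) `^ p)%:E s))%E).
      apply: ae_ge0_le_lower_integral => [s _|s _|]; [by rewrite lee_fin powR_ge0|by rewrite lee_fin powR_ge0|].
      move: xM x0; apply: filterS2 => s h1 h2 Is; rewrite lee_fin.
      apply: ge0_ler_powR; rewrite ?nnegrE ?(ltW p0) ?rnorm_ge0 ?mulr_ge0// ?gE//.
      rewrite -gE -(IE s) ?inE// gE; case: (boolP (inbox M s)) => [_|/h2 ->]; first by rewrite mulr1.
      by rewrite mulr0 rnorm0.
    rewrite integral_cst; last exact: measurable_itv.
    rewrite [X in (_ * X)%E](_ : _ = (2 ^- K)%:E) ?EFinM//; exact: mu_cell.
  have pb : rnorm (pr (cellb K (idx K t)) x) <= 4 * 2 ^- K * ((M%:R * g t) `^ p * 2 ^- K / 2 ^- K) `^ p^-1.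
    apply: (pr_bound (@test_cellb R K (idx K t)) (measurable_itv _) (mu_cell R K (idx K t)) _ _ A0 iA).
    - by rewrite invr_gt0 pow2_gt0.
    - by move=> s; rewrite /cellb ger0_norm ?indicE.
  apply: (le_trans (ler_wpM2l (ltW (pow2_gt0 R K)) pb)); rewrite mulfK; last by rewrite gt_eqF// invr_gt0 pow2_gt0.
  rewrite -powRrM mulfV ?gt_eqF// powRr1 ?mulr_ge0 ?gE//.
  rewrite le_eqVlt; apply/orP; left; apply/eqP; rewrite -gE.
  by field; rewrite gt_eqF// pow2_gt0.
have cF n : cmeas (dF (n + M) x : Lp) by exact: cLp_cmeas.
have [|||||N NP] := @pint_dominated (fun n t => dF (n + M) x t - x t) (fun t => (5 * M%:R) `^ p * g t)
    (fun n => cmeasB (cF n) (cLp_cmeas x)) _ _ _ _ _ (e `^ p) (powR_gt0 _ e0).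
- by apply: measurable_funM => //; apply: measurable_indic; exact: measurable_itv.
- by move=> t; rewrite mulr_ge0 ?powR_ge0// gE.
- under eq_integral do rewrite EFinM.
  rewrite ge0_integralZl ?lee_fin ?powR_ge0//;
    try (by move=> t _; rewrite lee_fin gE);
    try (by apply/measurable_EFinP; apply: measurable_indic; exact: measurable_itv).
  rewrite integral_indic// setIT lte_mul_pinfty ?lee_fin ?powR_ge0//; exact: box_fin.
- apply: filterS (dF_cvg_ae x) => t h.
  by rewrite (cvg_shiftn M (fun n => rnorm (dF n x t - x t))).
- move=> n; move: (dF_ae x) xM x0; apply: filterS3 => t e1 e2 e3; rewrite e1.
  rewrite [leRHS](_ : _ = (5 * M%:R * g t) `^ p); last first.
    by rewrite gE; case: (inbox M t); rewrite ?mulr1// !mulr0 powR0// gt_eqF.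
  apply: ge0_ler_powR; rewrite ?nnegrE ?(ltW p0) ?rnorm_ge0//; first by rewrite mulr_ge0// gE.
  apply: (le_trans (ler_rnormB _ _)).
  have -> : 5 * M%:R * g t = 4 * M%:R * g t + M%:R * g t by ring.
  apply: lerD.
    case: (boolP (inbox (n + M) t)) => bt; last by rewrite rnorm0 mulr_ge0 ?mulr_ge0// gE.
    by apply: small => //; exact: leq_addl.
  rewrite gE; case: (boolP (inbox M t)) => [_|/e3 ->]; first by rewrite mulr1.
  by rewrite rnorm0 mulr0.
exists (N + M)%N; apply: rnorm_le_pint; first exact: ltW.
by rewrite (eq_pint p1 (cLpB (dF (N + M) x) x)); exact: NP.
Qed.

Lemma dS_dense x (e : R) : 0 < e -> exists m y, rnorm (dS m y - x) <= e.
Proof.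
move=> e0; have e2 : 0 < e / 2 by rewrite divr_gt0.
have [z [M [zx zM z0]]] := trunc_density x e2.
have [K Kz] := dF_density zM z0 e2.
exists K.*2, z; rewrite (_ : dS K.*2 z = dF K z).
  have -> : dF K z - x = (dF K z - z) + (z - x) by rewrite addrA subrK.
  by apply: (le_trans (ler_rnormD _ _)); rewrite [e]splitr; exact: lerD.
by rewrite /dS doubleK odd_double scale0r addr0.
Qed.

Lemma dP_decomposition : decomposition (@dP R p p1) 12.
Proof.
split.
- exact: dP_linear.
- exact: dP_orth.
- by move=> n x; rewrite psum_dP dS_bound.
move=> x; apply/cvg_rnormP/cvgrPdist_lt => e e0.
(* [dS n] fixes the range of [dS m] for n >= m, so only the error of the approximant and its image
   count: (1 + 12) e / 14 < e. *)
have e14 : 0 < e / 14 by rewrite divr_gt0.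
have [m [y my]] := dS_dense x e14.
exists m => // n /= mn; rewrite sub0r normrN ger0_norm ?rnorm_ge0// psum_dP.
have -> : dS n x - x = (dS m y - x) - dS n (dS m y - x).
  by rewrite dSB (dS_comp_ge y mn) opprB [RHS]addrC addrA subrK.
apply: (le_lt_trans (ler_rnormB _ _)).
apply: (@le_lt_trans _ _ (e / 14 + 12 * (e / 14))).
  by apply: lerD => //; apply: (le_trans (dS_bound _ _)); rewrite ler_wpM2l.
by lra.
Qed.

End dyadic_density.

(** * Incomparable behaviour of the two families of functions *)

Section new_functions.
Context (R : realType).
Implicit Types (K k n : nat) (b g : R -> R).

(** Martingale differences of generation [k]; both [dl k] and [rd k] are of this kind, and nothing
    more is used to locate them in the decomposition. *)
Definition new k b := lev k.+1 b /\ forall K g, (K <= k)%N -> lev K g -> rp b g = 0.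

Lemma new_test k b : new k b -> test b. Proof. by move=> [[]]. Qed.

Lemma new_dl k : new k (dl k : R -> R).
Proof.
split; first split; first exact: test_dl.
- move=> t bt; rewrite dlE; have -> // : (k%:R <= t < k.+1%:R) = false.
  apply: contraNF bt => /andP[h1 h2]; apply/andP; split => //.
  by rewrite (le_trans _ h1)// (@le_trans _ _ 0)// oppr_le0.
- by move=> s t bs bt st; rewrite !dlE (dl_idx bs) (dl_idx bt) st.
move=> K g Kk [_ g0 _]; apply: rp0 => t; rewrite dlE.
case: (boolP (k%:R <= t < k.+1%:R)) => [/andP[h _]|_]; last by rewrite mul0r.
rewrite g0 ?mulr0//; apply/negP => /andP[_ tK].
by have := le_lt_trans h tK; rewrite ltr_nat ltnNge Kk.
Qed.

Lemma new_rd k : new k (rd k : R -> R).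
Proof.
split; first split; first exact: test_rd.
- move=> t bt; rewrite /rd neg1E; have -> : (-1 <= t < 0) = false.
    by apply: contraNF bt; exact: neg1_inbox.
  by rewrite mul0r.
- by move=> s t bs bt st; rewrite /rd !neg1E (neg1_idx bs) (neg1_idx bt) st.
move=> K g Kk lg; have [tg _ _] := lg.
have := rp_w_lev (lev_le Kk lg); rewrite /w rpDl ?(new_dl k).2//; try exact: test_dl; try exact: test_rd.
  by move=> <-; rewrite ((new_dl k).2 K g Kk lg) add0r.
exact: test_loc_int.
Qed.

(** The zero function is written as a multiple of [b] so that homogeneity of the pairing applies to
    it. *)
Lemma SR_new0 k n b : new k b -> (n <= k.*2)%N -> SR n b = (fun t => 0 * b t).
Proof.
move=> [_ b0] nk; have nk2 : (n./2 <= k)%N by rewrite -(doubleK k) half_leq.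
apply/funext => t; rewrite mul0r /SR /FR big1 ?add0r => [|i _]; last first.
  by rewrite rp_sym (b0 n./2) ?mulr0 ?mul0r//; exact: lev_cellb.
case: (boolP (odd n)) => on; last by rewrite mul0r.
rewrite /WR rp_sym (b0 (n./2).+1) ?mulr0 ?mul0r ?mulr0//; last exact: lev_w.
by rewrite -ltn_double; apply: leq_trans nk; rewrite -[X in (_ < X)%N](odd_double_half n) on.
Qed.

Lemma SR_new1 k n b : new k b -> (k < n./2)%N -> SR n b = b.
Proof. by move=> [lb _] kn; apply: SR_lev; exact: lev_le lb. Qed.

Lemma rd_orth k l : rp (rd k : R -> R) (rd l) = (k == l)%:R.
Proof.
have [->|/eqP kl] := eqVneq k l; first by rewrite rd_rd.
have [kl'|lk] := ltnP k l; first by rewrite rp_sym ((new_rd l).2 k.+1)//; exact: (new_rd k).1.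
rewrite ((new_rd k).2 l.+1)//; last exact: (new_rd l).1.
by rewrite ltn_neqAle lk andbT; apply/eqP => h; apply: kl.
Qed.

Lemma w_dl k : rp (w k : R -> R) (dl k) = 1.
Proof.
rewrite /w rpDl; [|exact: test_dl|exact: test_rd|exact/test_loc_int/test_dl].
by rewrite dl_dl eqxx rp_sym (rp0 (dl_rd k k)) addr0.
Qed.

Lemma w_rd k : rp (w k : R -> R) (rd k) = 1.
Proof.
rewrite /w rpDl; [|exact: test_dl|exact: test_rd|exact/test_loc_int/test_rd].
by rewrite rd_rd (rp0 (dl_rd k k)) add0r.
Qed.

End new_functions.

Section new_Lp.
Context (R : realType).
Local Notation mu := (@lebesgue_measure R).
Variables (p : R) (p1 : 1 <= p).
Local Notation Lp := (cLp mu p1).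
Implicit Types (b : R -> R) (x y : Lp).

Let p0 : 0 < p. Proof. exact: lt_le_trans p1. Qed.

Lemma prB b x y : test b -> pr b (x - y : Lp) = pr b x - pr b y.
Proof. by move=> tb; rewrite -scaleN1r prD// prZ// mulN1r. Qed.

Lemma pr_dP b j x : test b -> pr b (dP j x) = pr (SR j.+1 b) x - pr (SR j b) x.
Proof. by move=> tb; rewrite /dP prB// !pr_dS. Qed.

Lemma dP_new k j b : new k b -> j./2 != k -> dP j (cl p1 b) = 0.
Proof.
move=> nb jk; have tb := new_test nb; rewrite /dP !dS_cl//.
have [jk'|kj] := ltnP j./2 k.
  have jk2 : (j.+1 <= k.*2)%N.
    rewrite -(odd_double_half j); have := jk'; rewrite -ltn_double => h.
    by move: h jk'; case: (odd j) => /=; rewrite -!muln2; lia.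
  by rewrite !(SR_new0 nb) ?subrr// ltnW.
have kj' : (k < j./2)%N by rewrite ltn_neqAle eq_sym jk.
by rewrite !(SR_new1 nb) ?subrr// (leq_trans kj')// half_leq.
Qed.

(** The two projections add up to the difference of the averagings of levels [k.+1] and [k]; the
    transpose of the first fixes [b], that of the second kills it. *)
Lemma pr_new_split k b x : new k b -> pr b x = pr b (dP k.*2 x) + pr b (dP k.*2.+1 x).
Proof.
move=> nb; have tb := new_test nb; rewrite !pr_dP// addrC addrA subrK.
rewrite (SR_new1 nb); last by rewrite -doubleS doubleK.
by rewrite (SR_new0 nb)// prZl ?mul0r ?subr0//; exact: cLp_cloc.
Qed.

Lemma dP_even k x : dP k.*2 x = dW k x.
Proof.
by rewrite /dP /dS /= uphalf_double doubleK odd_double/= scale1r scale0r addr0 addrC addKr.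
Qed.

Lemma pr_even b b' k : test b -> test b' ->
  pr b (dP k.*2 (cl p1 b')) = (2^-1 * rp (w k) b' * rp b (w k))%:C.
Proof.
move=> tb tb'; have tw := test_w R k.
by rewrite dP_even /dW prZ// !pr_cl// !(rmorphM (real_complex R)).
Qed.

Lemma lin_ae (r : seq nat) (c : nat -> R[i]) (b : nat -> R -> R) : (forall k, test (b k)) ->
  (\sum_(k <- r) c k *: cl p1 (b k) : Lp) = (fun t => \sum_(k <- r) c k * (b k t)%:C) %[ae mu].
Proof.
move=> tb; elim: r => [|k r IH].
  by move: (@cLp0E _ _ R mu p p1); rewrite big_nil; apply: filterS => t e _; rewrite e// big_nil.
rewrite big_cons.
move: IH (cLpD (c k *: cl p1 (b k)) (\sum_(k <- r) c k *: cl p1 (b k)))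
  (cLpZ (c k) (cl p1 (b k))) (clE p1 (tb k)).
by apply: filterS4 => t e1 e2 e3 e4 _; rewrite e2// e1// e3// e4// big_cons.
Qed.

Lemma dl01 k (t : R) : dl k t = 0 \/ dl k t = 1.
Proof. by rewrite dlE; case: (_ <= _ < _); [right|left]. Qed.

Lemma dl_disj k l (t : R) : k != l -> dl k t = 1 -> dl l t = 0.
Proof.
rewrite !dlE => kl; case: (boolP (k%:R <= t < k.+1%:R)) => [/andP[h1 h2] _|_ /esym/eqP]; last by rewrite oner_eq0.
case: (boolP (l%:R <= t < l.+1%:R)) => [/andP[h3 h4]|//].
have := le_lt_trans h1 h4; have := le_lt_trans h3 h2; rewrite !ltr_nat !ltnS => lk lk'.
by move: kl; rewrite eqn_leq lk lk'.
Qed.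

Lemma dl_pow (r : seq nat) (a : nat -> R[i]) t : uniq r ->
  rnorm (\sum_(k <- r) a k * (dl k t)%:C) `^ p <= \sum_(k <- r) rnorm (a k) `^ p * dl k t.
Proof.
elim: r => [_|k r IH /=/andP[kr ur]]; first by rewrite !big_nil rnorm0 powR0// gt_eqF.
rewrite !big_cons; have [->|e1] := dl01 k t; first by rewrite !mulr0 !add0r IH.
rewrite e1 !mulr1 big1_seq ?addr0 => [|l /= lr].
  by rewrite lerDl sumr_ge0// => l _; rewrite mulr_ge0 ?powR_ge0// dlE.
rewrite (dl_disj _ e1) ?mulr0//; apply: contraNneq kr => ->; exact: lr.
Qed.

Lemma int_dl k (g : R -> R) : (\int[mu]_(t in `[k%:R, k.+1%:R[%classic) (g t)%:E =
  \int[mu]_t (dl k t * g t)%:E)%E.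
Proof.
rewrite integral_mkcond; apply: eq_integral => t _; rewrite patchE /dl indicE.
by case: (_ \in _); rewrite ?mul1r ?mul0r.
Qed.

Lemma dl_up (a : nat -> R[i]) m n :
  rnorm (\sum_(m <= k < n) a k *: cl p1 (dl k) : Lp) `^ p <=
  1 * \sum_(m <= k < n) rnorm (a k) `^ p.
Proof.
rewrite mul1r -lee_fin -pint_cLp (eq_pint p1 (lin_ae (index_iota m n) a (test_dl R))).
apply: (@le_trans _ _ (\int[mu]_t (\sum_(k <- index_iota m n) (rnorm (a k) `^ p * dl k t)%:E))%E).
  apply: ae_ge0_le_lower_integral => [t _|t _|].
  - by rewrite lee_fin powR_ge0.
  - by apply: sume_ge0 => k _; rewrite lee_fin mulr_ge0 ?powR_ge0// dlE.
  by apply: aeW => t _; rewrite sumEFin lee_fin dl_pow// iota_uniq.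
have md k : measurable_fun setT (fun t => (rnorm (a k) `^ p * dl k t)%:E).
  by apply/measurable_EFinP; apply: measurable_funM => //; case: (test_dl R k).
rewrite ge0_integral_sum//; last first.
  by move=> k t _; rewrite lee_fin mulr_ge0 ?powR_ge0// dlE.
rewrite -sumEFin; apply: lee_sum => k _.
have -> : (\int[mu]_t (rnorm (a k) `^ p * dl k t)%:E =
    \int[mu]_(t in `[k%:R, k.+1%:R[%classic) (cst (rnorm (a k) `^ p)%:E t))%E.
  rewrite [RHS](int_dl k (fun=> rnorm (a k) `^ p)).
  by apply: eq_integral => t _; rewrite mulrC.
rewrite integral_cst; last exact: measurable_itv.
rewrite [X in (_ * X)%E](_ : _ = 1%:E) ?mule1//; exact: mu_dl.
Qed.

(** The unit intervals are disjoint, so the p-th powers of the local norms add up to at most that of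
    [x]. *)
Lemma dl_eta x : exists B : R, forall n, \sum_(k < n) rnorm (pr (dl k) x) `^ p <= B.
Proof.
exists (4 `^ p * rnorm x `^ p) => n.
pose A (k : nat) := (\int[mu]_(t in `[k%:R, k.+1%:R[%classic) (rnorm (x t) `^ p)%:E)%E.
have A0 k : (0 <= A k)%E by apply: integral_ge0 => t _; rewrite lee_fin powR_ge0.
have Afin k : A k = (fine (A k))%:E.
  rewrite fineK// ge0_fin_numE//; apply: le_lt_trans (pint_sub x _) _; first exact: measurable_itv.
  exact: ltry.
have pA k : rnorm (pr (dl k) x) `^ p <= 4 `^ p * fine (A k).
  have iA : (A k <= (fine (A k))%:E)%E by rewrite -Afin.
  have := pr_bound (test_dl R k) (measurable_itv _) (mu_dl R k) ltr01 (@dl_le R k) (fine_ge0 (A0 k)) iA.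
  rewrite divr1 mulr1 => h.
  apply: (@le_trans _ _ ((4 * fine (A k) `^ p^-1) `^ p)).
    by apply: ge0_ler_powR; rewrite ?nnegrE ?(ltW p0) ?rnorm_ge0 ?mulr_ge0 ?powR_ge0.
  by rewrite powRM ?powR_ge0// -powRrM mulVf ?gt_eqF// powRr1// fine_ge0.
apply: (@le_trans _ _ (\sum_(k < n) 4 `^ p * fine (A k))); first by apply: ler_sum => k _.
rewrite -mulr_sumr ler_wpM2l ?powR_ge0// -lee_fin -pint_cLp -sumEFin.
under eq_bigr do rewrite -Afin /A (int_dl _ (fun t => rnorm (x t) `^ p)).
have mx : measurable_fun setT (fun t => rnorm (x t) `^ p).
  by apply: (measurableT_comp (measurable_powR _)); exact: (cmeas_rnorm (cLp_cmeas x)).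
rewrite -ge0_integral_sum//; last 2 first.
- by move=> k; apply/measurable_EFinP; apply: measurable_funM => //; case: (test_dl R k).
- by move=> k t _; rewrite lee_fin mulr_ge0 ?powR_ge0// dlE.
apply: ae_ge0_le_lower_integral => [t _|t _|].
- by apply: sume_ge0 => k _; rewrite lee_fin mulr_ge0 ?powR_ge0// dlE.
- by rewrite lee_fin powR_ge0.
apply: aeW => t _; rewrite sumEFin lee_fin -mulr_suml ler_piMl ?powR_ge0//.
have -> : \sum_(k < n) dl k t = (t < n%:R)%R%:R - (t < 0)%R%:R :> R.
  under eq_bigr do rewrite /dl indic_itv ?ler_nat//.
  rewrite -(big_mkord xpredT (fun k => (t < k.+1%:R)%R%:R - (t < k%:R)%R%:R)).
  by rewrite (telescope_sumr (fun k => (t < k%:R)%R%:R)).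
by case: (t < n%:R); case: (t < 0); rewrite /= ?subrr ?subr0 ?sub0r// ler_wnDr.
Qed.

End new_Lp.

(** * Orthogonality in L^2 *)

Section square.
Context (R : realType).
Local Notation mu := (@lebesgue_measure R).
Variables (p1 : 1 <= (2 : R)).
Local Notation L2 := (cLp mu p1).
Implicit Types (b : R -> R) (x y z : L2).

(** The real part of the inner product of L^2, which is what Pythagoras involves. *)
Definition ip x y : R := (\int[mu]_t (complex.Re (x t) * complex.Re (y t) + complex.Im (x t) * complex.Im (y t)))%R.

Lemma rnorm_sqr (z : R[i]) : rnorm z `^ 2 = complex.Re z ^+ 2 + complex.Im z ^+ 2.
Proof.
have -> : rnorm z `^ 2 = rnorm z ^+ 2 by rewrite -powR_mulrn ?rnorm_ge0.
by rewrite rnormc sqr_sqrtr// addr_ge0 ?sqr_ge0.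
Qed.

Lemma ip_integrable x y : mu.-integrable setT (EFin \o
  (fun t => complex.Re (x t) * complex.Re (y t) + complex.Im (x t) * complex.Im (y t))).
Proof.
have [rx ix] := cLp_cmeas x; have [ry iy] := cLp_cmeas y.
have mxy : measurable_fun setT (fun t => complex.Re (x t) * complex.Re (y t) + complex.Im (x t) * complex.Im (y t)).
  by apply: measurable_funD; apply: measurable_funM.
have mp u : measurable_fun setT (fun t => (rnorm ((u : L2) t) `^ 2)%:E).
  by apply/measurable_EFinP; apply: (measurableT_comp (measurable_powR _)); exact: (cmeas_rnorm (cLp_cmeas u)).
apply/integrableP; split; first exact/measurable_EFinP.
apply: (@le_lt_trans _ _ (\int[mu]_t ((rnorm (x t) `^ 2)%:E + (rnorm (y t) `^ 2)%:E))%E).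
  apply: ae_ge0_le_lower_integral => [t _|t _|]; first by [].
    by rewrite adde_ge0// lee_fin powR_ge0.
  apply: aeW => t _; rewrite -EFinD /= lee_fin !rnorm_sqr.
  move: (complex.Re (x t)) (complex.Re (y t)) (complex.Im (x t)) (complex.Im (y t)) => a b c d.
  rewrite ler_norml; apply/andP; split; rewrite -subr_ge0.
    rewrite (_ : _ - _ = ((a + b) ^+ 2 + (c + d) ^+ 2 + a ^+ 2 + b ^+ 2 + c ^+ 2 + d ^+ 2) / 2); last by field.
    by rewrite divr_ge0// !addr_ge0 ?sqr_ge0.
  rewrite (_ : _ - _ = ((a - b) ^+ 2 + (c - d) ^+ 2 + a ^+ 2 + b ^+ 2 + c ^+ 2 + d ^+ 2) / 2); last by field.
  by rewrite divr_ge0// !addr_ge0 ?sqr_ge0.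
rewrite ge0_integralD//; try (by move=> t _; rewrite lee_fin powR_ge0).
have h u : (\int[mu]_t (rnorm ((u : L2) t) `^ 2)%:E < +oo)%E.
  by have := pint_cLp u; rewrite /pint => ->; exact: ltry.
by rewrite lte_add_pinfty// h.
Qed.

Lemma ipC x y : ip x y = ip y x.
Proof. by apply: eq_Rintegral => t _; rewrite mulrC [X in _ + X]mulrC. Qed.

Lemma ipD x y z : ip (x + y) z = ip x z + ip y z.
Proof.
have i1 := ip_integrable x z; have i2 := ip_integrable y z.
rewrite /ip -RintegralD// /Rintegral; congr fine; apply: ae_eq_integral => //.
- by case/integrableP: (ip_integrable (x + y) z).
- by apply/measurable_EFinP; apply: measurable_funD; apply/measurable_EFinP; [case/integrableP: i1|case/integrableP: i2].
by apply: filterS (cLpD x y) => t e _; rewrite e// !raddfD/=; congr (_%:E); ring.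
Qed.

Lemma ip0 z : ip 0 z = 0.
Proof. by have := ipD 0 0 z; rewrite addr0 => /eqP; rewrite -subr_eq subrr => /eqP. Qed.

Lemma ipN x z : ip (- x) z = - ip x z.
Proof. by have := ipD x (- x) z; rewrite subrr ip0 => /eqP; rewrite eq_sym addrC addr_eq0 => /eqP. Qed.

Lemma ip_sum n (F : nat -> L2) z : ip (\sum_(i < n) F i) z = \sum_(i < n) ip (F i) z.
Proof.
elim: n => [|n IH]; first by rewrite !big_ord0 ip0.
by rewrite !big_ord_recr/= ipD IH.
Qed.

Lemma ip_norm x : ip x x = rnorm x ^+ 2.
Proof.
apply: EFin_inj; rewrite -powR_mulrn ?rnorm_ge0// -pint_cLp /ip /Rintegral /pint.
rewrite -[RHS]fineK; last by have := pint_cLp x; rewrite /pint => ->.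
congr ((fine _)%:E); apply: eq_integral => t _; congr (_%:E).
by rewrite rnorm_sqr !expr2.
Qed.

Lemma ip_cl a b y : test b -> ip (a *: cl p1 b) y =
  complex.Re a * complex.Re (pr b y) + complex.Im a * complex.Im (pr b y).
Proof.
move=> tb; have [ry iy] := cLp_cloc y.
rewrite /pr /= -!rpZr// /rp -RintegralD//; last 2 first.
- by apply: test_integrable => //; exact: loc_intZ.
- by apply: test_integrable => //; exact: loc_intZ.
have i1 := test_integrable tb (loc_intZ (complex.Re a) ry).
have i2 := test_integrable tb (loc_intZ (complex.Im a) iy).
rewrite /ip /Rintegral; congr fine; apply: ae_eq_integral => //.
- by case/integrableP: (ip_integrable (a *: cl p1 b) y).
- by apply/measurable_EFinP; apply: measurable_funD; apply/measurable_EFinP; [case/integrableP: i1|case/integrableP: i2].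
move: (cLpZ a (cl p1 b)) (clE p1 tb); apply: filterS2 => t e1 e2 _; rewrite e1// e2//.
by rewrite complex_ReM complex_ImM/=; congr (_%:E); ring.
Qed.

Lemma rnormD_orth x y : ip x y = 0 -> rnorm (x + y) ^+ 2 = rnorm x ^+ 2 + rnorm y ^+ 2.
Proof.
move=> xy; rewrite -!ip_norm ipD [ip x _]ipC [ip y (x + y)]ipC !ipD [ip y x]ipC xy.
by rewrite addr0 add0r.
Qed.

Lemma dS_orth n x y : (forall b, test b -> SR n b = b -> pr b y = 0) -> ip (dS n x) y = 0.
Proof.
move=> h; rewrite /dS ipD /dF (ip_sum _ (fun i => ((2 ^+ n./2)%:C * pr (cellb n./2 i) x) *: cl p1 (cellb n./2 i))).
rewrite big1 ?add0r => [|i _]; last first.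
  rewrite ip_cl ?h ?mulr0 ?addr0//; try exact: test_cellb.
  exact: SR_cell.
case: (boolP (odd n)) => on; last by rewrite scale0r ip0.
rewrite scale1r /dW ip_cl ?h ?mulr0 ?addr0//; try exact: test_w.
by apply: SR_w; rewrite -[X in (_ < X)%N](odd_double_half n) on.
Qed.

(** A test function fixed by [SR n] pairs to zero with [dP n x], as both [dS n.+1] and [dS n] can be
    moved onto it; [dS n x] is a combination of such functions. *)
Lemma dP_pyth n x : rnorm (psum (@dP R 2 p1) n x) ^+ 2 = \sum_(j < n) rnorm (dP j x) ^+ 2.
Proof.
elim: n => [|n IH]; first by rewrite /psum !big_ord0 rnorm0 expr0n.
rewrite [RHS]big_ord_recr/= -IH /psum big_ord_recr/= -/(psum _ n x) rnormD_orth//.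
rewrite psum_dP; apply: dS_orth => b tb e.
rewrite /dP prB// !pr_dS// e.
have cb x' : pr (SR n.+1 b) x' = pr b (dS n.+1 x' : L2) by rewrite pr_dS.
rewrite cb -[in pr b (dS n.+1 x)]e -(pr_dS n _ tb) dS_comp_le// pr_dS// e.
by rewrite subrr.
Qed.

Lemma rd_norm n (c : nat -> R[i]) :
  rnorm (\sum_(k < n) c k *: cl p1 (rd k) : L2) ^+ 2 = \sum_(k < n) rnorm (c k) ^+ 2.
Proof.
have cl1 k : rnorm (cl p1 (rd k)) ^+ 2 = 1.
  rewrite -ip_norm -[X in ip X _]scale1r ip_cl; last exact: test_rd.
  by rewrite pr_cl ?rd_rd/= ?mul0r ?addr0 ?mul1r//; exact: test_rd.
elim: n => [|n IH]; first by rewrite !big_ord0 rnorm0 expr0n.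
rewrite !big_ord_recr/= rnormD_orth ?IH; first by rewrite rnormZ exprMn cl1 mulr1.
rewrite ipC ip_cl; last exact: test_rd.
rewrite (pr_sumr _ (fun k => c k *: cl p1 (rd k)) (test_rd R n)) big1 ?mulr0 ?addr0// => k _.
rewrite prZ ?pr_cl ?rd_orth; try exact: test_rd.
by rewrite gtn_eqF ?mulr0.
Qed.

Lemma rd_bessel n y : \sum_(k < n) rnorm (pr (rd k) y) ^+ 2 <= rnorm y ^+ 2.
Proof.
pose s : L2 := \sum_(k < n) pr (rd k) y *: cl p1 (rd k).
have sE : rnorm s ^+ 2 = \sum_(k < n) rnorm (pr (rd k) y) ^+ 2 := rd_norm n (fun k => pr (rd k) y).
have sy : ip s y = rnorm s ^+ 2.
  rewrite sE /s (ip_sum n (fun k => pr (rd k) y *: cl p1 (rd k))); apply: eq_bigr => k _.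
  rewrite ip_cl; last exact: test_rd.
  by rewrite -!expr2 -rnorm_sqr powR_mulrn ?rnorm_ge0.
have sy' : ip s y = ip s s by rewrite sy ip_norm.
have H : rnorm (y - s) ^+ 2 = rnorm y ^+ 2 - rnorm s ^+ 2.
  rewrite -!ip_norm ipD ipN [ip y (y - s)]ipC [ip s (y - s)]ipC !ipD !ipN [ip y s]ipC !sy'.
  by rewrite subrr subr0.
by rewrite -sE -subr_ge0 -H sqr_ge0.
Qed.

End square.

Section rademacher_Lp.
Context (R : realType).
Local Notation mu := (@lebesgue_measure R).
Variables (p : R) (p1 : 1 <= p).
Local Notation Lp := (cLp mu p1).
Let one2 : 1 <= (2 : R). Proof. by rewrite ler1n. Qed.
Let p0 : 0 < p. Proof. exact: lt_le_trans p1. Qed.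

Lemma neg1_int : (\int[mu]_t (neg1 t)%:E = 1%:E)%E.
Proof. by rewrite integral_indic ?setIT//; exact: mu_neg1. Qed.

(** Orthonormality in L^2 and the inclusion of L^2 in L^p on [-1, 0), which has measure one. With s
    the L^2 norm, |y|^p is at most s^p where |y| <= s and at most s^(p-2) |y|^2 elsewhere; the total
    2 s^p <= (2 s)^p gives the constant 4 after squaring. *)
Lemma rd_up (a : nat -> R[i]) m n : p < 2 ->
  rnorm (\sum_(m <= k < n) a k *: cl p1 (rd k) : Lp) `^ 2 <=
  4 * \sum_(m <= k < n) rnorm (a k) `^ 2.
Proof.
move=> p2; set y := (\sum_(m <= k < n) _ : Lp).
pose y2 : cLp mu one2 := \sum_(m <= k < n) a k *: cl one2 (rd k).
have yE : y = (fun t => y2 t) %[ae mu].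
  move: (lin_ae p1 (index_iota m n) a (test_rd R)) (lin_ae one2 (index_iota m n) a (test_rd R)).
  by apply: filterS2 => t e1 e2 _; rewrite e1// -e2.
have y20 : {ae mu, forall t, neg1 (t : R) = 0 -> rnorm (y2 t) = 0}.
  apply: filterS (lin_ae one2 (index_iota m n) a (test_rd R)) => t e nt; rewrite e//.
  by rewrite big1 ?rnorm0// => k _; rewrite /rd nt mul0r mulr0.
have A : rnorm y2 ^+ 2 = \sum_(m <= k < n) rnorm (a k) `^ 2.
  have -> : y2 = \sum_(k < n) (if (m <= k)%N then a k else 0) *: cl one2 (rd k).
    rewrite -(big_mkord xpredT (fun k => (if (m <= k)%N then a k else 0) *: cl one2 (rd k))).
    rewrite /y2 (big_nat_widenl m 0)//= big_mkcond; apply: eq_bigr => k _.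
    by case: ifP => // _; rewrite scale0r.
  rewrite (rd_norm one2 n (fun k => if (m <= k)%N then a k else 0)).
  rewrite -(big_mkord xpredT (fun k => rnorm (if (m <= k)%N then a k else 0) ^+ 2)).
  rewrite [RHS](big_nat_widenl m 0)//= [RHS]big_mkcond; apply: eq_bigr => k _.
  by case: ifP => _; rewrite ?powR_mulrn ?rnorm_ge0// rnorm0 expr0n.
suff h : rnorm y <= 2 * rnorm y2.
  rewrite -A powR_mulrn ?rnorm_ge0// (_ : 4 * _ = (2 * rnorm y2) ^+ 2); last by ring.
  by rewrite ler_sqr ?nnegrE ?mulr_ge0 ?rnorm_ge0.
have [y20'|s0] := eqVneq (rnorm y2) 0.
  rewrite y20' mulr0; apply: rnorm_le_pint => //; rewrite powR0 ?gt_eqF//.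
  have z0 : y2 = 0 by exact: rnorm_eq0P.
  have yz : y = (fun=> 0) %[ae mu].
    move: yE (@cLp0E _ _ R mu 2 one2); rewrite z0; apply: filterS2 => t e1 e2 _.
    by rewrite e1// e2.
  rewrite (eq_pint p1 yz) /pint integral0_eq// => t _.
  by rewrite rnorm0 powR0// gt_eqF.
set s := rnorm y2 in s0 *; have sp : 0 < s by rewrite lt_neqAle eq_sym s0 rnorm_ge0.
apply: rnorm_le_pint; first by rewrite mulr_ge0// ltW.
have my2 : measurable_fun setT (fun t => (rnorm (y2 t) `^ 2)%:E).
  by apply/measurable_EFinP; apply: (measurableT_comp (measurable_powR _)); exact: (cmeas_rnorm (cLp_cmeas y2)).
have mn : measurable_fun setT (fun t : R => (neg1 t)%:E).
  by apply/measurable_EFinP; apply: measurable_indic; exact: measurable_itv.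
apply: (@le_trans _ _ (\int[mu]_t ((s `^ p)%:E * (neg1 t)%:E + (s `^ (p - 2))%:E * (rnorm (y2 t) `^ 2)%:E))%E).
  apply: ae_ge0_le_lower_integral => [t _|t _|].
  - by rewrite lee_fin powR_ge0.
  - by rewrite adde_ge0// mule_ge0// lee_fin ?powR_ge0// neg1E.
  move: yE y20; apply: filterS2 => t e1 e2 _; rewrite e1// -!EFinM -EFinD lee_fin.
  have [vs|sv] := leP (rnorm (y2 t)) s.
    rewrite (le_trans (_ : _ <= s `^ p * neg1 t))// ?lerDl ?mulr_ge0 ?powR_ge0//.
    move: e2; rewrite neg1E; case: (-1 <= t < 0) => [_|->//].
      by rewrite mulr1; apply: ge0_ler_powR; rewrite ?nnegrE ?(ltW p0) ?rnorm_ge0 ?(ltW sp).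
    by rewrite powR0 ?gt_eqF// mulr0.
  rewrite (le_trans (_ : _ <= s `^ (p - 2) * rnorm (y2 t) `^ 2))//; last first.
    by rewrite lerDr mulr_ge0 ?powR_ge0// neg1E.
  have v0 : 0 < rnorm (y2 t) by exact: lt_trans sv.
  have -> : rnorm (y2 t) `^ p = rnorm (y2 t) `^ (p - 2) * rnorm (y2 t) `^ 2.
    by rewrite -powRD ?subrK//; apply/implyP => _; rewrite gt_eqF.
  rewrite ler_wpM2r ?powR_ge0// /powR !gt_eqF// ler_expR ler_wnM2l ?subr_le0 ?(ltW p2)//.
  by rewrite ler_ln// ltW.
have n1 t : setT t -> (0 <= (s `^ p)%:E * (neg1 t)%:E)%E by move=> _; rewrite -EFinM lee_fin mulr_ge0 ?powR_ge0// neg1E.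
have n2 t : setT t -> (0 <= (s `^ (p - 2))%:E * (rnorm (y2 t) `^ 2)%:E)%E.
  by move=> _; rewrite -EFinM lee_fin mulr_ge0 ?powR_ge0.
rewrite [X in (X <= _)%E](ge0_integralD mu measurableT n1 (measurable_funeM _ mn) n2 (measurable_funeM _ my2)).
rewrite !ge0_integralZl ?lee_fin ?powR_ge0//; try (by move=> t _; rewrite lee_fin ?powR_ge0// neg1E).
rewrite neg1_int mule1; have -> : (\int[mu]_t (rnorm (y2 t) `^ 2)%:E = (s `^ 2)%:E)%E by exact: pint_cLp.
rewrite -EFinM -EFinD lee_fin -powRD; last by apply/implyP => _; rewrite gt_eqF.
rewrite subrK powRM ?(ltW sp)// (_ : s `^ p + s `^ p = 2 * s `^ p); last by ring.
rewrite ler_wpM2r ?powR_ge0//.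
by rewrite -[leLHS]powRr1// ler_powR// ler1n.
Qed.

(** For p > 2 the restriction of [x] to [-1, 0) is in L^2 and has the same pairings with the
    Rademacher functions; Bessel's inequality applies to it. *)
Lemma rd_eta (x : Lp) : 2 < p -> exists B : R, forall n, \sum_(k < n) rnorm (pr (rd k) x) `^ 2 <= B.
Proof.
move=> p2; have mneg : measurable_fun setT (@neg1 R) by apply: measurable_indic; exact: measurable_itv.
have mf : cmeas (fun t : R => (neg1 t)%:C * x t) := cmeas_real_mul mneg (cLp_cmeas x).
have [y yE] : exists y : cLp mu one2, y = (fun t => (neg1 t)%:C * x t) %[ae mu].
  apply: exists_cLp => //.
  apply: (@le_lt_trans _ _ (\int[mu]_t ((neg1 t)%:E + (rnorm (x t) `^ p)%:E))%E).
    apply: ae_ge0_le_lower_integral => [t _|t _|].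
    - by rewrite lee_fin powR_ge0.
    - by rewrite adde_ge0// lee_fin ?powR_ge0// neg1E.
    apply: aeW => t _; rewrite -EFinD lee_fin neg1E.
    case: (-1 <= t < 0); last by rewrite mul0r rnorm0 powR0 ?pnatr_eq0// add0r powR_ge0.
    rewrite mul1r; have [v1|v1] := leP (rnorm (x t)) 1.
      have : rnorm (x t) `^ 2 <= 1 `^ 2 by apply: ge0_ler_powR; rewrite ?nnegrE ?rnorm_ge0.
      by rewrite powR1 => /le_trans; apply; rewrite lerDl powR_ge0.
    have : rnorm (x t) `^ 2 <= rnorm (x t) `^ p by apply: ler_powR; exact: ltW.
    by move=> /le_trans; apply; rewrite lerDr ler01.
  have n1 t : setT t -> (0 <= (neg1 (t : R))%:E)%E by move=> _; rewrite lee_fin neg1E.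
  have n2 t : setT t -> (0 <= (rnorm (x t) `^ p)%:E)%E by move=> _; rewrite lee_fin powR_ge0.
  have m1 : measurable_fun setT (fun t : R => (neg1 t)%:E) by exact/measurable_EFinP.
  have m2 : measurable_fun setT (fun t => (rnorm (x t) `^ p)%:E).
    by apply/measurable_EFinP; apply: (measurableT_comp (measurable_powR _)); exact: (cmeas_rnorm (cLp_cmeas x)).
  rewrite [X in (X < _)%E](ge0_integralD mu measurableT n1 m1 n2 m2).
  rewrite neg1_int lte_add_pinfty ?ltry//.
  by have := pint_cLp x; rewrite /pint => ->; rewrite ltry.
have e k : pr (rd k) x = pr (rd k) y.
  have [rx ix] := cLp_cloc x; have [ry iy] := cLp_cloc y; have tr := test_rd R k.
  have idem (t : R) : rd k t * neg1 t = rd k t.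
    by rewrite /rd neg1E; case: (-1 <= t < 0); rewrite ?mulr1// mul0r mulr0.
  rewrite /pr; congr (_ +i* _); rewrite /rp /Rintegral; congr fine; apply: ae_eq_integral => //;
    try (by case/integrableP: (test_integrable tr rx)); try (by case/integrableP: (test_integrable tr ry));
    try (by case/integrableP: (test_integrable tr ix)); try (by case/integrableP: (test_integrable tr iy)).
    apply: filterS yE => t /(_ I) et _; congr (_%:E); rewrite /= et complex_ReM/= mul0r subr0.
    by rewrite mulrA idem.
  apply: filterS yE => t /(_ I) et _; congr (_%:E); rewrite /= et complex_ImM/= mul0r addr0.
  by rewrite mulrA idem.
exists (rnorm y ^+ 2) => n; apply: le_trans (rd_bessel n y).
by apply: ler_sum => k _; rewrite e powR_mulrn ?rnorm_ge0.
Qed.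

End rademacher_Lp.

(** * Conclusion *)

Section example.
Context (R : realType).
Local Notation mu := (@lebesgue_measure R).

(** A cell of level [K] is fixed by [SR K.*2], so its pairing with the image is a finite sum of m j
    times pairings of the argument with test functions; these do not see the exponent. By dyadic
    differentiation the pairings with all cells determine a locally integrable function almost
    everywhere. *)
Lemma dP_consistent (p q : R) (p1 : 1 <= p) (q1 : 1 <= q) (m : nat -> R[i])
    (f y : cLp mu p1) (g z : cLp mu q1) : f = g %[ae mu] ->
  multiplies (@dP R p p1) m f y -> multiplies (@dP R q q1) m g z -> y = z %[ae mu].
Proof.
move=> fg fy gz.
have prfg b : test b -> pr b f = pr b g.
  by move=> tb; apply: pr_ae => //; exact: cLp_cloc.
have tSR n b : test (SR n b).
  by apply: testD; [exact: test_FR|apply: testZ; exact: test_WR].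
have pryz K i : (i < ncell K)%N -> pr (cellb K i) y = pr (cellb K i) z.
  move=> iN; have tb := @test_cellb R K i.
  have e : SR K.*2 (cellb K i) = cellb K i :> (R -> R) by apply: SR_cell => //; rewrite doubleK.
  rewrite -[in LHS]e -[in RHS]e -!pr_dS// -!psum_dP /psum.
  rewrite (pr_sumr _ (fun j => dP j y) tb) (pr_sumr _ (fun j => dP j z) tb).
  apply: eq_bigr => j _; rewrite fy gz !prZ// !pr_dP//.
  by rewrite !prfg.
have [ry iy] := cLp_cloc y; have [rz iz] := cLp_cloc z.
have vanish (a b : R -> R) : loc_int a -> loc_int b ->
    (forall K i, (i < ncell K)%N -> rp (cellb K i) a = rp (cellb K i) b) -> {ae mu, forall t, a t = b t}.
  move=> la lb ab; have lb' := loc_intZ (-1) lb.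
  have lab := loc_intD la lb'.
  apply: filterS (dyadic_zero lab _) => [t /eqP|K i iN].
    by rewrite mulN1r subr_eq0 => /eqP.
  have tb := @test_cellb R K i.
  by rewrite rpDr// rpZr// ab// mulN1r subrr.
have hr := vanish _ _ ry rz (fun K i iN => congr1 (@complex.Re R) (pryz K i iN)).
have hi := vanish _ _ iy iz (fun K i iN => congr1 (@complex.Im R) (pryz K i iN)).
move: hr hi; apply: filterS2 => t e1 e2 _; apply/eqP; rewrite eq_complex.
by apply/andP; split; apply/eqP.
Qed.

Lemma dP_not_maximal (p : R) (p1 : 1 < p) : p != 2 ->
  ~ maximal_regularity (fun t : R => sg (@dP R p (ltW p1)) t%:C).
Proof.
move=> p2 [q [tau [q1 tau0 h]]].
have p0 : 0 < p by exact: (lt_trans ltr01 p1).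
have cX := @cLp_complete _ _ R mu p (ltW p1).
have dec := dP_decomposition (ltW p1).
have C0 : 0 <= 12 :> R by [].
have half k b : test b -> rp (w k : R -> R) b = 1 ->
    forall b', test b' -> rp (w k) b' = 1 -> pr b (dP k.*2 (cl (ltW p1) b')) = 2^-1.
  move=> tb wb b' tb' wb'; rewrite pr_even// wb' (rp_sym b) wb !mulr1.
  by rewrite (fmorphV (real_complex R)) (rmorph_nat (real_complex R)).
have odd_half k b b' : new k b -> test b' -> rp b b' = 0 -> rp (w k) b = 1 -> rp (w k) b' = 1 ->
    pr b (dP k.*2.+1 (cl (ltW p1) b')) = - 2^-1.
  move=> nb tb' bb' wb wb'; have tb := new_test nb.
  have := pr_new_split (cl (ltW p1) b') nb; rewrite half// pr_cl// bb' => /eqP.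
  by rewrite eq_sym addrC addr_eq0 => /eqP.
have drd k : rp (dl k : R -> R) (rd k) = 0 by apply: rp0 => t; exact: dl_rd.
have rdd k : rp (rd k : R -> R) (dl k) = 0 by rewrite rp_sym drd.
have [plt|pgt|pe] := ltgtP p 2; last by rewrite pe eqxx in p2.
  have [c [c0 c_rho c_sigma]] := exists_lp_not_lq p0 plt.
  have chiP k j : j./2 != k -> dP j (cl (ltW p1) (rd k)) = 0.
    by apply: dP_new; exact: new_rd.
  have etaZ k (a : R[i]) (x : cLp mu (ltW p1)) : pr (dl k) (a *: x : cLp mu (ltW p1)) = a * pr (dl k) x.
    by apply: prZ; exact: test_dl.
  have etaP k (x : cLp mu (ltW p1)) :
      pr (dl k) x = pr (dl k) (dP k.*2 x) + pr (dl k) (dP k.*2.+1 x).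
    by apply: pr_new_split; exact: new_dl.
  have etae k : pr (dl k) (dP k.*2 (cl (ltW p1) (rd k))) = 2^-1.
    by apply: half; [exact: test_dl|exact: w_dl|exact: test_rd|exact: w_rd].
  have etao k : pr (dl k) (dP k.*2.+1 (cl (ltW p1) (rd k))) = - 2^-1.
    by apply: odd_half; [exact: new_dl|exact: test_rd|exact: drd|exact: w_dl|exact: w_rd].
  exact: (@not_maximal_regularity_at R (cLp mu (ltW p1)) (@dP R p (ltW p1)) 12 cX dec C0
    (fun k => cl (ltW p1) (rd k)) (fun k (x : cLp mu (ltW p1)) => pr (dl k) x) chiP etaZ etaP etae etao
    _ _ _ (ltr0n R 2) p0 (ler0n R 4) (fun a m n => rd_up _ a m n plt) (fun x => dl_eta x)
    c c0 c_rho c_sigma q tau q1 tau0 h).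
have [c [c0 c_rho c_sigma]] := exists_lp_not_lq (ltr0n R 2) pgt.
have chiP k j : j./2 != k -> dP j (cl (ltW p1) (dl k)) = 0.
  by apply: dP_new; exact: new_dl.
have etaZ k (a : R[i]) (x : cLp mu (ltW p1)) : pr (rd k) (a *: x : cLp mu (ltW p1)) = a * pr (rd k) x.
  by apply: prZ; exact: test_rd.
have etaP k (x : cLp mu (ltW p1)) :
    pr (rd k) x = pr (rd k) (dP k.*2 x) + pr (rd k) (dP k.*2.+1 x).
  by apply: pr_new_split; exact: new_rd.
have etae k : pr (rd k) (dP k.*2 (cl (ltW p1) (dl k))) = 2^-1.
  by apply: half; [exact: test_rd|exact: w_rd|exact: test_dl|exact: w_dl].
have etao k : pr (rd k) (dP k.*2.+1 (cl (ltW p1) (dl k))) = - 2^-1.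
  by apply: odd_half; [exact: new_rd|exact: test_dl|exact: rdd|exact: w_rd|exact: w_dl].
exact: (@not_maximal_regularity_at R (cLp mu (ltW p1)) (@dP R p (ltW p1)) 12 cX dec C0
  (fun k => cl (ltW p1) (dl k)) (fun k (x : cLp mu (ltW p1)) => pr (rd k) x) chiP etaZ etaP etae etao
  _ _ _ p0 (ltr0n R 2) ler01 (fun a m n => dl_up _ a m n) (fun x => rd_eta x pgt)
  c c0 c_rho c_sigma q tau q1 tau0 h).
Qed.

End example.

Theorem corollary6p4 (R : realType) :
  exists T : forall (p : R) (p1 : 1 < p), R[i] -> LpR p1 -> LpR p1,
    [/\ forall (p : R) (p1 : 1 < p), holomorphic_C0_semigroup (pi / 2) (T p p1),
        consistent T
      & forall (p : R) (p1 : 1 < p),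
          maximal_regularity (fun t : R => T p p1 t%:C) <-> p = 2].
Proof.
have C0 : 0 <= 12 :> R by [].
pose mu := @lebesgue_measure R.
exists (fun p p1 z => sg (@dP R p (ltW p1)) z); split.
- move=> p p1; apply: (sg_holomorphic_C0 _ _ C0); first exact: cLp_complete.
  exact: dP_decomposition.
- move=> p q p1 q1 f g fg z sz.
  have az : adm z by right; exact: sector_Re sz.
  apply: (dP_consistent fg).
    by apply: (sgP _ _ C0 _ az); [exact: cLp_complete|exact: dP_decomposition].
  by apply: (sgP _ _ C0 _ az); [exact: cLp_complete|exact: dP_decomposition].
move=> p p1; split => [h|e].
  by apply/eqP; apply: contraPT h => p2; exact: dP_not_maximal.
subst p; apply: (hilbert_maximal_regularity _ _ C0); [exact: cLp_complete|exact: dP_decomposition|].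
exact: dP_pyth.
Qed.
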